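(* For every $n\in\mathbb{N}$ there exists a positive integer $e(n)$ such that for every $d$, every curve $p_t\in\mathscr{C}^{k,1}(I,H_{n,d})$ with $p_t\ne0$ for all $t\in I=[0,1]$ and $k\ge e(n)d-1$, and every $1\le q<e(n)d/(e(n)d-1)$, the curve $\mu_t:=\mu([p_t])$ belongs to $AC^q(I;(\mathscr{P}(\mathbb{C}\mathrm{P}^n),W_q))$.
   Context: $H_{n,d}$: complex homogeneous polynomials of degree $d$ in $z_0,\dots,z_n$; $P_{n,d}$ its projectivization. $\mathscr{C}^{k,1}$: $k$ times differentiable with Lipschitz $k$-th derivative. $\mu:P_{n,d}\to\mathscr{P}(\mathbb{C}\mathrm{P}^n)$ is given by $\int f\,\mathrm{d}\mu(p)=\frac1d\int_{\mathbb{G}(1,n)}\sum_{z\in Z(p)\cap\ell}m_z(p|_\ell)f(z)\,\mathrm{vol}_{\mathbb{G}(1,n)}(\mathrm{d}\ell)$, with $\mathbb{G}(1,n)$ the Grassmannian of projective lines with its $U(n+1)$-invariant probability measure and $m_z(p|_\ell)$ the multiplicity of $z$ as a zero of $p|_\ell$. $W_q$ is the $q$-Wasserstein distance with Fubini–Study cost. $AC^q(I;X)$: curves with $\mathsf d(x_s,x_t)\le\int_s^tm$ for some $m\in L^q(I)$ and all $s\le t$. *)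

(* Defs.v *)
From HB Require Import structures.
From mathcomp Require Import all_boot all_order all_algebra.
From mathcomp Require Import all_classical all_reals all_analysis.
From mathcomp Require Import complex.

Set Implicit Arguments.
Unset Strict Implicit.
Unset Printing Implicit Defensive.

Import Order.TTheory GRing.Theory Num.Theory.
Import numFieldNormedType.Exports.
Local Open Scope classical_set_scope.
Local Open Scope ring_scope.

Section ProjectiveDefs.
Variables (R : realType) (n : nat).

Notation vec := 'rV[R[i]]_(n.+1).

Definition cinner (u v : vec) : R[i] := \sum_(j < n.+1) (u 0 j)^* * v 0 j.
Definition cnorm (u : vec) : R := Num.sqrt (complex.Re (cinner u u)).

Definition cline (z : vec) : set vec := [set w | exists c : R[i], w = c *: z].

Record CP := MkCP { cp_set : set vec ;
                    cp_ok : exists z : vec, z != 0 /\ cp_set = cline z }.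

HB.instance Definition _ := gen_eqMixin CP.
HB.instance Definition _ := gen_choiceMixin CP.

Lemma CP_point_ok : exists z : vec, z != 0 /\ cline (const_mx 1) = cline z.
Proof.
exists (const_mx 1); split => //; apply/negP => /eqP/matrixP/(_ 0 0).
by rewrite !mxE => /eqP; rewrite oner_eq0.
Qed.
HB.instance Definition _ := isPointed.Build CP (MkCP CP_point_ok).

Definition cp_rep (x : CP) : vec := projT1 (cid (cp_ok x)).

Definition dFS (x y : CP) : R :=
  acos (ComplexField.Normc.normc (cinner (cp_rep x) (cp_rep y)) / (cnorm (cp_rep x) * cnorm (cp_rep y))).

Definition cp_open (A : set CP) : Prop :=
  forall x, A x -> exists2 e : R, 0 < e & forall y, dFS x y < e -> A y.

(* projective lines of CP^n = complex 2-planes in C^{n+1} *)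
Definition cindep (u v : vec) : Prop :=
  forall a b : R[i], a *: u + b *: v = 0 -> a = 0 /\ b = 0.
Definition span2 (u v : vec) : set vec :=
  [set w | exists a b : R[i], w = a *: u + b *: v].
Record Gr := MkGr { gr_set : set vec ;
                    gr_ok : exists u v : vec, cindep u v /\ gr_set = span2 u v }.

HB.instance Definition _ := gen_eqMixin Gr.
HB.instance Definition _ := gen_choiceMixin Gr.

(* Hausdorff distance between the unit spheres of two 2-planes: a metric on
   G(1,n) inducing its usual topology *)
Definition usph (L : Gr) : set vec := [set u | gr_set L u /\ cnorm u = 1].
Definition hdist (L M : Gr) : R :=
  sup [set inf [set cnorm (u - v) | v in usph M] | u in usph L].
Definition dGr (L M : Gr) : R := Num.max (hdist L M) (hdist M L).
Definition gr_open (A : set Gr) : Prop :=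
  forall L, A L -> exists2 e : R, 0 < e & forall M, dGr L M < e -> A M.

Definition unitary (U : 'M[R[i]]_(n.+1)) : Prop :=
  U *m (map_mx Num.conj U)^T = 1%:M.

Definition mon (d : nat) :=
  {a : {ffun 'I_n.+1 -> 'I_d.+1} | (\sum_(j < n.+1) (a j : nat))%N == d}.
Definition hpoly (d : nat) := mon d -> R[i].

Definition peval d (p : hpoly d) (z : vec) : R[i] :=
  \sum_(a : mon d) p a * \prod_(j < n.+1) z 0 j ^+ (val a j : nat).

Definition pline d (p : hpoly d) (z w : vec) : {poly R[i]} :=
  \sum_(a : mon d) p a *: \prod_(j < n.+1) ((z 0 j)%:P + (w 0 j)%:P * 'X) ^+ (val a j : nat).

(* multiplicity of the point x of the projective line L as a zero of p|_L:
   vanishing order at lambda = 0 of lambda |-> p(z + lambda w), with z a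
   representative of x and w a vector of L not on the line x (an affine chart
   of L around x).  When p|_L is identically zero this is 0 (convention, only
   relevant on a null set of lines). *)
Definition mult d (p : hpoly d) (x : CP) (L : Gr) : nat :=
  mup 0 (pline p (cp_rep x) (xget 0 [set w | gr_set L w /\ ~ cp_set x w])).

Definition zcount d (p : hpoly d) (A : set CP) (L : Gr) : R :=
  \sum_(x \in [set x : CP | cp_set x `<=` gr_set L /\ peval p (cp_rep x) = 0 /\ A x])
     ((mult p x L)%:R : R).

End ProjectiveDefs.

Arguments mon : clear implicits.
Arguments hpoly : clear implicits.

(* the Grassmannian of projective lines of CP^(n+1) (i.e. 2-planes of C^(n+2))
   is nonempty: this provides the pointed structure required for measurability *)
Lemma Gr_point_ok (R : realType) (n : nat) :
  exists u v : 'rV[R[i]]_(n.+2), cindep u v /\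
    span2 (delta_mx 0 0 : 'rV[R[i]]_(n.+2)) (delta_mx 0 1) = span2 u v.
Proof.
exists (delta_mx 0 0), (delta_mx 0 1); split => //.
move=> a b /matrixP H; have := H 0 0; have := H 0 1; rewrite !mxE /=.
by rewrite !mulr1 !mulr0 add0r addr0 => -> ->.
Qed.

HB.instance Definition _ (R : realType) (n : nat) :=
  isPointed.Build (Gr R n.+1) (MkGr (Gr_point_ok R n)).

Definition Grm (R : realType) (n : nat) := g_sigma_algebraType (@gr_open R n.+1).
Definition CPm (R : realType) (n : nat) := g_sigma_algebraType (@cp_open R n).

Section MeasureDefs.
Variables (R : realType) (n : nat).

Definition gr_invariant (vol : probability (Grm R n) R) : Prop :=
  forall U : 'M[R[i]]_(n.+2), unitary U ->
  forall A : set (Grm R n), measurable A ->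
    vol [set L : Grm R n | exists M : Gr R n.+1, A M /\ gr_set M = [set v *m U | v in gr_set L]] = vol A.

Definition muP (vol : probability (Grm R n) R) d (p : hpoly R n.+1 d)
    (A : set (CPm R n.+1)) : \bar R :=
  (((d%:R)^-1)%:E * \int[vol]_L (zcount p A L)%:E)%E.

Definition is_probability (dd : measure_display)
   (T' : measurableType dd) (mu : set T' -> \bar R) : Prop :=
  [/\ mu set0 = 0%E, (forall A, measurable A -> (0 <= mu A)%E),
      semi_sigma_additive mu & mu setT = 1%E].
End MeasureDefs.

Section WassersteinDefs.
Variables (R : realType) (n : nat).

Definition couplings (mu nu : set (CPm R n) -> \bar R) :
    set (probability (CPm R n * CPm R n)%type R) :=
  [set pi | (forall A, measurable A -> pi (A `*` setT) = mu A) /\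
            (forall B, measurable B -> pi (setT `*` B) = nu B)].

Definition Wq (q : R) (mu nu : set (CPm R n) -> \bar R) : \bar R :=
  ((ereal_inf [set (\int[pi]_xy ((dFS xy.1 xy.2) `^ q)%:E)%E
                 | pi in couplings mu nu]) `^ q^-1)%E.

Definition ACq (q : R) (c : R -> set (CPm R n) -> \bar R) : Prop :=
  (forall t, 0 <= t <= 1 -> is_probability (c t)) /\
  exists m : R -> R,
    [/\ measurable_fun (`[0%R, 1%R] : set R) m,
        (\int[lebesgue_measure]_(x in `[0%R, 1%R]) ((`|m x| `^ q)%:E) < +oo)%E &
        forall s t, 0 <= s -> s <= t -> t <= 1 ->
          (Wq q (c s) (c t) <= \int[lebesgue_measure]_(x in `[s, t]) (m x)%:E)%E].
End WassersteinDefs.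

Section SmoothDefs.
Variable R : realType.

Definition derivI (f : R -> R) (x l : R) : Prop :=
  (fun y => (f y - f x) / (y - x)) @ within [set y | 0 <= y <= 1 /\ y != x] (nbhs x)
    --> l.

Definition Ck1 (k : nat) (f : R -> R) : Prop :=
  exists G : nat -> R -> R,
    [/\ G 0%N = f,
        (forall j, (j < k)%N -> forall x, 0 <= x <= 1 -> derivI (G j) x (G j.+1 x)) &
        exists L : R, forall x y, 0 <= x <= 1 -> 0 <= y <= 1 ->
          `|G k x - G k y| <= L * `|x - y| ].

Definition Ck1_curve (n d k : nat) (p : R -> hpoly R n d) : Prop :=
  forall a : mon n d, Ck1 k (fun t => complex.Re (p t a)) /\
                        Ck1 k (fun t => complex.Im (p t a)).
End SmoothDefs.

(* Main.v *)
Require Import Defs.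
From HB Require Import structures.
From mathcomp Require Import all_boot all_order all_algebra.
From mathcomp Require Import all_classical all_reals all_analysis measurable_realfun.
From mathcomp Require Import complex polyrcf.
From mathcomp Require Import ring lra zify.

(* One can take e = 4. The proof avoids differentiating the roots: a curve is
   in AC^q as soon as the sums of D(x_i, x_(i+1))^q (x_(i+1) - x_i)^(1-q) over
   partitions are bounded (F. Riesz), and such bounds are additive over
   subintervals and can be integrated over lines.

   Roots of a monic polynomial of degree m <= d whose coefficients have Taylor
   expansions of order 4d (with the bottleneck distance on root multisets):
   after centring, cut [0, 1] into cells on which the largest root size is about
   16^-l and, after rescaling, the roots split into two stable clusters. The two
   factors are as regular as the polynomial, so induction on m applies on each
   cell. There are O(2^l) cells of level l, since shorter cells are caused by
   oscillations of coefficients, which are controlled by roots of Taylor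
   polynomials.

   Zeros on a line L: if max_L |p_t| >= (c 16^-l)^d for all t, the same
   decomposition bounds the sums for the zeros of p_t on L by O(8^l). The lines
   violating this for some t have volume O(16^-l), by a discretized tube
   estimate in which each point is joined to a point O where p_t does not vanish.
   Integrating over L bounds the sums for the L^q norm B(s, t) over L of the
   distance between the zeros of p_s and of p_t on L.

   Matching the zeros line by line couples mu_s and mu_t, so W_q <= C B. All
   this holds for some exponent larger than q as well, so that a dyadic maximal
   function of the superadditive function given by the suprema of those sums
   provides the density in L^q. *)

Set Implicit Arguments.
Unset Strict Implicit.
Unset Printing Implicit Defensive.

Import Order.TTheory GRing.Theory Num.Theory.
Import numFieldNormedType.Exports.
Local Open Scope classical_set_scope.
Local Open Scope ring_scope.
(** * Matchings of finite sequences *)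

(** Two obstacles shape the argument. Roots have no regular labelling, and constants must be uniform
    over lines; so the root estimates concern unordered lists, with constants depending only on
    degrees, dimension, q and a bound [A] on Taylor data. The second obstacle is that a cell of
    level l can be as short as 16^(-l d), which costs r^(1 - q) in a Riesz sum. For roots of monic
    polynomials this loss is paid by the factor sig(l)^q, the size of the roots in the cell. For the
    zeros on a line there is no such gain, since they are points of projective space at mutual
    distances of order 1. There (q - 1)(4d - 1) < 1 bounds the loss by a multiple of 4^l per cell;
    with 2^l cells this gives the rate 8^l, and only averaging over lines, the exceptional volume
    decaying like 16^(-l), makes the series converge. The factor 4 in 4d is what makes the numbers
    2, 4 and 16 balance. *)

Section MatchingDistance.
Variables (R : realType) (T : eqType) (d : T -> T -> R).

Lemma all2_map_same (U V W : Type) (r : V -> W -> bool) (f : U -> V) (g : U -> W) s :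
  all2 r (map f s) (map g s) = all (fun i => r (f i) (g i)) s.
Proof. by elim: s => //= x s ->. Qed.

Lemma all2_nth (V W : Type) (r : V -> W -> bool) v0 w0 s t i :
  all2 r s t -> (i < size s)%N -> r (nth v0 s i) (nth w0 t i).
Proof.
elim: s t i => [|x s IH] [|y t] [|i]//=; first by case/andP.
by case/andP => _ H1 H2; exact: IH.
Qed.

Lemma all2_size (V W : Type) (r : V -> W -> bool) s t : all2 r s t -> size s = size t.
Proof. by rewrite all2E => /andP[/eqP]. Qed.

Lemma all2_perm (r : T -> T -> bool) ys ys' zs :
  perm_eq ys ys' -> all2 r ys zs -> exists2 zs', perm_eq zs zs' & all2 r ys' zs'.
Proof.
case: ys => [|y0 ys1].
  by rewrite perm_sym => /perm_nilP -> H; exists zs.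
set ys := y0 :: ys1 => pyy H.
have sz := all2_size H.
move: pyy; rewrite perm_sym => /(perm_iotaP y0)[Is pI ->].
exists [seq nth y0 zs i | i <- Is].
  rewrite perm_sym; apply/(perm_iotaP y0); exists Is => //.
  by rewrite -sz.
rewrite all2_map_same; apply/allP => i.
rewrite (perm_mem pI) mem_iota add0n => /andP[_ Hi].
exact: all2_nth.
Qed.

Definition matched (e : R) (xs ys : seq T) : Prop :=
  exists2 ys', perm_eq ys ys' & all2 (fun x y => d x y <= e) xs ys'.

(* Bottleneck distance; it is 0 (infimum of the empty set) when the sizes differ. *)
Definition bdist (xs ys : seq T) : R := inf [set e | 0 <= e /\ matched e xs ys].

Lemma matched_trans e e' xs ys zs :
  (forall x y z, d x z <= d x y + d y z) ->
  matched e xs ys -> matched e' ys zs -> matched (e + e') xs zs.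
Proof.
move=> tri [ys' pys H1] [zs' pzs H2].
have [zs'' p2 H3] := all2_perm pys H2.
exists zs''; first exact: perm_trans pzs p2.
elim: xs ys' zs'' H1 H3 {pys H2 p2} => [|x xs IH] [|y ys'] [|z zs'']//=.
case/andP => h1 h2 /andP[h3 h4]; rewrite (IH ys') // andbT.
by apply: (le_trans (tri x y z)); exact: lerD.
Qed.

Lemma matched_sym e xs ys : (forall x y, d x y = d y x) ->
  matched e xs ys -> matched e ys xs.
Proof.
move=> sym [ys' pys H].
have H' : all2 (fun x y => d x y <= e) ys' xs.
  elim: xs ys' H {pys} => [|x xs IH] [|y ys'] //= /andP[h1 h2].
  by rewrite sym h1 IH.
by apply: (all2_perm _ H'); rewrite perm_sym.
Qed.

Lemma matched_le e e' xs ys : e <= e' -> matched e xs ys -> matched e' xs ys.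
Proof.
move=> ee [ys' p H]; exists ys' => //.
elim: xs ys' H {p} => [|x xs IH] [|y ys'] //= /andP[h1 h2].
by rewrite (le_trans h1 ee) IH.
Qed.

Lemma matched_ex xs ys : size xs = size ys -> exists2 e, 0 <= e & matched e xs ys.
Proof.
elim: xs ys => [|x xs IH] [|y ys]//; first by exists 0 => //; exists [::].
move=> [/IH[e e0 [ys' p H]]].
have h : 0 <= e + `|d x y| by apply: addr_ge0.
exists (e + `|d x y|) => //; exists (y :: ys'); first by rewrite perm_cons.
rewrite /= (le_trans (ler_norm _)) ?lerDr//=.
elim: xs ys' H {IH p} => [|u xs IH] [|v ys'] //= /andP[h1 h2].
by rewrite (le_trans h1) ?lerDl// IH.
Qed.

Lemma matched_cat e xs ys xs' ys' : matched e xs ys -> matched e xs' ys' ->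
  matched e (xs ++ xs') (ys ++ ys').
Proof.
move=> [us p1 H1] [vs p2 H2]; exists (us ++ vs); first exact: perm_cat.
elim: xs us H1 {p1} => [|x xs IH] [|u us] //= /andP[-> /IH ->].
by [].
Qed.

Lemma matched_perml e xs xs' ys : perm_eq xs xs' -> matched e xs ys -> matched e xs' ys.
Proof.
move=> p [ys' p' H]; have [zs pz H'] := all2_perm p H; exists zs => //.
exact: perm_trans pz.
Qed.

Lemma matched_permr e xs ys ys' : perm_eq ys ys' -> matched e xs ys -> matched e xs ys'.
Proof.
move=> p [zs p' H]; exists zs => //; apply: perm_trans p'; by rewrite perm_sym.
Qed.

Lemma bdist_has_inf xs ys : size xs = size ys ->
  has_inf [set e | 0 <= e /\ matched e xs ys].
Proof.
move=> /matched_ex[e e0 H]; split; first by exists e.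
by exists 0 => x [].
Qed.

Lemma bdist_le e xs ys : 0 <= e -> matched e xs ys -> bdist xs ys <= e.
Proof.
move=> e0 H; apply: ge_inf => //; by exists 0 => x [].
Qed.

Lemma bdist_ge0 xs ys : 0 <= bdist xs ys.
Proof.
rewrite /bdist; set E := [set e | _].
have [->|/set0P ne] := eqVneq E set0; first by rewrite inf0.
by apply: lb_le_inf => // x [].
Qed.

Lemma bdist_lt e xs ys : size xs = size ys -> bdist xs ys < e -> matched e xs ys.
Proof.
rewrite -subr_gt0 => sz lt; have [e' [_ H] lt'] := inf_adherent lt (bdist_has_inf sz).
by apply: matched_le H; move: lt'; rewrite addrC subrK => /ltW.
Qed.

Lemma bdist_sym xs ys : (forall x y, d x y = d y x) -> bdist xs ys = bdist ys xs.
Proof.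
move=> sym; rewrite /bdist; congr inf; apply/seteqP.
by split => e [e0 H]; split => //; exact: matched_sym.
Qed.

Lemma bdist_trans xs ys zs : (forall x y z, d x z <= d x y + d y z) ->
  size xs = size ys -> size ys = size zs ->
  bdist xs zs <= bdist xs ys + bdist ys zs.
Proof.
move=> tri s1 s2; apply/ler_addgt0Pr => e e0.
have e2 : 0 < e / 2 by rewrite divr_gt0.
have h1 : matched (bdist xs ys + e/2) xs ys by apply: bdist_lt; rewrite // ltrDl.
have h2 : matched (bdist ys zs + e/2) ys zs by apply: bdist_lt; rewrite // ltrDl.
apply: le_trans (bdist_le _ (matched_trans tri h1 h2)) _.
  by rewrite !addr_ge0 ?bdist_ge0 // ltW.
lra.
Qed.

Lemma bdist_perm xs xs' ys ys' : perm_eq xs xs' -> perm_eq ys ys' ->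
  bdist xs ys = bdist xs' ys'.
Proof.
move=> p1 p2; rewrite /bdist; congr inf; apply/seteqP; split => e [e0 H]; split => //.
  exact: matched_perml p1 (matched_permr p2 H).
by apply: matched_perml (matched_permr _ H); rewrite perm_sym.
Qed.

End MatchingDistance.

(** * Riesz sums *)

Section Riesz.
Variables (R : realType) (q : R).
Hypothesis q1 : 1 <= q.

(** The perspective of the convex function x^q: for l > 0 it is homogeneous of degree 1 and jointly
    convex, hence subadditive in the pair (x, l). *)
Definition rz (x l : R) : R := x `^ q * l `^ (1 - q).

Lemma rz_ge0 x l : 0 <= rz x l.
Proof. by rewrite mulr_ge0 ?powR_ge0. Qed.

Lemma rz_le x y l : 0 <= x -> x <= y -> rz x l <= rz y l.
Proof.
move=> x0 xy; rewrite ler_wpM2r ?powR_ge0// ge0_ler_powR ?nnegrE//.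
- exact: le_trans q1.
- exact: le_trans xy.
Qed.

Lemma rz_scale c r x l : 0 <= c -> 0 < r -> 0 <= x -> 0 <= l ->
  rz (c * x) (r * l) = c `^ q * r `^ (1 - q) * rz x l.
Proof. by move=> c0 r0 x0 l0; rewrite /rz !powRM// ?(ltW r0)//; ring. Qed.

(** Jensen's inequality for x^q at the slopes x / a and y / b, with weights a / (a + b) and b / (a +
    b). *)
Lemma rz_add x y a b : 0 <= x -> 0 <= y -> 0 < a -> 0 < b ->
  rz (x + y) (a + b) <= rz x a + rz y b.
Proof.
move=> x0 y0 a0 b0.
have ab : 0 < a + b by rewrite addr_gt0.
have abn : a + b != 0 by rewrite gt_eqF.
have la : 0 <= a / (a + b) <= 1.
  by rewrite divr_ge0 ?(ltW a0) ?(ltW ab)//= ler_pdivrMr// mul1r lerDl ltW.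
case/andP: la => la0 la1.
have xa : 0 <= x / a by rewrite divr_ge0// ltW.
have yb : 0 <= y / b by rewrite divr_ge0// ltW.
have := @convex_powR R q q1 (Itv01 la0 la1) (x / a) (y / b).
move=> H; have {}H : x / a \in `[0, +oo[%classic -> y / b \in `[0, +oo[%classic ->
   (a / (a + b) * (x / a) + unstable.onem (a / (a + b)) * (y / b)) `^ q <=
   a / (a + b) * ((x / a) `^ q) + unstable.onem (a / (a + b)) * ((y / b) `^ q).
  exact: H.
move: H.
have -> : unstable.onem (a / (a + b)) = b / (a + b) by rewrite /unstable.onem; field.
have -> : a / (a + b) * (x / a) + b / (a + b) * (y / b) = (x + y) / (a + b).
  by field; rewrite !gt_eqF.
move=> H.
have {}H : ((x + y) / (a + b)) `^ q <=
  a / (a + b) * (x / a) `^ q + b / (a + b) * (y / b) `^ q.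
  by apply: H; rewrite inE/= in_itv/= ?xa ?yb.
have pE z c : 0 <= z -> 0 < c -> rz z c = c * (z / c) `^ q.
  move=> z0 c0; rewrite /rz powRM ?invr_ge0 ?(ltW c0)//.
  rewrite mulrCA; congr (_ * _).
  rewrite -(powRr1 (ltW c0)) -[in RHS]powR_inv1 ?powR_ge0// -!powRrM !mul1r mulN1r.
  by rewrite -powRD// (gt_eqF c0) implybT.
rewrite !pE ?addr_ge0//.
apply: le_trans (ler_wpM2l (ltW ab) H) _.
rewrite mulrDr !mulrA.
by rewrite (mulrC (a + b) a) (mulrC (a + b) b) !mulfK.
Qed.

Variable D : R -> R -> R.
Hypothesis D0 : forall x y, 0 <= D x y.

Fixpoint rsum (x : R) (s : seq R) : R :=
  if s is y :: s' then rz (D x y) (y - x) + rsum y s' else 0.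

(* F. Riesz: for a distance [D], this characterizes the curves of class AC^q; the estimate is additive over subintervals and passes through integrals over lines. *)
Definition Rbound (a b M : R) : Prop :=
  forall x s, path <%R x s -> a <= x -> last x s <= b -> rsum x s <= M.

Lemma rsum_ge0 x s : 0 <= rsum x s.
Proof. by elim: s x => //= y s IH x; rewrite addr_ge0 ?rz_ge0. Qed.

Lemma path_lt_last (x : R) s : path <%R x s -> x <= last x s.
Proof. by elim: s x => //= y s IH x /andP[xy /IH]; apply: le_trans; exact: ltW. Qed.

Lemma Rbound_cat a b c M N : a <= b -> b <= c ->
  {in `[a, c] & &, forall x y z, D x z <= D x y + D y z} ->
  Rbound a b M -> Rbound b c N -> Rbound a c (M + N).
Proof.
move=> ab bc tri HM HN.
suff key x s : path <%R x s -> a <= x <= b -> last x s <= c ->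
  exists s1 s2, [/\ path <%R x s1, last x s1 <= b, path <%R b s2, last b s2 <= c &
   rsum x s <= rsum x s1 + rsum b s2].
  move=> x s ps ax lc.
  have N0 : 0 <= N by apply: (HN b [::]).
  have M0 : 0 <= M by apply: (HM a [::]).
  have [xb|bx] := lerP x b; last by apply: le_trans (HN x s ps (ltW bx) lc) _; rewrite lerDr.
  have [|s1 [s2 [p1 l1 p2 l2 H]]] := key x s ps _ lc; first by rewrite ax.
  apply: le_trans H _; apply: lerD; first exact: HM.
  exact: HN.
elim: s x => [|y s IH] x /=.
  by move=> _ /andP[_ xb] _; exists [::], [::]; split => //=; rewrite ?addr0.
move=> /andP[xy ps] /andP[ax xb] lc.
have yc := le_trans (path_lt_last ps) lc.
have ay := le_trans ax (ltW xy).
have [yb|by_] := lerP y b.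
  have [|s1 [s2 [p1 l1 p2 l2 H]]] := IH y ps _ lc; first by rewrite ay yb.
  exists (y :: s1), s2; split => //=; first by rewrite xy.
  by rewrite -addrA lerD2l.
have [xb'|xb'] := eqVneq x b.
  exists [::], (y :: s); split => //=; first by rewrite by_.
  by rewrite add0r xb'.
have {xb'}xb' : x < b by rewrite lt_neqAle xb'.
(* The step from x to y jumps over b. Inserting b can only increase the sum, by the triangle
   inequality and [rz_add]. *)
exists [:: b], (y :: s); split => //=; rewrite ?xb' ?by_//.
rewrite addr0 addrA lerD2r.
have -> : y - x = (b - x) + (y - b) by lra.
apply: le_trans (rz_add (D0 _ _) (D0 _ _) _ _); rewrite ?subr_gt0//.
apply: rz_le => //; apply: tri; rewrite in_itv/=.
- by rewrite ax (le_trans xb bc).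
- by rewrite (le_trans ax xb).
- by rewrite ay.
Qed.

Lemma Rbound_sub a b a' b' M : a <= a' -> b' <= b -> Rbound a b M -> Rbound a' b' M.
Proof.
move=> aa bb H x s p h1 h2; apply: H => //; [exact: le_trans h1|exact: le_trans bb].
Qed.

Lemma Rbound_mono a b M N : M <= N -> Rbound a b M -> Rbound a b N.
Proof. by move=> MN H x s p h1 h2; apply: le_trans MN; exact: H. Qed.

Fixpoint vsum (x : R) (s : seq R) : R :=
  if s is y :: s' then D x y + vsum y s' else 0.

(** For x > l one has rz x l = x (x / l)^(q - 1) >= x. Summed over a partition, this turns a Riesz
    bound into a bound on the total variation, which [pencil_tube] uses with q = 1. *)
Lemma le_rz x l : 0 <= x -> 0 < l -> x <= l + rz x l.
Proof.
move=> x0 l0; have [xl|lx] := lerP x l; first by rewrite (le_trans xl)// lerDl rz_ge0.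
apply: ler_wpDl; first exact: ltW.
have x0' : 0 < x := lt_trans l0 lx.
have -> : rz x l = x * (x / l) `^ (q - 1).
  rewrite /rz powRM ?invr_ge0 ?(ltW l0)// mulrA mulr_powRB1//; last exact: lt_le_trans q1.
  by congr (_ * _); rewrite -powR_inv1 ?(ltW l0)// -powRrM; congr (_ `^ _); ring.
rewrite ler_peMr// -[leLHS](powRr0 (x / l)) ler_powR// ?subr_ge0//.
by rewrite ler_pdivlMr// mul1r ltW.
Qed.

Lemma vsum_le a b M x s : Rbound a b M ->
  path <%R x s -> a <= x -> last x s <= b -> vsum x s <= (b - a) + M.
Proof.
move=> H p ax lb.
have := H x s p ax lb; suff : vsum x s <= (last x s - x) + rsum x s by lra.
elim: s x p {ax lb H} => [|y s IH] x /=; first by rewrite subrr addr0.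
move=> /andP[xy ps].
have := IH y ps; have := @le_rz (D x y) (y - x) (D0 _ _).
by rewrite subr_gt0 => /(_ xy); lra.
Qed.

End Riesz.
(** * Norms of polynomials *)

Notation nrm := (@ComplexField.Normc.normc _).

Section ComplexNorm.
Variable R : realType.
Implicit Types x y : R[i].

Lemma nrmC x : `|x| = (nrm x)%:C%C.
Proof. by []. Qed.

Lemma nrm_ge0 x : 0 <= nrm x.
Proof. by case: x => a b /=; rewrite sqrtr_ge0. Qed.

Lemma nrmD x y : nrm (x + y) <= nrm x + nrm y.
Proof.
have := ler_normD x y.
by rewrite !nrmC -rmorphD lecR.
Qed.

Lemma nrmM x y : nrm (x * y) = nrm x * nrm y.
Proof. exact: ComplexField.Normc.normcM. Qed.

Lemma nrmV x : nrm x^-1 = (nrm x)^-1.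
Proof. exact: ComplexField.Normc.normcV. Qed.

Lemma nrm0 : nrm (0 : R[i]) = 0.
Proof. exact: ComplexField.Normc.normc0. Qed.

Lemma nrm1 : nrm (1 : R[i]) = 1.
Proof. exact: ComplexField.Normc.normc1. Qed.

Lemma nrm_eq0 x : (nrm x == 0) = (x == 0).
Proof.
apply/eqP/eqP => [|->]; [exact: ComplexField.Normc.eq0_normc|exact: nrm0].
Qed.

Lemma nrm_gt0 x : (0 < nrm x) = (x != 0).
Proof. by rewrite lt0r nrm_eq0 nrm_ge0 andbT. Qed.

Lemma nrmN x : nrm (- x) = nrm x.
Proof. by case: x => a b /=; rewrite !sqrrN. Qed.

Lemma nrmB x y : nrm (x - y) = nrm (y - x).
Proof. by rewrite -nrmN opprB. Qed.

Lemma nrmX x n : nrm (x ^+ n) = nrm x ^+ n.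
Proof. by elim: n => [|n IH]; rewrite ?expr0 ?nrm1// !exprS nrmM IH. Qed.

Lemma nrmR (a : R) : nrm (a%:C%C) = `|a|.
Proof. by rewrite /= expr0n/= addr0 sqrtr_sqr. Qed.

Lemma nrm_sum (I : Type) (r : seq I) (P : pred I) (F : I -> R[i]) :
  nrm (\sum_(i <- r | P i) F i) <= \sum_(i <- r | P i) nrm (F i).
Proof.
elim/big_rec2: _ => [|i y x _ H]; first by rewrite nrm0.
by apply: (le_trans (nrmD _ _)); rewrite lerD2l.
Qed.

Lemma nrm_prod (I : Type) (r : seq I) (P : pred I) (F : I -> R[i]) :
  nrm (\prod_(i <- r | P i) F i) = \prod_(i <- r | P i) nrm (F i).
Proof. by elim/big_rec2: _ => [|i y x _ <-]; rewrite ?nrm1 ?nrmM. Qed.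

Lemma nrm_tri x y z : nrm (x - z) <= nrm (x - y) + nrm (y - z).
Proof. by rewrite (le_trans _ (nrmD _ _))// addrA subrK. Qed.

Lemma nrm_ge_sub x y : nrm x - nrm y <= nrm (x - y).
Proof. by rewrite lerBlDr (le_trans _ (nrmD _ _))// subrK. Qed.

Lemma nrm_Re x : `|complex.Re x| <= nrm x.
Proof. by case: x => a b /=; rewrite -sqrtr_sqr ler_wsqrtr// lerDl sqr_ge0. Qed.

Lemma nrm_Im x : `|complex.Im x| <= nrm x.
Proof. by case: x => a b /=; rewrite -sqrtr_sqr ler_wsqrtr// lerDr sqr_ge0. Qed.

Lemma nrm_le_ReIm x : nrm x <= `|complex.Re x| + `|complex.Im x|.
Proof.
have -> : x = (complex.Re x)%:C%C + 'i%C * (complex.Im x)%:C%C by exact: complexE.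
apply: le_trans (nrmD _ _) _; rewrite nrmM !nrmR.
have -> : nrm ('i%C : R[i]) = 1 by rewrite /= expr0n expr1n add0r sqrtr1.
by rewrite mul1r -complexE.
Qed.
End ComplexNorm.

Section PolyNorm.
Variable R : realType.
Local Notation C := R[i].
Implicit Types F G Q : {poly C}.

(** The l^1 norm of the coefficients, chosen because it is submultiplicative with constant 1 and
    dominates every coefficient. *)
Definition pn F : R := \sum_(i < size F) nrm F`_i.

Lemma pnE n F : (size F <= n)%N -> pn F = \sum_(i < n) nrm F`_i.
Proof.
move=> sF; rewrite /pn (big_ord_widen n (fun i => nrm F`_i))//.
rewrite [RHS](bigID (fun i : 'I_n => (i < size F)%N))/= [X in _ + X]big1 ?addr0// => i.
by rewrite -leqNgt => H; rewrite nth_default// nrm0.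
Qed.

Lemma pn_ge0 F : 0 <= pn F.
Proof. by apply: sumr_ge0 => i _; exact: nrm_ge0. Qed.

Lemma pn0 : pn 0 = 0.
Proof. by rewrite /pn size_poly0 big_ord0. Qed.

Lemma pn_coef F i : nrm F`_i <= pn F.
Proof.
have [H|H] := ltnP i (size F); last by rewrite nth_default// nrm0 pn_ge0.
by rewrite /pn (bigD1 (Ordinal H))//= lerDl sumr_ge0// => j _; exact: nrm_ge0.
Qed.

Lemma pnD F G : pn (F + G) <= pn F + pn G.
Proof.
pose n := maxn (size F) (size G).
rewrite (@pnE n) ?(leq_trans (size_polyD _ _))// (@pnE n F) ?leq_maxl// (@pnE n G) ?leq_maxr//.
by rewrite -big_split/=; apply: ler_sum => i _; rewrite coefD nrmD.
Qed.

Lemma pnZ c F : pn (c *: F) = nrm c * pn F.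
Proof.
rewrite (@pnE (size F)) ?size_scale_leq// /pn mulr_sumr.
by apply: eq_bigr => i _; rewrite coefZ nrmM.
Qed.

Lemma pnN F : pn (- F) = pn F.
Proof. by rewrite -scaleN1r pnZ nrmN nrm1 mul1r. Qed.

Lemma pnB F G : pn (F - G) <= pn F + pn G.
Proof. by rewrite (le_trans (pnD _ _))// pnN. Qed.

Lemma pnC c : pn c%:P = nrm c.
Proof. by rewrite (@pnE 1) ?size_polyC_leq1// big_ord1 coefC. Qed.

Lemma pn_sum (I : Type) (r : seq I) (P : pred I) (H : I -> {poly C}) :
  pn (\sum_(i <- r | P i) H i) <= \sum_(i <- r | P i) pn (H i).
Proof.
elim/big_rec2: _ => [|i y x _ h]; first by rewrite pn0.
by apply: (le_trans (pnD _ _)); rewrite lerD2l.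
Qed.

Lemma pnMXn F n : pn (F * 'X^n) <= pn F.
Proof.
have sz : (size (F * 'X^n)%R <= n + size F)%N.
  by apply: leq_trans (size_polyMleq _ _) _; rewrite size_polyXn addnS addnC.
rewrite (pnE sz).
rewrite big_split_ord/= big1 => [|i _]; last by rewrite coefMXn ltn_ord nrm0.
rewrite add0r /pn; apply: ler_sum => i _.
by rewrite coefMXn ltnNge leq_addr/= addKn.
Qed.

Lemma pnM F G : pn (F * G) <= pn F * pn G.
Proof.
rewrite -[in leLHS](coefK G) poly_def mulr_sumr.
apply: le_trans (pn_sum _ _ _) _; rewrite {2}/pn mulr_sumr.
apply: ler_sum => i _; rewrite -mul_polyC mulrCA mul_polyC pnZ mulrC.
by rewrite ler_wpM2r ?nrm_ge0 ?pnMXn.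
Qed.

Lemma pnX1 : pn 'X <= 1.
Proof.
by have := pnMXn 1 1; rewrite mul1r expr1 -[in leRHS]polyC1 pnC nrm1.
Qed.

Lemma pn_XsubC c : pn ('X - c%:P) <= 1 + nrm c.
Proof. by rewrite (le_trans (pnB _ _))// pnC lerD2r pnX1. Qed.

Lemma pn_prod (I : Type) (r : seq I) (H : I -> {poly C}) (B : R) :
  (forall i, pn (H i) <= B) -> pn (\prod_(i <- r) H i) <= B ^+ size r.
Proof.
move=> HB; elim: r => [|i r IH]; first by rewrite big_nil -polyC1 pnC nrm1 expr0.
rewrite big_cons /= exprS (le_trans (pnM _ _))//.
by rewrite ler_pM ?pn_ge0.
Qed.

Lemma pn_root_prod (r : seq C) (B : R) : {in r, forall z, nrm z <= B} -> 0 <= B ->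
  pn (\prod_(z <- r) ('X - z%:P)) <= (1 + B) ^+ size r.
Proof.
move=> H B0; elim: r H => [|z r IH] H; first by rewrite big_nil -polyC1 pnC nrm1.
rewrite big_cons /= exprS (le_trans (pnM _ _))//.
rewrite ler_pM ?pn_ge0//.
  by rewrite (le_trans (pn_XsubC _))// lerD2l H// mem_head.
by apply: IH => u Hu; apply: H; rewrite inE Hu orbT.
Qed.

Lemma pn_horner F z (B : R) : 1 <= B -> nrm z <= B ->
  nrm F.[z] <= pn F * B ^+ size F.
Proof.
move=> B1 zB; rewrite horner_coef (le_trans (nrm_sum _ _ _))// /pn mulr_suml.
apply: ler_sum => i _; rewrite nrmM nrmX ler_wpM2l ?nrm_ge0//.
have B0 : 0 <= B := le_trans ler01 B1.
have zi : nrm z ^+ i <= B ^+ i by rewrite lerXn2r ?nnegrE ?nrm_ge0.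
apply: le_trans zi _.
by rewrite ler_weXn2l// ltnW.
Qed.

Lemma root_bound F z : F \is monic -> root F z -> nrm z <= pn F.
Proof.
move=> mF rz.
have [z1|z1] := lerP (nrm z) 1.
  apply: le_trans z1 _; have := pn_coef F (size F).-1.
  by rewrite -lead_coefE (monicP mF) nrm1.
have z0 : 0 < nrm z by rewrite (lt_trans _ z1).
have sF : (0 < size F)%N by rewrite size_poly_gt0 monic_neq0.
case E : (size F) sF => [//|[|m]] _.
  by move: rz; rewrite (size1_polyC (eq_leq E)) rootC => /eqP h; move: (monic_neq0 mF);
    rewrite (size1_polyC (eq_leq E)) h eqxx.
have lc : F`_m.+1 = 1 by have := monicP mF; rewrite lead_coefE E.
move: rz; rewrite /root horner_coef E big_ord_recr/= lc mul1r addrC addr_eq0 => /eqP H.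
have : nrm z ^+ m.+1 <= (\sum_(i < m.+1) nrm F`_i) * nrm z ^+ m.
  rewrite -nrmX H nrmN (le_trans (nrm_sum _ _ _))// mulr_suml.
  apply: ler_sum => i _; rewrite nrmM nrmX ler_wpM2l ?nrm_ge0// ler_weXn2l ?(ltW z1)//.
  by rewrite -ltnS.
rewrite exprS ler_pM2r ?exprn_gt0// => /le_trans; apply.
by rewrite /pn E [leRHS]big_ord_recr/= lerDl nrm_ge0.
Qed.

(** Division by X - mu is bounded on polynomials of bounded degree: the top coefficient of F is read
    off from the product, and peeling it off lowers the degree. This allows a root to be removed in
    [root_match] and in [inv_mod1]. *)
Lemma pn_divX (mu : C) F n : (size F <= n)%N ->
  pn F <= (3 + nrm mu) ^+ n * pn (('X - mu%:P) * F).
Proof.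
elim: n F => [|n IH] F sF.
  by move: sF; rewrite leqn0 size_poly_eq0 => /eqP ->; rewrite mulr0 pn0 mulr0.
pose c := F`_n; pose F' := F - c *: 'X^n.
have sF' : (size F' <= n)%N.
  apply/leq_sizeP => j nj; rewrite coefB coefZ coefXn.
  move: nj; rewrite leq_eqVlt => /predU1P[<-|nj]; first by rewrite eqxx mulr1 subrr.
  by rewrite gtn_eqF// mulr0 subr0 nth_default// (leq_trans sF).
have cE : nrm c <= pn (('X - mu%:P) * F).
  have := pn_coef (('X - mu%:P) * F) n.+1.
  by rewrite mulrBl coefB coefXM/= -/c mul_polyC coefZ [F`_n.+1]nth_default// mulr0 subr0.
set E := ('X - mu%:P) * F in cE *.
have HF : F = F' + c *: 'X^n by rewrite subrK.
have EE : ('X - mu%:P) * F' = E - c *: (('X - mu%:P) * 'X^n).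
  by rewrite /F' mulrBr -scalerAr.
have pX : pn (('X - mu%:P) * 'X^n) <= 1 + nrm mu.
  exact: le_trans (pnMXn _ _) (pn_XsubC _).
have E0 : 0 <= pn E := pn_ge0 _.
have m0 := nrm_ge0 mu.
have h1 : pn (('X - mu%:P) * F') <= pn E * (2 + nrm mu).
  rewrite EE (le_trans (pnB _ _))// pnZ.
  have : nrm c * pn (('X - mu%:P) * 'X^n) <= pn E * (1 + nrm mu).
    by rewrite ler_pM ?nrm_ge0 ?pn_ge0.
  by lra.
have p1 : 1 <= (3 + nrm mu) ^+ n by rewrite exprn_ege1//; lra.
have h2 := le_trans (IH _ sF') (ler_wpM2l (le_trans ler01 p1) h1).
have h3 : pn F <= pn F' + nrm c.
  rewrite {1}HF (le_trans (pnD _ _))// pnZ lerD2l ler_piMr ?nrm_ge0//.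
  by have := pnMXn 1 n; rewrite mul1r -[in leRHS]polyC1 pnC nrm1.
have h4 : pn E <= (3 + nrm mu) ^+ n * pn E by rewrite ler_peMl.
rewrite exprSr; apply: (le_trans h3).
apply: le_trans (lerD h2 (le_trans cE h4)) _.
by rewrite le_eqVlt; apply/orP; left; apply/eqP; ring.
Qed.

Lemma pn_polyXn i : pn ('X^i) <= 1.
Proof. by have := pnMXn 1 i; rewrite mul1r -[in leRHS]polyC1 pnC nrm1. Qed.

Lemma modp_step Q (r : {poly C}) m : Q \is monic -> size Q = m.+1 -> (size r <= m)%N ->
  ('X * r) %% Q = 'X * r - ('X * r)`_m *: Q.
Proof.
move=> mQ sQ sr; set c := _`_m.
have -> : 'X * r = c%:P * Q + ('X * r - c *: Q) by rewrite mul_polyC addrCA subrr addr0.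
rewrite modpD modp_mull add0r modp_small; first by rewrite mul_polyC [c *: Q + _]addrCA subrr addr0.
rewrite sQ ltnS; apply/leq_sizeP => j; rewrite leq_eqVlt => /predU1P[<-|mj].
  rewrite coefB coefZ -/c; have := monicP mQ; rewrite lead_coefE sQ /= => ->.
  by rewrite mulr1 subrr.
rewrite coefB coefZ [Q`_j]nth_default ?sQ// mulr0 subr0 coefXM.
by case: j mj => //= j mj; rewrite nth_default// (leq_trans sr).
Qed.

Lemma pn_modXn Q m i : Q \is monic -> size Q = m.+1 -> pn ('X^i %% Q) <= (1 + pn Q) ^+ i.+1.
Proof.
move=> mQ sQ; have Q0 := pn_ge0 Q.
have sr i' : (size ('X^i' %% Q)%R <= m)%N.
  by rewrite -ltnS -sQ ltn_modp monic_neq0.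
elim: i => [|i IH].
  rewrite expr0 expr1; case: m sQ {sr} => [|m] sQ.
    have -> : Q = 1.
      rewrite [Q]size1_polyC ?sQ//; have := monicP mQ.
      by rewrite lead_coefE sQ /= => ->.
    by rewrite modp1 pn0 addr_ge0 ?pn_ge0.
  by rewrite modp_small ?size_poly1 ?sQ// -polyC1 pnC nrm1 lerDl.
rewrite exprS -modp_mul (modp_step mQ sQ (sr i)).
apply: (le_trans (pnB _ _)); rewrite pnZ.
have hX : pn ('X * ('X^i %% Q)) <= pn ('X^i %% Q).
  by rewrite mulrC -[X in _ * X]expr1 pnMXn.
apply: (@le_trans _ _ (pn ('X^i %% Q) * (1 + pn Q))).
  rewrite mulrDr mulr1 lerD// ler_wpM2r// (le_trans (pn_coef _ _))//.
by rewrite [leRHS]exprSr ler_wpM2r// addr_ge0.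
Qed.

(** [F %% Q] expanded on the remainders of the monomials. It agrees with the remainder for F of size
    at most n, and it is linear with a norm controlled by [pn Q], as [TT_lin] requires. *)
Definition modn_lin (n : nat) Q F : {poly C} := \sum_(i < n) F`_i *: ('X^i %% Q).

Lemma modn_linE n Q F : (size F <= n)%N -> modn_lin n Q F = F %% Q.
Proof.
move=> sF; rewrite /modn_lin -[in RHS](coefK F) poly_def.
rewrite (big_ord_widen n (fun i => F`_i *: 'X^i))// -[RHS]/(modp _ Q).
rewrite (big_morph (fun p => p %% Q) (modpD Q) (mod0p Q)).
rewrite [LHS](bigID (fun i : 'I_n => (i < size F)%N))/= [X in _ + X]big1 ?addr0.
  by apply: eq_bigr => i _; rewrite modpZl.
by move=> i; rewrite -leqNgt => H; rewrite nth_default// scale0r.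
Qed.

Lemma modn_lin_pn n Q m : Q \is monic -> size Q = m.+1 ->
  forall F, pn (modn_lin n Q F) <= (1 + pn Q) ^+ n * pn F.
Proof.
move=> mQ sQ F; rewrite /modn_lin (le_trans (pn_sum _ _ _))//.
have Q1 : 1 <= 1 + pn Q by rewrite lerDl pn_ge0.
apply: (@le_trans _ _ (\sum_(i < n) (1 + pn Q) ^+ n * nrm F`_i)).
  apply: ler_sum => i _; rewrite pnZ mulrC ler_wpM2r ?nrm_ge0//.
  by rewrite (le_trans (pn_modXn _ mQ sQ))// ler_weXn2l.
rewrite -mulr_sumr ler_wpM2l ?exprn_ge0 ?(le_trans ler01)//.
have [H|/ltnW H] := leqP (size F) n; first by rewrite (pnE H).
rewrite /pn (big_ord_widen (size F) (fun i => nrm F`_i))//.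
by rewrite [leRHS](bigID (fun i : 'I_(size F) => (i < n)%N))/= lerDl sumr_ge0// => i _; exact: nrm_ge0.
Qed.

Lemma modn_lin_add n Q F G : modn_lin n Q (F + G) = modn_lin n Q F + modn_lin n Q G.
Proof. by rewrite /modn_lin -big_split/=; apply: eq_bigr => i _; rewrite coefD scalerDl. Qed.

Lemma modn_linZ n Q c F : modn_lin n Q (c *: F) = c *: modn_lin n Q F.
Proof. by rewrite /modn_lin scaler_sumr; apply: eq_bigr => i _; rewrite coefZ scalerA. Qed.
End PolyNorm.
(** * Curves of polynomials with Taylor expansions *)

Section TaylorClass.
Variable R : realType.
Local Notation C := R[i].
Implicit Types (F G : R -> {poly C}) (s : nat) (A B t : R).

(* [TT s A t F]: on [0, 1], [F] has a Taylor expansion of order [s] at [t] with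
   coefficients and remainder bounded by [A]; the recursion through the divided
   difference [G] makes products and quotients immediate *)
Fixpoint TT s A t F : Prop :=
  match s with
  | 0 => forall x, 0 <= x <= 1 -> pn (F x) <= A
  | s'.+1 => (forall x, 0 <= x <= 1 -> pn (F x) <= A) /\
      exists2 G, TT s' A t G & forall x, 0 <= x <= 1 -> F x = F t + (x - t)%:C%C *: G x
  end.

Lemma TT_bd s A t F x : TT s A t F -> 0 <= x <= 1 -> pn (F x) <= A.
Proof. by case: s => [|s] H Hx; [exact: H|case: H => H _; exact: H]. Qed.

Lemma TT_ge0 s A t F : TT s A t F -> 0 <= A.
Proof. by move=> /TT_bd H; apply: le_trans (pn_ge0 (F 0)) _; apply: H; rewrite lexx ler01. Qed.

Lemma TT_mono s A B t F : A <= B -> TT s A t F -> TT s B t F.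
Proof.
move=> AB; elim: s F => [|s IH] F /=; first by move=> H x /H/le_trans; exact.
move=> [H [G HG E]]; split; first by move=> x /H/le_trans; exact.
by exists G => //; exact: IH.
Qed.

Lemma TT_pred s A t F : TT s.+1 A t F -> TT s A t F.
Proof.
elim: s F => [|s IH] F [H [G HG E]] /=; first exact: H.
by split=> //; exists G => //; exact: IH.
Qed.

Lemma TT_ext s A t F G : 0 <= t <= 1 -> (forall x, 0 <= x <= 1 -> F x = G x) -> TT s A t F -> TT s A t G.
Proof.
move=> t01 E; case: s => [|s] /=; first by move=> H x Hx; rewrite -E// H.
move=> [H [F' HF' EF]]; split; first by move=> x Hx; rewrite -E// H.
by exists F' => // x Hx; rewrite -!E// EF.
Qed.

Lemma TT_cst s A t c : pn c <= A -> TT s A t (fun=> c).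
Proof.
elim: s c => [|s IH] c H //=; split => //; exists (fun=> 0); last by move=> x _; rewrite scaler0 addr0.
by apply: IH; rewrite pn0 (le_trans (pn_ge0 c)).
Qed.

Lemma TT_add s A B t F G : TT s A t F -> TT s B t G -> TT s (A + B) t (fun x => F x + G x).
Proof.
elim: s F G => [|s IH] F G /=.
  by move=> HF HG x Hx; rewrite (le_trans (pnD _ _))// lerD ?HF ?HG.
move=> [HF [F' HF' EF]] [HG [G' HG' EG]]; split.
  by move=> x Hx; rewrite (le_trans (pnD _ _))// lerD ?HF ?HG.
exists (fun x => F' x + G' x); first exact: IH.
by move=> x Hx; rewrite EF// EG// scalerDr addrACA.
Qed.

Lemma TT_lin s A t F (Lm : {poly C} -> {poly C}) (c : R) : 
  (forall u v, Lm (u + v) = Lm u + Lm v) -> (forall a u, Lm (a *: u) = a *: Lm u) ->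
  0 <= c -> (forall u, pn (Lm u) <= c * pn u) ->
  TT s A t F -> TT s (c * A) t (fun x => Lm (F x)).
Proof.
move=> LD LZ c0 Lc; elim: s F => [|s IH] F /=.
  by move=> HF x Hx; rewrite (le_trans (Lc _))// ler_wpM2l// HF.
move=> [HF [F' HF' EF]]; split.
  by move=> x Hx; rewrite (le_trans (Lc _))// ler_wpM2l// HF.
exists (fun x => Lm (F' x)); first exact: IH.
by move=> x Hx; rewrite EF// LD LZ.
Qed.

Lemma TT_scale s A t F (a : C) : TT s A t F -> TT s (nrm a * A) t (fun x => a *: F x).
Proof.
apply: TT_lin => [u v|b u||u]; rewrite ?scalerDr ?nrm_ge0 ?pnZ//.
by rewrite !scalerA mulrC.
Qed.

Lemma TT_opp s A t F : TT s A t F -> TT s A t (fun x => - F x).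
Proof.
move=> H; have := @TT_lin s A t F (fun u => - u) 1; rewrite mul1r; apply=> //.
- by move=> u v; rewrite opprD.
- by move=> a u; rewrite scalerN.
- by move=> u; rewrite pnN mul1r.
Qed.

(** The product has the divided difference F' G + F(t) G', two products of one order less; hence a
    factor 2 per order. *)
Lemma TT_mul s A B t F G : 0 <= t <= 1 ->
  TT s A t F -> TT s B t G -> TT s (2 ^+ s * (A * B)) t (fun x => F x * G x).
Proof.
move=> t01; elim: s F G => [|s IH] F G.
  rewrite expr0 mul1r => HF HG x Hx; rewrite (le_trans (pnM _ _))//.
  by rewrite ler_pM ?pn_ge0 ?HF ?HG.
move=> HF HG; have A0 := TT_ge0 HF; have B0 := TT_ge0 HG.
have HG0 := TT_pred HG; move: HF HG => [HF [F' HF' EF]] [HG [G' HG' EG]]; split.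
  move=> x Hx; rewrite (le_trans (pnM _ _))//.
  apply: (@le_trans _ _ (A * B)); first by rewrite ler_pM ?pn_ge0 ?HF ?HG.
  by rewrite ler_peMl ?mulr_ge0// exprn_ege1// ler1n.
exists (fun x => F' x * G x + F t * G' x).
  have -> : 2 ^+ s.+1 * (A * B) = 2 ^+ s * (A * B) + 2 ^+ s * (A * B).
    by rewrite exprS -mulrA mulr_natl mulr2n.
  apply: TT_add; apply: IH => //; apply: TT_cst; exact: HF.
move=> x Hx; rewrite EF//= mulrDl [in F t * G x]EG// mulrDr scalerDr.
by rewrite -!scalerAr -!scalerAl -addrA [_ *: (F t * G' x) + _]addrC addrA.
Qed.

Lemma TT_step s A B t F G : 0 <= t <= 1 ->
  (forall x, 0 <= x <= 1 -> pn (F x) <= A) -> TT s B t G ->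
  (forall x, 0 <= x <= 1 -> F x = F t + (x - t)%:C%C *: G x) ->
  TT s.+1 (A + B) t F.
Proof.
move=> t01 HF HG E; have B0 := TT_ge0 HG.
have A0 : 0 <= A := le_trans (pn_ge0 _) (HF t t01).
split; first by move=> x Hx; rewrite (le_trans (HF x Hx))// lerDl.
by exists G => //; apply: TT_mono HG; rewrite lerDr.
Qed.

(** The divided difference of 1 / f at t is - G(x) / (f(x) f(t)), where G is that of f. It involves
    1 / f only at the previous order, so the order is raised one step at a time. *)
Lemma TT_inv s A c : 0 < c -> exists A', forall t (f : R -> C), 0 <= t <= 1 ->
  (forall x, 0 <= x <= 1 -> c <= nrm (f x)) ->
  TT s A t (fun x => (f x)%:P) -> TT s A' t (fun x => ((f x)^-1)%:P).
Proof.
move=> c0; have bd (f : R -> C) : (forall x, 0 <= x <= 1 -> c <= nrm (f x)) ->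
  forall x, 0 <= x <= 1 -> pn ((f x)^-1)%:P <= c^-1.
  move=> H x Hx; rewrite pnC nrmV lef_pV2 ?posrE// ?H//.
  by rewrite (lt_le_trans c0)// H.
elim: s => [|s [A' IH]]; first by exists c^-1 => t f t01 H _; exact: bd.
exists (c^-1 + (2 ^+ s * (2 ^+ s * (A' * c^-1) * (1 * A)))) => t f t01 H HT.
have HA' := IH t f t01 H (TT_pred HT).
case: HT => _ [G HG E].
apply: (@TT_step _ _ _ _ _ (fun x : R => - (((f x)^-1)%:P * ((f t)^-1)%:P * ((G x)`_0)%:P))) => //.
- exact: bd.
- apply: TT_opp; apply: TT_mul => //; first by apply: TT_mul => //; apply: TT_cst; exact: bd.
  apply: (@TT_lin _ _ _ _ (fun u => (u`_0)%:P)) => //.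
  + by move=> u v; rewrite coefD polyCD.
  + by move=> a u; rewrite coefZ -mul_polyC polyCM.
  + by move=> u; rewrite pnC mul1r pn_coef.
move=> x Hx.
have fx : f x != 0 by rewrite -nrm_gt0 (lt_le_trans c0)// H.
have ft : f t != 0 by rewrite -nrm_gt0 (lt_le_trans c0)// H.
have := congr1 (fun u : {poly C} => u`_0) (E x Hx); rewrite coefD coefZ !coefC /= => Ex.
rewrite -!polyCM -polyCN -mul_polyC -polyCM -polyCD; congr polyC.
have -> : (x - t)%:C%C * - ((f x)^-1 / f t * (G x)`_0) = - ((f x)^-1 / f t) * (f x - f t).
  have -> : f x - f t = (x - t)%:C%C * (G x)`_0 by apply/eqP; rewrite subr_eq addrC -Ex.
  by rewrite mulrN mulNr mulrCA.
by field; rewrite fx ft.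
Qed.

End TaylorClass.

(** * Separated factors of a curve of monic polynomials *)

Definition Pr (R : realType) (rs : seq R[i]) : {poly R[i]} := \prod_(z <- rs) ('X - z%:P).

Section Factors.
Variable R : realType.
Local Notation C := R[i].
Implicit Types (rs : seq C) (A g t : R).

Lemma Pr_monic rs : Pr rs \is monic.
Proof. exact: monic_prod_XsubC. Qed.

Lemma size_Pr rs : size (Pr rs) = (size rs).+1.
Proof. exact: size_prod_XsubC. Qed.

Lemma Pr_cat rs rs' : Pr (rs ++ rs') = Pr rs * Pr rs'.
Proof. by rewrite /Pr big_cat. Qed.

Lemma Pr_perm rs rs' : perm_eq rs rs' -> Pr rs = Pr rs'.
Proof. by move=> p; rewrite /Pr (perm_big _ p). Qed.

Lemma root_Pr rs z : root (Pr rs) z = (z \in rs).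
Proof. exact: root_prod_XsubC. Qed.

Lemma Pr_horner rs z : nrm (Pr rs).[z] = \prod_(u <- rs) nrm (z - u).
Proof.
rewrite /Pr horner_prod nrm_prod; apply: eq_bigr => u _; by rewrite hornerXsubC.
Qed.

Definition Cmod (A : R) m n : R := (1 + (1 + A) ^+ m) ^+ n.

Lemma pn_modPr A rs n (F : {poly C}) : 0 <= A -> {in rs, forall z, nrm z <= A} -> (size F <= n)%N ->
  pn (F %% Pr rs) <= Cmod A (size rs) n * pn F.
Proof.
move=> A0 HA sF; rewrite -(modn_linE _ sF).
apply: le_trans (modn_lin_pn n (Pr_monic rs) (size_Pr rs) F) _.
rewrite ler_wpM2r ?pn_ge0// /Cmod lerXn2r ?nnegrE ?addr_ge0 ?pn_ge0 ?exprn_ge0 ?addr_ge0//.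
by rewrite lerD2l pn_root_prod.
Qed.

(** Q - Q(mu) = H (X - mu), so - H / Q(mu) inverts X - mu modulo Q; the separation bounds |Q(mu)|
    from below by g^m. *)
Lemma inv_mod1 A g m : 0 <= A -> 0 < g -> exists B, forall rs mu,
  size rs = m -> {in rs, forall z, nrm z <= A} -> nrm mu <= A ->
  {in rs, forall z, g <= nrm (mu - z)} ->
  exists W : {poly C}, [/\ (size W <= m)%N, pn W <= B & (W * ('X - mu%:P)) %% Pr rs = 1 %% Pr rs].
Proof.
move=> A0 g0.
exists ((g ^+ m)^-1 * ((3 + A) ^+ m * ((1 + A) ^+ m + (A + A) ^+ m))) => rs mu srs HA HmA Hg.
pose Q := Pr rs; pose a := Q.[mu].
have ag : g ^+ m <= nrm a.
  rewrite /a Pr_horner -srs; elim: {srs HA Q a} rs Hg => [|z rs IH] Hg; first by rewrite big_nil.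
  rewrite big_cons exprS ler_pM ?exprn_ge0 ?(ltW g0)//; first by rewrite Hg ?mem_head.
  by apply: IH => u Hu; rewrite Hg// inE Hu orbT.
have aA : nrm a <= (A + A) ^+ m.
  rewrite /a Pr_horner -srs; elim: {srs Hg Q a ag} rs HA => [|z rs IH] Hg; first by rewrite big_nil.
  rewrite big_cons /= exprS ler_pM ?nrm_ge0 ?prodr_ge0 //.
  - by move=> i _; exact: nrm_ge0.
  - by rewrite (le_trans (nrmD _ _))// nrmN lerD// Hg ?mem_head.
  - by apply: IH => u Hu; rewrite Hg// inE Hu orbT.
have gm0 : 0 < g ^+ m by rewrite exprn_gt0.
have a0 : a != 0 by rewrite -nrm_gt0 (lt_le_trans gm0).
have rt : root (Q - a%:P) mu by rewrite rootE hornerD hornerN hornerC subrr.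
have [H HE] := factor_theorem _ _ rt.
have sH : (size H <= m)%N.
  have [->|H0] := eqVneq H 0; first by rewrite size_poly0.
  have : (size (H * ('X - mu%:P))%R <= m.+1)%N.
    rewrite -HE (leq_trans (size_polyD _ _))// geq_max size_Pr srs leqnn size_polyN.
    by rewrite (leq_trans (size_polyC_leq1 _)).
  by rewrite size_Mmonic ?monicXsubC// size_XsubC addn2.
exists (- a^-1 *: H); split.
- exact: leq_trans (size_scale_leq _ _) sH.
- rewrite pnZ nrmN nrmV; apply: ler_pM; rewrite ?invr_ge0 ?nrm_ge0 ?pn_ge0//.
    by rewrite lef_pV2 ?posrE ?nrm_gt0.
  apply: le_trans (pn_divX mu sH) _.
  rewrite mulrC -mulrC [('X - _) * H]mulrC -HE.
  apply: ler_pM; rewrite ?pn_ge0 ?exprn_ge0 ?addr_ge0 ?nrm_ge0//.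
    by rewrite lerXn2r ?nnegrE ?addr_ge0 ?nrm_ge0// lerD2l.
  rewrite (le_trans (pnB _ _))// pnC lerD//.
  by rewrite -srs pn_root_prod.
rewrite -scalerAl -HE modpZl modpD modpN modpp add0r -[a%:P]mulr1 mul_polyC modpZl.
have aV : a^-1 * a = 1 := mulVf a0.
by rewrite scalerN scaleNr opprK scalerA aV scale1r.
Qed.

(** [Pr rs2] is inverted one linear factor at a time, with a reduction modulo [Pr rs1] after each
    product to keep the degree below m1. *)
Lemma inv_mod A g m1 m2 : 0 <= A -> 0 < g -> exists B, forall rs1 rs2,
  size rs1 = m1 -> size rs2 = m2 ->
  {in rs1, forall z, nrm z <= A} -> {in rs2, forall z, nrm z <= A} ->
  {in rs1 & rs2, forall z u, g <= nrm (z - u)} ->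
  exists V : {poly C}, [/\ (size V <= m1)%N, pn V <= B & (V * Pr rs2) %% Pr rs1 = 1 %% Pr rs1].
Proof.
move=> A0 g0; have [B1 HB1] := inv_mod1 m1 A0 g0.
elim: m2 => [|m2 [B2 IH]].
  exists (Cmod A m1 1 * 1) => rs1 rs2 s1 /size0nil -> H1 _ _.
  exists (1 %% Pr rs1); split.
  - by rewrite -ltnS -s1 -size_Pr ltn_modp monic_neq0// Pr_monic.
  - rewrite -s1 (le_trans (pn_modPr A0 H1 (n := 1) _)) ?size_poly1//.
    by rewrite -polyC1 pnC nrm1.
  - rewrite /Pr big_nil mulr1; exact: modp_id.
exists (Cmod A m1 (m1 + m1) * (B2 * B1)) => rs1 [//|mu rs2] s1 [s2] H1 H2 Hs.
have H2' : {in rs2, forall z, nrm z <= A} by move=> z Hz; rewrite H2// inE Hz orbT.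
have [|V [sV pV EV]] := IH rs1 rs2 s1 s2 H1 H2'.
  by move=> z u Hz Hu; rewrite Hs// inE Hu orbT.
have [||W [sW pW EW]] := HB1 rs1 mu s1 H1.
- by rewrite H2 ?mem_head.
- by move=> z Hz; rewrite nrmB Hs ?mem_head.
exists ((V * W) %% Pr rs1); split.
- by rewrite -ltnS -s1 -size_Pr ltn_modp monic_neq0// Pr_monic.
- rewrite -s1 (le_trans (pn_modPr A0 H1 (n := m1 + m1) _)) //.
    rewrite (leq_trans (size_polyMleq _ _))// (leq_trans (leq_pred _))//; exact: leq_add.
  rewrite s1 ler_wpM2l ?exprn_ge0 ?addr_ge0 ?exprn_ge0 ?addr_ge0//.
  by rewrite (le_trans (pnM _ _))// ler_pM ?pn_ge0.
rewrite /Pr big_cons -/(Pr rs2) mulrC modp_mul mulrC -/(Pr rs1).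
have -> : V * W * (('X - mu%:P) * Pr rs2) = (V * Pr rs2) * (W * ('X - mu%:P)) by ring.
rewrite -modp_mul EW modp_mul mulr1; exact: EV.
Qed.

Lemma mod_mul1 (F V W Q : {poly C}) : (V * W) %% Q = 1 %% Q -> (F * (V * W)) %% Q = F %% Q.
Proof. by move=> H; rewrite -modp_mul H modp_mul mulr1. Qed.

(** The separation compares roots at two different times, since [Pr (rs2 x)] has to be inverted
    modulo [Pr (rs1 t)]. *)
Definition factored A g m1 m2 (rs1 rs2 : R -> seq C) (P : R -> {poly C}) : Prop :=
  [/\ forall x, 0 <= x <= 1 -> size (rs1 x) = m1 /\ {in rs1 x, forall z, nrm z <= A},
      forall x, 0 <= x <= 1 -> size (rs2 x) = m2 /\ {in rs2 x, forall z, nrm z <= A},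
      forall x y, 0 <= x <= 1 -> 0 <= y <= 1 -> {in rs1 x & rs2 y, forall z u, g <= nrm (z - u)} &
      forall x, 0 <= x <= 1 -> P x = Pr (rs1 x) * Pr (rs2 x)].

(* With [V x] the inverse of [Q2 x] modulo [Q1 t], one has
   [Q1 x - Q1 t = (P x - P t) V x] and [V x - V t = - V x V t (Q2 x - Q2 t)]
   modulo [Q1 t]; so one order of regularity is gained at each step. *)
Lemma factor_step s A B0 B1 B2 B3 g m1 m2 : 0 <= A ->
  exists B, forall t (rs1 rs2 : R -> seq C) P (V : R -> {poly C}), 0 <= t <= 1 -> factored A g m1 m2 rs1 rs2 P ->
  TT s.+1 B0 t P ->
  (forall x, 0 <= x <= 1 -> [/\ (size (V x) <= m1)%N, pn (V x) <= B3 &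
      (V x * Pr (rs2 x)) %% Pr (rs1 t) = 1 %% Pr (rs1 t)]) ->
  TT s B1 t V ->
  TT s.+1 B t (fun x => Pr (rs1 x)) /\
  (TT s.+1 B2 t (fun x => Pr (rs2 x)) -> TT s.+1 B t V).
Proof.
move=> A0.
pose M1 := (1 + A) ^+ m1.
pose n := (m1 + m1 + (m1 + m2).+1)%N.
exists (M1 + (1 + M1) ^+ n * (2 ^+ s * (B0 * B1)) + (B3 + (1 + M1) ^+ n * (2 ^+ s * (2 ^+ s * (B1 * B3) * `|B2|)))).
move=> t rs1 rs2 P V t01 [F1 F2 F3 F4] TP HV TV.
pose Q1 := Pr (rs1 t).
have [s1t A1t] := F1 t t01; have [s2t A2t] := F2 t t01.
have mQ1 : Q1 \is monic := Pr_monic _.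
have sQ1 : size Q1 = m1.+1 by rewrite size_Pr s1t.
have pQ1 : pn Q1 <= M1 by rewrite /M1 -s1t pn_root_prod.
have M10 : 0 <= M1 := le_trans (pn_ge0 _) pQ1.
have linTT s' B t' F : TT s' B t' F -> TT s' ((1 + M1) ^+ n * B) t' (fun x => modn_lin n Q1 (F x)).
  apply: TT_lin.
  - exact: modn_lin_add.
  - by move=> a u; exact: modn_linZ.
  - by rewrite exprn_ge0// addr_ge0.
  - move=> u; rewrite (le_trans (modn_lin_pn n mQ1 sQ1 u))// ler_wpM2r ?pn_ge0//.
    by rewrite lerXn2r ?nnegrE ?addr_ge0 ?pn_ge0// lerD2l.
have B1_0 : 0 <= B1 := TT_ge0 TV.
have B0_0 : 0 <= B0 := TT_ge0 TP.
have B3_0 : 0 <= B3 by have [_ h _] := HV t t01; exact: le_trans (pn_ge0 _) h.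
have szmod (F : {poly C}) : (size F <= m1)%N -> F %% Q1 = F.
  by move=> h; rewrite modp_small// sQ1 ltnS.
have szB x y : 0 <= x <= 1 -> 0 <= y <= 1 -> (size (Pr (rs1 x) - Pr (rs1 y))%R <= m1)%N.
  move=> Hx Hy; apply/leq_sizeP => j; rewrite leq_eqVlt coefB => /predU1P[<-|mj].
    have l1 u : 0 <= u <= 1 -> (Pr (rs1 u))`_m1 = 1.
      by move=> Hu; have := monicP (Pr_monic (rs1 u)); rewrite lead_coefE size_Pr (F1 u Hu).1.
    by rewrite !l1// subrr.
  by rewrite !nth_default ?subrr ?size_Pr ?(F1 _ Hx).1 ?(F1 _ Hy).1.
have szP x : 0 <= x <= 1 -> (size (P x) <= (m1 + m2).+1)%N.
  move=> Hx; rewrite F4// (leq_trans (size_polyMleq _ _))// !size_Pr (F1 _ Hx).1 (F2 _ Hx).1.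
  by rewrite addSn addnS.
have szMm (F G : {poly C}) a b : (size F <= a)%N -> (size G <= b)%N -> (size (F * G)%R <= a + b)%N.
  move=> ha hb; rewrite (leq_trans (size_polyMleq _ _))// (leq_trans (leq_pred _))//.
  exact: leq_add.
have X0 : 0 <= M1 + (1 + M1) ^+ n * (2 ^+ s * (B0 * B1)).
  by rewrite addr_ge0// mulr_ge0 ?exprn_ge0 ?addr_ge0// mulr_ge0 ?exprn_ge0 ?mulr_ge0.
have H1 : TT s.+1 (M1 + (1 + M1) ^+ n * (2 ^+ s * (B0 * B1))) t (fun x => Pr (rs1 x)).
  move: TP => [_ [P' TP' EP]].
  apply: (@TT_step _ _ _ _ _ _ (fun x : R => modn_lin n Q1 (P' x * V x))) => //.
  - by move=> x Hx; have [h1 h2] := F1 x Hx; rewrite /M1 -h1 pn_root_prod.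
  - by apply: linTT; exact: TT_mul.
  move=> x Hx; apply/eqP; rewrite addrC -subr_eq; apply/eqP.
  rewrite -modn_linZ scalerAl.
  have -> : (x - t)%:C%C *: P' x = P x - P t by rewrite (EP x Hx) [RHS]addrC addKr.
  have [sV _ EV] := HV x Hx.
  rewrite modn_linE; last first.
    have -> : n = ((m1 + m2).+1 + (m1 + m1))%N by rewrite /n addnC.
    rewrite szMm ?(leq_trans sV) ?leq_addr//.
    by rewrite (leq_trans (size_polyD _ _))// size_polyN geq_max !szP.
  rewrite -[LHS]szmod ?szB// !F4//.
  have -> : (Pr (rs1 x) * Pr (rs2 x) - Pr (rs1 t) * Pr (rs2 t)) * V x =
    (Pr (rs1 x) - Q1) * (V x * Pr (rs2 x)) + (Q1 * (Pr (rs2 x) - Pr (rs2 t)) * V x).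
    by rewrite /Q1; ring.
  rewrite [RHS]modpD (mod_mul1 _ EV) -[X in _ = _ + X %% _]mulrA [X in _ = _ + X]modp_mulr.
  by rewrite addr0.
split.
  apply: TT_mono H1; rewrite lerDl addr_ge0// mulr_ge0 ?exprn_ge0 ?addr_ge0//.
  by rewrite mulr_ge0 ?exprn_ge0 ?addr_ge0// mulr_ge0 ?exprn_ge0// ?mulr_ge0 ?exprn_ge0 ?mulr_ge0//.
move=> [_ [G2 /(TT_mono (ler_norm B2)) TG2 EG2]].
have H2 : TT s.+1 (B3 + (1 + M1) ^+ n * (2 ^+ s * (2 ^+ s * (B1 * B3) * `|B2|))) t V.
  apply: (@TT_step _ _ _ _ _ _ (fun x : R => modn_lin n Q1 (- (V x * V t * G2 x)))) => //.
  - by move=> x Hx; have [] := HV x Hx.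
  - apply: linTT; apply: TT_opp; apply: TT_mul => //; apply: TT_mul => //.
    by apply: TT_cst; have [] := HV t t01.
  move=> x Hx; apply/eqP; rewrite addrC -subr_eq; apply/eqP.
  have [sV _ EV] := HV x Hx; have [sVt _ EVt] := HV t t01.
  rewrite -modn_linZ scalerN scalerAr.
  have -> : (x - t)%:C%C *: G2 x = Pr (rs2 x) - Pr (rs2 t) by rewrite (EG2 x Hx) [RHS]addrC addKr.
  rewrite modn_linE; last first.
    rewrite size_polyN; apply: (szMm _ _ (m1 + m1)%N (m1 + m2).+1); first exact: (szMm _ _ m1 m1).
    rewrite (leq_trans (size_polyD _ _))// size_polyN geq_max !size_Pr (F2 x Hx).1 s2t.
    by rewrite ltnS leq_addl.
  rewrite -[LHS]szmod; last by rewrite (leq_trans (size_polyD _ _))// size_polyN geq_max sV.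
  have -> : - (V x * V t * (Pr (rs2 x) - Pr (rs2 t))) =
     V x * (V t * Pr (rs2 t)) - V t * (V x * Pr (rs2 x)) by ring.
  by rewrite [RHS]modpD [X in _ = _ + X]modpN (mod_mul1 _ EV) (mod_mul1 _ EVt) -modpN -modpD.
by apply: TT_mono H2; rewrite lerDr.
Qed.

Lemma factoredC A g m1 m2 (rs1 rs2 : R -> seq C) P : factored A g m1 m2 rs1 rs2 P ->
  factored A g m2 m1 rs2 rs1 P.
Proof.
move=> [F1 F2 F3 F4]; split => //.
  by move=> x y Hx Hy z u Hz Hu; rewrite nrmB (F3 y x).
by move=> x Hx; rewrite F4// mulrC.
Qed.

(** A quantitative Hensel lemma: the factors inherit the regularity of the product as long as their
    roots stay apart. The induction on s carries the two factors together with the inverse of each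
    modulo the other, because the next order of each of these curves uses the previous order of the
    others. *)
Lemma factor_TT s A B0 g m1 m2 : 0 <= A -> 0 < g ->
  exists B, forall t (rs1 rs2 : R -> seq C) P, 0 <= t <= 1 ->
  factored A g m1 m2 rs1 rs2 P -> TT s B0 t P ->
  TT s B t (fun x => Pr (rs1 x)) /\ TT s B t (fun x => Pr (rs2 x)).
Proof.
move=> A0 g0.
have [C1 HC1] := inv_mod m1 m2 A0 g0; have [C2 HC2] := inv_mod m2 m1 A0 g0.
suff [B HB] : exists B, forall t (rs1 rs2 : R -> seq C) P (V U : R -> {poly C}), 0 <= t <= 1 ->
  factored A g m1 m2 rs1 rs2 P -> TT s B0 t P ->
  (forall x, 0 <= x <= 1 -> [/\ (size (V x) <= m1)%N, pn (V x) <= C1 &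
      (V x * Pr (rs2 x)) %% Pr (rs1 t) = 1 %% Pr (rs1 t)]) ->
  (forall x, 0 <= x <= 1 -> [/\ (size (U x) <= m2)%N, pn (U x) <= C2 &
      (U x * Pr (rs1 x)) %% Pr (rs2 t) = 1 %% Pr (rs2 t)]) ->
  [/\ TT s B t (fun x => Pr (rs1 x)), TT s B t (fun x => Pr (rs2 x)), TT s B t V & TT s B t U].
  exists B => t rs1 rs2 P t01 HF TP; have [F1 F2 F3 F4] := HF.
  have exV x : exists V : {poly C}, 0 <= x <= 1 -> [/\ (size V <= m1)%N, pn V <= C1 &
      (V * Pr (rs2 x)) %% Pr (rs1 t) = 1 %% Pr (rs1 t)].
    have [x01|] := boolP (0 <= x <= 1); last by exists 0.
    have [V HV] := HC1 (rs1 t) (rs2 x) (F1 t t01).1 (F2 x x01).1 (F1 t t01).2 (F2 x x01).2 (F3 t x t01 x01).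
    by exists V.
  have exU x : exists V : {poly C}, 0 <= x <= 1 -> [/\ (size V <= m2)%N, pn V <= C2 &
      (V * Pr (rs1 x)) %% Pr (rs2 t) = 1 %% Pr (rs2 t)].
    have [x01|] := boolP (0 <= x <= 1); last by exists 0.
    have [|V HV] := HC2 (rs2 t) (rs1 x) (F2 t t01).1 (F1 x x01).1 (F2 t t01).2 (F1 x x01).2.
      by move=> z u Hz Hu; rewrite nrmB (F3 x t).
    by exists V.
  have [V HV] := choice exV; have [U HU] := choice exU.
  by have [] := HB t rs1 rs2 P V U t01 HF TP HV HU.
elim: s => [|s [B IH]].
  exists ((1 + A) ^+ m1 + (1 + A) ^+ m2 + `|C1| + `|C2|) => t rs1 rs2 P V U t01 [F1 F2 _ _] _ HV HU.
  have a1 : 0 <= (1 + A) ^+ m1 by rewrite exprn_ge0// addr_ge0.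
  have a2 : 0 <= (1 + A) ^+ m2 by rewrite exprn_ge0// addr_ge0.
  have n1 := normr_ge0 C1; have n2 := normr_ge0 C2.
  have l1 := ler_norm C1; have l2 := ler_norm C2.
  split => x Hx /=.
  - have [h1 h2] := F1 x Hx; have := pn_root_prod h2 A0; rewrite h1 -/(Pr (rs1 x)); lra.
  - have [h1 h2] := F2 x Hx; have := pn_root_prod h2 A0; rewrite h1 -/(Pr (rs2 x)); lra.
  - have [_ h _] := HV x Hx; lra.
  - have [_ h _] := HU x Hx; lra.
have [D1 HD1] := factor_step s B0 B B C1 g m1 m2 A0.
have [D2 HD2] := factor_step s B0 B B C2 g m2 m1 A0.
have [E1 HE1] := factor_step s B0 B D2 C1 g m1 m2 A0.
have [E2 HE2] := factor_step s B0 B D1 C2 g m2 m1 A0.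
exists (`|D1| + `|D2| + `|E1| + `|E2|) => t rs1 rs2 P V U t01 HF TP HV HU.
have [T1 T2 T3 T4] := IH t rs1 rs2 P V U t01 HF (TT_pred TP) HV HU.
have [G1 _] := HD1 t rs1 rs2 P V t01 HF TP HV T3.
have [G2 _] := HD2 t rs2 rs1 P U t01 (factoredC HF) TP HU T4.
have [_ G3] := HE1 t rs1 rs2 P V t01 HF TP HV T3.
have [_ G4] := HE2 t rs2 rs1 P U t01 (factoredC HF) TP HU T4.
have n1 := normr_ge0 D1; have n2 := normr_ge0 D2; have n3 := normr_ge0 E1; have n4 := normr_ge0 E2.
have l1 := ler_norm D1; have l2 := ler_norm D2; have l3 := ler_norm E1; have l4 := ler_norm E2.
split.
- by apply: TT_mono G1; lra.
- by apply: TT_mono G2; lra.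
- by apply: TT_mono (G3 G2); lra.
- by apply: TT_mono (G4 G1); lra.
Qed.
End Factors.

(** * Interpolation *)

Lemma coef_comp_scaleX (F : comNzRingType) (p : {poly F}) r s :
  (p \Po (r *: 'X))`_s = p`_s * r ^+ s.
Proof.
rewrite poly.coef_comp_poly.
under eq_bigr do rewrite exprZn coefZ coefXn.
have [sp|sp] := ltnP s (size p); last first.
  rewrite nth_default// mul0r big1// => i _.
  by rewrite gtn_eqF ?mulr0// (leq_trans (ltn_ord i)).
rewrite (bigD1 (Ordinal sp))//= eqxx mulr1 big1 ?addr0// => i ne.
by rewrite eq_sym -(inj_eq val_inj)/= in ne *; rewrite (negPf ne) !mulr0.
Qed.

Lemma size_comp_scaleX (F : comNzRingType) (p : {poly F}) r :
  (size (p \Po (r *: 'X)) <= size p)%N.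
Proof.
by apply/leq_sizeP => j h; rewrite coef_comp_scaleX nth_default// mul0r.
Qed.

Section Interpolation.
Variable R : realType.

(** The nodes fill only half of the unit interval: for u in [0, 1], either u + [0, 1/2] or u -
    [0, 1/2] lies in [0, 1]. *)
Definition node (K i : nat) : R := i%:R / (2 * K%:R).

Lemma node_inj K : (0 < K)%N -> injective (fun i => (node K i)%:C%C).
Proof.
move=> K0 i j /complexI; rewrite /node => /(congr1 (fun x => x * (2 * K%:R))).
have nz : 2 * K%:R != 0 :> R by rewrite mulf_neq0// pnatr_eq0 -lt0n.
by rewrite !divfK// => /eqP; rewrite eqr_nat => /eqP.
Qed.

Lemma interpC K : (0 < K)%N -> exists2 CI : R, 1 <= CI &
  forall (T : {poly R[i]}) (B : R), (size T <= K)%N ->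
  (forall i : 'I_K, nrm T.[(node K i)%:C%C] <= B) -> forall s, nrm T`_s <= CI * B.
Proof.
move=> K0.
pose lg (i : 'I_K) : {poly R[i]} := tnth (lagrange K (fun i => (node K i)%:C%C)) i.
exists (1 + \sum_(i < K) pn (lg i)); first by rewrite lerDl sumr_ge0// => i _; exact: pn_ge0.
move=> T B sT HB s.
have B0 : 0 <= B by apply: le_trans (HB (Ordinal K0)); exact: nrm_ge0.
have TE := lagrange_gen K0 (node_inj K0) sT.
have -> : nrm T`_s = nrm (\sum_(i < K) T.[(node K i)%:C%C]%:P * lg i)`_s by rewrite -TE.
rewrite coef_sum (le_trans (nrm_sum _ _ _))//.
rewrite mulrDl mul1r ler_wpDl// mulr_suml; apply: ler_sum => i _.
rewrite coefCM nrmM mulrC ler_pM ?nrm_ge0 ?HB//; exact: pn_coef.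
Qed.

Lemma node01 K i : (i < K)%N -> 0 <= node K i <= 2^-1.
Proof.
move=> iK; have K0 : 0 < K%:R :> R by rewrite ltr0n (leq_ltn_trans _ iK).
rewrite /node divr_ge0 ?mulr_ge0//= ler_pdivrMr ?mulr_gt0// mulrA mulVf// mul1r.
by rewrite ler_nat ltnW.
Qed.

(* [u] is the position of the expansion point inside the unit interval *)
Lemma interp K : (0 < K)%N -> exists2 CI : R, 1 <= CI &
  forall (T : {poly R}) (B u : R), (size T <= K)%N -> 0 <= u <= 1 ->
  (forall y : R, 0 <= y <= 1 -> `|T.[y - u]| <= B) -> forall s, `|T`_s| <= CI * B.
Proof.
move=> K0; have [CI C1 H] := interpC K0; exists CI => // T B u sT /andP[u0 u1] HB s.
pose Tc := map_poly (real_complex R) T.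
have hE x : (map_poly (real_complex R) T).[x%:C%C] = (T.[x])%:C%C by rewrite horner_map.
have [u2|u2] := lerP u 2^-1.
  have := H Tc B; rewrite size_map_poly sT => /(_ isT) /(_ _ s).
  rewrite coef_map/= expr0n/= addr0 sqrtr_sqr; apply => i.
  rewrite hE nrmR; have /andP[n0 n1] := node01 (ltn_ord i).
  have := HB (node K i + u); rewrite addrK; apply; apply/andP; split; first by rewrite addr_ge0.
  lra.
(* T(-X), whose coefficients have the same absolute values; its values at the nodes are values of
   T.[y - u] with y <= u. *)
pose T' : {poly R[i]} := \poly_(i < K) ((-1) ^+ i * Tc`_i).
have := H T' B (size_poly _ _) _ s.
have cE : nrm T'`_s = `|T`_s|.
  rewrite coef_poly; case: ltnP => sK.
    by rewrite nrmM nrmX nrmN nrm1 expr1n mul1r coef_map/= expr0n/= addr0 sqrtr_sqr.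
  by rewrite nrm0 nth_default ?normr0// (leq_trans sT).
rewrite cE; apply => i; have /andP[n0 n1] := node01 (ltn_ord i).
have -> : T'.[(node K i)%:C%C] = (T.[- node K i])%:C%C.
  have sTc : (size (map_poly (real_complex R) T) <= K)%N by rewrite size_map_poly.
  rewrite -hE horner_poly (horner_coef_wide _ sTc).
  have E (c x : R[i]) j : (-1) ^+ j * c * x ^+ j = c * (- x) ^+ j.
    by rewrite [in RHS]exprNn mulrCA mulrA.
  by apply: eq_bigr => j _; rewrite rmorphN E.
rewrite nrmR; have := HB (u - node K i); rewrite addrAC subrr add0r; apply.
apply/andP; split; lra.
Qed.
End Interpolation.
(** * Cell decomposition of the parameter interval *)

Lemma size_count_label (T : Type) (L : finType) (lab : T -> L) (M : nat) (s : seq T) :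
  (forall l, (count (fun i => lab i == l) s <= M)%N) -> (size s <= #|L| * M)%N.
Proof.
move=> H; have -> : size s = (\sum_(l : L) count (fun i => lab i == l) s)%N.
  elim: s {H} => [|x s IH] /=; first by rewrite big1.
  rewrite big_split/= -IH (bigD1 (lab x))//= eqxx big1 ?addn0//.
  by move=> l /negPf; rewrite eq_sym => ->.
by rewrite -sum_nat_const leq_sum.
Qed.

(* The [a j] are the coefficients of a polynomial curve, [w j] being the degree of [a j] in the roots: at level [l] all the roots have size at most about [sig l], and rescaling by [sig l] makes one coefficient of order 1. A cell of level [l] is an interval on which the rescaled coefficients vary little. Since K = 4d and [sig l] = A 16^-l, a Taylor error r^K <= (sig l)^d allows cells of length 2^-l, whence O(2^l) cells. *)
Section Cells.
Variables (R : realType) (d N : nat).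
Hypothesis d0 : (0 < d)%N.
Let K := (4 * d)%N.
Variables (CI A c0 : R).
Hypothesis C1 : 1 <= CI.
Hypothesis HCI : forall (T : {poly R}) (B u : R), (size T <= K)%N -> 0 <= u <= 1 ->
  (forall y : R, 0 <= y <= 1 -> `|T.[y - u]| <= B) -> forall s, `|T`_s| <= CI * B.
Hypothesis A1 : 1 <= A.
Hypothesis c01 : 0 < c0 <= 1.
Variables (a : 'I_N -> R -> R) (w : 'I_N -> nat) (Tay : 'I_N -> R -> {poly R}).
Hypothesis wd : forall j, (0 < w j <= d)%N.
Hypothesis Tsz : forall j t, 0 <= t <= 1 -> (size (Tay j t) <= K)%N.
Hypothesis Tbd : forall j t s, 0 <= t <= 1 -> `|(Tay j t)`_s| <= A.
Hypothesis Terr : forall j t x, 0 <= t <= 1 -> 0 <= x <= 1 ->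
  `|a j x - (Tay j t).[x - t]| <= A * `|x - t| ^+ K.

Definition sig (l : nat) : R := A * 16^-1 ^+ l.

Definition lev t l : Prop := (forall j, `|a j t| <= sig l ^+ w j) /\
  exists j, sig l.+1 ^+ w j < `|a j t|.

(** What is later required of a cell: near constancy at the scale of its level and, after rescaling
    to [0, 1], Taylor expansions of order K with a bound that depends neither on l nor on r. *)
Definition cell_ok (l : nat) (u r t : R) : Prop :=
  [/\ 0 <= u /\ u + r <= 1, 0 < r <= 1, u <= t <= u + r, lev t l &
   (forall j x, u <= x <= u + r -> `|a j x - a j t| <= c0 * sig l ^+ w j) /\
   (forall j y, 0 <= y <= 1 -> exists T : {poly R}, [/\ (size T <= K)%N, forall s, `|T`_s| <= 3 * CI &
      forall x, 0 <= x <= 1 -> `|a j (u + r * x) / sig l ^+ w j - T.[x - y]| <= 3 * CI * `|x - y| ^+ K])].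

Let K0 : (0 < K)%N. Proof. by rewrite muln_gt0. Qed.
Let A0 : 0 < A. Proof. exact: lt_le_trans A1. Qed.

Lemma sig_gt0 l : 0 < sig l.
Proof. by rewrite mulr_gt0// exprn_gt0. Qed.

(** [k0] makes the nonconstant Taylor terms, fewer than K, add up to at most c0 / 4. [k1] is smaller
    by 2^K, for doubling a radius, and by 4 CI, for recovering Taylor coefficients by interpolation
    in [good_fail_osc]. *)
Let k0 : R := c0 / (4 * K%:R).
Let k1 : R := k0 * 2^-1 ^+ K / (4 * CI).

Lemma k0_gt0 : 0 < k0.
Proof. by case/andP: c01 => c0' _; rewrite divr_gt0// mulr_gt0// ltr0n. Qed.

Lemma k1_gt0 : 0 < k1.
Proof. have CI0 : 0 < CI := lt_le_trans ltr01 C1.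
have h0 := k0_gt0; have h2 : 0 < 2^-1 ^+ K :> R by rewrite exprn_gt0.
by apply: divr_gt0; apply: mulr_gt0. Qed.

Lemma k1_le : k1 <= k0 / 4.
Proof.
rewrite /k1 ler_pdivrMr ?mulr_gt0 ?(lt_le_trans _ C1)//.
have h : 2^-1 ^+ K <= 1 :> R by rewrite exprn_ile1// invf_le1// ler1n.
have := k0_gt0 => h0; have : k0 * 2^-1 ^+ K <= k0 by rewrite ler_piMr// ltW.
have : k0 <= k0 * CI by rewrite ler_peMr// ltW.
lra.
Qed.

Lemma sigw_ge l j : 16^-1 ^+ (l * d) <= sig l ^+ w j.
Proof.
rewrite /sig exprMn -exprM.
have h : 16^-1 ^+ (l * d) <= 16^-1 ^+ (l * w j) :> R.
  rewrite ler_wiXn2l ?invr_ge0// ?invf_le1 ?ler1n//.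
  by rewrite leq_mul2l; case/andP: (wd j) => _ ->; rewrite orbT.
apply: le_trans h _; rewrite ler_peMl ?exprn_ge0// exprn_ege1//.
Qed.

Lemma Tay0 j t : 0 <= t <= 1 -> (Tay j t)`_0 = a j t.
Proof.
move=> t01; have := Terr j t01 t01; rewrite subrr normr0 expr0n gtn_eqF// mulr0.
by rewrite normr_le0 subr_eq0 horner_coef0 => /eqP.
Qed.

(** The test bears on single Taylor terms instead of the oscillation itself: it is monotone in r,
    and by interpolation it can only fail through the remainder or through an oscillation of some
    coefficient. *)
Definition good (t r : R) (l : nat) : bool :=
  [forall j, [forall s : 'I_K, (0 < s)%N ==> (`|(Tay j t)`_s| * r ^+ s <= k0 * sig l ^+ w j)]
     && (A * r ^+ K <= k1 * sig l ^+ w j)].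

Lemma goodP t r l : reflect ((forall j s, (0 < s)%N -> (s < K)%N -> `|(Tay j t)`_s| * r ^+ s <= k0 * sig l ^+ w j) /\
   forall j, A * r ^+ K <= k1 * sig l ^+ w j) (good t r l).
Proof.
apply: (iffP forallP) => [H|[H1 H2] j].
  split => [j s s0 sK|j]; have /andP[/forallP h1 h2] := H j => //.
  by have := h1 (Ordinal sK); rewrite s0.
by rewrite H2 andbT; apply/forallP => s; apply/implyP => s0; exact: H1.
Qed.

(** A radius below which the crude bound A on the Taylor data already gives [good] at level l; it
    bounds the lengths of cells from below by a multiple of 16^(-l d). *)
Definition rmin (l : nat) : R := k1 / A * 16^-1 ^+ (l * d).

Lemma rmin_gt0 l : 0 < rmin l.
Proof. by rewrite /rmin mulr_gt0 ?exprn_gt0// divr_gt0 ?k1_gt0. Qed.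

Lemma good_small t r l : 0 <= t <= 1 -> 0 <= r <= 1 -> r <= rmin l -> good t r l.
Proof.
move=> t01 /andP[r0 r1] rl; apply/goodP.
have key j s : (0 < s)%N -> A * r ^+ s <= k1 * sig l ^+ w j.
  move=> s0; have h1 : r ^+ s <= r by case: s s0 => // s _; rewrite exprS ler_piMr// exprn_ile1.
  have h2 : A * r ^+ s <= k1 * 16^-1 ^+ (l * d).
    apply: (@le_trans _ _ (A * rmin l)); first by rewrite ler_wpM2l ?(ltW A0)// (le_trans h1).
    by rewrite /rmin mulrA [A * _]mulrC divfK// gt_eqF.
  by apply: le_trans h2 _; rewrite ler_wpM2l ?sigw_ge// ltW// k1_gt0.
split => [j s s0 sK|j]; last exact: key.
apply: (@le_trans _ _ (A * r ^+ s)); first by rewrite ler_wpM2r ?exprn_ge0// Tbd.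
apply: le_trans (key j s s0) _; rewrite ler_wpM2r ?exprn_ge0 ?(ltW (sig_gt0 _))//.
by have := k1_le; have := k0_gt0; lra.
Qed.

Lemma half_gt0 n : 0 < 2^-1 ^+ n :> R. Proof. by rewrite exprn_gt0. Qed.
Lemma half_le1 n : 2^-1 ^+ n <= 1 :> R. Proof. by rewrite exprn_ile1// invf_le1// ler1n. Qed.

Lemma half_small (e : R) : 0 < e -> exists n, 2^-1 ^+ n <= e.
Proof.
move=> e0; have [n Hn] := ltr_add_invr (y := 0) e0; exists n.
have h : 2^-1 ^+ n <= n.+1%:R^-1 :> R.
  rewrite exprVn lef_pV2 ?posrE ?exprn_gt0// -natrX ler_nat; exact: ltn_expl.
by apply: le_trans h _; rewrite ltW// -[X in X < _]add0r.
Qed.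

Lemma good_ex t l : 0 <= t <= 1 -> exists n, good t (2^-1 ^+ n) l.
Proof.
move=> t01; have [n Hn] := half_small (rmin_gt0 l); exists n.
by apply: good_small => //; rewrite half_le1 ltW ?half_gt0.
Qed.

(** Either r = 1 or doubling r fails. This failure is the event that [small_label] charges to a root
    of a Taylor polynomial. *)
Definition rad (t : R) (l : nat) (r : R) : Prop :=
  exists n, [/\ r = 2^-1 ^+ n, good t r l & (n = 0)%N \/ ~~ good t (2 * r) l].

Lemma rad_ex t l : 0 <= t <= 1 -> exists r, rad t l r.
Proof.
move=> t01; have ex := good_ex l t01.
case: (ex_minnP ex) => n gn nmin; exists (2^-1 ^+ n); exists n; split => //.
case: n gn nmin => [|n] gn nmin; [by left|right].
rewrite exprS mulrA mulfV// mul1r; apply/negP => /nmin; by rewrite ltnn.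
Qed.

Lemma rad_ge t l r : 0 <= t <= 1 -> rad t l r -> Num.min 1 (rmin l / 2) <= r.
Proof.
move=> t01 [[|n] [-> g ng]]; first by rewrite expr0 ge_min lexx.
case: ng => // ng; rewrite ge_min; apply/orP; right.
rewrite leNgt; apply/negP => lt; move/negP: ng; apply; apply: good_small => //.
  by rewrite exprS mulrA mulfV// mul1r half_le1 ltW ?half_gt0.
by move: lt; rewrite ltr_pdivlMr// mulrC => /ltW.
Qed.

Lemma rad_bd t l r : rad t l r -> 0 < r <= 1.
Proof. by move=> [n [-> _ _]]; rewrite half_gt0 half_le1. Qed.

Lemma Tay_expand j t x : 0 <= t <= 1 ->
  (Tay j t).[x] = a j t + \sum_(1 <= s < K) (Tay j t)`_s * x ^+ s.
Proof.
move=> t01; rewrite (horner_coef_wide _ (Tsz j t01)).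
by rewrite -(big_mkord xpredT (fun s => (Tay j t)`_s * x ^+ s)) big_ltn// expr0 mulr1 Tay0.
Qed.

Lemma good_osc t r l j x : 0 <= t <= 1 -> 0 <= x <= 1 -> 0 <= r -> good t r l -> `|x - t| <= r ->
  `|a j x - a j t| <= c0 / 2 * sig l ^+ w j.
Proof.
move=> t01 x01 r0 /goodP[H1 H2] xt.
have S0 : 0 <= sig l ^+ w j by rewrite exprn_ge0 ?(ltW (sig_gt0 _)).
have h1 : `|a j x - (Tay j t).[x - t]| <= k1 * sig l ^+ w j.
  apply: le_trans (Terr j t01 x01) (le_trans _ (H2 j)).
  by rewrite ler_wpM2l ?(ltW A0)// lerXn2r// nnegrE.
have h2 : `|(Tay j t).[x - t] - a j t| <= K%:R * (k0 * sig l ^+ w j).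
  rewrite Tay_expand// addrC addKr (le_trans (ler_norm_sum _ _ _))//.
  apply: (@le_trans _ _ (\sum_(1 <= s < K) k0 * sig l ^+ w j)).
    rewrite big_seq [leRHS]big_seq; apply: ler_sum => s.
    rewrite mem_index_iota => /andP[s0 sK]; rewrite normrM normrX.
    apply: le_trans (H1 j s s0 sK); rewrite ler_wpM2l// lerXn2r// nnegrE.
  rewrite big_const_nat iter_addr_0 -[leLHS]mulr_natl ler_wpM2r ?mulr_ge0 ?(ltW k0_gt0)//.
    by case/andP: c01 => /ltW.
  by rewrite ler_nat leq_subr.
have kk : K%:R * k0 = c0 / 4.
  by rewrite /k0; field; rewrite pnatr_eq0 -lt0n.
have : k1 <= c0 / 4.
  have h0 := k0_gt0; have h4 := k1_le.
  have : k0 <= K%:R * k0 by rewrite ler_peMl ?(ltW h0)// ler1n.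
  by rewrite kk; lra.
move=> /(ler_wpM2r S0) h3; move: h2; rewrite mulrA kk => h2.
have -> : a j x - a j t = (a j x - (Tay j t).[x - t]) + ((Tay j t).[x - t] - a j t) by rewrite addrA subrK.
apply: le_trans (ler_normD _ _) _; lra.
Qed.

Lemma lev_ub t l j : lev t l -> `|a j t| <= sig l ^+ w j.
Proof. by case. Qed.

Lemma cellP t l u r : 0 <= t <= 1 -> lev t l -> 0 < r <= 1 -> good t r l ->
  0 <= u -> u + r <= 1 -> u <= t <= u + r -> cell_ok l u r t.
Proof.
move=> t01 lv r01 g u0 ur tu.
have [r0 r1] := andP r01.
have S0 j : 0 < sig l ^+ w j by rewrite exprn_gt0// sig_gt0.
have osc j x : u <= x <= u + r -> `|a j x - a j t| <= c0 / 2 * sig l ^+ w j.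
  move=> /andP[x1 x2]; apply: (@good_osc t r); rewrite ?(ltW r0)//.
    by rewrite (le_trans u0)// (le_trans x2).
  by case/andP: tu => t1 t2; rewrite ler_norml; apply/andP; split; lra.
have [c00 c1] := andP c01.
split => //; split => j.
  move=> x /(osc j); move/le_trans; apply; rewrite ler_wpM2r ?(ltW (S0 j))//; lra.
move=> y y01.
have uy z : 0 <= z <= 1 -> u <= u + r * z <= u + r.
  move=> /andP[z0 z1]; rewrite lerDl mulr_ge0 ?(ltW r0)//= lerD2l.
  by rewrite ler_piMr// ltW.
have in01 z : u <= z <= u + r -> 0 <= z <= 1.
  by move=> /andP[h1 h2]; rewrite (le_trans u0)// (le_trans h2).
have t'01 : 0 <= u + r * y <= 1 := in01 _ (uy y y01).
(* The Taylor polynomial at the image u + r y of y, written in the coordinates of the cell. *)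
pose T := (sig l ^+ w j)^-1 *: (Tay j (u + r * y) \Po (r *: 'X)).
have TE z : T.[z] = (sig l ^+ w j)^-1 * (Tay j (u + r * y)).[r * z].
  by rewrite /T hornerZ horner_comp hornerZ hornerX.
have err x : 0 <= x <= 1 -> `|a j (u + r * x) / sig l ^+ w j - T.[x - y]| <= `|x - y| ^+ K.
  move=> x01; rewrite TE mulrC -mulrBr normrM gtr0_norm ?invr_gt0//.
  rewrite ler_pdivrMl//.
  have := Terr j t'01 (in01 _ (uy x x01)).
  have -> : u + r * x - (u + r * y) = r * (x - y) by ring.
  move=> /le_trans; apply; rewrite normrM (gtr0_norm r0) exprMn mulrA ler_wpM2r ?exprn_ge0//.
  move/goodP: g => [_ /(_ j)] /le_trans; apply.
  rewrite ler_piMl ?(ltW (S0 j))//.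
  have := k1_le; have := k0_gt0; have : k0 <= 1 / 4; last lra.
  rewrite /k0 ler_pdivrMr ?mulr_gt0 ?ltr0n// mulrA divfK//mul1r (le_trans c1)// ler1n//.
have CI3 : 1 <= 3 * CI by have := C1; lra.
have sT : (size T <= K)%N.
  by rewrite (leq_trans (size_scale_leq _ _))// (leq_trans (size_comp_scaleX _ _))// Tsz.
exists T; split => //.
(* On the cell the rescaled coefficient is at most 2 and differs from T by at most 1, so T is at
   most 3; interpolation then bounds its coefficients by 3 CI. *)
- move=> s; rewrite mulrC; apply: (HCI sT y01) => x x01.
  have h1 := err x x01; have [x0 x1] := andP x01; have [y0 y1] := andP y01.
  have h2 : `|x - y| ^+ K <= 1.
    by rewrite exprn_ile1// ler_norml; apply/andP; split; lra.
  have h3 : `|a j (u + r * x) / sig l ^+ w j| <= 2.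
    rewrite normrM normfV (gtr0_norm (S0 j)) ler_pdivrMr//.
    have := osc j _ (uy x x01); have := lev_ub j lv => o1 o2.
    have := ler_normB (a j (u + r * x)) (a j t).
    have -> : a j (u + r * x) = (a j (u + r * x) - a j t) + a j t by rewrite subrK.
    move=> _; apply: le_trans (ler_normD _ _) _.
    have : c0 / 2 * sig l ^+ w j <= 1 * sig l ^+ w j by rewrite ler_wpM2r ?(ltW (S0 j))//; lra.
    lra.
  have -> : T.[x - y] = a j (u + r * x) / sig l ^+ w j - (a j (u + r * x) / sig l ^+ w j - T.[x - y]) by ring.
  by apply: le_trans (ler_normB _ _) _; lra.
- move=> x x01; apply: le_trans (err x x01) _.
  by rewrite ler_peMl ?exprn_ge0.
Qed.

(* scale below which Taylor polynomials resolve level [l] *)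
Let M0 : nat := (Num.truncn (8 / k1)).+2.

Lemma hscale : exists n2 : nat, forall l j, A * (2 * 2^-1 ^+ (n2 + l)) ^+ K <= k1 / 8 * sig l ^+ w j.
Proof.
have h : 0 < k1 / (8 * A * 2 ^+ K).
  by rewrite divr_gt0 ?k1_gt0// !mulr_gt0 ?exprn_gt0.
have [n2 Hn] := half_small h; exists n2 => l j.
apply: (@le_trans _ _ (k1 / 8 * 16^-1 ^+ (l * d))); last first.
  by rewrite ler_wpM2l ?sigw_ge// divr_ge0 ?(ltW k1_gt0).
rewrite exprD !exprMn -!exprM.
have -> : 2^-1 ^+ (l * K) = 16^-1 ^+ (l * d) :> R.
  by rewrite /K mulnCA exprM; congr (_ ^+ _); rewrite -[16]/(2 ^ 4)%:R natrX exprVn.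
rewrite !mulrA ler_wpM2r ?exprn_ge0//.
have h2 : 2^-1 ^+ (n2 * K) <= k1 / (8 * A * 2 ^+ K).
  apply: le_trans Hn; rewrite ler_wiXn2l ?invr_ge0// ?invf_le1 ?ler1n//.
  by rewrite leq_pmulr.
have A2 : 0 < A * 2 ^+ K by rewrite mulr_gt0 ?exprn_gt0.
apply: le_trans (ler_wpM2l (ltW A2) h2) _.
rewrite le_eqVlt; apply/orP; left; apply/eqP; field.
by rewrite gt_eqF//= gt_eqF// exprn_gt0.
Qed.

(** If all a_j vary by at most k1 sig(l)^w on [t, t + r], interpolation bounds the Taylor terms on
    radius r by 2 CI k1 sig(l)^w, and 2^K times this is at most k0 sig(l)^w: the radius 2 r would
    still be good. Only points to the right of t are used, so that the oscillation takes place
    inside the step that starts at t. *)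
Lemma good_fail_osc t r l : 0 <= t -> t + r <= 1 -> 0 < r -> lev t l -> good t r l -> ~~ good t (2 * r) l ->
  (exists j, k1 * sig l ^+ w j < A * (2 * r) ^+ K) \/
  exists j x, t < x <= t + r /\ k1 * sig l ^+ w j < `|a j x - a j t|.
Proof.
move=> t0 tr r0 lv g ng.
have t01 : 0 <= t <= 1 by rewrite t0 (le_trans _ tr)// lerDl ltW.
have [[j Hj]|H2] := pselect (exists j, k1 * sig l ^+ w j < A * (2 * r) ^+ K); first by left; exists j.
right; apply: contrapT => H; move/negP: ng; apply; apply/goodP; split; last first.
  by move=> j; rewrite leNgt; apply/negP => lt; apply: H2; exists j.
move=> j s s0 sK; have S0 : 0 < sig l ^+ w j by rewrite exprn_gt0// sig_gt0.
have k1' := k1_gt0.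
have osc y : 0 <= y <= 1 -> `|a j (t + r * y) - a j t| <= k1 * sig l ^+ w j.
  move=> /andP[]; rewrite le_eqVlt => /predU1P[<- _|y0 y1].
    by rewrite mulr0 addr0 subrr normr0 mulr_ge0 ?ltW.
  rewrite leNgt; apply/negP => lt; apply: H; exists j, (t + r * y); split => //.
  by rewrite ltrDl mulr_gt0//= lerD2l ler_piMr// ltW.
pose T := (Tay j t - (a j t)%:P) \Po (r *: 'X).
have TE z : T.[z] = (Tay j t).[r * z] - a j t.
  by rewrite /T horner_comp hornerZ hornerX hornerD hornerN hornerC.
have sT : (size T <= K)%N.
  rewrite (leq_trans (size_comp_scaleX _ _))//.
  by rewrite (leq_trans (size_polyD _ _))// geq_max Tsz//= size_polyN (leq_trans (size_polyC_leq1 _)).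
have bd y : 0 <= y <= 1 -> `|T.[y - 0]| <= 2 * k1 * sig l ^+ w j.
  move=> y01; rewrite subr0 TE.
  have x01 : 0 <= t + r * y <= 1.
    case/andP: y01 => y0 y1; rewrite addr_ge0 ?mulr_ge0 ?(ltW r0)//= (le_trans _ tr)// lerD2l.
    by rewrite ler_piMr// ltW.
  have := Terr j t01 x01; rewrite [t + _ - t]addrC addKr => e1.
  have e2 : `|a j (t + r * y) - (Tay j t).[r * y]| <= k1 * sig l ^+ w j.
    move/goodP: g => [_ /(_ j)]; apply: le_trans; apply: le_trans e1 _.
    rewrite ler_wpM2l ?(ltW A0)// normrM (gtr0_norm r0) exprMn.
    case/andP: y01 => y0 y1; rewrite ler_piMr ?exprn_ge0 ?(ltW r0)// ger0_norm// exprn_ile1//.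
  have := osc y y01 => o1.
  have -> : (Tay j t).[r * y] - a j t = (a j (t + r * y) - a j t) - (a j (t + r * y) - (Tay j t).[r * y]) by ring.
  by apply: le_trans (ler_normB _ _) _; lra.
have h01 : 0 <= (0 : R) <= 1 by rewrite lexx ler01.
have := HCI sT h01 bd s.
have -> : T`_s = (Tay j t)`_s * r ^+ s.
  by rewrite /T coef_comp_scaleX coefB coefC gtn_eqF// subr0.
rewrite normrM normrX (gtr0_norm r0) => h.
have CI0 : 0 < CI := lt_le_trans ltr01 C1.
have h2 : 2 ^+ s <= 2 ^+ K :> R by rewrite ler_weXn2l ?ler1n// ltnW.
rewrite exprMn mulrCA.
apply: le_trans (ler_wpM2r _ h2) _; first by rewrite mulr_ge0 ?exprn_ge0// ltW.
have h3 : 0 <= 2 ^+ K :> R by rewrite exprn_ge0.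
apply: le_trans (ler_wpM2l h3 h) _.
have -> : 2 ^+ K * (CI * (2 * k1 * sig l ^+ w j)) = k0 / 2 * sig l ^+ w j.
  rewrite /k1 exprVn; field; rewrite gt_eqF//= expf_neq0//.
rewrite ler_wpM2r ?(ltW S0)//; have := k0_gt0; lra.
Qed.
Lemma lev_or t lm : (exists2 l, (l < lm)%N & lev t l) \/ (0 <= t <= 1 -> forall j, `|a j t| <= sig lm ^+ w j).
Proof.
elim: lm => [|lm [[l ll H]|IH]].
- right => t01 j; rewrite /sig expr0 mulr1 -Tay0//.
  apply: le_trans (Tbd j 0 t01) _; rewrite -[leLHS]expr1 ler_weXn2l//.
  by case/andP: (wd j).
- by left; exists l => //; exact: ltnW.
have [[j Hj]|H2] := pselect (exists j, sig lm.+1 ^+ w j < `|a j t|).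
  have [t01|nt] := boolP (0 <= t <= 1); last by right.
  by left; exists lm => //; split; [exact: IH|exists j].
by right => t01 j; rewrite leNgt; apply/negP => lt; apply: H2; exists j.
Qed.

Variable lmax : nat.

(** Points below the last level. The distances to which the decomposition is applied vanish between
    two of them: such points are collapsed in the case of roots, and do not exist in the case of
    good lines. The factor 2 leaves room for the oscillation over a step. *)
Definition Btyp x : Prop := 0 <= x <= 1 /\ forall j, `|a j x| <= 2 * sig lmax ^+ w j.

Let rho0 := Num.min 1 (rmin lmax / 2).

Lemma rho0_gt0 : 0 < rho0.
Proof. by rewrite lt_min ltr01 divr_gt0 ?rmin_gt0. Qed.

Lemma rmin_mono l l' : (l <= l')%N -> rmin l' <= rmin l.
Proof.
move=> ll; rewrite /rmin ler_wpM2l//; first by apply: divr_ge0; apply: ltW; [exact: k1_gt0|exact: A0].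
by rewrite ler_wiXn2l ?invr_ge0 ?invf_le1 ?ler1n// leq_mul2r ll orbT.
Qed.

Definition stepP (t : R) (ro : R * option nat) : Prop := 0 <= t <= 1 ->
  [/\ rho0 <= ro.1, 0 < ro.1 <= 1 &
  match ro.2 with
  | Some l => [/\ (l < lmax)%N, lev t l & rad t l ro.1]
  | None => forall x, 0 <= x <= 1 -> `|x - t| <= ro.1 -> Btyp x
  end].

Lemma step_ex t : exists ro, stepP t ro.
Proof.
have [t01|nt] := boolP (0 <= t <= 1); last by exists (1, None) => t01; move: nt; rewrite t01.
have [[l ll lv]|H] := lev_or t lmax.
  have [r rr] := rad_ex l t01; exists (r, Some l) => _ /=; split => //; last exact: rad_bd rr.
  apply: le_trans (rad_ge t01 rr); rewrite /rho0 le_min !ge_min lexx/=.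
  by apply/orP; right; rewrite ler_wpM2r ?rmin_mono// ltnW.
exists (Num.min 1 (rmin lmax), None) => _ /=; split.
- rewrite /rho0 le_min !ge_min lexx/=; apply/orP; right; have := rmin_gt0 lmax; lra.
- by rewrite lt_min ltr01 rmin_gt0 ge_min lexx.
move=> x x01 xt; split => // j.
have m0 : 0 <= Num.min 1 (rmin lmax) by rewrite le_min ler01 ltW ?rmin_gt0.
have g : good t (Num.min 1 (rmin lmax)) lmax.
  by apply: good_small => //; rewrite ?m0 ge_min lexx ?orbT.
have := good_osc j t01 x01 m0 g xt; have := H t01 j.
have S0 : 0 <= sig lmax ^+ w j by rewrite exprn_ge0 ?(ltW (sig_gt0 _)).
have : c0 / 2 * sig lmax ^+ w j <= 1 * sig lmax ^+ w j.
  by rewrite ler_wpM2r//; case/andP: c01 => *; lra.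
move=> h1 h2 h3; have -> : a j x = (a j x - a j t) + a j t by rewrite subrK.
by apply: le_trans (ler_normD _ _) _; lra.
Qed.

(* A cell shorter than 2^-l ends where some coefficient has moved by a fixed fraction of its level; each such oscillation gives a root of a Taylor polynomial on an interval of length 2^-l, which bounds their number. *)
Section Greedy.
Variable st : R -> R * option nat.
Hypothesis Hst : forall t, stepP t (st t).

Fixpoint tau (i : nat) : R := if i is i'.+1 then Num.min 1 (tau i' + (st (tau i')).1) else 0.

Lemma tau01 i : 0 <= tau i <= 1.
Proof.
elim: i => [|i IH] /=; first by rewrite lexx ler01.
have [_ /andP[r0 _] _] := Hst IH; case/andP: (IH) => h0 h1.
by rewrite le_min ler01 ge_min lexx addr_ge0// ltW.
Qed.

Lemma tau_mono i j : (i <= j)%N -> tau i <= tau j.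
Proof.
elim: j => [|j IH]; first by rewrite leqn0 => /eqP ->.
rewrite leq_eqVlt => /predU1P[->//|]; rewrite ltnS => /IH /le_trans; apply => /=.
have /andP[h0 h1] := tau01 j; have [_ /andP[r0 _] _] := Hst (tau01 j).
by rewrite le_min h1 lerDl ltW.
Qed.

Lemma tau_end : exists n, tau n = 1.
Proof.
have key n : Num.min 1 (n%:R * rho0) <= tau n.
  elim: n => [|n IH]; first by rewrite mul0r ge_min lexx orbT.
  have [h _ _] := Hst (tau01 n).
  rewrite [tau n.+1]/= le_min; apply/andP; split; first by rewrite ge_min lexx.
  move: IH; rewrite -[n.+1]addn1 natrD mulrDl mul1r !ge_min => /orP[]IH.
    by apply/orP; left; apply: le_trans IH _; rewrite lerDl (le_trans (ltW rho0_gt0)).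
  by apply/orP; right; rewrite lerD.
have [n Hn] := ltr_add_invr (y := 0) rho0_gt0.
exists n.+1; apply/eqP; rewrite eq_le; case/andP: (tau01 n.+1) => _ -> /=.
apply: le_trans (key n.+1); rewrite le_min lexx/=.
by move: Hn; rewrite add0r -[n.+1%:R^-1]mul1r ltr_pdivrMr ?ltr0n// mulrC => /ltW.
Qed.

Definition act (l i : nat) : bool := (tau i < 1) && ((st (tau i)).2 == Some l).

Lemma act_spec l i : act l i -> [/\ (l < lmax)%N, lev (tau i) l & rad (tau i) l (st (tau i)).1].
Proof. by case/andP => _ /eqP E; have [_ _] := Hst (tau01 i); rewrite E. Qed.

Lemma count_trunc l n : (count (fun i => act l i && (1 < tau i + (st (tau i)).1)%R) (iota 0 n) <= 1)%N.
Proof.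
set p := (fun i => _); rewrite -size_filter.
case E : (seq.filter p (iota 0 n)) => [//|i0 s]; rewrite -E.
have p0 : p i0 by have : i0 \in seq.filter p (iota 0 n) by [rewrite E mem_head]; rewrite mem_filter => /andP[].
rewrite (@uniq_leq_size _ _ [:: i0]) ?filter_uniq ?iota_uniq// => i; rewrite mem_filter inE => /andP[pi _].
have key i1 i2 : p i1 -> p i2 -> (i1 < i2)%N -> False.
  move=> /andP[_ h1] /andP[/andP[h2 _] _] /tau_mono; rewrite /= (min_idPl (ltW h1)).
  by rewrite leNgt h2.
by case: (ltngtP i i0) => // h; [case: (key _ _ pi p0 h)|case: (key _ _ p0 pi h)].
Qed.

Lemma count_big l n (h : R) : 0 < h ->
  (count (fun i => [&& act l i, tau i + (st (tau i)).1 <= 1 & h <= (st (tau i)).1]) (iota 0 n))%:R <= h^-1.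
Proof.
move=> h0; set p := (fun i => _).
have : (count p (iota 0 n))%:R * h <= tau n.
  elim: n => [|n IH]; first by rewrite mul0r.
  rewrite -[n.+1]addn1 iotaD count_cat add0n natrD mulrDl /= addn0.
  have [/and3P[_ h1 h2]|_] := boolP (p n).
    by rewrite mul1r addn1 /= (min_idPr h1) lerD.
  by rewrite mul0r addr0 (le_trans IH)// addn1 tau_mono.
have /andP[_ t1] := tau01 n; move=> /le_trans/(_ t1).
by rewrite -ler_pdivlMr// mul1r.
Qed.

Let Hs n2 l : R := 2^-1 ^+ (n2 + l).

(** A short cell of level l is charged to a label: a window g of length [Hs], a coefficient j, a
    sign b and a threshold m. The polynomial [pol L] of its label has a root inside the cell, so
    cells with the same label give distinct roots and there are at most K of them. *)
Let lab n2 l := ('I_(2 ^ (n2 + l)) * 'I_N * bool * 'I_(2 * M0))%type.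
Let pol n2 l (L : lab n2 l) : {poly R} :=
  let: (g, j, b, m) := L in
  (-1) ^+ b *: Tay j (g%:R * Hs n2 l) - ((m%:R - M0%:R) * (k1 / 4 * sig l ^+ w j))%:P.

Lemma small_label n2 l i : (forall l j, A * (2 * 2^-1 ^+ (n2 + l)) ^+ K <= k1 / 8 * sig l ^+ w j) ->
  act l i -> tau i + (st (tau i)).1 <= 1 -> (st (tau i)).1 < Hs n2 l ->
  exists (L : lab n2 l) (xi : R), [/\ tau i < xi < tau i.+1, pol L != 0, (size (pol L) <= K)%N &
     root (pol L) (xi - (L.1.1.1)%:R * Hs n2 l)].
Proof.
move=> HH ai; have [ll lv rr] := act_spec ai.
have ti01 := tau01 i; have r01 := rad_bd rr.
have t1 : tau i < 1 by case/andP: ai.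
rewrite [tau i.+1]/=; move: rr r01; set t := tau i in ti01 lv t1 *; set r := (st t).1 => rr r01 tr rH.
rewrite (min_idPr tr); set H := Hs n2 l in rH *.
have H0 : 0 < H := half_gt0 _.
have H1 : H <= 1 := half_le1 _.
have [r0 r1] := andP r01; have [t0 _] := andP ti01.
pose g := Num.truncn (t / H).
have /andP[g1 g2] : g%:R <= t / H < g.+1%:R by apply: Num.Theory.truncn_itv; rewrite divr_ge0// ltW.
have {}g1 : g%:R * H <= t by rewrite -ler_pdivlMr.
have {}g2 : t < g%:R * H + H by move: g2; rewrite -natr1 ltr_pdivrMr// mulrDl mul1r.
have gl : (g < 2 ^ (n2 + l))%N.
  rewrite -(ltr_nat R) natrX; have : g%:R * H < 1 by exact: le_lt_trans t1.
  by rewrite /H /Hs exprVn ltr_pdivrMr ?exprn_gt0// mul1r.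
have gH01 : 0 <= g%:R * H <= 1 by rewrite mulr_ge0 ?(ltW H0)//= (le_trans g1)// ltW.
(* The cell is shorter than [Hs], so r < 1 and the choice of n2 rules out a failure through the
   remainder: some coefficient oscillates inside the cell. *)
have [j [x [/andP[tx xr] osc]]] : exists j x, t < x <= t + r /\ k1 * sig l ^+ w j < `|a j x - a j t|.
  have [n [rn gd ng]] := rr.
  have n0 : n <> 0%N by move=> n0; move: rH; rewrite rn n0 expr0 ltNge H1.
  case: ng => [//|ng].
  case: (good_fail_osc t0 tr r0 lv gd ng) => // -[j Hj]; exfalso.
  have h8 := HH l j; have S0 : 0 < sig l ^+ w j by rewrite exprn_gt0// sig_gt0.
  have : A * (2 * r) ^+ K <= A * (2 * H) ^+ K.
    by rewrite ler_wpM2l ?(ltW A0)// lerXn2r ?nnegrE ?mulr_ge0 ?(ltW r0) ?(ltW H0)// ler_wpM2l// ltW.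
  move=> h9; have := lt_le_trans Hj (le_trans h9 h8); rewrite ltr_pM2r//.
  by have := k1_gt0; lra.
have S0 : 0 < sig l ^+ w j by rewrite exprn_gt0// sig_gt0.
have k10 := k1_gt0.
pose u := k1 / 4 * sig l ^+ w j.
have u0 : 0 < u by rewrite mulr_gt0// divr_gt0.
pose f y := (Tay j (g%:R * H)).[y - g%:R * H].
have ferr y : t <= y <= t + r -> `|a j y - f y| <= k1 / 8 * sig l ^+ w j.
  move=> /andP[y1 y2]; apply: le_trans (HH l j).
  apply: le_trans (Terr j gH01 _) _; first by rewrite (le_trans t0)//= (le_trans y2).
  rewrite -/(Hs n2 l) -/H ler_wpM2l ?(ltW A0)// lerXn2r ?nnegrE//; first by rewrite mulr_ge0// ltW.
  rewrite ger0_norm; lra.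
have ft : `|f t| <= 2 * sig l ^+ w j.
  have := ferr t; rewrite lexx lerDl (ltW r0) => /(_ isT) e1.
  have e2 := lev_ub j lv.
  have -> : f t = a j t - (a j t - f t) by ring.
  apply: le_trans (ler_normB _ _) _.
  have : k1 / 8 * sig l ^+ w j <= 1 * sig l ^+ w j; last lra.
  rewrite ler_wpM2r ?(ltW S0)//; have := k1_le; have : k0 <= 1; last lra.
  rewrite /k0 ler_pdivrMr ?mulr_gt0 ?ltr0n// mul1r; case/andP: c01 => _ c1; apply: (le_trans c1).
  by rewrite -natrM ler1n muln_gt0 K0.
have fx : u < `|f x - f t|.
  have e1 := ferr t; rewrite lexx lerDl (ltW r0) in e1; have {}e1 := e1 isT.
  have e2 := ferr x; rewrite (ltW tx) xr in e2; have {}e2 := e2 isT.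
  have : `|a j x - a j t| <= `|f x - f t| + (`|a j x - f x| + `|a j t - f t|).
    have -> : a j x - a j t = (f x - f t) + ((a j x - f x) - (a j t - f t)) by ring.
    by rewrite (le_trans (ler_normD _ _))// lerD2l ler_normB.
  have := mulr_gt0 k10 S0; rewrite /u; lra.
(* The sign makes F increase from t to x by more than u, so the first multiple of u above F t is at
   most F t + u < F x. The shift by [M0] makes its index m a natural number. *)
pose b := f x < f t.
pose F y := (-1) ^+ b * f y.
have Fx : F t + u < F x.
  rewrite /F /b; have [h|h] := ltP (f x) (f t).
    by rewrite ltr0_norm ?subr_lt0// in fx; rewrite expr1 !mulN1r; lra.
  by rewrite ger0_norm ?subr_ge0// in fx; rewrite expr0 !mul1r; lra.
have Ft : `|F t| <= 2 * sig l ^+ w j by rewrite /F normrMsign.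
have Ftu : `|F t / u| <= 8 / k1.
  rewrite normrM normfV (gtr0_norm u0) ler_pdivrMr// (le_trans Ft)//.
  by rewrite /u le_eqVlt; apply/orP; left; apply/eqP; field; rewrite gt_eqF.
have M0g : 8 / k1 + 1 < M0%:R.
  have /andP[_] : (Num.truncn (8 / k1))%:R <= 8 / k1 < (Num.truncn (8 / k1)).+1%:R.
    by apply: Num.Theory.truncn_itv; rewrite divr_ge0// ltW.
  by rewrite /M0 -[X in _ -> _ < X]natr1 => h; rewrite ltrD2r.
have [q1 q2] : - (8 / k1) <= F t / u /\ F t / u <= 8 / k1 by apply/andP; rewrite -ler_norml.
pose m := (Num.truncn (F t / u + M0%:R)).+1.
have /andP[m1 m2] : (Num.truncn (F t / u + M0%:R))%:R <= F t / u + M0%:R < m%:R.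
  by apply: Num.Theory.truncn_itv; lra.
have mM : (m < 2 * M0)%N.
  by rewrite -(ltr_nat R) natrM /m -natr1; lra.
pose v := (m%:R - M0%:R) * u.
have v1 : F t < v by rewrite -ltr_pdivrMr// ltrBrDr.
have v2 : v <= F t + u.
  by rewrite /v /m -natr1 -lerBlDr -[X in _ - X]mul1r -mulrBl -ler_pdivlMr//; lra.
pose L : lab n2 l := (Ordinal gl, j, b, Ordinal mM).
have pE y : (pol L).[y - g%:R * H] = F y - v.
  by rewrite /pol /L /= hornerD hornerN hornerC hornerZ.
have tx' : t - g%:R * H <= x - g%:R * H by rewrite lerD2r ltW.
have [|z] := poly_ivtoo (p := pol L) tx'.
  by rewrite !pE nmulr_rlt0 ?subr_gt0 ?subr_lt0//; exact: le_lt_trans Fx.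
rewrite in_itv/= => /andP[z1 z2] rz.
exists L, (z + g%:R * H); split.
- by rewrite -ltrBlDr z1 -ltrBrDr (lt_le_trans z2)// lerD2r.
- apply/eqP => p0; have := pE t; rewrite p0 horner0 => /esym/eqP.
  by rewrite subr_eq0 lt_eqF.
- rewrite (leq_trans (size_polyD _ _))// geq_max size_polyN (leq_trans (size_polyC_leq1 _))// andbT.
  by rewrite (leq_trans (size_scale_leq _ _))// Tsz.
- by rewrite /L/= addrK.
Qed.

Lemma count_small n2 l n : (forall l j, A * (2 * 2^-1 ^+ (n2 + l)) ^+ K <= k1 / 8 * sig l ^+ w j) ->
  (count (fun i => [&& act l i, tau i + (st (tau i)).1 <= 1 & (st (tau i)).1 < Hs n2 l]%R) (iota 0 n) <=
   2 ^ (n2 + l) * (N * 2 * (2 * M0) * K))%N.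
Proof.
move=> HH; set p := (fun i => _).
have spec i : p i -> exists Lx : lab n2 l * R, [/\ tau i < Lx.2 < tau i.+1, pol Lx.1 != 0, (size (pol Lx.1) <= K)%N &
     root (pol Lx.1) (Lx.2 - (Lx.1.1.1.1)%:R * Hs n2 l)].
  move=> /and3P[h1 h2 h3]; have [L [xi H]] := small_label HH h1 h2 h3; by exists (L, xi).
rewrite -size_filter; set s := seq.filter p _.
have sp i : i \in s -> p i by rewrite mem_filter => /andP[].
have us : uniq s by rewrite filter_uniq ?iota_uniq.
case E : s => [//|i0 s0]; rewrite -E.
have i0s : i0 \in s by rewrite E mem_head.
have [Lx0 _] := spec i0 (sp i0 i0s).
have /choice[Lx HL] : forall i, exists Lx : lab n2 l * R, p i -> [/\ tau i < Lx.2 < tau i.+1, pol Lx.1 != 0, (size (pol Lx.1) <= K)%N &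
     root (pol Lx.1) (Lx.2 - (Lx.1.1.1.1)%:R * Hs n2 l)].
  move=> i; have [/spec[Lx H]|/negPf np] := boolP (p i); first by exists Lx.
  by exists Lx0.
have -> : (2 ^ (n2 + l) * (N * 2 * (2 * M0) * K) = #|{: lab n2 l}| * K)%N.
  by rewrite !card_prod !card_ord card_bool !mulnA.
apply: (size_count_label (lab := fun i => (Lx i).1)) => L.
rewrite -size_filter; set s' := seq.filter _ s.
have s'P i : i \in s' -> p i /\ (Lx i).1 = L.
  by rewrite mem_filter => /andP[/eqP h /sp].
case E' : s' => [//|i1 s1]; rewrite -E'.
have [p1 L1] : p i1 /\ (Lx i1).1 = L by apply: s'P; rewrite E' mem_head.
have [_ P0 sP _] := HL i1 p1; rewrite L1 in P0 sP.
apply: leq_trans sP; apply: ltnW.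
rewrite -(size_map (fun i => (Lx i).2 - (L.1.1.1)%:R * Hs n2 l)).
apply: max_poly_roots => //.
  apply/allP => y /mapP[i /s'P[pi Li] ->].
  by have [_ _ _] := HL i pi; rewrite Li.
rewrite map_inj_in_uniq; first exact: filter_uniq.
move=> i j /s'P[pi _] /s'P[pj _] /addIr.
have [/andP[a1 a2] _ _ _] := HL i pi; have [/andP[b1 b2] _ _ _] := HL j pj.
by case: (ltngtP i j) => // /tau_mono h e; exfalso; move: h; rewrite leNgt => /negP; apply;
  [rewrite (lt_trans b1)// -e|rewrite (lt_trans a1)// e].
Qed.

Lemma count_act n2 l n : (forall l j, A * (2 * 2^-1 ^+ (n2 + l)) ^+ K <= k1 / 8 * sig l ^+ w j) ->
  (count (act l) (iota 0 n) <= 2 ^ l * (2 ^ n2 * (2 + N * 2 * (2 * M0) * K)))%N.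
Proof.
move=> HH.
pose p1 i := act l i && (1 < tau i + (st (tau i)).1)%R.
pose p2 i := [&& act l i, tau i + (st (tau i)).1 <= 1 & Hs n2 l <= (st (tau i)).1]%R.
pose p3 i := [&& act l i, tau i + (st (tau i)).1 <= 1 & (st (tau i)).1 < Hs n2 l]%R.
have : (count (act l) (iota 0 n) <= count p1 (iota 0 n) + count p2 (iota 0 n) + count p3 (iota 0 n))%N.
  elim: (iota 0 n) => //= i s IH.
  have : (act l i <= p1 i + p2 i + p3 i)%N.
    by rewrite /p1 /p2 /p3; case: (act l i) => //=; case: ltP => //=; case: ltP.
  by move=> h; rewrite (leq_trans (leq_add h IH))// leq_eqVlt; apply/orP; left; apply/eqP; ring.
move=> /leq_trans; apply.
have h1 : (count p1 (iota 0 n) <= 2 ^ (n2 + l))%N by rewrite (leq_trans (count_trunc l n))// expn_gt0.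
have h2 : (count p2 (iota 0 n) <= 2 ^ (n2 + l))%N.
  have h := @count_big l n (Hs n2 l) (half_gt0 _).
  by rewrite -(ler_nat R) natrX (le_trans h)// /Hs exprVn invrK.
have h3 := @count_small n2 l n HH.
rewrite (leq_trans (leq_add (leq_add h1 h2) h3))// leq_eqVlt; apply/orP; left; apply/eqP.
rewrite expnD; ring.
Qed.

Section WithMetric.
Variables (q : R) (D : R -> R -> R) (W : nat -> R).
Hypothesis q1 : 1 <= q.
Hypothesis D0 : forall x y, 0 <= D x y.
Hypothesis Dtri : {in `[0, 1] & &, forall x y z, D x z <= D x y + D y z}.
Hypothesis W0 : forall l, 0 <= W l.
Hypothesis DB : forall x y, Btyp x -> Btyp y -> D x y = 0.
Hypothesis DC : forall l u r t, (l < lmax)%N -> rmin l / 2 <= r -> cell_ok l u r t -> Rbound q D u (u + r) (W l).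

Definition wt (i : nat) : R := if tau i < 1 then (if (st (tau i)).2 is Some l then W l else 0) else 0.

Lemma cell_Rbound i : Rbound q D (tau i) (tau i.+1) (wt i).
Proof.
have /andP[t0 t1] := tau01 i; have /andP[t'0 t'1] := tau01 i.+1; rewrite /wt.
case: ltP => [lt1|ge1]; last first.
  have e : tau i = 1 by apply/eqP; rewrite eq_le t1.
  have e' : tau i.+1 = 1 by apply/eqP; rewrite eq_le t'1 -e tau_mono.
  rewrite e e' => x [|y s] //= /andP[xy ps] h1 h2; exfalso.
  by have := lt_le_trans (le_lt_trans h1 xy) (le_trans (path_lt_last ps) h2); rewrite ltxx.
have [rho r01 spec] := Hst (tau01 i); have [r0 r1] := andP r01.
move: spec; case E: (st (tau i)).2 => [l|].
  move=> [ll lv rr]; set r := (st (tau i)).1 in rho r01 r0 r1 rr.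
  (* Near 1 the cell is moved to the left, so that it keeps its full length r inside [0, 1] although
     the greedy step is truncated. *)
  pose u := Num.min (tau i) (1 - r).
  have u0 : 0 <= u by rewrite le_min t0 subr_ge0.
  have ur : u + r <= 1 by rewrite -lerBrDr /u ge_min lexx orbT.
  have tu : u <= tau i by rewrite /u ge_min lexx.
  have tu2 : tau i <= u + r by rewrite /u -lerBlDr le_min; apply/andP; split; lra.
  have tu3 : tau i.+1 <= u + r.
    have m2 : tau i.+1 <= tau i + r by rewrite /= ge_min lexx orbT.
    by rewrite /u -lerBlDr le_min; apply/andP; split; lra.
  have [n [_ gd _]] := rr.
  have ck : cell_ok l u r (tau i) by apply: cellP => //; rewrite ?tau01// tu.
  apply: Rbound_sub tu tu3 _; apply: DC ll _ ck.
  have := rad_ge (tau01 i) rr; rewrite ge_min => /orP[h|//].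
  apply: (@le_trans _ _ 1); last by rewrite (le_trans h).
  have : rmin l <= 1; last lra.
  have h1 : k0 <= 1.
    rewrite /k0 ler_pdivrMr ?mulr_gt0 ?ltr0n// mul1r; case/andP: c01 => _ c1; apply: (le_trans c1).
    by rewrite -natrM ler1n muln_gt0 K0.
  have h2 := k1_le; have h3 := k1_gt0.
  have h4 : 0 <= k1 / A by apply: divr_ge0; apply: ltW.
  have h5 : k1 / A <= 1 by rewrite ler_pdivrMr// mul1r (le_trans _ A1)//; lra.
  have h6 : 16^-1 ^+ (l * d) <= 1 :> R by apply: exprn_ile1; rewrite ?invf_le1 ?ler1n.
  by rewrite /rmin (le_trans _ h6)// ler_piMl// exprn_ge0.
move=> HB x s; have : forall x, tau i <= x <= tau i.+1 -> Btyp x.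
  move=> y /andP[y1 y2]; apply: HB; first by rewrite (le_trans t0)//= (le_trans y2).
  rewrite ger0_norm ?subr_ge0// lerBlDl (le_trans y2)//= ge_min lexx orbT//.
move=> Bt; elim: s x => [|y s IH] x //= /andP[xy ps] tx ls.
have xls := path_lt_last ps.
have ty : tau i <= y := le_trans tx (ltW xy).
rewrite DB; last 2 first.
- by apply: Bt; rewrite tx (le_trans (ltW xy) (le_trans xls ls)).
- by apply: Bt; rewrite ty (le_trans xls).
rewrite /rz powR0 ?gt_eqF ?(lt_le_trans ltr01)// mul0r add0r.
exact: IH.
Qed.

Lemma cells_Rbound n2 : (forall l j, A * (2 * 2^-1 ^+ (n2 + l)) ^+ K <= k1 / 8 * sig l ^+ w j) ->
  Rbound q D 0 1 ((2 ^ n2 * (2 + N * 2 * (2 * M0) * K))%:R * \sum_(l < lmax) 2 ^+ l * W l).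
Proof.
move=> HH; have [n tn] := tau_end.
have : Rbound q D 0 (tau n) (\sum_(i < n) wt i).
  elim: n {tn} => [|n IH].
    rewrite big_ord0 => x [|y s] //= /andP[xy ps] h1 h2; exfalso.
    by have := lt_le_trans (le_lt_trans h1 xy) (le_trans (path_lt_last ps) h2); rewrite ltxx.
  rewrite big_ord_recr [X in Rbound _ _ _ _ X]/=; have H3 := @cell_Rbound n; apply: (Rbound_cat q1 D0 _ _ _ IH H3).
  - by case/andP: (tau01 n).
  - exact: tau_mono.
  - move=> x y z Hx Hy Hz; have /andP[_ h] := tau01 n.+1.
    by apply: Dtri; rewrite !in_itv/= in Hx Hy Hz *; case/andP: Hx => a1 a2; case/andP: Hy => b1 b2;
      case/andP: Hz => e1 e2; rewrite ?a1 ?b1 ?e1/= ?(le_trans _ h).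
rewrite tn; apply: Rbound_mono.
apply: (@le_trans _ _ (\sum_(l < lmax) (count (act l) (iota 0 n))%:R * W l)).
  rewrite -(big_mkord xpredT wt); rewrite /index_iota subn0; elim: (iota 0 n) => [|i s IH].
    by rewrite big_nil sumr_ge0// => l _; rewrite mul0r.
  rewrite big_cons /=; apply: (@le_trans _ _ (\sum_(l < lmax) ((act l i)%:R * W l + (count (act l) s)%:R * W l))).
    rewrite big_split/= lerD//.
    rewrite /wt /act; case: ltP => _ /=; last by rewrite sumr_ge0// => l _; rewrite mul0r.
    have [_ _] := Hst (tau01 i); case: (st (tau i)).2 => [l [ll _ _]|_]; last by rewrite sumr_ge0// => l _; rewrite mulr_ge0.
    rewrite (bigD1 (Ordinal ll))//= eqxx mul1r lerDl sumr_ge0// => j _; by rewrite mulr_ge0.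
  by apply: ler_sum => l _; rewrite natrD mulrDl.
rewrite mulr_sumr; apply: ler_sum => l _; rewrite mulrA ler_wpM2r//.
by rewrite -natrX -natrM ler_nat mulnC; exact: count_act.
Qed.
End WithMetric.
End Greedy.
End Cells.
(** * Sobolev regularity of the roots *)

Section RboundTools.
Variables (R : realType) (q : R).
Hypothesis q1 : 1 <= q.
Implicit Types D : R -> R -> R.

Let q0 : 0 <= q. Proof. exact: le_trans q1. Qed.

Lemma rz_addr x y l : 0 <= x -> 0 <= y -> rz q (x + y) l <= 2 `^ q * (rz q x l + rz q y l).
Proof.
move=> x0 y0; rewrite /rz -mulrDl mulrA ler_wpM2r ?powR_ge0//.
have key u v : 0 <= u -> u <= v -> (u + v) `^ q <= 2 `^ q * (u `^ q + v `^ q).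
  move=> u0 uv; have v0 := le_trans u0 uv.
  apply: (@le_trans _ _ ((2 * v) `^ q)).
    by rewrite ge0_ler_powR ?nnegrE ?addr_ge0 ?mulr_ge0//; lra.
  by rewrite powRM// ler_wpM2l ?powR_ge0// lerDr powR_ge0.
have [xy|/ltW yx] := lerP x y; first exact: key.
by rewrite addrC [X in _ * X]addrC; exact: key.
Qed.

Lemma rsum_add D D1 D2 x s : (forall x y, 0 <= D x y) -> (forall x y, 0 <= D1 x y) -> (forall x y, 0 <= D2 x y) ->
  (forall y z, x <= y <= last x s -> x <= z <= last x s -> D y z <= D1 y z + D2 y z) -> path <%R x s ->
  rsum q D x s <= 2 `^ q * (rsum q D1 x s + rsum q D2 x s).
Proof.
move=> d0 d1 d2; elim: s x => [|y s IH] x H /=; first by rewrite addr0 mulr0.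
move=> /andP[xy ps]; have yl := path_lt_last ps.
have : rz q (D x y) (y - x) <= 2 `^ q * (rz q (D1 x y) (y - x) + rz q (D2 x y) (y - x)).
  apply: le_trans (rz_addr _ _ _) => //; apply: rz_le => //; apply: H => /=.
    by rewrite lexx (le_trans (ltW xy)).
  by rewrite (ltW xy) yl.
have : rsum q D y s <= 2 `^ q * (rsum q D1 y s + rsum q D2 y s).
  apply: IH => // u v /andP[u1 u2] /andP[v1 v2]; apply: H => /=.
    by rewrite (le_trans (ltW xy)).
  by rewrite (le_trans (ltW xy)).
lra.
Qed.

Lemma Rbound_add D D1 D2 a b M1 M2 : (forall x y, 0 <= D x y) -> (forall x y, 0 <= D1 x y) -> (forall x y, 0 <= D2 x y) ->
  (forall y z, a <= y <= b -> a <= z <= b -> D y z <= D1 y z + D2 y z) ->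
  Rbound q D1 a b M1 -> Rbound q D2 a b M2 -> Rbound q D a b (2 `^ q * (M1 + M2)).
Proof.
move=> d0 d1 d2 H H1 H2 x s ps ax lb; apply: le_trans (rsum_add d0 d1 d2 _ ps) _.
  move=> y z /andP[y1 y2] /andP[z1 z2]; apply: H.
    by rewrite (le_trans ax)//= (le_trans y2).
  by rewrite (le_trans ax)//= (le_trans z2).
by rewrite ler_wpM2l ?powR_ge0// lerD ?H1 ?H2.
Qed.

Lemma rsum_le D D' x s : (forall x y, 0 <= D x y) ->
  (forall y z, x <= y <= last x s -> x <= z <= last x s -> D y z <= D' y z) -> path <%R x s ->
  rsum q D x s <= rsum q D' x s.
Proof.
move=> d0; elim: s x => [|y s IH] x H //= /andP[xy ps]; have yl := path_lt_last ps.
apply: lerD.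
  apply: rz_le => //; apply: H => /=.
    by rewrite lexx (le_trans (ltW xy)).
  by rewrite (ltW xy) yl.
apply: IH => // u v /andP[u1 u2] /andP[v1 v2]; apply: H => /=.
  by rewrite (le_trans (ltW xy)).
by rewrite (le_trans (ltW xy)).
Qed.

Lemma Rbound_le D D' a b M : (forall x y, 0 <= D x y) ->
  (forall y z, a <= y <= b -> a <= z <= b -> D y z <= D' y z) -> Rbound q D' a b M -> Rbound q D a b M.
Proof.
move=> d0 H H1 x s ps ax lb; apply: le_trans (rsum_le d0 _ ps) (H1 _ _ ps ax lb).
move=> y z /andP[y1 y2] /andP[z1 z2]; apply: H.
  by rewrite (le_trans ax)//= (le_trans y2).
by rewrite (le_trans ax)//= (le_trans z2).
Qed.

Lemma rz_self L l : 0 <= L -> 0 < l -> rz q (L * l) l = L `^ q * l.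
Proof.
move=> L0 l0; rewrite /rz powRM// ?(ltW l0)// -mulrA; congr (_ * _).
rewrite -powRD; last by rewrite (gt_eqF l0) implybT.
by rewrite addrC subrK powRr1// ltW.
Qed.

Lemma Rbound_lip L a b : 0 <= L -> a <= b -> Rbound q (fun x y => L * `|x - y|) a b (L `^ q * (b - a)).
Proof.
move=> L0 ab x s ps ax lb; apply: (@le_trans _ _ (L `^ q * (last x s - x))).
  elim: s x ps {ax lb} => [|y s IH] x /=; first by rewrite subrr mulr0.
  move=> /andP[xy ps]; rewrite distrC ger0_norm ?subr_ge0 ?(ltW xy)// rz_self ?subr_gt0//.
  by have := IH y ps; lra.
by rewrite ler_wpM2l ?powR_ge0// lerB.
Qed.

Lemma Rbound_rescale D D' u r c M : (forall x y, 0 <= D x y) -> (forall x y, 0 <= D' x y) -> 0 < r -> 0 <= c ->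
  (forall x y, 0 <= x <= 1 -> 0 <= y <= 1 -> D (u + r * x) (u + r * y) <= c * D' x y) ->
  Rbound q D' 0 1 M -> Rbound q D u (u + r) (c `^ q * r `^ (1 - q) * M).
Proof.
move=> d0 d'0 r0 c0 H HM x s ps ux lu.
pose g y := (y - u) / r.
have gK y : u + r * g y = y by rewrite /g mulrC divfK ?gt_eqF// addrC subrK.
have g01 y : u <= y <= u + r -> 0 <= g y <= 1.
  move=> /andP[h1 h2]; rewrite /g divr_ge0 ?subr_ge0 ?(ltW r0)//= ler_pdivrMr// mul1r.
  by rewrite lerBlDl.
have gm y z : y < z -> g y < g z by move=> h; rewrite /g ltr_pM2r ?invr_gt0// ltrD2r.
have pg : path <%R (g x) (map g s).
  by elim: s x ps {ux lu} => [|y s IH] x //= /andP[xy /IH ->]; rewrite gm.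
have xl := path_lt_last ps.
have h1 : 0 <= g x by have /andP[] := g01 x (introT andP (conj ux (le_trans xl lu))).
have h2 : last (g x) (map g s) <= 1.
  by rewrite last_map; have /andP[] := g01 (last x s) (introT andP (conj (le_trans ux xl) lu)).
apply: le_trans (ler_wpM2l (mulr_ge0 (powR_ge0 _ _) (powR_ge0 _ _)) (HM _ _ pg h1 h2)).
elim: s x ps ux lu {xl h1 h2 pg} => [|y s IH] x /=; first by rewrite mulr0.
move=> /andP[xy ps] ux lu; have yl := path_lt_last ps.
have hx : u <= x <= u + r by rewrite ux (le_trans (ltW xy) (le_trans yl lu)).
have hy : u <= y <= u + r by rewrite (le_trans ux (ltW xy)) (le_trans yl).
rewrite mulrDr lerD//; last by apply: IH => //; case/andP: hy.
have -> : y - x = r * (g y - g x) by rewrite /g; field; rewrite gt_eqF.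
rewrite -rz_scale// ?subr_ge0 ?(ltW (gm _ _ xy))//.
by apply: rz_le => //; have := H (g x) (g y) (g01 x hx) (g01 y hy); rewrite !gK.
Qed.

(* Replacing [D] by the pseudo-metric in which [S] is collapsed to a point. *)
Section Collapse.
Variables (D : R -> R -> R) (S I : set R) (del : R).
Hypothesis D0 : forall x y, 0 <= D x y.
Hypothesis Dxx : forall x, I x -> D x x = 0.
Hypothesis Dsym : forall x y, D x y = D y x.
Hypothesis Dtri : forall x y z, I x -> I y -> I z -> D x z <= D x y + D y z.
Hypothesis SI : S `<=` I.
Hypothesis Sdel : forall x y, S x -> S y -> D x y <= del.
Hypothesis del0 : 0 < del.

Let e x := inf [set D x u | u in S].
Definition collapse x y := if `[< S !=set0 >] then Num.min (D x y) (e x + e y) else D x y.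

Let hi x : S !=set0 -> has_inf [set D x u | u in S].
Proof. by move=> [u Su]; split; [exists (D x u), u|exists 0 => _ [v _ <-]]. Qed.

Let e0 x : 0 <= e x.
Proof.
rewrite /e; have [->|/set0P[u Su]] := eqVneq S set0; first by rewrite image_set0 inf0.
by apply: lb_le_inf => [|_ [v _ <-]//]; exists (D x u), u.
Qed.

Let eS x : S x -> e x = 0.
Proof.
move=> Sx; apply/eqP; rewrite eq_le e0 andbT -(Dxx (SI Sx)).
by apply: ge_inf; [case: (hi x (ex_intro _ x Sx))|exists x].
Qed.

Let e_lip x y : S !=set0 -> I x -> I y -> e x <= D x y + e y.
Proof.
move=> S0 Ix Iy; rewrite -lerBlDl; apply: lb_le_inf; first by case: (hi y S0).
move=> _ [u Su <-]; rewrite lerBlDl; apply: le_trans (Dtri Ix Iy (SI Su)).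
by apply: ge_inf; [case: (hi x S0)|exists u].
Qed.

Lemma collapse_ge0 x y : 0 <= collapse x y.
Proof. by rewrite /collapse; case: asboolP => // _; rewrite le_min D0 addr_ge0. Qed.

Lemma collapse_le x y : collapse x y <= D x y.
Proof. by rewrite /collapse; case: asboolP => // _; rewrite ge_min lexx. Qed.

Lemma collapse_S x y : S x -> S y -> collapse x y = 0.
Proof.
move=> Sx Sy; rewrite /collapse; case: asboolP => [_|]; last by case; exists x.
by rewrite !eS// addr0 (min_idPr _).
Qed.

Lemma collapse_tri x y z : I x -> I y -> I z -> collapse x z <= collapse x y + collapse y z.
Proof.
move=> Ix Iy Iz; rewrite /collapse; case: asboolP => [S0|_]; last exact: Dtri.
have h1 := Dtri Ix Iy Iz; have h2 := e_lip S0 Ix Iy; have h3 := e_lip S0 Iz Iy.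
rewrite [D z y]Dsym in h3; have := e0 y => h4.
by rewrite ge_min; case: (leP (D x y)) => _; case: (leP (D y z)) => _; apply/orP;
  [left|right|right|right]; lra.
Qed.

Lemma le_collapse x y : I x -> I y -> D x y <= collapse x y + 2 * del.
Proof.
move=> Ix Iy; rewrite /collapse; have := del0 => dl; case: asboolP => [S0|_]; last lra.
have [_|_] := leP (D x y) (e x + e y); first lra.
have d2 : 0 < del / 2 by rewrite divr_gt0.
have [_ [u Su <-] hu] := inf_adherent d2 (hi x S0).
have [_ [v Sv <-] hv] := inf_adherent d2 (hi y S0).
have := Dtri Ix (SI Su) Iy; have := Dtri (SI Su) (SI Sv) Iy; have := Sdel Su Sv.
have hu' : D x u < e x + del / 2 by [].
have hv' : D y v < e y + del / 2 by [].
by rewrite [D v y]Dsym; lra.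
Qed.

End Collapse.
End RboundTools.

(** * Taylor classes and Taylor polynomials *)

Section TaylorClass.
Variable R : realType.
Implicit Types (F G : R -> {poly R[i]}) (A t x : R).

Lemma TT_lip s A t F x : TT s.+1 A t F -> 0 <= x <= 1 -> pn (F x - F t) <= A * `|x - t|.
Proof.
move=> [_ [G HG E]] x01; rewrite E// addrC addKr pnZ nrmR mulrC ler_wpM2r//.
exact: (TT_bd HG).
Qed.

Lemma TT_taylor s A t F : 0 <= t <= 1 -> TT s A t F ->
  exists (T : nat -> {poly R[i]}) (G : R -> {poly R[i]}),
    [/\ forall i, pn (T i) <= A, forall x, 0 <= x <= 1 -> pn (G x) <= A &
      forall x, 0 <= x <= 1 -> F x = \sum_(i < s) ((x - t)%:C%C ^+ i) *: T i + (x - t)%:C%C ^+ s *: G x].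
Proof.
move=> t01; elim: s F => [|s IH] F H.
  exists (fun=> 0), F; split => //; first by move=> i; rewrite pn0 (TT_ge0 H).
  by move=> x _; rewrite big_ord0 add0r expr0 scale1r.
case: (H) => HF [G /IH[T [G' [H1 H2 H3]]] E].
exists (fun i => if i is i'.+1 then T i' else F t), G'; split => //; first by case=> [|i]//; exact: HF.
move=> x x01; rewrite E// H3// big_ord_recl/= expr0 scale1r -addrA; congr (_ + _).
rewrite scalerDr scaler_sumr scalerA -exprS; congr (_ + _).
by apply: eq_bigr => i _; rewrite scalerA -exprS.
Qed.

Lemma nrm_sub01 t x : 0 <= t <= 1 -> 0 <= x <= 1 -> nrm ((x - t)%:C%C : R[i]) <= 1.
Proof. by move=> /andP[? ?] /andP[? ?]; rewrite nrmR ler_norml; lra. Qed.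

Lemma TT_of_taylor s A t F (T : nat -> {poly R[i]}) G : 0 <= t <= 1 ->
  (forall i, pn (T i) <= A) -> (forall x, 0 <= x <= 1 -> pn (G x) <= A) ->
  (forall x, 0 <= x <= 1 -> F x = \sum_(i < s) ((x - t)%:C%C ^+ i) *: T i + (x - t)%:C%C ^+ s *: G x) ->
  TT s (s.+1%:R * A) t F.
Proof.
move=> t01 HT HG; have A0 : 0 <= A := le_trans (pn_ge0 _) (HT 0%N).
have bd n x : 0 <= x <= 1 -> forall (T : nat -> {poly R[i]}) P, (forall i, pn (T i) <= A) -> pn P <= A ->
    pn (\sum_(i < n) ((x - t)%:C%C ^+ i) *: T i + (x - t)%:C%C ^+ n *: P) <= n.+1%:R * A.
  move=> x01 T' P HT' HP.
  have key i (Q : {poly R[i]}) : pn Q <= A -> pn ((x - t)%:C%C ^+ i *: Q) <= A.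
    move=> HQ; rewrite pnZ nrmX (le_trans _ HQ)// ler_piMl ?pn_ge0//.
    by rewrite exprn_ile1 ?nrm_ge0 ?nrm_sub01.
  rewrite -natr1 mulrDl mul1r (le_trans (pnD _ _))// lerD ?key//.
  apply: le_trans (pn_sum _ _ _) _.
  have -> : n%:R * A = \sum_(i < n) A by rewrite sumr_const card_ord mulr_natl.
  by apply: ler_sum => i _; exact: key.
elim: s F T HT => [|s IH] F T HT E.
  by move=> x x01; rewrite E// bd// HG.
split; first by move=> x x01; rewrite E// bd// HG.
exists (fun x => \sum_(i < s) (x - t)%:C%C ^+ i *: T i.+1 + (x - t)%:C%C ^+ s *: G x).
  apply: TT_mono (IH _ (fun i => T i.+1) _ _) => //; by rewrite ler_wpM2r// ler_nat.
move=> x x01; have -> : F t = T 0%N.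
  rewrite E// subrr big_ord_recl/= expr0 scale1r expr0n/= scale0r addr0 big1 ?addr0// => i _.
  by rewrite expr0n/= scale0r.
rewrite E// big_ord_recl/= expr0 scale1r -addrA; congr (_ + _).
rewrite scalerDr scaler_sumr scalerA -exprS; congr (_ + _).
by apply: eq_bigr => i _; rewrite scalerA -exprS.
Qed.

Lemma TT_real (a : R -> R) (T : {poly R}) s A y : 0 <= A -> 0 <= y <= 1 -> (size T <= s)%N -> (forall i, `|T`_i| <= A) ->
  (forall x, 0 <= x <= 1 -> `|a x - T.[x - y]| <= A * `|x - y| ^+ s) ->
  TT s (s.+1%:R * A) y (fun x => ((a x)%:C%C)%:P).
Proof.
move=> A0 y01 sT HT Ha.
(* The remainder divided by (x - y)^s. Where the denominator vanishes the quotient is 0, and the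
   hypothesis makes the remainder 0 there as well. *)
apply: (@TT_of_taylor s A y _ (fun i => ((T`_i)%:C%C)%:P) (fun x => (((a x - T.[x - y]) / (x - y) ^+ s)%:C%C)%:P)) => //.
- by move=> i; rewrite pnC nrmR.
- move=> x x01; rewrite pnC nrmR normrM normfV normrX.
  have [n0|n0] := eqVneq (`|x - y| ^+ s) 0; first by rewrite n0 invr0 mulr0.
  have p0 : 0 < `|x - y| ^+ s by rewrite lt_neqAle eq_sym n0 exprn_ge0.
  by rewrite ler_pdivrMr ?Ha.
- move=> x x01; have E : a x = \sum_(i < s) (x - y) ^+ i * T`_i + (x - y) ^+ s * ((a x - T.[x - y]) / (x - y) ^+ s).
    have -> : \sum_(i < s) (x - y) ^+ i * T`_i = T.[x - y].
      by rewrite (horner_coef_wide _ sT); apply: eq_bigr => i _; rewrite mulrC.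
    have [n0|n0] := eqVneq ((x - y) ^+ s) 0; last by rewrite mulrC divfK//; lra.
    have := Ha x x01; rewrite -normrX n0 normr0 mulr0 normr_le0 mul0r addr0 subr_eq0 => /eqP; by [].
  rewrite [in LHS]E rmorphD rmorph_sum/= !polyCD raddf_sum/=; congr (_ + _).
    by apply: eq_bigr => i _; rewrite rmorphM rmorphXn/= polyCM mul_polyC.
  by rewrite rmorphM rmorphXn/= polyCM mul_polyC.
Qed.

Lemma TT_coef s A t F i : TT s A t F -> TT s A t (fun x => ((F x)`_i)%:P).
Proof.
move=> H; rewrite -[A]mul1r; apply: (TT_lin (Lm := fun u : {poly R[i]} => (u`_i)%:P)) H => //.
- by move=> u v; rewrite coefD polyCD.
- by move=> a u; rewrite coefZ polyCM mul_polyC.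
- by move=> u; rewrite pnC mul1r pn_coef.
Qed.

Lemma TT_mulXn s A t F i : TT s A t F -> TT s A t (fun x => F x * 'X^i).
Proof.
move=> H; rewrite -[A]mul1r; apply: (TT_lin (Lm := fun u : {poly R[i]} => u * 'X^i)) H => //.
- by move=> u v; rewrite mulrDl.
- by move=> a u; rewrite scalerAl.
- by move=> u; rewrite mul1r pnMXn.
Qed.

Lemma TT_sum s t n (A : 'I_n -> R) (F : 'I_n -> R -> {poly R[i]}) : (forall i, TT s (A i) t (F i)) ->
  TT s (\sum_(i < n) A i) t (fun x => \sum_(i < n) F i x).
Proof.
elim: n A F => [|n IH] A F H.
  rewrite big_ord0 (_ : (fun x : R => _) = (fun=> 0)); first by apply: TT_cst; rewrite pn0.
  by apply/funext => x; rewrite big_ord0.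
rewrite big_ord_recl (_ : (fun x : R => _) = (fun x => F ord0 x + \sum_(i < n) F (lift ord0 i) x)).
  by apply: TT_add => //; apply: IH.
by apply/funext => x; rewrite big_ord_recl.
Qed.

Lemma TT_exp s A n : exists B, forall t F, 0 <= t <= 1 -> TT s A t F -> TT s B t (fun x => F x ^+ n).
Proof.
elim: n => [|n [B IH]].
  exists 1 => t F _ _; rewrite (_ : (fun x : R => _) = (fun=> 1)); first by apply: TT_cst; rewrite -polyC1 pnC nrm1.
  by apply/funext => x; rewrite expr0.
exists (2 ^+ s * (A * B)) => t F t01 H; rewrite (_ : (fun x : R => _) = (fun x => F x * F x ^+ n)).
  by apply: TT_mul => //; apply: IH.
by apply/funext => x; rewrite exprS.
Qed.

Lemma TT_compX s A B n : exists E, forall t F (c : R -> R[i]), 0 <= t <= 1 ->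
  (forall x, (size (F x) <= n)%N) -> TT s A t F -> TT s B t (fun x => (c x)%:P) ->
  TT s E t (fun x => F x \Po ('X + (c x)%:P)).
Proof.
have [Ex HEx] := choice (TT_exp s (1 + B)).
exists (\sum_(i < n) 2 ^+ s * (A * Ex i)) => t F c t01 sF HF Hc.
rewrite (_ : (fun x : R => _) = (fun x => \sum_(i < n) ((F x)`_i)%:P * ('X + (c x)%:P) ^+ i)).
  apply: TT_sum => i; apply: TT_mul => //; first exact: TT_coef.
  apply: HEx => //; apply: TT_add Hc; apply: TT_cst; exact: pnX1.
apply/funext => x; rewrite comp_polyE (big_ord_widen n (fun i => (F x)`_i *: ('X + (c x)%:P) ^+ i))//.
rewrite [RHS](bigID (fun i : 'I_n => (i < size (F x))%N))/= [X in _ = _ + X]big1 ?addr0 => [|i].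
  by apply: eq_bigr => i _; rewrite mul_polyC.
by rewrite -leqNgt => h; rewrite nth_default// mul0r.
Qed.
End TaylorClass.

(** * Continuity and separation of roots *)

Section Clusters.
Variable R : realType.
Notation C := (R[i]).
Notation nrm := (@ComplexField.Normc.normc R).
Implicit Types (rs : seq C) (z u : C).

Definition dC (x y : C) : R := nrm (x - y).

Lemma dC_sym x y : dC x y = dC y x. Proof. exact: nrmB. Qed.
Lemma dC_tri x y z : dC x z <= dC x y + dC y z. Proof. exact: nrm_tri. Qed.
Lemma Pr_cons z rs : Pr (z :: rs) = ('X - z%:P) * Pr rs.
Proof. by rewrite /Pr big_cons. Qed.

Lemma Pr_small_root rs z (e : R) : (0 < size rs)%N -> 0 <= e -> nrm (Pr rs).[z] <= e ^+ size rs ->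
  exists2 u, u \in rs & nrm (z - u) <= e.
Proof.
move=> s0 e0 H; have [/hasP[u ru h]|/hasPn h] := boolP (has (fun u => nrm (z - u) <= e) rs); first by exists u.
exfalso; move: H; rewrite Pr_horner; apply/negP; rewrite -ltNge.
elim: rs s0 h => // u rs IH _ h; rewrite big_cons /= exprS.
have h1 : e < nrm (z - u) by rewrite ltNge h// mem_head.
case: rs IH h => [|v rs] IH h; first by rewrite big_nil expr0 !mulr1.
apply: ltr_pM => //; first exact: exprn_ge0.
by apply: IH => // w rw; apply: h; rewrite in_cons rw orbT.
Qed.

(** Continuity of the roots with a modulus uniform over bounded lists. A root z of [Pr rs] makes
    [Pr rs'] small at z, so some u in rs' is near z; after division by X - z the remaining
    polynomials are still close, with a loss that [del] anticipates. *)
Lemma root_match m (B e : R) : 0 <= B -> 0 < e -> exists2 del, 0 < del & forall rs rs', size rs = m -> size rs' = m ->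
  {in rs, forall z, nrm z <= B} -> {in rs', forall z, nrm z <= B} ->
  pn (Pr rs - Pr rs') <= del -> matched dC e rs rs'.
Proof.
move=> B0 e0; elim: m => [|m [d1 d10 IH]].
  by exists 1 => // rs rs' /size0nil -> /size0nil -> _ _ _; exists [::].
pose L := (3 + B) ^+ m.+1; have L0 : 0 < L by rewrite exprn_gt0// ltr_wpDr.
pose L2 := (1 + B) ^+ m; have L20 : 0 < L2 by rewrite exprn_gt0// ltr_wpDr.
pose eta := Num.min e (d1 / (2 * L * L2)).
have eta0 : 0 < eta by rewrite lt_min e0 divr_gt0// !mulr_gt0.
pose E := (1 + B) ^+ m.+2; have E0 : 0 < E by rewrite exprn_gt0// ltr_wpDr.
pose del := Num.min (d1 / (2 * L)) (eta ^+ m.+1 / E).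
have del0 : 0 < del by rewrite lt_min (divr_gt0 d10 (mulr_gt0 _ L0))//= (divr_gt0 _ E0)// exprn_gt0.
exists del => // -[//|z rs] rs' [srs] srs' Hrs Hrs' Hd.
have zB : nrm z <= B by apply: Hrs; rewrite mem_head.
have [u ru zu] : exists2 u, u \in rs' & nrm (z - u) <= eta.
  apply: Pr_small_root; [by rewrite srs'|exact: ltW|rewrite srs'].
  have -> : (Pr rs').[z] = - (Pr (z :: rs) - Pr rs').[z].
    by rewrite hornerD hornerN Pr_cons hornerM hornerXsubC subrr mul0r add0r opprK.
  rewrite nrmN; apply: (@le_trans _ _ (del * E)); last by rewrite -ler_pdivlMr// ge_min lexx orbT.
  have h1 : nrm z <= 1 + B by rewrite (le_trans zB)// lerDr.
  apply: le_trans (pn_horner (B := 1 + B) _ _ h1) _; first by rewrite lerDl.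
  rewrite ler_pM ?pn_ge0 ?exprn_ge0 ?addr_ge0// ler_weXn2l ?lerDl//.
  rewrite (leq_trans (size_polyD _ _))// geq_max size_Pr size_polyN size_Pr srs' /= srs.
  by rewrite leqnn.
have p := perm_to_rem ru.
pose rs1 := rem u rs'; have srs1 : size rs1 = m by rewrite /rs1 size_rem// srs'.
have Hrs1 : {in rs1, forall z, nrm z <= B} by move=> w /mem_rem/Hrs'.
suff : matched dC e (z :: rs) (u :: rs1) by apply: matched_permr; rewrite perm_sym.
have [|||||ys py ay] := IH rs rs1 => //.
- by move=> w rw; apply: Hrs; rewrite in_cons rw orbT.
- apply: le_trans (pn_divX z (n := m.+1) _) _.
    rewrite (leq_trans (size_polyD _ _))// geq_max size_Pr size_polyN size_Pr srs srs1; by rewrite leqnn.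
  apply: (@le_trans _ _ (L * (del + eta * L2))).
    apply: ler_pM; rewrite ?exprn_ge0 ?addr_ge0 ?nrm_ge0 ?pn_ge0//.
      by rewrite lerXn2r ?nnegrE ?addr_ge0 ?nrm_ge0// lerD2l.
    have -> : ('X - z%:P) * (Pr rs - Pr rs1) = (Pr (z :: rs) - Pr rs') + (z - u) *: Pr rs1.
      by rewrite (Pr_perm p) !Pr_cons -mul_polyC polyCB; ring.
    rewrite (le_trans (pnD _ _))// lerD// pnZ ler_pM ?nrm_ge0 ?pn_ge0//.
    by rewrite (le_trans (pn_root_prod Hrs1 B0))// srs1.
  have h1 : L * del <= d1 / 2.
    rewrite mulrC -ler_pdivlMr//; have : del <= d1 / (2 * L) by rewrite ge_min lexx.
    by rewrite invfM mulrA.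
  have h2 : L * (eta * L2) <= d1 / 2.
    have : eta <= d1 / (2 * L * L2) by rewrite ge_min lexx orbT.
    rewrite ler_pdivlMr ?mulr_gt0//; lra.
  by rewrite mulrDr; lra.
exists (u :: ys); first by rewrite perm_cons.
by rewrite /= ay andbT (le_trans zu)// ge_min lexx.
Qed.

(** Each point of s destroys at most half of the current empty interval. *)
Lemma gap (s : seq R) (a b : R) : a < b -> exists c, exists2 c', [/\ a <= c, c' <= b & (b - a) / 2 ^+ size s <= c' - c] &
  {in s, forall x, x <= c \/ c' <= x}.
Proof.
move=> ab; elim: s => [|x s [c [c' [h1 h2 h3] h4]]]; first by exists a, b => //; rewrite expr0 divr1 !lexx.
pose g := (b - a) / 2 ^+ size s.
have g0 : 0 < g by rewrite divr_gt0 ?subr_gt0 ?exprn_gt0.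
have gE : (b - a) / 2 ^+ size (x :: s) = g / 2 by rewrite /= exprS invfM /g; ring.
rewrite gE; rewrite -/g in h3.
have [xm|xm] := lerP x ((c + c') / 2).
  exists (Num.max c x), c'; first by split; rewrite // ?le_max ?h1// /Num.max; case: ifP; lra.
  move=> y; rewrite in_cons => /orP[/eqP ->|/h4[H|H]]; rewrite ?le_max ?lexx ?orbT ?H; by [left|right].
exists c, (Num.min c' x); first by split; rewrite // ?ge_min ?h2// /Num.min; case: ifP; lra.
move=> y; rewrite in_cons => /orP[/eqP ->|/h4[H|H]]; rewrite ?ge_min ?lexx ?orbT ?H; by [left|right].
Qed.

Lemma pn_Pr_small rs (b : R) : 0 <= b <= 1 -> {in rs, forall z, nrm z <= b} ->
  pn (Pr rs - 'X^(size rs)) <= (2 ^+ size rs - 1) * b.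
Proof.
move=> /andP[b0 b1]; elim: rs => [|z rs IH] H; first by rewrite /Pr big_nil !expr0 !subrr pn0 mul0r.
have Hz : nrm z <= b by apply: H; rewrite mem_head.
have Hr : {in rs, forall z, nrm z <= b} by move=> w rw; apply: H; rewrite in_cons rw orbT.
have -> : Pr (z :: rs) - 'X^(size (z :: rs)) = ('X - z%:P) * (Pr rs - 'X^(size rs)) - z *: 'X^(size rs).
  by rewrite Pr_cons /= exprS -mul_polyC; ring.
rewrite (le_trans (pnB _ _))// pnZ.
have h1 := pn_polyXn R (size rs).
have h2 := IH Hr; have h3 : pn ('X - z%:P) <= 2 by rewrite (le_trans (pn_XsubC _))//; lra.
have h4 : pn (('X - z%:P) * (Pr rs - 'X^(size rs))) <= 2 * ((2 ^+ size rs - 1) * b).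
  by rewrite (le_trans (pnM _ _))// ler_pM ?pn_ge0.
have h5 : nrm z * pn ('X^(size rs)) <= b * 1 by rewrite ler_pM ?pn_ge0 ?nrm_ge0.
by rewrite /= exprS; lra.
Qed.

(** A large coefficient forces a root z1 with |z1| > b. As the roots are centred, the differences z1
    - u average to z1, so some u is farther than b from z1. A gap in the distances to z1 then
    separates two nonempty clusters. *)
Lemma split_roots m (be : R) : 0 < be -> exists2 g, 0 < g & forall rs, size rs = m ->
  \sum_(z <- rs) z = 0 -> (exists2 i, (i < m)%N & be <= nrm (Pr rs)`_i) ->
  exists rs1 rs2, [/\ perm_eq rs (rs1 ++ rs2), (0 < size rs1)%N, (0 < size rs2)%N &
    {in rs1 & rs2, forall z u, g <= nrm (z - u)}].
Proof.
move=> be0; pose b := Num.min 1 (be / 2 ^+ m); have b0 : 0 < b by rewrite lt_min ltr01 divr_gt0 ?exprn_gt0.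
exists (b / 2 ^+ m); first by rewrite divr_gt0 ?exprn_gt0.
move=> rs srs sum0 [i im Hi].
have [z1 rz1 z1b] : exists2 z, z \in rs & b < nrm z.
  have [/hasP//|/hasPn h] := boolP (has (fun z => b < nrm z) rs).
  have H : {in rs, forall z, nrm z <= b} by move=> z rz; rewrite leNgt h.
  have b01 : 0 <= b <= 1 by rewrite (ltW b0) ge_min lexx.
  have := pn_Pr_small b01 H; rewrite srs => h1.
  have := pn_coef (Pr rs - 'X^m) i; rewrite coefB coefXn ltn_eqF//= subr0 => h2.
  have : b * 2 ^+ m <= be by rewrite -ler_pdivlMr ?exprn_gt0// ge_min lexx orbT.
  lra.
have m0 : (0 < m)%N by apply: leq_ltn_trans im.
have [u ru ub] : exists2 u, u \in rs & b < nrm (z1 - u).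
  have [/hasP//|/hasPn h] := boolP (has (fun u => b < nrm (z1 - u)) rs).
  have E : \sum_(u <- rs) (z1 - u) = z1 *+ m by rewrite sumrB sum0 subr0 big_const_seq count_predT srs iter_addr_0.
  have : nrm (z1 *+ m) <= \sum_(u <- rs) nrm (z1 - u) by rewrite -E nrm_sum.
  have -> : nrm (z1 *+ m) = nrm z1 * m%:R.
    rewrite -[z1 *+ m]mulr_natr nrmM; congr (_ * _); rewrite -(rmorph_nat (real_complex R)) nrmR ger0_norm//.
  have : \sum_(u <- rs) nrm (z1 - u) <= b * m%:R.
    have -> : b * m%:R = \sum_(u <- rs) b by rewrite big_const_seq count_predT srs iter_addr_0 mulr_natr.
    by rewrite big_seq [leRHS]big_seq; apply: ler_sum => w rw; rewrite leNgt h.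
  move=> h1 h2; have := le_trans h2 h1; rewrite ler_pM2r ?ltr0n// leNgt z1b; by [].
have [c [c' [h1 h2 h3] h4]] := gap (map (fun u => nrm (z1 - u)) rs) b0.
rewrite size_map srs subr0 in h3.
have cc : c < c' by rewrite -subr_gt0; apply: lt_le_trans h3; rewrite divr_gt0 ?exprn_gt0.
pose p u := nrm (z1 - u) <= c.
have z1p : p z1 by rewrite /p subrr nrm0.
have up : ~~ p u by rewrite /p -ltNge (lt_le_trans cc)// (le_trans h2)// ltW.
exists (seq.filter p rs), (seq.filter (predC p) rs); split.
- by rewrite perm_sym perm_filterC.
- by rewrite size_filter -has_count; apply/hasP; exists z1.
- by rewrite size_filter -has_count; apply/hasP; exists u.
- move=> w v; rewrite !mem_filter => /andP[pw rw] /andP[/= pv rv].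
  have : c' <= nrm (z1 - v).
    have [|h|//] := h4 (nrm (z1 - v)); first by apply/mapP; exists v.
    by move: pv; rewrite /p h.
  move: pw; rewrite /p => pw; have := nrm_tri z1 w v; lra.
Qed.

Lemma matched_split (T : eqType) (d : T -> T -> R) (e : R) xs1 xs2 ys : matched d e (xs1 ++ xs2) ys ->
  exists ys1 ys2, [/\ perm_eq ys (ys1 ++ ys2), all2 (fun x y => d x y <= e) xs1 ys1 &
   all2 (fun x y => d x y <= e) xs2 ys2].
Proof.
move=> [ys' p H].
suff [ys1 [ys2 [E H1 H2]]] : exists ys1 ys2, [/\ ys' = ys1 ++ ys2, all2 (fun x y => d x y <= e) xs1 ys1 &
   all2 (fun x y => d x y <= e) xs2 ys2] by exists ys1, ys2; rewrite -E.
elim: xs1 ys' H {p} => [|x xs1 IH] ys' H; first by exists [::], ys'.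
case: ys' H => [|y ys'] //= /andP[h1 /IH[ys1 [ys2 [-> h2 h3]]]].
by exists (y :: ys1), ys2; split => //=; rewrite h1.
Qed.

Lemma all2_mem (T : eqType) (r : T -> T -> bool) xs ys y : all2 r xs ys -> y \in ys -> exists2 x, x \in xs & r x y.
Proof.
elim: xs ys => [|x xs IH] [|z ys] //= /andP[h1 h2]; rewrite in_cons => /orP[/eqP ->|yy].
  by exists x; rewrite // mem_head.
by have [w w1 w2] := IH _ h2 yy; exists w; rewrite // in_cons w1 orbT.
Qed.

(** If |z| > 2 s, the geometric sum that bounds the lower terms is smaller than |z|^m. *)
Lemma coef_root_bound rs (s : R) : 0 <= s -> (forall i, (i < size rs)%N -> nrm (Pr rs)`_i <= s ^+ (size rs - i)) ->
  {in rs, forall z, nrm z <= 2 * s}.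
Proof.
move=> s0 H z rz; rewrite leNgt; apply/negP => zs; set m := size rs in H.
have z0 : 0 < nrm z by apply: le_lt_trans zs; rewrite mulr_ge0.
have : root (Pr rs) z by rewrite root_Pr.
rewrite /root horner_coef size_Pr big_ord_recr/= -/m.
have -> : (Pr rs)`_m = 1 by have := Pr_monic rs; rewrite monicE lead_coefE size_Pr => /eqP.
rewrite mul1r addrC addr_eq0 => /eqP E.
have : nrm z ^+ m <= \sum_(i < m) s ^+ (m - i) * nrm z ^+ i.
  rewrite -nrmX E nrmN (le_trans (nrm_sum _ _ _))//; apply: ler_sum => i _.
  by rewrite nrmM nrmX ler_wpM2r ?exprn_ge0 ?nrm_ge0// H.
apply/negP; rewrite -ltNge; elim: m {H E} => [|m IH]; first by rewrite big_ord0 expr0.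
rewrite big_ord_recr/= subSnn expr1.
have -> : \sum_(i < m) s ^+ (m.+1 - i) * nrm z ^+ i = s * \sum_(i < m) s ^+ (m - i) * nrm z ^+ i.
  by rewrite mulr_sumr; apply: eq_bigr => i _; rewrite subSn ?exprS ?mulrA// ltnW.
have h : 0 < nrm z ^+ m by rewrite exprn_gt0.
rewrite exprS; have h1 : 2 * s * nrm z ^+ m < nrm z * nrm z ^+ m by rewrite ltr_pM2r.
have := ler_wpM2l s0 (ltW IH); lra.
Qed.

Lemma Pr_shift rs c : Pr (map (fun z => z - c) rs) = Pr rs \Po ('X + c%:P).
Proof.
elim: rs => [|z rs IH]; first by rewrite /Pr !big_nil comp_polyC.
rewrite /= !Pr_cons comp_polyM IH; congr (_ * _).
by rewrite comp_polyB comp_polyX comp_polyC polyCB; ring.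
Qed.

Lemma Pr_scale rs (c : C) i : c != 0 -> (i <= size rs)%N ->
  (Pr (map (fun z => z / c) rs))`_i = (Pr rs)`_i / c ^+ (size rs - i).
Proof.
move=> c0; have E : Pr (map (fun z => z / c) rs) = c ^- size rs *: (Pr rs \Po (c *: 'X)).
  elim: rs => [|z rs IH]; first by rewrite /Pr !big_nil comp_polyC expr0 invr1 scale1r.
  rewrite /= !Pr_cons comp_polyM IH comp_polyB comp_polyX comp_polyC.
  have -> : 'X - (z / c)%:P = c^-1 *: (c *: 'X - z%:P).
    by rewrite scalerBr scalerA mulVf// scale1r -mul_polyC -polyCM mulrC.
  by rewrite -scalerAl -scalerAr exprS invfM -scalerA.
move=> si; rewrite E coefZ coef_comp_scaleX -{1}(subnK si) exprD.
by field; rewrite !expf_neq0.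
Qed.
End Clusters.
Section MatchMap.
Variable R : realType.

Lemma matched_map (T T' : eqType) (d : T -> T -> R) (d' : T' -> T' -> R) (f g : T' -> T) e e' xs ys :
  matched d' e xs ys -> {in xs & ys, forall x y, d' x y <= e -> d (f x) (g y) <= e'} ->
  matched d e' (map f xs) (map g ys).
Proof.
move=> [ys' p H] Hfg; exists (map g ys'); first exact: perm_map.
have {}Hfg : {in xs & ys', forall x y, d' x y <= e -> d (f x) (g y) <= e'}.
  by move=> x y hx; rewrite -(perm_mem p) => hy; exact: Hfg.
elim: xs ys' H Hfg {p} => [|x xs IH] [|y ys'] //= /andP[h1 h2] Hfg.
rewrite Hfg ?mem_head//=; apply: IH => // u v hu hv; apply: Hfg; by rewrite in_cons ?hu ?hv orbT.
Qed.

Lemma bdist_map (T T' : eqType) (d : T -> T -> R) (d' : T' -> T' -> R) (f g : T' -> T) c k xs ys :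
  size xs = size ys -> 0 <= c -> 0 <= k ->
  {in xs & ys, forall x y, d (f x) (g y) <= c * d' x y + k} ->
  bdist d (map f xs) (map g ys) <= c * bdist d' xs ys + k.
Proof.
move=> sz c0 k0 H; apply/ler_addgt0Pr => e e0.
have e1 : 0 < e / (c + 1) by rewrite divr_gt0// ltr_wpDl.
have := @bdist_lt _ _ d' (bdist d' xs ys + e / (c + 1)) xs ys sz; rewrite ltrDl e1 => /(_ isT) M.
have h0 := bdist_ge0 d' xs ys.
have h1 : c * (e / (c + 1)) <= e.
  by rewrite mulrCA ler_piMr ?(ltW e0)// ler_pdivrMr ?ltr_wpDl// mul1r lerDl.
apply: le_trans (_ : _ <= c * (bdist d' xs ys + e / (c + 1)) + k) _; last by lra.
apply: bdist_le; first by rewrite addr_ge0// mulr_ge0// addr_ge0// ltW.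
apply: matched_map M _ => x y hx hy hd; apply: le_trans (H x y hx hy) _.
by rewrite lerD2r ler_wpM2l.
Qed.

Lemma bdist_cat (T : eqType) (d : T -> T -> R) xs1 xs2 ys1 ys2 : size xs1 = size ys1 -> size xs2 = size ys2 ->
  bdist d (xs1 ++ xs2) (ys1 ++ ys2) <= bdist d xs1 ys1 + bdist d xs2 ys2.
Proof.
move=> s1 s2; apply/ler_addgt0Pr => e e0.
have h1 := bdist_ge0 d xs1 ys1; have h2 := bdist_ge0 d xs2 ys2.
apply: bdist_le; first lra.
by apply: matched_cat; apply: bdist_lt => //; lra.
Qed.
End MatchMap.

Section CellLemma.
Variable R : realType.

(** The order of the quantifiers is the point: [CI] comes first, since [cell_roots] and [line_cell]
    choose c0 in terms of it, and the constants [Cn] and [rr0] precede the functions, hence are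
    uniform in them and in [lmax]. *)
Lemma cell_lemma (d N : nat) (w : 'I_N -> nat) (q : R) : (0 < d)%N -> (forall j, (0 < w j <= d)%N) -> 1 <= q ->
  exists2 CI : R, 1 <= CI & forall A c0 : R, 1 <= A -> 0 < c0 <= 1 ->
  exists Cn rr0 : R, [/\ 0 <= Cn, 0 < rr0 &
   forall (a : 'I_N -> R -> R) (lmax : nat) (D : R -> R -> R) (W : nat -> R),
    (forall j t, 0 <= t <= 1 -> exists T : {poly R}, [/\ (size T <= 4 * d)%N, forall s, `|T`_s| <= A &
       forall x, 0 <= x <= 1 -> `|a j x - T.[x - t]| <= A * `|x - t| ^+ (4 * d)]) ->
    (forall x y, 0 <= D x y) ->
    {in `[0, 1] & &, forall x y z, D x z <= D x y + D y z} ->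
    (forall l, 0 <= W l) ->
    (forall x y, Btyp A a w lmax x -> Btyp A a w lmax y -> D x y = 0) ->
    (forall l u r t, (l < lmax)%N -> rr0 * 16^-1 ^+ (l * d) <= r -> cell_ok d CI A c0 a w l u r t ->
      Rbound q D u (u + r) (W l)) ->
    Rbound q D 0 1 (Cn * \sum_(l < lmax) 2 ^+ l * W l)].
Proof.
move=> d0 wd q1; have K0 : (0 < 4 * d)%N by rewrite muln_gt0.
have [CI C1 HCI] := interp R K0; exists CI => // A c0 A1 c01.
have [n2 H2] := hscale d0 C1 A1 c01 wd.
pose k1 := c0 / (4 * (4 * d)%:R) * 2^-1 ^+ (4 * d) / (4 * CI).
exists (2 ^ n2 * (2 + N * 2 * (2 * (Num.trunc (8 / k1)).+2) * (4 * d)))%:R, (k1 / A / 2).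
have k10 : 0 < k1.
  have CI0 : 0 < CI := lt_le_trans ltr01 C1; case/andP: c01 => c00 _.
  apply: divr_gt0; apply: mulr_gt0 => //; rewrite ?exprn_gt0//; apply: divr_gt0 => //.
  by apply: mulr_gt0; rewrite // ltr0n.
have A0 : 0 < A by exact: lt_le_trans A1.
have r0 : 0 < k1 / A / 2 by apply: divr_gt0 => //; apply: divr_gt0.
split=> //.
move=> a lmax D W Ha D0 Dt W0 DB DC.
have HT0 (jt : 'I_N * R) : exists T : {poly R}, 0 <= jt.2 <= 1 ->
    [/\ (size T <= 4 * d)%N, forall s, `|T`_s| <= A &
       forall x, 0 <= x <= 1 -> `|a jt.1 x - T.[x - jt.2]| <= A * `|x - jt.2| ^+ (4 * d)].
  case: jt => j t /=.
  have [t01|n] := boolP (0 <= t <= 1); first by have [T HT] := Ha j t t01; exists T.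
  by exists 0.
have [Tay HT] := choice HT0.
pose Ty j t := Tay (j, t).
have Tsz j t : 0 <= t <= 1 -> (size (Ty j t) <= 4 * d)%N by move=> /(HT (j, t))[].
have Tbd j t s : 0 <= t <= 1 -> `|(Ty j t)`_s| <= A by move=> /(HT (j, t))[].
have Terr j t x : 0 <= t <= 1 -> 0 <= x <= 1 -> `|a j x - (Ty j t).[x - t]| <= A * `|x - t| ^+ (4 * d).
  by move=> /(HT (j, t))[_ _ H] /H.
have [st Hst] := choice (step_ex d0 C1 A1 c01 wd Tsz Tbd Terr lmax).
apply: (cells_Rbound d0 C1 HCI A1 c01 wd Tsz Tbd Terr Hst q1 D0 Dt W0 DB _ H2).
move=> l u r t ll hr; apply: (DC _ _ _ _ ll); apply: le_trans hr.
by rewrite /rmin -/k1 mulrAC.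
Qed.
End CellLemma.

Section Components.
Variable R : realType.

Definition part (b : bool) (z : R[i]) : R := if b then complex.Im z else complex.Re z.

Lemma part_le b z : `|part b z| <= nrm z.
Proof. by case: b; [exact: nrm_Im|exact: nrm_Re]. Qed.

Lemma partD b z u : part b (z + u) = part b z + part b u.
Proof. by case: b z u => -[? ?] [? ?]. Qed.

Lemma partB b z u : part b (z - u) = part b z - part b u.
Proof. by case: b z u => -[? ?] [? ?]. Qed.

Lemma part_sum b n (F : 'I_n -> R[i]) : part b (\sum_(i < n) F i) = \sum_(i < n) part b (F i).
Proof.
elim: n F => [|n IH] F; first by rewrite !big_ord0; case: b.
by rewrite !big_ord_recr/= partD IH.
Qed.

Lemma partZ b (c : R) z : part b (c%:C%C * z) = c * part b z.
Proof. by case: b z => -[x y] /=; rewrite mul0r ?addr0 ?subr0. Qed.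

Lemma partE z : z = (part false z)%:C%C + 'i%C * (part true z)%:C%C.
Proof. exact: complexE. Qed.

(** Even indices are real parts and odd indices imaginary parts; the coefficient index is j./2.
    Cells are built for real functions because their number is controlled by real roots of Taylor
    polynomials. *)
Definition cpart (P : R -> {poly R[i]}) (j : nat) (x : R) : R := part (odd j) (P x)`_(j./2).

Lemma cpartE (P : R -> {poly R[i]}) i x :
  (P x)`_i = (cpart P i.*2 x)%:C%C + 'i%C * (cpart P i.*2.+1 x)%:C%C.
Proof. by rewrite /cpart /= odd_double doubleK uphalf_double -partE. Qed.

Lemma cpart_nrm (P : R -> {poly R[i]}) i x : nrm (P x)`_i <= `|cpart P i.*2 x| + `|cpart P i.*2.+1 x|.
Proof. by rewrite /cpart /= odd_double doubleK uphalf_double nrm_le_ReIm. Qed.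

Lemma cpart_le (P : R -> {poly R[i]}) j x : `|cpart P j x| <= nrm (P x)`_(j./2).
Proof. exact: part_le. Qed.

Lemma TT_cpart s A t (P : R -> {poly R[i]}) j : 0 <= t <= 1 -> TT s A t P ->
  exists T : {poly R}, [/\ (size T <= s)%N, forall i, `|T`_i| <= A &
   forall x, 0 <= x <= 1 -> `|cpart P j x - T.[x - t]| <= A * `|x - t| ^+ s].
Proof.
move=> t01 HP; have A0 := TT_ge0 HP; have [T [G [HT HG E]]] := TT_taylor t01 HP.
exists (\poly_(k < s) part (odd j) (T k)`_(j./2)); split; first exact: size_poly.
  move=> i; rewrite coef_poly; case: ifP => _; last by rewrite normr0.
  by rewrite (le_trans (part_le _ _))// (le_trans (pn_coef _ _)).
move=> x x01; rewrite (horner_coef_wide _ (size_poly _ _)) /cpart E// coefD partD coef_sum part_sum coefZ.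
rewrite -[X in _ + X - _]/(part (odd j) _) addrAC -sumrB big1 ?add0r => [|i _].
  have -> : (x - t)%:C%C ^+ s = ((x - t) ^+ s)%:C%C :> R[i] by rewrite rmorphXn.
  rewrite partZ normrM normrX mulrC ler_wpM2r ?exprn_ge0//.
  by rewrite (le_trans (part_le _ _))// (le_trans (pn_coef _ _))// HG.
have -> : (x - t)%:C%C ^+ i = ((x - t) ^+ i)%:C%C :> R[i] by rewrite rmorphXn.
by rewrite coefZ partZ coef_poly ltn_ord mulrC subrr.
Qed.
End Components.

(** * The induction step: roots over one cell *)

Section CellRoots.
Variables (R : realType) (d : nat) (q : R).
Hypothesis d0 : (0 < d)%N.
Hypothesis q1 : 1 <= q.
Notation C := (R[i]).
Notation nrm := (@ComplexField.Normc.normc R).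

Definition rdist (rs : R -> seq C) (x y : R) : R := bdist (@dC R) (rs x) (rs y).

Definition IHroots m := forall m' (A : R), (m' < m)%N -> exists2 M, 0 <= M & forall rs : R -> seq C,
  (forall x, size (rs x) = m') -> (forall t, 0 <= t <= 1 -> TT (4 * d) A t (fun x => Pr (rs x))) ->
  Rbound q (rdist rs) 0 1 M.

Lemma TT_of_comps s m B y (rs : R -> seq C) : 0 <= B -> 0 <= y <= 1 -> (forall x, size (rs x) = m) ->
  (forall j : 'I_(m.*2), exists T : {poly R}, [/\ (size T <= s)%N, forall i, `|T`_i| <= B &
      forall x, 0 <= x <= 1 -> `|cpart (fun x => Pr (rs x)) j x - T.[x - y]| <= B * `|x - y| ^+ s]) ->
  TT s (1 + \sum_(i < m) (s.+1%:R * B + s.+1%:R * B)) y (fun x => Pr (rs x)).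
Proof.
move=> B0 y01 sz H; pose P x := Pr (rs x).
have HT (j : nat) : (j < m.*2)%N -> TT s (s.+1%:R * B) y (fun x => ((cpart P j x)%:C%C)%:P).
  by move=> jm; have [T [h1 h2 h3]] := H (Ordinal jm); exact: (TT_real B0 y01 h1 h2 h3).
rewrite (_ : (fun x : R => _) = (fun x => 'X^m + \sum_(i < m)
   (((cpart P i.*2 x)%:C%C)%:P + 'i%C *: ((cpart P i.*2.+1 x)%:C%C)%:P) * 'X^i)).
  apply: TT_add; first by apply: TT_cst; exact: pn_polyXn.
  apply: TT_sum => i; apply: TT_mulXn; apply: TT_add; first by apply: HT; rewrite ltn_double.
  have -> : s.+1%:R * B = nrm 'i%C * (s.+1%:R * B) by rewrite /= expr0n/= add0r expr1n sqrtr1 mul1r.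
  by apply: TT_scale; apply: HT; rewrite ltn_Sdouble.
apply/funext => x; rewrite -[LHS]coefK size_Pr sz poly_def big_ord_recr/= addrC; congr (_ + _).
  have -> : (Pr (rs x))`_m = 1 by have := Pr_monic (rs x); rewrite monicE lead_coefE size_Pr sz => /eqP.
  by rewrite scale1r.
apply: eq_bigr => i _; rewrite -/(P x) cpartE -mul_polyC polyCD polyCM -mul_polyC; by [].
Qed.

Lemma dcoef_pn (rs rs' : seq C) (e : R) m : size rs = m -> size rs' = m ->
  (forall i, (i < m)%N -> nrm ((Pr rs)`_i - (Pr rs')`_i) <= e) -> pn (Pr rs - Pr rs') <= m%:R * e.
Proof.
move=> s1 s2 H; rewrite (@pnE R m); last first.
  rewrite -ltnS; apply: leq_trans (_ : (size (Pr rs - Pr rs')%R < m.+1)%N) _ => //.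
  have sz : (size (Pr rs - Pr rs')%R <= m.+1)%N.
    by rewrite (leq_trans (size_polyD _ _))// geq_max size_polyN !size_Pr s1 s2 leqnn.
  rewrite ltnS; apply/leq_sizeP => j; rewrite leq_eqVlt => /orP[/eqP <-|mj]; last first.
    by apply: nth_default; exact: leq_trans sz mj.
  have := Pr_monic rs; have := Pr_monic rs'; rewrite !monicE !lead_coefE !size_Pr s1 s2 /= coefB.
  by move=> /eqP -> /eqP ->; rewrite subrr.
have -> : m%:R * e = \sum_(i < m) e by rewrite sumr_const card_ord mulr_natl.
by apply: ler_sum => i _; rewrite coefB H.
Qed.

(** After rescaling by [sig l] the polynomial varies little over the cell, and at t it has a
    coefficient of size at least 16^(-m). So [split_roots] gives two clusters at t, and [root_match]
    propagates them over the cell, where [factor_TT] and the induction hypothesis apply to each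
    cluster. *)
Lemma cell_roots m (CI : R) : (m <= d)%N -> 1 <= CI -> IHroots m ->
  exists2 c0 : R, 0 < c0 <= 1 & exists2 M2 : R, 0 <= M2 & forall (A : R) (rs : R -> seq C) l u r t, 1 <= A ->
  (forall x, size (rs x) = m) -> (forall x, \sum_(z <- rs x) z = 0) ->
  cell_ok d CI A c0 (fun j : 'I_(m.*2) => cpart (fun x => Pr (rs x)) j) (fun j => (m - j./2)%N) l u r t ->
  Rbound q (rdist rs) u (u + r) (sig A l `^ q * r `^ (1 - q) * M2).
Proof.
move=> md C1 IH; have CI0 : 0 <= CI := le_trans ler01 C1.
pose be : R := 16^-1 ^+ m; have be0 : 0 < be by rewrite exprn_gt0.
have [g g0 Hsplit] := split_roots m be0.
have g4 : 0 < g / 4 by rewrite divr_gt0.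
(* Over the cell the real and imaginary parts of the coefficients are at most 2, so the coefficients
   are at most 4 and the roots at most 8. *)
have [del del0 Hmatch] := root_match m (ltW (ltr0n R 8)) g4.
pose c0 := Num.min 1 (del / (2 * m.+1%:R)).
have c00 : 0 < c0 by rewrite lt_min ltr01 divr_gt0// mulr_gt0.
have c01 : c0 <= 1 by rewrite ge_min lexx.
exists c0; first by rewrite c00.
pose B1 : R := 1 + \sum_(i < m) ((4 * d).+1%:R * (3 * CI) + (4 * d).+1%:R * (3 * CI)).
have g2 : 0 < g / 2 by rewrite divr_gt0.
have [Bf HBf] := choice (fun m1 => factor_TT (4 * d) B1 m1 (m - m1) (ltW (ltr0n R 8)) g2).
have HMf0 (p : nat * nat) : exists M, 0 <= M /\ ((p.1 < m)%N -> forall rs : R -> seq C,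
   (forall x, size (rs x) = p.1) -> (forall t, 0 <= t <= 1 -> TT (4 * d) (Bf p.2) t (fun x => Pr (rs x))) ->
   Rbound q (rdist rs) 0 1 M).
  case: p => m1 m2 /=.
  have [h|h] := ltnP m1 m; last by exists 0; split => //; rewrite ltnNge h.
  by have [M M0 HM] := IH m1 (Bf m2) h; exists M.
have [Mf HMf] := choice HMf0.
have Mf0 p : 0 <= Mf p by case: (HMf p).
exists (\sum_(m1 < m) 2 `^ q * (Mf (m1 : nat, m1 : nat) + Mf ((m - m1)%N, m1 : nat))).
  by apply: sumr_ge0 => i _; rewrite mulr_ge0 ?powR_ge0// addr_ge0.
move=> A rs l u r t A1 sz sum0 [[u0 ur] /andP[r0 r1] /andP[ut tr] [lev1 [j0 lev2]] [osc tay]].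
set a := (fun j : 'I_(m.*2) => cpart (fun x => Pr (rs x)) j) in lev1 lev2 osc tay.
pose s := sig A l; have s0 : 0 < s by apply: sig_gt0.
have sC0 : s%:C%C != 0 :> C by rewrite -nrm_eq0 nrmR normr_eq0 gt_eqF.
pose rr x := map (fun z => z / s%:C%C) (rs (u + r * x)).
have szr x : size (rr x) = m by rewrite size_map sz.
have cmp (j : nat) x : (j < m.*2)%N -> cpart (fun x => Pr (rr x)) j x = cpart (fun x => Pr (rs x)) j (u + r * x) / s ^+ (m - j./2).
  move=> jm; rewrite /cpart Pr_scale//; last by rewrite sz ltnW// ltn_half_double.
  rewrite sz -rmorphXn/= -fmorphV/= mulrC partZ mulrC; by [].
have TTr y : 0 <= y <= 1 -> TT (4 * d) B1 y (fun x => Pr (rr x)).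
  move=> y01; apply: TT_of_comps => //; first by rewrite mulr_ge0.
  by move=> j; have [T [h1 h2 h3]] := tay j y y01; exists T; split => // x x01; rewrite cmp//; exact: h3.
pose t' := (t - u) / r.
have t'E : u + r * t' = t by rewrite /t' mulrC divfK ?gt_eqF// addrC subrK.
have t'01 : 0 <= t' <= 1 by rewrite /t' divr_ge0 ?subr_ge0 ?(ltW r0)//= ler_pdivrMr// mul1r lerBlDl.
have in01 x : 0 <= x <= 1 -> u <= u + r * x <= u + r.
  by move=> /andP[x0 x1]; rewrite lerDl mulr_ge0 ?(ltW r0)//= lerD2l ler_piMr// ltW.
have sw (j : 'I_(m.*2)) : 0 < s ^+ (m - j./2) by rewrite exprn_gt0.
have cosc (j : 'I_(m.*2)) x : 0 <= x <= 1 ->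
    `|cpart (fun x => Pr (rr x)) j x - cpart (fun x => Pr (rr x)) j t'| <= c0.
  move=> x01; rewrite !cmp// t'E -mulrBl normrM normfV (ger0_norm (ltW (sw j))) ler_pdivrMr//.
  exact: (osc j _ (in01 x x01)).
have ct (j : 'I_(m.*2)) : `|cpart (fun x => Pr (rr x)) j t'| <= 1.
  by rewrite cmp// t'E normrM normfV (ger0_norm (ltW (sw j))) ler_pdivrMr// mul1r; exact: lev1.
have c2 (j : 'I_(m.*2)) x : 0 <= x <= 1 -> `|cpart (fun x => Pr (rr x)) j x| <= 2.
  move=> x01; have := cosc j x x01; have := ct j; have := ler_normD (cpart (fun x => Pr (rr x)) j x - cpart (fun x => Pr (rr x)) j t') (cpart (fun x => Pr (rr x)) j t').
  by rewrite subrK; clear -c01; lra.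
have bd x : 0 <= x <= 1 -> {in rr x, forall z, nrm z <= 8}.
  move=> x01 z hz; have -> : 8 = 2 * 4 :> R by rewrite -natrM.
  apply: coef_root_bound hz => // i; rewrite szr => im.
  have i1 : (i.*2 < m.*2)%N by rewrite ltn_double.
  have i2 : (i.*2.+1 < m.*2)%N by rewrite ltn_Sdouble.
  apply: le_trans (cpart_nrm (fun x => Pr (rr x)) i x) _.
  have := c2 (Ordinal i1) x x01; have := c2 (Ordinal i2) x x01 => /= h1 h2.
  apply: (@le_trans _ _ 4); first by clear -h1 h2; lra.
  by rewrite -[leLHS]expr1 ler_weXn2l ?ler1n// subn_gt0.
have near x : 0 <= x <= 1 -> matched (@dC R) (g / 4) (rr t') (rr x).
  move=> x01; apply: Hmatch => //; [exact: bd|exact: bd|].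
  apply: (@le_trans _ _ (m%:R * (2 * c0))).
    apply: dcoef_pn => // i im.
    have i1 : (i.*2 < m.*2)%N by rewrite ltn_double.
    have i2 : (i.*2.+1 < m.*2)%N by rewrite ltn_Sdouble.
    apply: le_trans (nrm_le_ReIm _) _.
    rewrite -[complex.Re _]/(part false _) -[complex.Im _]/(part true _) !partB.
    have := cosc (Ordinal i1) x x01; have := cosc (Ordinal i2) x x01.
    rewrite /cpart /= odd_double doubleK uphalf_double => h1 h2.
    by rewrite distrC [X in _ + X]distrC; clear -h1 h2; lra.
  have : c0 <= del / (2 * m.+1%:R) by rewrite ge_min lexx orbT.
  rewrite ler_pdivlMr ?mulr_gt0// => h; apply: le_trans h.
  rewrite -natr1; clear -c00; lra.
have [] := Hsplit (rr t') (szr t').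
- rewrite big_map -mulr_suml sum0 mul0r//.
- exists (j0./2); first by rewrite ltn_half_double.
  apply: le_trans (cpart_le (fun x => Pr (rr x)) j0 t'); rewrite cmp// t'E normrM normfV (ger0_norm (ltW (sw j0))).
  rewrite ler_pdivlMr//; apply: le_trans (ltW lev2).
  have -> : sig A l.+1 = 16^-1 * s by rewrite /s /sig exprS; ring.
  have h : be <= 16^-1 ^+ (m - j0./2).
    by rewrite /be ler_wiXn2l ?invr_ge0// ?invf_le1 ?ler1n// leq_subr.
  have E : (16^-1 * s) ^+ (m - j0./2) = 16^-1 ^+ (m - j0./2) * s ^+ (m - j0./2) by exact: exprMn.
  by rewrite E (ler_wpM2r (ltW (sw j0)) h).
move=> r1' [r2' [pp sz1 sz2 Hgap]].
pose m1 := size r1'.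
have mE : size r1' + size r2' = m :> nat by rewrite -(szr t') (perm_size pp) size_cat.
have m1m : (m1 < m)%N by rewrite /m1 -mE -[X in (X < _)%N]addn0 ltn_add2l.
(* The clusters at x are read off from a matching with the roots at t', chosen independently for
   each x. *)
have Hpr0 (x : R) : exists p : seq C * seq C, [/\ size p.1 = m1, size p.2 = (m - m1)%N & 0 <= x <= 1 ->
    [/\ perm_eq (rr x) (p.1 ++ p.2), {in p.1, forall z, exists2 w, w \in r1' & nrm (w - z) <= g / 4} &
       {in p.2, forall z, exists2 w, w \in r2' & nrm (w - z) <= g / 4}]].
  have [x01|/negP nx] := boolP (0 <= x <= 1); last first.
    by exists (nseq m1 0, nseq (m - m1) 0); split => //=; rewrite size_nseq.
  have [y1 [y2 [p1 p2 p3]]] := matched_split (matched_perml pp (near x x01)).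
  exists (y1, y2); split => /=; first by rewrite -(all2_size p2).
    by rewrite -(all2_size p3) -/m1 -mE addKn.
  by move=> _; split => // z hz; [exact: (all2_mem p2 hz)|exact: (all2_mem p3 hz)].
have [pr Hpr] := choice Hpr0.
have fac : factored 8 (g / 2) m1 (m - m1) (fun x => (pr x).1) (fun x => (pr x).2) (fun x => Pr (rr x)).
  split => [x x01|x x01|x y x01 y01 z v hz hv|x x01].
  - have [h1 h2 /(_ x01)[h3 _ _]] := Hpr x; split => // z hz; apply: (bd x x01).
    by rewrite (perm_mem h3) mem_cat hz.
  - have [h1 h2 /(_ x01)[h3 _ _]] := Hpr x; split => // z hz; apply: (bd x x01).
    by rewrite (perm_mem h3) mem_cat hz orbT.
  - have [_ _ /(_ x01)[_ /(_ z hz)[w1 w1r n1] _]] := Hpr x; have [_ _ /(_ y01)[_ _ /(_ v hv)[w2 w2r n2]]] := Hpr y.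
    have := Hgap w1 w2 w1r w2r; have := nrm_tri w1 z w2; have := nrm_tri z v w2; rewrite nrmB in n2; clear -n1 n2; lra.
  - by have [_ _ /(_ x01)[h3 _ _]] := Hpr x; rewrite -Pr_cat; exact: Pr_perm.
have F1 y : 0 <= y <= 1 -> TT (4 * d) (Bf m1) y (fun x => Pr (pr x).1) by move=> y01; case: (HBf m1 y _ _ _ y01 fac (TTr y y01)).
have F2 y : 0 <= y <= 1 -> TT (4 * d) (Bf m1) y (fun x => Pr (pr x).2) by move=> y01; case: (HBf m1 y _ _ _ y01 fac (TTr y y01)).
have R1 : Rbound q (rdist (fun x => (pr x).1)) 0 1 (Mf (m1, m1)).
  by case: (HMf (m1, m1)) => _ /=; apply => // x; case: (Hpr x).
have R2 : Rbound q (rdist (fun x => (pr x).2)) 0 1 (Mf ((m - m1)%N, m1)).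
  case: (HMf ((m - m1)%N, m1)) => _ /=; apply => //; last by move=> x; case: (Hpr x).
  by rewrite /m1 -mE addKn -[X in (X < _)%N]add0n ltn_add2r.
have RR : Rbound q (rdist rr) 0 1 (2 `^ q * (Mf (m1, m1) + Mf ((m - m1)%N, m1))).
  apply: (Rbound_add q1 _ _ _ _ R1 R2) => [x y|x y|x y|x y x01 y01]; rewrite ?bdist_ge0//.
  have [h1 h2 /(_ x01)[h3 _ _]] := Hpr x; have [k1 k2 /(_ y01)[k3 _ _]] := Hpr y.
  by rewrite /rdist (bdist_perm _ h3 k3); apply: bdist_cat; rewrite ?h1 ?h2.
apply: Rbound_mono (Rbound_rescale q1 (D' := rdist rr) _ _ r0 (ltW s0) _ RR).
- rewrite ler_wpM2l ?mulr_ge0 ?powR_ge0//.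
  rewrite (bigD1 (Ordinal m1m))//= lerDl; apply: sumr_ge0 => i _; by rewrite mulr_ge0 ?powR_ge0// addr_ge0.
- by move=> x y; exact: bdist_ge0.
- by move=> x y; exact: bdist_ge0.
- move=> x y x01 y01; rewrite /rdist.
  have E z : rs (u + r * z) = map (fun v => s%:C%C * v) (rr z).
    by rewrite /rr -map_comp -[LHS]map_id; apply: eq_map => v /=; rewrite mulrC divfK.
  rewrite !E -[leRHS]addr0; apply: bdist_map => //; rewrite ?szr ?(ltW s0)// => v w _ _.
  by rewrite addr0 /dC -mulrBr nrmM nrmR ger0_norm// ltW.
Qed.
End CellRoots.

(** * Riesz bounds for root curves *)

Section RootsRbound.
Variables (R : realType) (d : nat) (q : R).
Hypothesis d0 : (0 < d)%N.
Hypothesis q1 : 1 <= q.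
Hypothesis qd : q * ((4 * d)%:R - 1) < (4 * d)%:R.
Notation C := (R[i]).
Notation nrm := (@ComplexField.Normc.normc R).

Lemma rsum_small (e : R) x s : 0 < e -> exists2 del, 0 < del & forall del', 0 <= del' <= del ->
  rsum q (fun _ _ => del') x s <= e.
Proof.
move=> e0; have q0 : 0 < q := lt_le_trans ltr01 q1.
pose S := rsum q (fun _ _ => 1) x s.
have S0 : 0 <= S by exact: rsum_ge0.
have h0 : 0 < e / (S + 1) by rewrite divr_gt0// ltr_wpDl.
exists ((e / (S + 1)) `^ q^-1); first by rewrite powR_gt0.
move=> del' /andP[d'0 d'1].
have -> : rsum q (fun _ _ => del') x s = del' `^ q * S.
  rewrite /S; elim: s x {S S0 h0 d'1} => [|y s IH] x /=; first by rewrite mulr0.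
  by rewrite IH mulrDr /rz powR1 mul1r.
have h1 : del' `^ q <= e / (S + 1).
  have -> : e / (S + 1) = ((e / (S + 1)) `^ q^-1) `^ q by rewrite -powRrM mulVf ?gt_eqF// powRr1// ltW.
  by rewrite ge0_ler_powR ?nnegrE ?powR_ge0// ltW.
apply: le_trans (ler_wpM2r S0 h1) _; rewrite mulrAC ler_pdivrMr ?ltr_wpDl// ler_wpM2l ?(ltW e0)//; lra.
Qed.

(** For a fixed partition a small enough constant distance [del] contributes at most 1 to the Riesz
    sum, and M does not depend on [del]. *)
Lemma Rbound_approx D M : (forall x y, 0 <= D x y) ->
  (forall del : R, 0 < del -> exists2 D', (forall x y, 0 <= D' x y) /\
     (forall x y, 0 <= x <= 1 -> 0 <= y <= 1 -> D x y <= D' x y + del) & Rbound q D' 0 1 M) ->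
  Rbound q D 0 1 (2 `^ q * (M + 1)).
Proof.
move=> D0 H x s ps x0 ls; have [del del0 Hd] := rsum_small x s ltr01.
have [D' [D'0 D'1] HD'] := H del del0.
apply: le_trans (rsum_add q1 (D1 := D') (D2 := fun _ _ => del) _ _ _ _ ps) _ => //.
- by move=> _ _; exact: ltW.
- move=> y z /andP[y1 y2] /andP[z1 z2]; apply: D'1.
    by rewrite (le_trans x0)//= (le_trans y2).
  by rewrite (le_trans x0)//= (le_trans z2).
- rewrite ler_wpM2l ?powR_ge0// lerD ?HD'//.
  by apply: Hd; rewrite lexx ltW.
Qed.

(** The hypothesis on q enters here. It gives 4 d (q - 1) < q, so the term sig(l)^q r^(1 - q) of a
    cell of least length, multiplied by the number 2^l of cells, is at most a multiple of 2^(l - 4 l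
    q + l q), which is at most 2^(- l). *)
Lemma powR_cell (A rr0 r : R) l : 0 < A -> 0 < rr0 -> rr0 * 16^-1 ^+ (l * d) <= r ->
  2 ^+ l * (sig A l `^ q * (rr0 * 16^-1 ^+ (l * d)) `^ (1 - q)) <= A `^ q * rr0 `^ (1 - q) * 2^-1 ^+ l /\
  r `^ (1 - q) <= (rr0 * 16^-1 ^+ (l * d)) `^ (1 - q).
Proof.
move=> A0 r0 hr; have g0 : 0 < rr0 * 16^-1 ^+ (l * d) by rewrite mulr_gt0// exprn_gt0.
split; last first.
  have -> : 1 - q = - (q - 1) by rewrite opprB.
  rewrite !powRN lef_pV2 ?posrE ?powR_gt0//; last exact: lt_le_trans hr.
  rewrite ge0_ler_powR ?nnegrE ?subr_ge0// ?(ltW g0)//; apply: ltW; exact: lt_le_trans hr.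
have p16 k : (16^-1 ^+ k : R) = 2 `^ (- (4 * k%:R)).
  rewrite exprVn powRN; have -> : 16 = 2 ^+ 4 :> R by ring.
  by rewrite -exprM -natrM powR_mulrn.
have p2 : (2 ^+ l : R) = 2 `^ l%:R by rewrite powR_mulrn.
have ph : (2^-1 ^+ l : R) = 2 `^ (- l%:R) by rewrite exprVn p2 powRN.
rewrite /sig !powRM ?exprn_ge0 ?(ltW A0) ?(ltW r0)// !p16 -!powRrM.
have -> : 2 ^+ l * (A `^ q * 2 `^ (- (4 * l%:R) * q) * (rr0 `^ (1 - q) * 2 `^ (- (4 * (l * d)%:R) * (1 - q))))
 = A `^ q * rr0 `^ (1 - q) * (2 `^ l%:R * 2 `^ (- (4 * l%:R) * q) * 2 `^ (- (4 * (l * d)%:R) * (1 - q))).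
  by rewrite p2; ring.
rewrite ler_wpM2l ?mulr_ge0 ?powR_ge0// ph -!powRD ?pnatr_eq0 ?implybT//.
rewrite ler_powR ?ler1n// natrM.
have := qd; rewrite natrM => qd'; have l0 : 0 <= l%:R :> R by [].
have : l%:R * (4 * d%:R * (q - 1)) <= l%:R * q by rewrite ler_wpM2l//; lra.
have : l%:R <= l%:R * q by rewrite ler_peMr.
lra.
Qed.

Lemma sig_small (A del : R) : 1 <= A -> 0 < del -> exists l, sig A l <= del.
Proof.
move=> A1 del0; have A0 : 0 < A := lt_le_trans ltr01 A1.
have [n Hn] := half_small (divr_gt0 del0 A0); exists n.
rewrite /sig mulrC -ler_pdivlMr//; apply: le_trans Hn.
by rewrite lerXn2r ?nnegrE ?invr_ge0// lef_pV2 ?posrE// ler_nat.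
Qed.

Theorem centered_Rbound m A : (0 < m <= d)%N -> IHroots d q m -> 1 <= A ->
  exists2 M, 0 <= M & forall rs : R -> seq C,
  (forall x, size (rs x) = m) -> (forall x, \sum_(z <- rs x) z = 0) ->
  (forall t, 0 <= t <= 1 -> TT (4 * d) A t (fun x => Pr (rs x))) -> Rbound q (rdist rs) 0 1 M.
Proof.
move=> /andP[m0 md] IH A1; have A0 : 0 < A := lt_le_trans ltr01 A1.
pose w (j : 'I_(m.*2)) := (m - j./2)%N.
have wd j : (0 < w j <= d)%N by rewrite /w subn_gt0 ltn_half_double ltn_ord (leq_trans (leq_subr _ _)).
have [CI C1 Hcell] := cell_lemma d0 wd q1.
have [c0 c01 [M2 M20 HM2]] := cell_roots q1 md C1 IH.
have [Cn [rr0 [Cn0 rr00 H]]] := Hcell A c0 A1 c01.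
pose M3 := Cn * (A `^ q * rr0 `^ (1 - q) * M2 * 2).
have M30 : 0 <= M3 by rewrite !mulr_ge0 ?powR_ge0.
exists (2 `^ q * (M3 + 1)); first by rewrite mulr_ge0 ?powR_ge0// addr_ge0.
move=> rs sz sum0 HT; apply: Rbound_approx; first by move=> x y; exact: bdist_ge0.
move=> del del0; have d32 : 0 < del / 32 by rewrite divr_gt0.
(* Below level [lm] all roots are at most 8 del / 32, so two such root lists are at distance at most
   del / 2. *)
have [lm Hlm] := sig_small A1 d32.
pose a (j : 'I_(m.*2)) := cpart (fun x => Pr (rs x)) j.
pose S : set R := Btyp A a w lm; pose I : set R := [set x | 0 <= x <= 1].
have s0 := sig_gt0 A1 lm.
have Sbd x : S x -> {in rs x, forall z, nrm z <= 8 * sig A lm}.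
  move=> [x01 Hx] z hz; have -> : 8 * sig A lm = 2 * (4 * sig A lm) by lra.
  apply: coef_root_bound hz => [|i]; [by rewrite mulr_ge0 ?(ltW s0)|rewrite sz => im].
  have i1 : (i.*2 < m.*2)%N by rewrite ltn_double.
  have i2 : (i.*2.+1 < m.*2)%N by rewrite ltn_Sdouble.
  apply: le_trans (cpart_nrm (fun x => Pr (rs x)) i x) _.
  have := Hx (Ordinal i1); have := Hx (Ordinal i2); rewrite /w /= doubleK uphalf_double => h1 h2.
  apply: (@le_trans _ _ (4 * sig A lm ^+ (m - i))); first by rewrite /a/= in h1 h2; lra.
  by rewrite (exprMn _ 4) ler_wpM2r ?exprn_ge0 ?(ltW s0)// -[leLHS]expr1 ler_weXn2l ?ler1n ?subn_gt0.
have Dxx x : I x -> rdist rs x x = 0.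
  move=> _; apply/eqP; rewrite eq_le bdist_ge0 andbT; apply: bdist_le => //.
  exists (rs x) => //; elim: (rs x) => //= z r ->; by rewrite /dC subrr nrm0 lexx.
have Dsym x y : rdist rs x y = rdist rs y x by apply: bdist_sym; exact: dC_sym.
have Dtri x y z : rdist rs x z <= rdist rs x y + rdist rs y z.
  by apply: bdist_trans; rewrite ?sz//; exact: dC_tri.
have Dge x y : 0 <= rdist rs x y by exact: bdist_ge0.
have Sdel x y : S x -> S y -> rdist rs x y <= del / 2.
  move=> Sx Sy; have hx := Sbd x Sx; have hy := Sbd y Sy.
  apply: bdist_le; first by rewrite divr_ge0// ltW.
  exists (rs y) => //; have : size (rs x) = size (rs y) by rewrite !sz.
  elim: (rs x) (rs y) hx hy => [|z r IHr] [|v r'] //= hx hy [sr].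
  have hx' : {in r, forall z, nrm z <= 8 * sig A lm} by move=> u hu; apply: hx; rewrite in_cons hu orbT.
  have hy' : {in r', forall z, nrm z <= 8 * sig A lm} by move=> u hu; apply: hy; rewrite in_cons hu orbT.
  rewrite (IHr r' hx' hy' sr) andbT /dC (le_trans (nrmD _ _))// nrmN.
    by have := hx z (mem_head _ _); have := hy v (mem_head _ _); lra.
have SI : S `<=` I by move=> x [].
have d2 : 0 < del / 2 by rewrite divr_gt0.
have DT x y z : I x -> I y -> I z -> rdist rs x z <= rdist rs x y + rdist rs y z by move=> _ _ _.
(* Collapsing the points below level [lm] costs at most 2 (del / 2). It stops the decomposition at
   level [lm], and the resulting bound is independent of [lm]. *)
exists (collapse (rdist rs) S); first split.
- by move=> x y; exact: collapse_ge0.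
- move=> x y hx hy; have := le_collapse Dge Dsym DT SI Sdel d2 hx hy; lra.
pose W l := sig A l `^ q * (rr0 * 16^-1 ^+ (l * d)) `^ (1 - q) * M2.
have W0 l : 0 <= W l by rewrite !mulr_ge0 ?powR_ge0.
apply: Rbound_mono (H a lm (collapse (rdist rs) S) W _ _ _ W0 _ _).
- rewrite ler_wpM2l//; apply: (@le_trans _ _ (\sum_(l < lm) A `^ q * rr0 `^ (1 - q) * M2 * 2^-1 ^+ l)).
    apply: ler_sum => l _; have [h _] := powR_cell A0 rr00 (lexx (rr0 * 16^-1 ^+ (l * d))).
    by rewrite /W mulrA [leRHS]mulrAC ler_wpM2r.
  rewrite -mulr_sumr ler_wpM2l ?mulr_ge0 ?powR_ge0//.
  suff : \sum_(l < lm) 2^-1 ^+ l = 2 - 2 * 2^-1 ^+ lm :> R by move=> ->; rewrite lerBlDr lerDl mulr_ge0// exprn_ge0// invr_ge0.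
  elim: lm {Hlm S s0 Sbd Sdel SI} => [|n IHn]; first by rewrite big_ord0 expr0; lra.
  by rewrite big_ord_recr/= IHn exprS; field.
- by move=> j t t01; apply: TT_cpart => //; exact: HT.
- by move=> x y; exact: collapse_ge0.
- move=> x y z; rewrite !in_itv/= => hx hy hz; exact: (collapse_tri Dge Dsym DT SI).
- move=> x y Sx Sy; exact: (collapse_S Dge Dxx Dsym SI Sx Sy).
move=> l u r t ll hr cell.
have [_ h] := powR_cell A0 rr00 hr.
apply: Rbound_le (Rbound_mono _ (HM2 A rs l u r t A1 sz sum0 cell)) => //.
- by move=> x y; exact: collapse_ge0.
- by move=> x y _ _; exact: collapse_le.
- by rewrite /W ler_wpM2r// ler_wpM2l// powR_ge0.
Qed.

(** The mean of the roots is, up to a constant factor, a coefficient of the polynomial, hence as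
    regular as the polynomial and Lipschitz. Subtracting it reduces to centred lists, which
    [split_roots] can separate into strictly smaller ones. *)
Theorem roots_Rbound m A : (m <= d)%N -> exists2 M, 0 <= M & forall rs : R -> seq C,
  (forall x, size (rs x) = m) ->
  (forall t, 0 <= t <= 1 -> TT (4 * d) A t (fun x => Pr (rs x))) -> Rbound q (rdist rs) 0 1 M.
Proof.
elim/ltn_ind: m A => m IH A md.
have [->|m0] := posnP m.
  exists 0 => // rs sz _.
  have HL : Rbound q (fun x y => 0 * `|x - y|) 0 1 (0 `^ q * (1 - 0)) by exact: Rbound_lip.
  rewrite powR0 ?mul0r ?gt_eqF ?(lt_le_trans ltr01)// in HL.
  apply: (Rbound_le q1 _ _ HL) => [x y|x y _ _]; first exact: bdist_ge0.
  rewrite mul0r; apply: bdist_le => //; exists (rs y) => //.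
  by rewrite (size0nil (sz x)) (size0nil (sz y)).
have IHm : IHroots d q m.
  by move=> m' A' m'm; apply: IH => //; apply: leq_trans md; exact: ltnW.
have [A0|A0] := ltP A 0.
  exists 0 => // rs sz HT; have /TT_ge0 := HT 0 (introT andP (conj (lexx 0) ler01)).
  by rewrite leNgt A0.
have mC : (m%:R : C) != 0 by rewrite pnatr_eq0 -lt0n.
pose c0 := nrm (m%:R^-1 : C).
have [E HE] := TT_compX (4 * d) A (c0 * A) m.+1.
have A'1 : 1 <= 1 + `|E| by rewrite lerDl.
have m0d : (0 < m <= d)%N by rewrite m0.
have [M M0 HM] := centered_Rbound m0d IHm A'1.
exists (2 `^ q * (M + (c0 * A) `^ q * (1 - 0))).
  by rewrite mulr_ge0 ?powR_ge0// addr_ge0// mulr_ge0 ?powR_ge0 ?subr0.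
move=> rs sz HT.
pose c x := m%:R^-1 * \sum_(z <- rs x) z.
have Hc t : 0 <= t <= 1 -> TT (4 * d) (c0 * A) t (fun x => (c x)%:P).
  move=> t01; have := TT_scale (- m%:R^-1) (TT_coef m.-1 (HT t t01)); rewrite nrmN -/c0.
  congr (TT _ _ _ _); apply/funext => x; rewrite /c /Pr -mul_polyC -polyCM; congr (_%:P).
  by rewrite -{2}(sz x) coefPn_prod_XsubC ?sz -?lt0n ?mulrNN.
pose rs' x := map (fun z => z - c x) (rs x).
have sz' x : size (rs' x) = m by rewrite size_map.
have R1 : Rbound q (rdist rs') 0 1 M.
  apply: HM => // [x|t t01].
    by rewrite big_map sumrB big_const_seq count_predT sz iter_addr_0 /c -[X in _ - X]mulr_natl mulrA mulfV// mul1r subrr.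

  apply: (@TT_mono _ _ E); first by rewrite (le_trans (ler_norm _))// lerDr.
  have := HE t (fun x => Pr (rs x)) c t01 _ (HT t t01) (Hc t t01).
  rewrite (_ : (fun x => Pr (rs x) \Po ('X + (c x)%:P)) = (fun x => Pr (rs' x))); last by apply/funext => x; rewrite Pr_shift.
  by apply => x; rewrite size_Pr sz.
have cA0 : 0 <= c0 * A by rewrite mulr_ge0 ?nrm_ge0.
have RL : Rbound q (fun x y => c0 * A * `|x - y|) 0 1 ((c0 * A) `^ q * (1 - 0)) by exact: Rbound_lip.
apply: (Rbound_add q1 _ _ _ _ R1 RL) => [x y|x y|x y|x y x01 y01];
  [exact: bdist_ge0|exact: bdist_ge0|exact: mulr_ge0|].
have Ers z : rs z = map (fun v => v + c z) (rs' z).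
  by rewrite /rs' -map_comp -[LHS]map_id; apply: eq_map => v /=; rewrite subrK.
rewrite /rdist [rs x]Ers [rs y]Ers -[bdist _ (rs' x) _]mul1r.
apply: bdist_map => [|//||v u _ _]; [by rewrite !sz'|exact: mulr_ge0|].
rewrite mul1r /dC; have -> : v + c x - (u + c y) = (v - u) + (c x - c y) by ring.
rewrite (le_trans (nrmD _ _))// lerD2l -pnC polyCB.
have := Hc y y01; case: (4 * d)%N (muln_gt0 4 d) => [|s _ HTs]; first by rewrite d0.
exact: (TT_lip HTs x01).
Qed.
End RootsRbound.
(** * Projective geometry *)

Section HermitianNorm.
Variables (R : realType) (m : nat).
Notation C := (R[i]).
Notation nrm := (@ComplexField.Normc.normc R).
Notation vec := ('rV[C]_(m.+1)).
Implicit Types u v w : vec.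

Lemma sum_RtoC (I : Type) (r : seq I) (F : I -> R) : (\sum_(i <- r) F i)%:C%C = \sum_(i <- r) (F i)%:C%C :> C.
Proof. by rewrite rmorph_sum. Qed.

Lemma mul_conjC (z : C) : z^* * z = (nrm z ^+ 2)%:C%C.
Proof. by rewrite mulrC -normCK nrmC rmorphXn. Qed.

Lemma nrm_conj (z : C) : nrm z^* = nrm z.
Proof. by apply: (@complexI R); rewrite -!nrmC norm_conjC. Qed.

Lemma cinner_self u : cinner u u = (\sum_j nrm (u 0 j) ^+ 2)%:C%C.
Proof. by rewrite /cinner sum_RtoC; apply: eq_bigr => j _; rewrite mul_conjC. Qed.

Lemma cnorm_ge0 u : 0 <= cnorm u. Proof. exact: sqrtr_ge0. Qed.

Lemma cnorm_sqr u : cnorm u ^+ 2 = \sum_j nrm (u 0 j) ^+ 2.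
Proof. by rewrite /cnorm cinner_self sqr_sqrtr// sumr_ge0// => j _; rewrite sqr_ge0. Qed.

Lemma cinner_cnorm u : cinner u u = (cnorm u ^+ 2)%:C%C.
Proof. by rewrite cnorm_sqr cinner_self. Qed.

Lemma nrm_le_cnorm u j : nrm (u 0 j) <= cnorm u.
Proof.
rewrite -(@ler_pXn2r _ 2)// ?nnegrE ?nrm_ge0 ?cnorm_ge0// cnorm_sqr (bigD1 j)//= lerDl.
by rewrite sumr_ge0// => i _; rewrite sqr_ge0.
Qed.

Lemma cnorm_le_sum u : cnorm u <= \sum_j nrm (u 0 j).
Proof.
have S0 : 0 <= \sum_j nrm (u 0 j) by rewrite sumr_ge0// => j _; exact: nrm_ge0.
rewrite -(@ler_pXn2r _ 2)// ?nnegrE ?cnorm_ge0// cnorm_sqr expr2 mulr_suml.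
apply: ler_sum => j _; rewrite expr2 ler_wpM2l ?nrm_ge0// (bigD1 j)//= lerDl.
by rewrite sumr_ge0// => i _; exact: nrm_ge0.
Qed.

Lemma cnorm_eq0 u : (cnorm u == 0) = (u == 0).
Proof.
apply/eqP/eqP => [H|->].
  apply/matrixP => i j; rewrite (ord1 i) mxE; apply/eqP; rewrite -nrm_eq0 eq_le nrm_ge0 andbT -H.
  exact: nrm_le_cnorm.
by apply/eqP; rewrite eq_le cnorm_ge0 andbT (le_trans (cnorm_le_sum _))// big1// => j _; rewrite mxE nrm0.
Qed.

Lemma cnorm_gt0 u : (0 < cnorm u) = (u != 0).
Proof. by rewrite lt0r cnorm_eq0 cnorm_ge0 andbT. Qed.

Lemma cinnerZl (c : C) u v : cinner (c *: u) v = c^* * cinner u v.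
Proof. by rewrite /cinner mulr_sumr; apply: eq_bigr => j _; rewrite mxE rmorphM mulrA. Qed.

Lemma cinnerZr (c : C) u v : cinner u (c *: v) = c * cinner u v.
Proof. by rewrite /cinner mulr_sumr; apply: eq_bigr => j _; rewrite mxE mulrCA. Qed.

Lemma cinnerDl u v w : cinner (u + v) w = cinner u w + cinner v w.
Proof. by rewrite /cinner -big_split; apply: eq_bigr => j _; rewrite mxE rmorphD mulrDl. Qed.

Lemma cinnerDr u v w : cinner w (u + v) = cinner w u + cinner w v.
Proof. by rewrite /cinner -big_split; apply: eq_bigr => j _; rewrite mxE mulrDr. Qed.

Lemma cinnerC u v : cinner u v = (cinner v u)^*.
Proof. by rewrite /cinner rmorph_sum; apply: eq_bigr => j _; by rewrite rmorphM [RHS]mulrC; congr (_ * _); exact: esym (conjCK _). Qed.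

Lemma cnormZ (c : C) u : cnorm (c *: u) = nrm c * cnorm u.
Proof.
apply/eqP; rewrite -(@eqrXn2 _ 2)// ?mulr_ge0 ?nrm_ge0 ?cnorm_ge0//; apply/eqP.
rewrite exprMn !cnorm_sqr mulr_sumr; apply: eq_bigr => j _; by rewrite mxE nrmM exprMn.
Qed.

Lemma cnormN u : cnorm (- u) = cnorm u.
Proof. by rewrite -scaleN1r cnormZ nrmN nrm1 mul1r. Qed.

Lemma cnormB u v : cnorm (u - v) = cnorm (v - u).
Proof. by rewrite -cnormN opprB. Qed.

(* Entries of the orthogonal projection onto the line of [u]; they embed CP^m into the Hermitian matrices. *)
Definition pm u (i j : 'I_m.+1) : C := u 0 i * (u 0 j)^* / (cnorm u ^+ 2)%:C%C.

Lemma pmZ (c : C) u i j : c != 0 -> pm (c *: u) i j = pm u i j.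
Proof.
move=> c0; rewrite /pm cnormZ !mxE rmorphM exprMn rmorphM/= -mul_conjC.
have [->|u0] := eqVneq u 0; first by rewrite !mxE !(mul0r, mulr0).
have n0 : (cnorm u ^+ 2)%:C%C != 0 :> C by rewrite -nrm_eq0 nrmR normr_eq0 expf_neq0// cnorm_eq0.
have c1 : c^* != 0 by rewrite conjC_eq0.
by rewrite mulrACA [c * c^*]mulrC -mulf_div divff ?mul1r// mulf_neq0.
Qed.

Lemma pm_unit u i j : cnorm u = 1 -> pm u i j = u 0 i * (u 0 j)^*.
Proof. by move=> u1; rewrite /pm u1 expr1n divr1. Qed.

Lemma pm_frob1 u v : cnorm u = 1 -> cnorm v = 1 ->
  \sum_i \sum_j nrm (pm u i j - pm v i j) ^+ 2 = 2 - 2 * nrm (cinner u v) ^+ 2.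
Proof.
move=> u1 v1; apply: (@complexI R); rewrite sum_RtoC.
have -> : (2 - 2 * nrm (cinner u v) ^+ 2)%:C%C = cinner u u * cinner u u + cinner v v * cinner v v
    - cinner u v * cinner v u - cinner v u * cinner u v.
  rewrite (cinnerC v u) [cinner u v * _]mulrC mul_conjC !cinner_cnorm u1 v1 expr1n mulr1.
  by rewrite -rmorphD -!rmorphB; congr (_%:C%C); ring.
rewrite /cinner !big_distrlr -big_split -!sumrB/=.
apply: eq_bigr => i _; rewrite sum_RtoC -big_split -!sumrB/=; apply: eq_bigr => j _.
rewrite -mul_conjC !pm_unit// rmorphB !rmorphM/=.
have -> : (u 0 j)^*^* = u 0 j by exact: conjCK.
have -> : (v 0 j)^*^* = v 0 j by exact: conjCK.
ring.
Qed.

Definition unitv u : vec := (cnorm u)^-1%:C%C *: u.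

Lemma cnorm_unitv u : u != 0 -> cnorm (unitv u) = 1.
Proof.
by move=> u0; rewrite cnormZ nrmR ger0_norm ?invr_ge0 ?cnorm_ge0// mulVf// cnorm_eq0.
Qed.

Lemma pm_unitv u i j : u != 0 -> pm (unitv u) i j = pm u i j.
Proof. by move=> u0; rewrite pmZ// -nrm_eq0 nrmR normr_eq0 invr_eq0 cnorm_eq0. Qed.

Lemma cinner_unitv u v : nrm (cinner (unitv u) (unitv v)) = nrm (cinner u v) / (cnorm u * cnorm v).
Proof.
rewrite cinnerZl cinnerZr !nrmM nrm_conj !nrmR !ger0_norm ?invr_ge0 ?cnorm_ge0// invfM.
by rewrite mulrA mulrC.
Qed.

Lemma pm_frob u v : u != 0 -> v != 0 ->
  \sum_i \sum_j nrm (pm u i j - pm v i j) ^+ 2 = 2 - 2 * (nrm (cinner u v) / (cnorm u * cnorm v)) ^+ 2.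
Proof.
move=> u0 v0; rewrite -cinner_unitv -pm_frob1 ?cnorm_unitv//.
by apply: eq_bigr => i _; apply: eq_bigr => j _; rewrite !pm_unitv.
Qed.

(** The squared Frobenius distance of the two projections is 2 - 2 cos^2; its nonnegativity is the
    Cauchy-Schwarz inequality. *)
Lemma cos_angle_le1 u v : 0 <= nrm (cinner u v) / (cnorm u * cnorm v) <= 1.
Proof.
rewrite divr_ge0 ?nrm_ge0 ?mulr_ge0 ?cnorm_ge0//=.
have [->|u0] := eqVneq u 0; first by rewrite (eqP (introT eqP _ : cnorm 0 == 0)) ?mul0r ?invr0 ?mulr0//; apply/eqP; rewrite cnorm_eq0.
have [->|v0] := eqVneq v 0; first by rewrite (eqP (introT eqP _ : cnorm 0 == 0)) ?mulr0 ?invr0 ?mulr0//; apply/eqP; rewrite cnorm_eq0.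
have : 0 <= \sum_i \sum_j nrm (pm u i j - pm v i j) ^+ 2.
  by rewrite sumr_ge0// => i _; rewrite sumr_ge0// => j _; rewrite sqr_ge0.
rewrite pm_frob// => h.
rewrite -(@ler_pXn2r _ 2)// ?nnegrE ?divr_ge0 ?nrm_ge0 ?mulr_ge0 ?cnorm_ge0// expr1n; lra.
Qed.

Lemma cauchy_schwarz u v : nrm (cinner u v) <= cnorm u * cnorm v.
Proof.
have [->|u0] := eqVneq u 0; first by rewrite /cinner big1 ?nrm0 ?mulr_ge0 ?cnorm_ge0// => j _; rewrite mxE conjC0 mul0r.
have [->|v0] := eqVneq v 0; first by rewrite /cinner big1 ?nrm0 ?mulr_ge0 ?cnorm_ge0// => j _; rewrite mxE mulr0.
have /andP[_] := cos_angle_le1 u v; by rewrite ler_pdivrMr ?mul1r// mulr_gt0 ?cnorm_gt0.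
Qed.

Lemma cnormD u v : cnorm (u + v) <= cnorm u + cnorm v.
Proof.
rewrite -(@ler_pXn2r _ 2)// ?nnegrE ?addr_ge0 ?cnorm_ge0//.
have E w : cnorm w ^+ 2 = complex.Re (cinner w w) by rewrite cinner_cnorm.
have ReD (a b : C) : complex.Re (a + b) = complex.Re a + complex.Re b by case: a b => ? ? [].
rewrite sqrrD !E cinnerDl !cinnerDr !ReD.
have h1 := le_trans (le_trans (ler_norm _) (nrm_Re (cinner u v))) (cauchy_schwarz u v).
have h2 := le_trans (le_trans (ler_norm _) (nrm_Re (cinner v u))) (cauchy_schwarz v u).
by rewrite -mulr_natr; lra.
Qed.

Lemma cnorm_tri u v w : cnorm (u - w) <= cnorm (u - v) + cnorm (v - w).
Proof. by rewrite (le_trans _ (cnormD _ _))// addrA subrK. Qed.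

Lemma cnorm0 : cnorm (0 : vec) = 0.
Proof. by apply/eqP; rewrite cnorm_eq0. Qed.

Lemma unitv_lip u v : u != 0 -> v != 0 -> cnorm (unitv u - unitv v) <= 2 * cnorm (u - v) / cnorm u.
Proof.
move=> u0 v0; have nu : 0 < cnorm u by rewrite cnorm_gt0.
have nv : 0 < cnorm v by rewrite cnorm_gt0.
have -> : unitv u - unitv v = (cnorm u)^-1%:C%C *: (u - v) + ((cnorm u)^-1 - (cnorm v)^-1)%:C%C *: v.
  by rewrite /unitv rmorphB scalerBr scalerBl; rewrite addrA subrK.
apply: le_trans (cnormD _ _) _; rewrite !cnormZ !nrmR ger0_norm ?invr_ge0 ?cnorm_ge0//.
have : `|(cnorm u)^-1 - (cnorm v)^-1| * cnorm v <= cnorm (u - v) / cnorm u.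
  have -> : (cnorm u)^-1 - (cnorm v)^-1 = (cnorm v - cnorm u) / (cnorm u * cnorm v).
    by field; rewrite !gt_eqF.
  rewrite normrM normfV [`|cnorm u * _|]ger0_norm ?mulr_ge0 ?cnorm_ge0// invfM mulrA mulfVK ?gt_eqF//.
  rewrite ler_wpM2r ?invr_ge0 ?cnorm_ge0// ler_norml.
  have := cnormD (u - v) v; have := cnormD (v - u) u; rewrite !subrK [cnorm (v - u)]cnormB; lra.
have -> : 2 * cnorm (u - v) / cnorm u = (cnorm u)^-1 * cnorm (u - v) + cnorm (u - v) / cnorm u.
  by field; rewrite gt_eqF.
lra.
Qed.

Lemma pm_lip u v i j : u != 0 -> v != 0 -> nrm (pm u i j - pm v i j) <= 4 * cnorm (u - v) / cnorm u.
Proof.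
move=> u0 v0; rewrite -pm_unitv// -[pm v _ _]pm_unitv// !pm_unit ?cnorm_unitv//.
set a := unitv u; set b := unitv v.
have -> : a 0 i * (a 0 j)^* - b 0 i * (b 0 j)^* = (a - b) 0 i * (a 0 j)^* + b 0 i * ((a - b) 0 j)^*.
  by rewrite !mxE rmorphB; ring.
rewrite (le_trans (nrmD _ _))// !nrmM !nrm_conj.
have h := unitv_lip u0 v0; rewrite -/a -/b in h.
have h1 : nrm ((a - b) 0 i) * nrm (a 0 j) <= cnorm (a - b) * 1.
  by rewrite ler_pM ?nrm_ge0 ?nrm_le_cnorm// -(cnorm_unitv u0) nrm_le_cnorm.
have h2 : nrm (b 0 i) * nrm ((a - b) 0 j) <= 1 * cnorm (a - b).
  by rewrite ler_pM ?nrm_ge0 ?nrm_le_cnorm// -(cnorm_unitv v0) nrm_le_cnorm.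
lra.
Qed.
End HermitianNorm.

Section Sine.
Variable R : realType.

Lemma sin_le (x : R) : 0 <= x -> sin x <= x.
Proof.
rewrite le_eqVlt => /orP[/eqP <-|x0]; first by rewrite sin0.
have [c _ H] := @MVT R sin cos 0 x x0 (fun y _ => is_derive_sin y) (continuous_subspaceT (@continuous_sin R)).
move: H; rewrite sin0 !subr0 => ->; by rewrite ler_piMl ?(ltW x0)// cos_le1.
Qed.

(** Where cos x >= 1/2 the mean value theorem applies; elsewhere sin x >= 1/2, while x <= pi / 2 <=
    2. *)
Lemma sin_ge (x : R) : 0 <= x <= pi / 2 -> x <= 4 * sin x.
Proof.
move=> /andP[]; rewrite le_eqVlt => /orP[/eqP <- _|x0 xp]; first by rewrite sin0 mulr0.
have [h|h] := lerP (1/2) (cos x).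
  have [c] := @MVT R sin cos 0 x x0 (fun y _ => is_derive_sin y) (continuous_subspaceT (@continuous_sin R)).
  rewrite in_itv/= => /andP[c0 cx]; rewrite sin0 !subr0 => ->.
  have : cos x <= cos c.
    rewrite leNgt; apply/negP => hc; move: hc; rewrite ltr_cos ?in_itv/=; last 2 first.
      by have := pi_gt0 R; lra.
      by have := pi_gt0 R; lra.
    by lra.
  move=> h1; have : 1/2 * x <= cos c * x by rewrite ler_wpM2r ?(ltW x0)//; lra.
  lra.
have s0 : 0 <= sin x by apply: sin_ge0_pi; rewrite (ltW x0)/=; have := pi_gt0 R; lra.
have c0 : 0 <= cos x by apply: cos_ge0_pihalf; apply/andP; split; have := pi_gt0 R; lra.
have h1 : cos x ^+ 2 <= (1/2)^+2 by rewrite lerXn2r ?nnegrE//; lra.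
have := cos2Dsin2 x => h2.
have h3 : (1/2) ^+ 2 <= sin x ^+ 2 by rewrite [X in X <= _]expr2 in h1 *; lra.
have : 1/2 <= sin x by rewrite -(@ler_pXn2r _ 2)// ?nnegrE//; lra.
have := pihalf_02 R; lra.
Qed.
End Sine.

(** * Points of projective space *)

Section Points.
Variables (R : realType) (m : nat).
Notation C := (R[i]).
Notation nrm := (@ComplexField.Normc.normc R).
Notation vec := ('rV[C]_(m.+1)).
Implicit Types (u v w z : vec) (x y : CP R m).

Lemma cp_repP x : cp_rep x != 0 /\ cp_set x = cline (cp_rep x).
Proof. by rewrite /cp_rep; case: (cid (cp_ok x)). Qed.

Lemma cp_rep_neq0 x : cp_rep x != 0. Proof. by case: (cp_repP x). Qed.

Lemma cp_inj x y : cp_set x = cp_set y -> x = y.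
Proof. by case: x y => [X hX] [Y hY] /= E; subst Y; congr MkCP; exact: Prop_irrelevance. Qed.

Definition pt z : CP R m :=
  if pselect (z != 0) is left h then MkCP (ex_intro _ z (conj h erefl)) else point.

Lemma cp_set_pt z : z != 0 -> cp_set (pt z) = cline z.
Proof. by rewrite /pt; case: pselect. Qed.

Lemma clineZ (c : C) z : c != 0 -> cline (c *: z) = cline z.
Proof.
move=> c0; apply/seteqP; split => w [a ->]; first by exists (a * c); rewrite scalerA.
by exists (a / c); rewrite scalerA divfK.
Qed.

Lemma pt_rep z : z != 0 -> exists2 c : C, c != 0 & cp_rep (pt z) = c *: z.
Proof.
move=> z0; have [r0 H] := cp_repP (pt z); rewrite cp_set_pt// in H.
have : cline (cp_rep (pt z)) (cp_rep (pt z)) by exists 1; rewrite scale1r.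
rewrite -H => -[c E]; exists c => //; apply: contraNneq r0 => c0; by rewrite E c0 scale0r.
Qed.

Lemma pt_cp_rep x : pt (cp_rep x) = x.
Proof. by apply: cp_inj; rewrite cp_set_pt ?cp_rep_neq0//; case: (cp_repP x). Qed.

Lemma ptZ (c : C) z : c != 0 -> z != 0 -> pt (c *: z) = pt z.
Proof.
move=> c0 z0; apply: cp_inj; rewrite !cp_set_pt ?clineZ//.
by rewrite scaler_eq0 negb_or c0.
Qed.

Lemma pt_eq z w : z != 0 -> w != 0 -> pt z = pt w -> exists2 c : C, c != 0 & w = c *: z.
Proof.
move=> z0 w0 /(congr1 (@cp_set _ _)); rewrite !cp_set_pt// => E.
have : cline w w by exists 1; rewrite scale1r.
rewrite -E => -[c Ec]; exists c => //; apply: contraNneq w0 => c0; by rewrite Ec c0 scale0r.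
Qed.

Definition pmp x := pm (cp_rep x).

Lemma pmp_pt z i j : z != 0 -> pmp (pt z) i j = pm z i j.
Proof. by move=> z0; have [c c0 E] := pt_rep z0; rewrite /pmp E pmZ. Qed.

(** The l^1 distance of the projection matrices, equivalent to [dFS] by [dFS_le_rho] and
    [rho_le_dFS]. It replaces [dFS] in all matchings because its triangle inequality is
    immediate. *)
Definition rho x y : R := \sum_i \sum_j nrm (pmp x i j - pmp y i j).

Lemma rho_ge0 x y : 0 <= rho x y.
Proof. by do 2![apply: sumr_ge0 => ? _]; exact: nrm_ge0. Qed.

Lemma rho_xx x : rho x x = 0.
Proof. by rewrite /rho big1// => i _; rewrite big1// => j _; rewrite subrr nrm0. Qed.

Lemma rho_sym x y : rho x y = rho y x.
Proof. by apply: eq_bigr => i _; apply: eq_bigr => j _; rewrite nrmB. Qed.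

Lemma rho_tri (x y z : CP R m) : rho x z <= rho x y + rho y z.
Proof.
rewrite -big_split/=; apply: ler_sum => i _; rewrite -big_split/=; apply: ler_sum => j _; exact: nrm_tri.
Qed.

Lemma pm_le1 z i j : z != 0 -> nrm (pm z i j) <= 1.
Proof.
move=> z0; rewrite -pm_unitv// pm_unit ?cnorm_unitv// nrmM nrm_conj.
by rewrite -[leRHS](mulr1 1) ler_pM ?nrm_ge0// -(cnorm_unitv z0) nrm_le_cnorm.
Qed.

Lemma sum2_const (c : R) : \sum_(i < m.+1) \sum_(j < m.+1) c = m.+1%:R ^+ 2 * c.
Proof. by rewrite !sumr_const !card_ord -mulrnA -[LHS]mulr_natl natrM expr2. Qed.

Lemma rho_le x y : rho x y <= m.+1%:R ^+ 2 * 2.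
Proof.
rewrite -sum2_const; apply: ler_sum => i _; apply: ler_sum => j _.
rewrite (le_trans (nrmD _ _))// nrmN.
by have := pm_le1 i j (cp_rep_neq0 x); have := pm_le1 i j (cp_rep_neq0 y); rewrite /pmp; lra.
Qed.

Lemma rho_pt u v : u != 0 -> v != 0 -> rho (pt u) (pt v) <= m.+1%:R ^+ 2 * (4 * cnorm (u - v) / cnorm u).
Proof.
move=> u0 v0; rewrite -sum2_const; do 2![apply: ler_sum => ? _].
by rewrite !pmp_pt// pm_lip.
Qed.

Let fs x y := \sum_i \sum_j nrm (pmp x i j - pmp y i j) ^+ 2.

Lemma sin_dFS x y : sin (dFS x y) ^+ 2 = fs x y / 2 /\ 0 <= dFS x y <= pi / 2.
Proof.
have E := pm_frob (cp_rep_neq0 x) (cp_rep_neq0 y).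
have h := cos_angle_le1 (cp_rep x) (cp_rep y).
set s := nrm _ / _ in E h; have hs : -1 <= s <= 1 by case/andP: h => h0 ->; rewrite (le_trans _ h0)//; lra.
rewrite /dFS -/s; split.
  rewrite sin_acos// sqr_sqrtr; last by rewrite subr_ge0 expr_le1//; case/andP: h.
  by rewrite /fs /pmp E; field.
rewrite acos_ge0//= leNgt; apply/negP => lt.
have hc : cos (acos s) < cos (pi / 2).
  by rewrite ltr_cos ?in_itv/= ?acos_ge0 ?acos_lepi//; have := pi_ge0 R; lra.
by rewrite acosK ?in_itv// cos_pihalf in hc; case/andP: h => h0 _; have := lt_le_trans hc h0; rewrite ltxx.
Qed.

Lemma dFS_ge0 x y : 0 <= dFS x y. Proof. by have [_ /andP[]] := sin_dFS x y. Qed.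

Lemma dFS_le_rho x y : dFS x y <= 4 * rho x y.
Proof.
have [E h] := sin_dFS x y; apply: le_trans (sin_ge h) _; rewrite ler_pM2l//.
apply: le_trans (ler_norm _) _; rewrite -(@ler_pXn2r _ 2)// ?nnegrE ?rho_ge0// -normrX ger0_norm ?sqr_ge0// E.
have f0 : 0 <= fs x y by do 2![apply: sumr_ge0 => ? _]; rewrite sqr_ge0.
suff : fs x y <= rho x y ^+ 2 by lra.
rewrite expr2 {1}/rho mulr_suml; apply: ler_sum => i _; rewrite mulr_suml; apply: ler_sum => j _.
rewrite expr2 ler_wpM2l ?nrm_ge0//; apply: le_trans (_ : _ <= \sum_j0 nrm (pmp x i j0 - pmp y i j0)) _.
  by rewrite (bigD1 j)//= lerDl sumr_ge0// => ? _; exact: nrm_ge0.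
by rewrite /rho [leRHS](bigD1 i)//= lerDl; do 2![apply: sumr_ge0 => ? _]; exact: nrm_ge0.
Qed.

Lemma rho_le_dFS x y : rho x y <= m.+1%:R ^+ 2 * (2 * dFS x y).
Proof.
have [E /andP[h0 hp]] := sin_dFS x y; rewrite -sum2_const; apply: ler_sum => i _; apply: ler_sum => j _.
rewrite -(@ler_pXn2r _ 2)// ?nnegrE ?nrm_ge0 ?mulr_ge0//.
have s0 : 0 <= sin (dFS x y) by apply: sin_ge0_pi; rewrite h0/=; have := pi_ge0 R; lra.
have : sin (dFS x y) ^+ 2 <= dFS x y ^+ 2 by rewrite ler_pXn2r ?nnegrE// sin_le.
rewrite E exprMn => h; apply: (@le_trans _ _ (fs x y)); last first.
  have h2 : 0 <= dFS x y ^+ 2 by rewrite sqr_ge0.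
  have -> : 2 ^+ 2 = 4 :> R by ring.
  lra.
rewrite /fs (bigD1 i)//= (bigD1 j)//= -addrA lerDl addr_ge0//.
  by apply: sumr_ge0 => ? _; rewrite sqr_ge0.
by do 2![apply: sumr_ge0 => ? _]; rewrite sqr_ge0.
Qed.

Lemma cp_openP (A : set (CP R m)) :
  cp_open A <-> forall x, A x -> exists2 e : R, 0 < e & forall y, rho x y < e -> A y.
Proof.
have c0 : 0 < m.+1%:R ^+ 2 * 2 :> R by rewrite mulr_gt0// exprn_gt0// ltr0n.
split=> H x /H[e e0 He].
  exists (e / 4) => [|y hy]; first by rewrite divr_gt0.
  by apply: He; apply: le_lt_trans (dFS_le_rho x y) _; rewrite mulrC -ltr_pdivlMr.
exists (e / (m.+1%:R ^+ 2 * 2)) => [|y hy]; first by rewrite divr_gt0.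
by apply: He; apply: le_lt_trans (rho_le_dFS x y) _; rewrite mulrA mulrC -ltr_pdivlMr.
Qed.

Lemma cp_open_measurable (A : set (CPm R m)) : cp_open A -> measurable A.
Proof. by move=> h; apply: sub_sigma_algebra. Qed.

Lemma cp_openI : setI_closed (@cp_open R m).
Proof.
move=> A B hA hB x [Ax Bx]; have [e e0 He] := hA x Ax; have [e' e'0 He'] := hB x Bx.
exists (Num.min e e'); first by rewrite lt_min e0.
by move=> y; rewrite lt_min => /andP[h1 h2]; split; [exact: He|exact: He'].
Qed.

Lemma cp_openT : cp_open (setT : set (CP R m)).
Proof. by move=> x _; exists 1. Qed.

Lemma part_pm_measurable i j b (c : R) : measurable [set x : CPm R m | part b (pmp x i j) < c].
Proof.
apply: cp_open_measurable; apply/cp_openP => x /= hx.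
exists (c - part b (pmp x i j)); first by rewrite subr_gt0.
move=> y hy /=; have : nrm (pmp y i j - pmp x i j) <= rho x y.
  rewrite /rho (bigD1 i)//= (bigD1 j)//= -addrA nrmB lerDl addr_ge0//.
    by apply: sumr_ge0 => ? _; exact: nrm_ge0.
  by do 2![apply: sumr_ge0 => ? _]; exact: nrm_ge0.
have := le_trans (ler_norm _) (part_le b (pmp y i j - pmp x i j)); rewrite partB; lra.
Qed.

(* Index of the grid cube of mesh [1/M] containing the projection matrix of [x]. *)
Definition cell (M : nat) x : {ffun 'I_m.+1 * 'I_m.+1 * bool -> 'I_(M.*2).+1} :=
  [ffun t => inord (Num.trunc (M%:R * (part t.2 (pmp x t.1.1 t.1.2) + 1)))].

Lemma part_itv x b i j : 0 <= part b (pmp x i j) + 1 <= 2.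
Proof.
have := part_le b (pmp x i j); have := pm_le1 i j (cp_rep_neq0 x); rewrite -/(pmp x i j) ler_norml => h1 h2.
by case/andP: (h2 : (_ <= _ <= _)) => ? ?; lra.
Qed.

Lemma cell_trunc M x b i j : (Num.trunc (M%:R * (part b (pmp x i j) + 1)) <= M.*2)%N.
Proof.
have /andP[h1 h2] := part_itv x b i j; have p0 : 0 <= M%:R * (part b (pmp x i j) + 1) by rewrite mulr_ge0.
rewrite -(ler_nat R); have /andP[h3 _] := Num.Theory.truncn_itv p0; apply: le_trans h3 _.
by rewrite -muln2 natrM ler_wpM2l.
Qed.

Lemma cell_rho M x y : (0 < M)%N -> cell M x = cell M y -> rho x y <= m.+1%:R ^+ 2 * (2 / M%:R).
Proof.
move=> M0 E; rewrite -sum2_const; apply: ler_sum => i _; apply: ler_sum => j _.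
have M0' : 0 < M%:R :> R by rewrite ltr0n.
have key b : `|part b (pmp x i j - pmp y i j)| <= M%:R^-1.
  have := congr1 (fun f : {ffun _ -> _} => f (i, j, b)) E; rewrite !ffunE/= => /(congr1 val)/=.
  rewrite !inordK ?ltnS ?cell_trunc// => Et.
  have /andP[hx _] := part_itv x b i j; have /andP[hy _] := part_itv y b i j.
  have /andP[a1 a2] := Num.Theory.truncn_itv (mulr_ge0 (ltW M0') hx).
  have /andP[b1 b2] := Num.Theory.truncn_itv (mulr_ge0 (ltW M0') hy).
  rewrite Et in a1 a2; rewrite -natr1 in a2 b2.
  rewrite partB -[M%:R^-1]mul1r ler_pdivlMr// -[X in _ * X](ger0_norm (ltW M0')) -normrM ler_norml; lra.
rewrite (le_trans (nrm_le_ReIm _))//.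
have -> : 2 / M%:R = M%:R^-1 + M%:R^-1 :> R by ring.
by rewrite lerD//; [exact: (key false)|exact: (key true)].
Qed.

Lemma cell_measurable M f : (0 < M)%N -> measurable [set x : CPm R m | cell M x = f].
Proof.
move=> M0; have -> : [set x : CPm R m | cell M x = f] = \bigcap_(t in [set: 'I_m.+1 * 'I_m.+1 * bool]) [set x | cell M x t = f t].
  apply/seteqP; split => x /=; first by move=> E t _ /=; rewrite E.
  by move=> H; apply/ffunP => t; exact: H.
apply: fin_bigcap_measurable => [|[[i j] b] _]; first exact: finite_finset.
have M0' : 0 < M%:R :> R by rewrite ltr0n.
have E c : [set x : CPm R m | part b (pmp x i j) < c] = [set x | M%:R * (part b (pmp x i j) + 1) < M%:R * (c + 1)].
  by apply/seteqP; split => x /=; rewrite ltr_pM2l// ltrD2r.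
pose k : nat := f (i, j, b).
rewrite (_ : [set x | _] = [set x | part b (pmp x i j) < (k.+1%:R / M%:R - 1)] `\` [set x | part b (pmp x i j) < (k%:R / M%:R - 1)]).
  by apply: measurableD; exact: part_pm_measurable.
have cE (c : R) : M%:R * (c / M%:R - 1 + 1) = c by rewrite subrK mulrC divfK ?gt_eqF.
rewrite !E !cE; apply/seteqP; split => x /=; rewrite ffunE/=.
  have /andP[hx _] := part_itv x b i j.
  have /andP[a1 a2] := Num.Theory.truncn_itv (mulr_ge0 (ltW M0') hx).
  move=> /(congr1 val)/=; rewrite inordK ?ltnS ?cell_trunc// -/k => Ek; rewrite Ek in a1 a2.
  by split => //; apply/negP; rewrite -leNgt.
move=> [h1 /negP]; rewrite -leNgt => h2; apply: val_inj; rewrite /= inordK ?ltnS ?cell_trunc//.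
by apply: Num.Theory.truncn_def; rewrite h2.
Qed.
End Points.

(** * Restriction of a form to a projective line *)

Section LinePolynomials.
Variables (R : realType) (m d : nat).
Notation C := (R[i]).
Notation nrm := (@ComplexField.Normc.normc R).
Notation vec := ('rV[C]_(m.+1)).
Implicit Types (u v w z : vec) (p : hpoly R m d) (L : Gr R m) (A : set (CP R m)).

Lemma poly_ext (P Q : {poly C}) : (forall x, P.[x] = Q.[x]) -> P = Q.
Proof.
move=> H; apply/eqP; rewrite -subr_eq0; apply/negPn/negP => nz.
pose rs := [seq (k%:R : C) | k <- iota 0 (size (P - Q)%R).+1].
have ar : all (root (P - Q)) rs by apply/allP => x _; rewrite /root hornerD hornerN H subrr.
have ur : uniq rs by rewrite map_inj_uniq ?iota_uniq// => i j /eqP; rewrite eqr_nat => /eqP.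
by have := max_poly_roots nz ar ur; rewrite /rs size_map size_iota ltnNge leqnSn.
Qed.

Lemma mon_sum (a : mon m d) : (\sum_(j < m.+1) (val a j : nat))%N = d.
Proof. by case: a => a /= /eqP. Qed.

Lemma pline_horner p z w x : (pline p z w).[x] = peval p (z + x *: w).
Proof.
rewrite /pline horner_sum; apply: eq_bigr => a _; rewrite hornerZ horner_prod; congr (_ * _).
by apply: eq_bigr => j _; rewrite horner_exp !hornerE !mxE mulrC.
Qed.

Lemma pevalZ p c z : peval p (c *: z) = c ^+ d * peval p z.
Proof.
rewrite /peval mulr_sumr; apply: eq_bigr => a _; rewrite mulrCA; congr (_ * _).
rewrite -[in c ^+ d](mon_sum a) -prodrXr -big_split/=; apply: eq_bigr => j _.
by rewrite mxE exprMn.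
Qed.

Lemma coefM_top (F : comNzRingType) (A B : {poly F}) a b : (size A <= a.+1)%N -> (size B <= b.+1)%N ->
  (A * B)`_(a + b) = A`_a * B`_b.
Proof.
move=> sA sB; rewrite coefM; have h : (a < (a + b).+1)%N by rewrite ltnS leq_addr.
rewrite (bigD1 (Ordinal h))//= addKn big1 ?addr0// => j; rewrite -(inj_eq val_inj)/= => ja.
have [lt|lt|E] := ltngtP j a; last by rewrite E eqxx in ja.
  by rewrite [B`__]nth_default ?mulr0// (leq_trans sB)//; have := ltn_ord j; lia.
by rewrite nth_default ?mul0r// (leq_trans sA).
Qed.

Lemma prod_top (F : comNzRingType) (I : Type) (r : seq I) (P : I -> {poly F}) (e : I -> nat) :
  (forall i, (size (P i) <= (e i).+1)%N) ->
  (size (\prod_(i <- r) P i)%R <= (\sum_(i <- r) e i).+1)%N /\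
  (\prod_(i <- r) P i)`_(\sum_(i <- r) e i)%N = \prod_(i <- r) (P i)`_(e i).
Proof.
move=> H; elim: r => [|i r [IH1 IH2]]; first by rewrite !big_nil size_poly1 coef1.
rewrite !big_cons; split; last by rewrite coefM_top// IH2.
apply: leq_trans (size_polyMleq _ _) _; apply: (@leq_trans ((e i).+1 + (\sum_(i <- r) e i).+1).-1)%N; first by rewrite -!subn1 leq_sub2r// leq_add.
by rewrite addSn addnS.
Qed.

Lemma lin_top (a b : C) : (size (a%:P + b%:P * 'X)%R <= 2)%N /\ (a%:P + b%:P * 'X)`_1 = b.
Proof.
split; last by rewrite coefD coefC mul_polyC coefZ coefX add0r mulr1.
rewrite (leq_trans (size_polyD _ _))// geq_max (leq_trans (size_polyC_leq1 _))//=.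
by rewrite mul_polyC (leq_trans (size_scale_leq _ _))// size_polyX.
Qed.

Lemma exp_top (P : {poly C}) b k : (size P <= 2)%N -> P`_1 = b -> (size (P ^+ k)%R <= k.+1)%N /\ (P ^+ k)`_k = b ^+ k.
Proof.
move=> sP Pb; have := @prod_top C 'I_k (index_enum 'I_k) (fun=> P) (fun=> 1%N) (fun=> sP).
by rewrite sum1_card !prodr_const card_ord Pb.
Qed.

Lemma pline_top p z w : (size (pline p z w) <= d.+1)%N /\ (pline p z w)`_d = peval p w.
Proof.
have H (a : mon m d) : (size (\prod_(j < m.+1) ((z 0 j)%:P + (w 0 j)%:P * 'X) ^+ (val a j : nat))%R <= d.+1)%N /\
   (\prod_(j < m.+1) ((z 0 j)%:P + (w 0 j)%:P * 'X) ^+ (val a j : nat))`_d = \prod_(j < m.+1) w 0 j ^+ (val a j : nat).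
  have [h1 h2] := lin_top (0 : C) 0.
  have := @prod_top C 'I_m.+1 (index_enum _) (fun j => ((z 0 j)%:P + (w 0 j)%:P * 'X) ^+ (val a j : nat)) (fun j => val a j : nat).
  rewrite mon_sum => -[j|s1 s2]; first by have [k1 k2] := lin_top (z 0 j) (w 0 j); have [] := exp_top (val a j) k1 k2.
  split=> //; rewrite s2; apply: eq_bigr => j _.
  by have [k1 k2] := lin_top (z 0 j) (w 0 j); have [] := exp_top (val a j) k1 k2.
split.
  rewrite /pline; elim/big_ind: _ => [|P Q h1 h2|a _]; first by rewrite size_poly0.
    by rewrite (leq_trans (size_polyD _ _))// geq_max h1.
  by rewrite (leq_trans (size_scale_leq _ _))//; case: (H a).
by rewrite /pline coef_sum; apply: eq_bigr => a _; rewrite coefZ; have [_ ->] := H a.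
Qed.

Lemma pline_factor p u v : peval p v != 0 -> exists2 rs, size rs = d & pline p u v = peval p v *: Pr rs.
Proof.
move=> pv; have [sz top] := pline_top p u v; have [rs E] := closed_field_poly_normal (pline p u v).
have sz' : size (pline p u v) = d.+1.
  apply/eqP; rewrite eqn_leq sz ltnNge; apply/negP => h; move: pv.
  by rewrite -top nth_default ?eqxx.
have lc : lead_coef (pline p u v) = peval p v by rewrite lead_coefE sz'.
exists rs; last by rewrite -lc.
by move: sz'; rewrite E lc size_scale// size_Pr => -[].
Qed.

Lemma peval_bin p u v rs : peval p v != 0 -> size rs = d -> pline p u v = peval p v *: Pr rs -> forall s r,
  peval p (s *: u + r *: v) = peval p v * \prod_(x <- rs) (r - x * s).
Proof.
move=> pv sz E s r; have [->|s0] := eqVneq s 0.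
  rewrite scale0r add0r pevalZ mulrC; congr (_ * _).
  by under eq_bigr do rewrite mulr0 subr0; rewrite big_const_seq count_predT sz iter_mulr_1.
have -> : s *: u + r *: v = s *: (u + (r / s) *: v) by rewrite scalerDr scalerA mulrC divfK.
rewrite pevalZ -pline_horner E hornerZ mulrCA; congr (_ * _).
rewrite /Pr horner_prod -sz -(iter_mulr_1 (size rs) s) -(count_predT rs) -big_const_seq -big_split/=.
by apply: eq_bigr => x _; rewrite hornerXsubC; field.
Qed.

Definition lbasis L u v := cindep u v /\ gr_set L = span2 u v.

Lemma lbasis_exists L : exists u v, lbasis L u v.
Proof. by have [u [v [h1 h2]]] := gr_ok L; exists u, v. Qed.

Lemma cindep_neq0 u v (a b : C) : cindep u v -> (a, b) != (0, 0) -> a *: u + b *: v != 0.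
Proof. by move=> h; apply: contra => /eqP/h[-> ->]. Qed.

Lemma lbasis_change L u v (a b c e : C) : lbasis L u v -> a * e - b * c != 0 ->
  lbasis L (a *: u + b *: v) (c *: u + e *: v).
Proof.
move=> [ind E] det; split.
  move=> s r; rewrite !scalerDr !scalerA addrACA -!scalerDl => /ind[h1 h2].
  have hs : s * (a * e - b * c) = 0.
    have -> : s * (a * e - b * c) = (s * a + r * c) * e - (s * b + r * e) * c by ring.
    by rewrite h1 h2 !mul0r subrr.
  have hr : r * (a * e - b * c) = 0.
    have -> : r * (a * e - b * c) = (s * b + r * e) * a - (s * a + r * c) * b by ring.
    by rewrite h1 h2 !mul0r subrr.
  by split; apply/eqP; [move/eqP: hs|move/eqP: hr]; rewrite mulf_eq0 (negPf det) orbF.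
rewrite E; apply/seteqP; split => w [s [r ->]]; last first.
  exists (s * a + r * c), (s * b + r * e).
  by rewrite !scalerDr !scalerA addrACA -!scalerDl.
exists ((s * e - r * c) / (a * e - b * c)), ((r * a - s * b) / (a * e - b * c)).
rewrite !scalerDr !scalerA addrACA -!scalerDl; congr (_ *: _ + _ *: _); by field.
Qed.

Lemma lbasis_with L w : gr_set L w -> w != 0 -> exists u, lbasis L u w.
Proof.
have [u [v H]] := lbasis_exists L; case: (H) => ind E; rewrite E => -[a [b ->]] nz.
have [a0|a0] := eqVneq a 0.
  exists u; have b0 : b != 0 by apply: contraNneq nz => b0; rewrite a0 b0 !scale0r addr0.
  have := @lbasis_change L u v 1 0 a b H; rewrite mul1r mul0r subr0 => /(_ b0).
  by rewrite scale1r scale0r addr0.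
exists v; have := @lbasis_change L u v 0 1 a b H; rewrite mul0r mul1r sub0r oppr_eq0 => /(_ a0).
by rewrite scale1r scale0r add0r.
Qed.

Definition pts u v (rs : seq C) : seq (CP R m) := [seq pt (u + x *: v) | x <- rs].

(** As p is nonzero at v, the point at infinity of the chart x -> u + x v is not a zero: the d roots
    of [pline p u v] account for all zeros of p on L, with multiplicity. *)
Definition zdata p L u v rs :=
  [/\ lbasis L u v, peval p v != 0, size rs = d & pline p u v = peval p v *: Pr rs].

Lemma zdata_exists p L w : gr_set L w -> peval p w != 0 -> (0 < d)%N -> exists u v rs, zdata p L u v rs.
Proof.
move=> Lw pw d0; have w0 : w != 0.
  apply: contraNneq pw => ->; by rewrite -[0](scale0r 0) pevalZ expr0n gtn_eqF// mul0r.
have [u H] := lbasis_with Lw w0; have [rs h1 h2] := pline_factor u pw.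
by exists u, w, rs.
Qed.

Lemma indep_line_neq0 u v (x : C) : cindep u v -> u + x *: v != 0.
Proof.
move=> h; rewrite -[u]scale1r; apply: cindep_neq0 => //; by rewrite xpair_eqE oner_eq0.
Qed.

Lemma pt_line_inj u v : cindep u v -> injective (fun x => pt (u + x *: v)).
Proof.
move=> ind x y /pt_eq => /(_ (indep_line_neq0 _ ind) (indep_line_neq0 _ ind))[c c0 E].
have := ind (1 - c) (y - c * x); case=> [|/eqP h1 /eqP h2].
  rewrite !scalerBl scale1r -!scalerA addrACA -opprD -scalerDr -E.
  by rewrite subrr.
by move: h1 h2; rewrite !subr_eq0 => /eqP <- /eqP ->; rewrite mul1r.
Qed.

(** [mult] is computed from a representative and a direction chosen arbitrarily. In terms of u and v
    the polynomial it uses is a product of linear factors; those with y = x vanish at 0 to order 1,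
    and the others do not vanish there. *)
Lemma mult_count p L u v rs x : zdata p L u v rs -> x \in rs ->
  mult p (pt (u + x *: v)) L = count_mem x rs.
Proof.
move=> [[ind E] pv sz pE] xr; rewrite /mult.
have nz := indep_line_neq0 x ind; have [al al0 ->] := pt_rep nz.
set W := [set w | _].
(* The direction lies off the complex line x; in coordinates this says that ga - x be is nonzero. *)
have [be [ga [wE hw]]] : exists be ga, xget 0 W = be *: u + ga *: v /\ ga - x * be != 0.
  have : exists w, W w.
    exists v; split; first by rewrite E; exists 0, 1; rewrite scale0r scale1r add0r.
    rewrite cp_set_pt// => -[c]; rewrite scalerDr scalerA => h.
    have := ind c (c * x - 1); case=> [|c0 /eqP]; first by rewrite scalerBl scale1r addrA -h subrr.
    by rewrite c0 mul0r sub0r oppr_eq0 oner_eq0.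
  move=> /(xgetPex 0) [h1 h2]; move: h1; rewrite E => -[be [ga h]]; exists be, ga; split=> //.
  apply/negP; rewrite subr_eq0 => /eqP h3; apply: h2; rewrite cp_set_pt//; exists be.
  by rewrite h h3 scalerDr scalerA mulrC.
rewrite wE.
have -> : pline p (al *: (u + x *: v)) (be *: u + ga *: v) =
   peval p v *: \prod_(y <- rs) ((al * (x - y))%:P + (ga - y * be)%:P * 'X).
  apply: poly_ext => t; rewrite pline_horner hornerZ horner_prod.
  have -> : al *: (u + x *: v) + t *: (be *: u + ga *: v) = (al + t * be) *: u + (al * x + t * ga) *: v.
    by rewrite !scalerDr !scalerA addrACA -!scalerDl.
  rewrite (peval_bin pv sz pE); congr (_ * _); apply: eq_bigr => y _; rewrite !hornerE; ring.
pose F y : {poly C} := (al * (x - y))%:P + (ga - y * be)%:P * 'X.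
have F0 y : F y != 0.
  apply/negP => /eqP h; have := congr1 (horner^~ 0) h; rewrite /F !hornerE => /eqP.
  rewrite mulf_eq0 (negPf al0)/= subr_eq0 => /eqP xy; move: h; rewrite /F -xy subrr mulr0 polyC0 add0r.
  by move/eqP; rewrite mulf_eq0 polyX_eq0 orbF polyC_eq0 (negPf hw).
have P0 r : \prod_(y <- r) F y != 0 by rewrite prodf_seq_neq0; apply/allP => y _; rewrite F0.
rewrite -mul_polyC mupMr; last by rewrite /root hornerC.
rewrite -[LHS]/(mup 0 (\prod_(y <- rs) F y)); elim: rs {sz pE xr} => [|y r IH]; first by rewrite big_nil mupNroot// /root hornerE oner_eq0.
rewrite big_cons mupM// IH /= eq_sym; congr (_ + _)%N.
have [xy|xy] := eqVneq x y.
  rewrite /F -xy subrr mulr0 polyC0 add0r mupMr; last by rewrite /root hornerC.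
  by have := mup_XsubCX 1 (0 : C) 0; rewrite eqxx expr1 polyC0 subr0.
by rewrite mupNroot// /root /F !hornerE mulf_neq0// subr_eq0.
Qed.

Lemma count_undup_sum (T : eqType) (a : pred T) (s : seq T) :
  count a s = (\sum_(x <- undup s | a x) count_mem x s)%N.
Proof.
rewrite -(permP (perm_count_undup s)) count_flatten -map_comp sumnE big_map [RHS]big_mkcond/=.
by apply: eq_bigr => x _ /=; rewrite count_nseq; case: (a x); rewrite ?mul1n ?mul0n.
Qed.

Lemma zcount_pts p L u v rs A : zdata p L u v rs ->
  zcount p A L = (count (fun x => `[< A x >]) (pts u v rs))%:R.
Proof.
move=> D; case: (D) => [[ind E] pv sz pE].
have memE x : x \in pts u v rs -> exists2 y, y \in rs & x = pt (u + y *: v) by move=> /mapP.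
have SE : [set x : CP R m | cp_set x `<=` gr_set L /\ peval p (cp_rep x) = 0 /\ A x] =
    [set` [seq x <- undup (pts u v rs) | `[< A x >]]].
  apply/seteqP; split => x /=; rewrite mem_filter mem_undup.
    move=> [xL [px Ax]]; apply/andP; split; first exact/asboolP.
    have [r0 xE] := cp_repP x; have : gr_set L (cp_rep x) by apply: xL; rewrite xE; exists 1; rewrite scale1r.
    rewrite E => -[s [r h]]; move: px; rewrite h (peval_bin pv sz pE) => /eqP; rewrite mulf_eq0 (negPf pv)/=.
    rewrite prodf_seq_eq0 => /hasP[y yr /=]; rewrite subr_eq0 => /eqP ry.
    have s0 : s != 0 by apply: contraNneq r0 => s0; rewrite h ry s0 mulr0 !scale0r addr0.
    apply/mapP; exists y => //; rewrite -[x]pt_cp_rep h ry mulrC -scalerA -scalerDr ptZ//.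
    exact: indep_line_neq0.
  move=> /andP[/asboolP Ax /memE[y yr xE]]; have nz := indep_line_neq0 y ind; split; last split=> //.
    rewrite xE cp_set_pt// E => _ [c ->]; exists c, (c * y); by rewrite scalerDr scalerA.
  rewrite xE; have [c c0 ->] := pt_rep nz; rewrite pevalZ -[u in u + _]scale1r (peval_bin pv sz pE).
  by rewrite (_ : \prod_(_ <- _) _ = 0) ?mulr0//; apply/eqP; rewrite prodf_seq_eq0; apply/hasP; exists y => //=; rewrite mulr1 subrr.
rewrite /zcount SE -fsbig_seq ?filter_uniq ?undup_uniq//.
rewrite count_undup_sum natr_sum big_filter [LHS]big_seq_cond [RHS]big_seq_cond.
apply: eq_bigr => x /andP[]; rewrite mem_undup => /memE[y yr ->] _; congr (_%:R).
rewrite (mult_count D)// /pts count_map; apply: eq_count => z /=.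
by rewrite (inj_eq (pt_line_inj ind)).
Qed.

Lemma zcount_degenerate p L A : (forall w, gr_set L w -> peval p w = 0) -> zcount p A L = 0.
Proof.
move=> H; rewrite /zcount fsbig1// => x [xL _]; rewrite /mult.
set W := [set w | _].
have LW : gr_set L (xget 0 W).
  case: xgetP => [w _ []//|_]; have [u [v [_ ->]]] := lbasis_exists L.
  by exists 0, 0; rewrite !scale0r addr0.
have Lx : gr_set L (cp_rep x) by apply: xL; rewrite (cp_repP x).2; exists 1; rewrite scale1r.
have [u [v [_ E]]] := lbasis_exists L.
have -> : pline p (cp_rep x) (xget 0 W) = 0.
  apply: poly_ext => t; rewrite pline_horner horner0 H//; move: LW Lx; rewrite E => -[a [b ->]] [c [e ->]].
  by exists (c + t * a), (e + t * b); rewrite !scalerDr !scalerA addrACA -!scalerDl.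
(* The zero polynomial gets multiplicity 0, so that a line contained in the zero set has count 0. *)
have -> : mup 0 (0 : {poly C}) = 0%N.
  rewrite /mup; case: (arg_maxnP) => [|i _ _]; first by rewrite dvdp0.
  by have := ltn_ord i; rewrite {2}size_poly0 => h; case: (nat_of_ord i) h.
by [].
Qed.

(* The zeros of [p] on [L] with multiplicity; the empty list when [p] vanishes on [L]. *)
Definition zl p L : seq (CP R m) :=
  if pselect (exists t : vec * vec * seq C, zdata p L t.1.1 t.1.2 t.2) is left h then
    let t := projT1 (cid h) in pts t.1.1 t.1.2 t.2 else [::].

Lemma zcount_zl p L A : (0 < d)%N -> zcount p A L = (count (fun x => `[< A x >]) (zl p L))%:R.
Proof.
move=> d0; rewrite /zl; case: pselect => [h|h]; first by case: (cid h) => t Ht /=; rewrite (zcount_pts _ Ht).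
rewrite zcount_degenerate// => w Lw; apply/eqP/negPn/negP => pw; apply: h.
by have [u [v [rs D]]] := zdata_exists Lw pw d0; exists (u, v, rs).
Qed.

Lemma zl_perm p L u v rs : (0 < d)%N -> zdata p L u v rs -> perm_eq (zl p L) (pts u v rs).
Proof.
move=> d0 D; apply/allP => x _ /=; apply/eqP; apply/eqP; rewrite -(eqr_nat R); apply/eqP.
have E s : (count_mem x s)%:R = (count (fun y => `[< [set x] y >]) s)%:R :> R.
  by congr (_%:R); apply: eq_count => y /=; apply/eqP/asboolP.
by rewrite !E -zcount_zl// (zcount_pts _ D).
Qed.
End LinePolynomials.

(** * Frames of lines and convergence of lines *)

Section Frames.
Variables (R : realType) (m : nat).
Notation C := (R[i]).
Notation nrm := (@ComplexField.Normc.normc R).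
Notation vec := ('rV[C]_(m.+1)).
Implicit Types (u v w z : vec) (L M : Gr R m).

Lemma lbasis_mem L u v (a b : C) : lbasis L u v -> gr_set L (a *: u + b *: v).
Proof. by move=> [_ ->]; exists a, b. Qed.

Lemma lbasis_fst L u v : lbasis L u v -> gr_set L u.
Proof. by move=> /(lbasis_mem 1 0); rewrite scale1r scale0r addr0. Qed.

Lemma lbasis_snd L u v : lbasis L u v -> gr_set L v.
Proof. by move=> /(lbasis_mem 0 1); rewrite scale1r scale0r add0r. Qed.

Lemma gr_setD L u v (a b : C) : gr_set L u -> gr_set L v -> gr_set L (a *: u + b *: v).
Proof.
have [x [y [_ E]]] := lbasis_exists L; rewrite E => -[c [e ->]] [c' [e' ->]].
exists (a * c + b * c'), (a * e + b * e').
by rewrite !scalerDr !scalerA addrACA -!scalerDl.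
Qed.

Lemma gr_setZ L u (a : C) : gr_set L u -> gr_set L (a *: u).
Proof. by move=> h; have := gr_setD a 0 h h; rewrite scale0r addr0. Qed.

Lemma lbasis_of L u v : gr_set L u -> gr_set L v -> cindep u v -> lbasis L u v.
Proof.
have [x [y H]] := lbasis_exists L; case: (H) => ind E; rewrite E => -[a [b ->]] [c [e ->]] uv.
apply: lbasis_change => //; apply/eqP => det.
have h1 := uv e (- b); have h2 := uv (- c) a.
have E1 : e *: (a *: x + b *: y) + - b *: (c *: x + e *: y) = 0.
  rewrite !scalerDr !scalerA addrACA -!scalerDl.
  by rewrite (_ : e * a + - b * c = 0) ?scale0r ?add0r; [rewrite (_ : _ + _ = 0) ?scale0r//; ring|rewrite -det; ring].
have E2 : - c *: (a *: x + b *: y) + a *: (c *: x + e *: y) = 0.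
  rewrite !scalerDr !scalerA addrACA -!scalerDl.
  by rewrite (_ : - c * a + a * c = 0) ?scale0r ?add0r; [rewrite (_ : _ + _ = 0) ?scale0r// -det; ring|ring].
have [e0 /eqP] := h1 E1; rewrite oppr_eq0 => /eqP b0; have [/eqP] := h2 E2; rewrite oppr_eq0 => /eqP c0 a0.
have := uv 1 0; rewrite a0 b0 !scale0r !addr0 scaler0 => /(_ erefl)[/eqP].
by rewrite oner_eq0.
Qed.

Lemma cindep_minor u v : cindep u v -> exists i j, u 0 i * v 0 j - u 0 j * v 0 i != 0.
Proof.
move=> ind; apply/not_existsP => H.
have u0 : u != 0 by have := @cindep_neq0 R m u v 1 0 ind; rewrite scale1r scale0r addr0; apply; rewrite xpair_eqE oner_eq0.
have [i ui] : exists i, u 0 i != 0.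
  apply/not_existsP => h; move/negP: u0; apply; apply/eqP/matrixP => a b.
  by rewrite (ord1 a) mxE; apply/eqP/negPn/negP; exact: h.
have := ind (- (v 0 i / u 0 i)) 1; case=> [|_ /eqP]; last by rewrite oner_eq0.
apply/matrixP => a j; rewrite (ord1 a) !mxE mul1r.
have h : u 0 i * v 0 j - u 0 j * v 0 i = 0 by apply/eqP/negPn/negP => hh; apply: (H i); exists j.
have -> : v 0 j = (u 0 j * v 0 i) / u 0 i by apply: (mulIf ui); rewrite divfK//; move/eqP: h; rewrite subr_eq0 mulrC => /eqP ->.
by field.
Qed.

Lemma minor_cindep u v i j : u 0 i * v 0 j - u 0 j * v 0 i != 0 -> cindep u v.
Proof.
move=> nz a b /matrixP E; have := E 0 i; have := E 0 j; rewrite !mxE => Ej Ei.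
have ha : a * (u 0 i * v 0 j - u 0 j * v 0 i) = 0.
  have -> : a * (u 0 i * v 0 j - u 0 j * v 0 i) = (a * u 0 i + b * v 0 i) * v 0 j - (a * u 0 j + b * v 0 j) * v 0 i by ring.
  by rewrite Ei Ej !mul0r subrr.
have hb : b * (u 0 i * v 0 j - u 0 j * v 0 i) = 0.
  have -> : b * (u 0 i * v 0 j - u 0 j * v 0 i) = (a * u 0 j + b * v 0 j) * u 0 i - (a * u 0 i + b * v 0 i) * u 0 j by ring.
  by rewrite Ei Ej !mul0r subrr.
by split; apply/eqP; [move/eqP: ha|move/eqP: hb]; rewrite mulf_eq0 (negPf nz) orbF.
Qed.

(** Independence is the nonvanishing of some 2 by 2 minor, an open condition. *)
Lemma cindep_stable u v : cindep u v -> exists2 e : R, 0 < e & forall u' v', cnorm (u - u') < e -> cnorm (v - v') < e -> cindep u' v'.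
Proof.
move=> /cindep_minor[i [j nz]]; set D := _ - _ in nz.
have D0 : 0 < nrm D by rewrite nrm_gt0.
pose B := 1 + cnorm u + cnorm v; have B1 : 1 <= B by rewrite /B -addrA lerDl addr_ge0 ?cnorm_ge0.
have B0 : 0 < B := lt_le_trans ltr01 B1.
exists (Num.min 1 (nrm D / (8 * B))); first by rewrite lt_min ltr01 divr_gt0// mulr_gt0.
move=> u' v'; rewrite !lt_min => /andP[u1 u2] /andP[v1 v2]; apply: (@minor_cindep _ _ i j).
rewrite -nrm_gt0.
have cb (w w' : vec) k : nrm (w 0 k - w' 0 k) <= cnorm (w - w') by have := nrm_le_cnorm (w - w') k; rewrite !mxE.
have ub k : nrm (u 0 k) <= B by have := nrm_le_cnorm u k; have := cnorm_ge0 v; rewrite /B; lra.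
have vb' k : nrm (v' 0 k) <= B.
  have := nrm_ge_sub (v' 0 k) (v 0 k); rewrite nrmB; have := cb v v' k; have := nrm_le_cnorm v k; have := cnorm_ge0 u; rewrite /B; lra.
set e := nrm D / (8 * B) in u2 v2.
have key a b : nrm (u 0 a * v 0 b - u' 0 a * v' 0 b) <= 2 * B * e.
  have -> : u 0 a * v 0 b - u' 0 a * v' 0 b = u 0 a * (v 0 b - v' 0 b) + (u 0 a - u' 0 a) * v' 0 b by ring.
  rewrite (le_trans (nrmD _ _))// !nrmM.
  have h1 : nrm (u 0 a) * nrm (v 0 b - v' 0 b) <= B * e by rewrite ler_pM ?nrm_ge0// (le_trans (cb _ _ _))// ltW.
  have h2 : nrm (u 0 a - u' 0 a) * nrm (v' 0 b) <= e * B by rewrite ler_pM ?nrm_ge0// (le_trans (cb _ _ _))// ltW.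
  lra.
have eE : e * (8 * B) = nrm D by rewrite /e divfK// gt_eqF// mulr_gt0.
set D' := _ - _; have : nrm (D - D') <= 4 * B * e.
  have -> : D - D' = (u 0 i * v 0 j - u' 0 i * v' 0 j) - (u 0 j * v 0 i - u' 0 j * v' 0 i) by rewrite /D /D'; ring.
  by rewrite (le_trans (nrmD _ _))// nrmN; have := key i j; have := key j i; lra.
have := nrm_ge_sub D D'; lra.
Qed.

Lemma usph_exists L : exists w, usph L w.
Proof.
have [u [v H]] := lbasis_exists L; have u0 : u != 0.
  by have := @cindep_neq0 R m u v 1 0 H.1; rewrite scale1r scale0r addr0; apply; rewrite xpair_eqE oner_eq0.
by exists (unitv u); split; [apply: gr_setZ; exact: lbasis_fst H|exact: cnorm_unitv].
Qed.

(** The Hausdorff distance only concerns unit vectors, so w is normalized and the unit vector found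
    near it is scaled back. *)
Lemma gr_near L w (e : R) : gr_set L w -> 0 < e ->
  exists2 del : R, 0 < del & forall M, dGr L M < del -> exists2 w', gr_set M w' & cnorm (w - w') < e.
Proof.
move=> Lw e0; have [->|w0] := eqVneq w 0.
  exists 1 => // M _; have [u [v H]] := lbasis_exists M; exists 0; last by rewrite subrr cnorm0.
  by have := lbasis_mem 0 0 H; rewrite !scale0r addr0.
have nw : 0 < cnorm w by rewrite cnorm_gt0.
exists (e / cnorm w) => [|M]; first by rewrite divr_gt0.
rewrite /dGr gt_max => /andP[hd _].
pose I u := inf [set cnorm (u - v) | v in usph M].
have hI u v : usph M v -> I u <= cnorm (u - v).
  by move=> hv; apply: ge_inf; [exists 0 => _ [z _ <-]; exact: cnorm_ge0|exists v].
have Iw : I (unitv w) <= hdist L M.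
  apply: ub_le_sup; last by exists (unitv w) => //; split; [exact: gr_setZ|exact: cnorm_unitv].
  have [v Mv] := usph_exists M; exists 2 => _ [u [_ u1] <-]; apply: le_trans (hI _ _ Mv) _.
  by rewrite (le_trans (cnormD _ _))// cnormN u1 Mv.2.
have [v0 Mv0] := usph_exists M.
have := le_lt_trans Iw hd; rewrite -subr_gt0 => /inf_adherent.
have hinf : has_inf [set cnorm (unitv w - v) | v in usph M].
  by split; [exists (cnorm (unitv w - v0)), v0|exists 0 => _ [z _ <-]; exact: cnorm_ge0].
move=> /(_ _ hinf)[_ [v Mv <-] h0].
have h : cnorm (unitv w - v) < e / cnorm w by move: h0; rewrite -/(I (unitv w)); lra.
exists ((cnorm w)%:C%C *: v); first by apply: gr_setZ; case: Mv.
have -> : w - (cnorm w)%:C%C *: v = (cnorm w)%:C%C *: (unitv w - v).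
  rewrite scalerBr /unitv scalerA -rmorphM mulfV ?scale1r// gt_eqF//.
by rewrite cnormZ nrmR ger0_norm ?cnorm_ge0// mulrC -ltr_pdivlMr.
Qed.

Lemma gr_near_basis L u v (e : R) : lbasis L u v -> 0 < e ->
  exists2 del : R, 0 < del & forall M, dGr L M < del -> exists u' v',
    [/\ lbasis M u' v', cnorm (u - u') < e & cnorm (v - v') < e].
Proof.
move=> H e0; have [e1 e10 He1] := cindep_stable H.1.
have e2 : 0 < Num.min e e1 by rewrite lt_min e0.
have [d1 d10 H1] := gr_near (lbasis_fst H) e2; have [d2 d20 H2] := gr_near (lbasis_snd H) e2.
exists (Num.min d1 d2) => [|M]; first by rewrite lt_min d10.
rewrite lt_min => /andP[/H1[u' Mu hu] /H2[v' Mv hv]]; exists u', v'.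
move: hu hv; rewrite !lt_min => /andP[hu hu1] /andP[hv hv1]; split => //.
by apply: lbasis_of => //; exact: He1.
Qed.

Lemma gram_schmidt u v : cnorm u = 1 -> cinner u (v - cinner u v *: u) = 0.
Proof.
by move=> u1; rewrite -scaleN1r cinnerDr !cinnerZr cinner_cnorm u1 expr1n mulr1 mulN1r subrr.
Qed.

Lemma lbasis_orthonormal L : exists u v, [/\ lbasis L u v, cnorm u = 1, cnorm v = 1 & cinner u v = 0].
Proof.
have [x [y H]] := lbasis_exists L.
have x0 : x != 0.
  by have := @cindep_neq0 R m x y 1 0 H.1; rewrite scale1r scale0r addr0; apply; rewrite xpair_eqE oner_eq0.
pose u := unitv x; pose v := y - cinner u y *: u.
have u1 : cnorm u = 1 by exact: cnorm_unitv.
have cx : (cnorm x)^-1%:C%C != 0 :> C by rewrite -nrm_eq0 nrmR normr_eq0 invr_eq0 cnorm_eq0.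
have Hb : lbasis L u v.
  have -> : v = (- cinner u y * (cnorm x)^-1%:C%C) *: x + 1 *: y by rewrite /v /u /unitv scalerA scale1r addrC mulNr scaleNr.
  rewrite /u /unitv -[_ *: x]addr0 -[0](scale0r y); apply: lbasis_change => //.
  by rewrite mulr1 mul0r subr0.
have v0 : v != 0.
  by have := @cindep_neq0 R m u v 0 1 Hb.1; rewrite scale1r scale0r add0r; apply; rewrite xpair_eqE oner_eq0 andbF.
have uv : cinner u v = 0.
  exact: gram_schmidt.
exists u, (unitv v); split => //; last 1 first.
- by rewrite cinnerZr uv mulr0.
- have cv : (cnorm v)^-1%:C%C != 0 :> C by rewrite -nrm_eq0 nrmR normr_eq0 invr_eq0 cnorm_eq0.
  have := @lbasis_change R m L u v 1 0 0 (cnorm v)^-1%:C%C Hb; rewrite mul1r mul0r subr0 => /(_ cv).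
  by rewrite scale1r !scale0r addr0 add0r.
- exact: cnorm_unitv.
Qed.
End Frames.

(** * Continuity of the zeros with respect to the line *)

Section LineContinuity.
Variables (R : realType) (m d : nat).
Notation C := (R[i]).
Notation nrm := (@ComplexField.Normc.normc R).
Notation vec := ('rV[C]_(m.+1)).
Implicit Types (u v w z : vec) (L M : Gr R m) (p : hpoly R m d).

Lemma pn_prod_lip (I : Type) (r : seq I) (P Q : I -> {poly C}) (B del : R) : 1 <= B -> 0 <= del ->
  (forall i, pn (P i) <= B) -> (forall i, pn (Q i) <= B) -> (forall i, pn (P i - Q i) <= del) ->
  pn (\prod_(i <- r) P i - \prod_(i <- r) Q i) <= (size r)%:R * B ^+ size r * del.
Proof.
move=> B1 d0 hP hQ hPQ; have B0 := le_trans ler01 B1.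
elim: r => [|i r IH]; first by rewrite !big_nil subrr pn0 !mul0r.
rewrite !big_cons /=.
have -> : P i * \prod_(j <- r) P j - Q i * \prod_(j <- r) Q j =
  P i * (\prod_(j <- r) P j - \prod_(j <- r) Q j) + (P i - Q i) * \prod_(j <- r) Q j by ring.
have h1 : pn (P i * (\prod_(j <- r) P j - \prod_(j <- r) Q j)) <= B * ((size r)%:R * B ^+ size r * del).
  by rewrite (le_trans (pnM _ _))// ler_pM ?pn_ge0.
have h2 : pn ((P i - Q i) * \prod_(j <- r) Q j) <= del * B ^+ size r.
  by rewrite (le_trans (pnM _ _))// ler_pM ?pn_ge0// pn_prod.
have h3 : del * B ^+ size r <= B ^+ (size r).+1 * del.
  by rewrite mulrC ler_wpM2r// exprS ler_peMl// exprn_ge0.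
rewrite (le_trans (pnD _ _))// exprS -natr1; rewrite exprS in h3; lra.
Qed.

Lemma pline_lip (A0 B : R) : 0 <= A0 -> 1 <= B -> exists2 Kp : R, 0 <= Kp & forall p u v u' v',
  (forall a, nrm (p a) <= A0) ->
  cnorm u <= B -> cnorm v <= B -> cnorm u' <= B -> cnorm v' <= B ->
  pn (pline p u v - pline p u' v') <= Kp * (cnorm (u - u') + cnorm (v - v')).
Proof.
move=> A00 B1; pose B2 := B + B; have B21 : 1 <= B2 by rewrite /B2; lra.
have B20 : 0 <= B2 := le_trans ler01 B21.
pose Ce := d%:R * B2 ^+ d; have Ce0 : 0 <= Ce by rewrite mulr_ge0// exprn_ge0.
have Bd1 : 1 <= B2 ^+ d by rewrite exprn_ege1.
exists (\sum_(a : mon m d) A0 * (m.+1%:R * (B2 ^+ d) ^+ m.+1 * Ce)).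
  by apply: sumr_ge0 => a _; rewrite !mulr_ge0 ?nrm_ge0 ?exprn_ge0.
move=> p u v u' v' hp hu hv hu' hv'.
rewrite /pline -sumrB mulr_suml (le_trans (pn_sum _ _ _))//; apply: ler_sum => a _.
rewrite -scalerBr pnZ -[leRHS]mulrA ler_pM ?nrm_ge0 ?pn_ge0//.
set del := cnorm (u - u') + _; have del0 : 0 <= del by rewrite addr_ge0 ?cnorm_ge0.
have lin_le (w z : vec) j : cnorm w <= B -> cnorm z <= B -> pn ((w 0 j)%:P + (z 0 j)%:P * 'X) <= B2.
  move=> hw hz; rewrite (le_trans (pnD _ _))// /B2 lerD ?pnC ?(le_trans (nrm_le_cnorm _ _))//.
  rewrite mul_polyC pnZ; have := nrm_le_cnorm z j; have := pnX1 R; have := nrm_ge0 (z 0 j) => h0 h1 h2.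
  by have := ler_wpM2l h0 h1; lra.
have lin_d j : pn (((u 0 j)%:P + (v 0 j)%:P * 'X) - ((u' 0 j)%:P + (v' 0 j)%:P * 'X)) <= del.
  have -> : ((u 0 j)%:P + (v 0 j)%:P * 'X) - ((u' 0 j)%:P + (v' 0 j)%:P * 'X) = ((u - u') 0 j)%:P + ((v - v') 0 j)%:P * 'X.
    by rewrite !mxE !polyCB; ring.
  rewrite (le_trans (pnD _ _))// /del lerD ?pnC ?nrm_le_cnorm//.
  rewrite mul_polyC pnZ; have := nrm_le_cnorm (v - v') j; have := pnX1 R; have := nrm_ge0 ((v - v') 0 j) => h0 h1 h2.
  by have := ler_wpM2l h0 h1; lra.
have ad (j : 'I_m.+1) : (val a j <= d)%N by rewrite -ltnS.
have exp_le (w z : vec) j : cnorm w <= B -> cnorm z <= B -> pn (((w 0 j)%:P + (z 0 j)%:P * 'X) ^+ (val a j : nat)) <= B2 ^+ d.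
  move=> hw hz; rewrite -[X in pn X](_ : \prod_(i <- nseq (val a j) tt) ((w 0 j)%:P + (z 0 j)%:P * 'X) = _); last first.
    by rewrite big_const_seq count_predT size_nseq iter_mulr_1.
  by rewrite (le_trans (@pn_prod R _ _ _ B2 _))// ?size_nseq ?ler_weXn2l// => _; exact: lin_le.
have exp_d j : pn (((u 0 j)%:P + (v 0 j)%:P * 'X) ^+ (val a j : nat) - ((u' 0 j)%:P + (v' 0 j)%:P * 'X) ^+ (val a j : nat)) <= Ce * del.
  have := @pn_prod_lip unit (nseq (val a j) tt) (fun=> (u 0 j)%:P + (v 0 j)%:P * 'X) (fun=> (u' 0 j)%:P + (v' 0 j)%:P * 'X) B2 del B21 del0.
  rewrite !big_const_seq !count_predT !size_nseq !iter_mulr_1 => /(_ (fun=> lin_le u v j hu hv) (fun=> lin_le u' v' j hu' hv') (fun=> lin_d j)) h.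
  apply: le_trans h _; rewrite ler_wpM2r// ler_pM ?exprn_ge0 ?ler_nat ?ler_weXn2l//.
have sz : size (index_enum 'I_m.+1) = m.+1 by rewrite -sum1_size sum1_card card_ord.
have := @pn_prod_lip 'I_m.+1 (index_enum _) (fun j => ((u 0 j)%:P + (v 0 j)%:P * 'X) ^+ (val a j : nat))
  (fun j => ((u' 0 j)%:P + (v' 0 j)%:P * 'X) ^+ (val a j : nat)) (B2 ^+ d) (Ce * del) Bd1 (mulr_ge0 Ce0 del0).
rewrite sz mulrA; apply => j; [exact: exp_le|exact: exp_le|exact: exp_d].
Qed.

Lemma finite_pos (T : eqType) (s : seq T) (f : T -> R) : (forall x, x \in s -> 0 < f x) ->
  exists2 c : R, 0 < c & forall x, x \in s -> c <= f x.
Proof.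
elim: s => [|x s IH] H; first by exists 1.
have [c c0 Hc] := IH (fun y hy => H y (mem_behead (s := x :: s) hy)).
exists (Num.min (f x) c); first by rewrite lt_min c0 H// mem_head.
move=> y; rewrite in_cons => /orP[/eqP ->|/Hc h]; first by rewrite ge_min lexx.
by rewrite ge_min h orbT.
Qed.

(** This concerns lines on which p is not identically zero. A basis of M close to (u, v) keeps p(v')
    away from 0, so both restrictions are multiples of monic polynomials of degree d that are close
    to each other, and [root_match] applies. *)
Lemma zl_continuous p L u v rs (e : R) : (0 < d)%N -> zdata p L u v rs -> 0 < e ->
  exists2 del : R, 0 < del & forall M, dGr L M < del -> matched (@rho R m) e (zl p L) (zl p M).
Proof.
move=> d0 D e0; case: (D) => [Hb pv sz pE].
pose B := 1 + cnorm u + cnorm v; have B1 : 1 <= B by rewrite /B -addrA lerDl addr_ge0 ?cnorm_ge0.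
have B0 : 0 < B := lt_le_trans ltr01 B1.
have BB1 : 1 <= B + 1 by lra.
pose A0 := \sum_(a : mon m d) nrm (p a); have A00 : 0 <= A0 by apply: sumr_ge0 => a _; exact: nrm_ge0.
have hA a : nrm (p a) <= A0 by rewrite /A0 (bigD1 a)//= lerDl; apply: sumr_ge0 => b _; exact: nrm_ge0.
have [Kp Kp0 HK0] := pline_lip A00 BB1.
have HK u1 v1 u2 v2 := HK0 p u1 v1 u2 v2 hA.
have [c c0 Hc] : exists2 c : R, 0 < c & forall x, x \in rs -> c <= cnorm (u + x *: v).
  by apply: finite_pos => x _; rewrite cnorm_gt0 indep_line_neq0//; case: Hb.
pose N2 : R := m.+1%:R ^+ 2; have N20 : 0 < N2 by rewrite exprn_gt0// ltr0n.
pose r0 := 1 + pn (Pr rs); have r01 : 1 <= r0 by rewrite lerDl pn_ge0.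
have r00 : 0 < r0 := lt_le_trans ltr01 r01.
pose e1 := e * c / (8 * N2 * (B + 1)).
have e10 : 0 < e1 by rewrite divr_gt0 ?mulr_gt0// ltr_wpDr// ltW.
have [del del0 Hm] := root_match d (ltW r00) e10.
pose np := nrm (peval p v); have np0 : 0 < np by rewrite nrm_gt0.
(* [ka] bounds the change of the restricted polynomial. The first term keeps |p(v')| at least half
   of |p(v)|; the second makes the monic polynomials closer than [del]. *)
pose ka := Num.min (np / 2) (Num.min del 1 * np / (2 * (r0 + 1))).
have ka0 : 0 < ka.
  rewrite lt_min divr_gt0//=; apply: divr_gt0; last by rewrite mulr_gt0// addr_gt0.
  by rewrite mulr_gt0// lt_min del0 ltr01.
pose eta := Num.min 1 (Num.min (ka / (2 * (Kp + 1))) (e * c / (8 * N2 * (r0 + 1)))).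
have p1 : 0 < ka / (2 * (Kp + 1)) by rewrite divr_gt0// mulr_gt0// ltr_wpDl.
have p2 : 0 < e * c / (8 * N2 * (r0 + 1)).
  by apply: divr_gt0; rewrite !mulr_gt0// addr_gt0.
have eta0 : 0 < eta by rewrite !lt_min ltr01 p1.
have [dl dl0 HM] := gr_near_basis Hb eta0.
exists dl => // M /HM[u' [v' [Hb' hu hv]]].
move: (hu) (hv); rewrite !lt_min => /andP[u1 /andP[u2 u3]] /andP[v1 /andP[v2 v3]].
have nu' : cnorm u' <= B + 1.
  have := cnormD (u' - u) u; rewrite subrK [cnorm (u' - u)]cnormB /B; have := cnorm_ge0 v; clear -u1; lra.
have nv' : cnorm v' <= B + 1.
  have := cnormD (v' - v) v; rewrite subrK [cnorm (v' - v)]cnormB /B; have := cnorm_ge0 u; clear -v1; lra.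
have nu : cnorm u <= B + 1 by rewrite /B; have := cnorm_ge0 v; clear -R; lra.
have nv : cnorm v <= B + 1 by rewrite /B; have := cnorm_ge0 u; clear -R; lra.
have dP : pn (pline p u v - pline p u' v') <= ka.
  apply: le_trans (HK _ _ _ _ nu nv nu' nv') _.
  have h : cnorm (u - u') + cnorm (v - v') <= ka / (Kp + 1).
    have E : ka / (Kp + 1) = ka / (2 * (Kp + 1)) + ka / (2 * (Kp + 1)) by field; rewrite gt_eqF// ltr_wpDl.
    by rewrite E; apply: ltW; exact: ltrD.
  apply: le_trans (ler_wpM2l Kp0 h) _; rewrite mulrCA ler_piMr ?(ltW ka0)// ler_pdivrMr ?ltr_wpDl// mul1r lerDl//.
have dv : nrm (peval p v - peval p v') <= ka.
  rewrite -(pline_top p u v).2 -(pline_top p u' v').2 -coefB; exact: le_trans (pn_coef _ _) dP.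
have ka1 : ka <= np / 2 by rewrite ge_min lexx.
have pv'n : np / 2 <= nrm (peval p v') by have := nrm_ge_sub (peval p v) (peval p v'); rewrite -/np; clear -dv ka1; lra.
have pv' : peval p v' != 0 by rewrite -nrm_gt0; apply: lt_le_trans pv'n; rewrite divr_gt0.
have [rs' sz' pE'] := pline_factor u' pv'.
have D' : zdata p M u' v' rs' by split.
have dPr : pn (Pr rs - Pr rs') <= Num.min del 1.
  have E : peval p v' *: (Pr rs - Pr rs') = (pline p u v - pline p u' v') - (peval p v - peval p v') *: Pr rs.
    by rewrite pE pE' scalerBr scalerBl; set X := _ *: _; set Y := _ *: _; set Z := _ *: _; clearbody X Y Z; clear -X; ring.
  have h1 : nrm (peval p v') * pn (Pr rs - Pr rs') <= ka * (r0 + 1).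
    rewrite -pnZ E (le_trans (pnB _ _))// pnZ.
    have : nrm (peval p v - peval p v') * pn (Pr rs) <= ka * pn (Pr rs) by rewrite ler_wpM2r ?pn_ge0.
    rewrite /r0; clear -dP ka0; lra.
  have h2 : ka * (r0 + 1) <= Num.min del 1 * np / 2.
    have kb : ka <= Num.min del 1 * np / (2 * (r0 + 1)) by rewrite ge_min lexx orbT.
    have r1 : 0 < r0 + 1 by rewrite addr_gt0.
    have -> : Num.min del 1 * np / 2 = Num.min del 1 * np / (2 * (r0 + 1)) * (r0 + 1) by field; rewrite gt_eqF.
    by rewrite ler_wpM2r// ltW.
  have h3 : np / 2 * pn (Pr rs - Pr rs') <= nrm (peval p v') * pn (Pr rs - Pr rs') by rewrite ler_wpM2r ?pn_ge0.
  have np2 : 0 < np / 2 by rewrite divr_gt0.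
  have E2 : np / 2 * Num.min del 1 = Num.min del 1 * np / 2 by rewrite mulrC mulrA.
  by rewrite -(ler_pM2l np2) E2; exact: le_trans h3 (le_trans h1 h2).
have rb : {in rs, forall y : C, nrm y <= r0}.
  by move=> z hz; rewrite (le_trans (root_bound (Pr_monic rs) _)) ?root_Pr// lerDr.
have rb' : {in rs', forall y : C, nrm y <= r0}.
  move=> z hz; rewrite (le_trans (root_bound (Pr_monic rs') _)) ?root_Pr// /r0.
  have -> : Pr rs' = Pr rs - (Pr rs - Pr rs') by rewrite opprB addrC subrK.
  rewrite (le_trans (pnB _ _))// addrC lerD2r (le_trans dPr)// ge_min lexx orbT//.
have mt := Hm rs rs' sz sz' rb rb' (le_trans dPr _); rewrite ge_min lexx in mt; have {}mt := mt isT.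
apply: matched_perml (_ : perm_eq (pts u v rs) (zl p L)) _; first by rewrite perm_sym zl_perm.
apply: matched_permr (_ : perm_eq (pts u' v' rs') (zl p M)) _; first by rewrite perm_sym zl_perm.
apply: matched_map mt _ => x y hx hy; rewrite /dC => hxy.
have nx := indep_line_neq0 x Hb.1; have ny := indep_line_neq0 y Hb'.1.
apply: le_trans (rho_pt nx ny) _; rewrite -/N2.
have h : cnorm (u + x *: v - (u' + y *: v')) <= e * c / (4 * N2).
  have -> : u + x *: v - (u' + y *: v') = (u - u') + (x *: (v - v') + (x - y) *: v').
    by rewrite scalerBr scalerBl opprD addrACA; congr (_ + _); rewrite addrA subrK.
  apply: le_trans (cnormD _ _) _; apply: le_trans (lerD (lexx _) (cnormD _ _)) _; rewrite !cnormZ.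
  set ee := e * c / (8 * N2 * (r0 + 1)) in u3 v3.
  have k1 : nrm x * cnorm (v - v') <= r0 * ee by rewrite ler_pM ?nrm_ge0 ?cnorm_ge0 ?rb// ltW.
  have k2 : nrm (x - y) * cnorm v' <= e1 * (B + 1) by rewrite ler_pM ?nrm_ge0 ?cnorm_ge0.
  have E1 : e1 * (B + 1) = e * c / (8 * N2) by rewrite /e1; field; rewrite !gt_eqF// addr_gt0.
  have E2 : ee * (r0 + 1) = e * c / (8 * N2) by rewrite /ee; field; rewrite !gt_eqF// addr_gt0.
  have E3 : e * c / (4 * N2) = e * c / (8 * N2) + e * c / (8 * N2) by field; rewrite gt_eqF.
  rewrite E3; lra.
have cx := Hc x hx; rewrite mulrA ler_pdivrMr ?cnorm_gt0//.
apply: le_trans (_ : e * c <= _); last by rewrite ler_wpM2l ?(ltW e0).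
by move: h; rewrite ler_pdivlMr ?mulr_gt0//; lra.
Qed.
End LineContinuity.
(** * Measurability of the zero counts *)

Section CountableFibres.
Context (dd : measure_display) (X : measurableType dd).

(** Measurability for the discrete structure of a countable target, expressed by fibres without
    putting a sigma-algebra on the target; for countable targets it passes to every function of such
    maps. *)
Definition mfib (T : Type) (f : X -> T) := forall t, measurable [set x | f x = t].

Lemma mfib_preimage (T : countType) (f : X -> T) (S : set T) : mfib f -> measurable (f @^-1` S).
Proof.
move=> H; have -> : f @^-1` S = \bigcup_t (if `[< S t >] then [set x | f x = t] else set0).
  apply/seteqP; split => x /=; first by move=> h; exists (f x) => //; case: asboolP.
  by move=> [t _]; case: asboolP => //= St ->.
apply: countable_bigcupT_measurable => [|t]; first exact: countableP.
by case: asboolP.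
Qed.

Lemma mfib_comp (T : countType) (U : Type) (f : X -> T) (h : T -> U) : mfib f -> mfib (h \o f).
Proof. by move=> H u; have := @mfib_preimage T f [set t | h t = u] H. Qed.

Lemma mfib_measurable (T : countType) (d' : measure_display) (Y : measurableType d') (f : X -> T) (h : T -> Y) :
  mfib f -> measurable_fun setT (h \o f).
Proof. by move=> H _ B mB; rewrite setTI comp_preimage; exact: mfib_preimage. Qed.

Lemma mfib_pair (T U : Type) (f : X -> T) (g : X -> U) : mfib f -> mfib g -> mfib (fun x => (f x, g x)).
Proof.
move=> Hf Hg [t u]; have -> : [set x | (f x, g x) = (t, u)] = [set x | f x = t] `&` [set x | g x = u].
  by apply/seteqP; split => x /= [-> ->].
exact: measurableI.
Qed.

Lemma mfib2 (T U : countType) (V : Type) (f : X -> T) (g : X -> U) (h : T -> U -> V) :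
  mfib f -> mfib g -> mfib (fun x => h (f x) (g x)).
Proof. by move=> Hf Hg; exact: (mfib_comp (fun p => h p.1 p.2) (mfib_pair Hf Hg)). Qed.

Lemma mfib_cst (T : Type) (t : T) : mfib (fun=> t).
Proof.
move=> u; have [->|ne] := pselect (t = u); first by rewrite (_ : [set _ | _] = setT)//; apply/seteqP.
by rewrite (_ : [set _ | _] = set0)//; apply/seteqP; split.
Qed.

Lemma mfib_sum (f : nat -> X -> nat) N : (forall j, mfib (f j)) -> mfib (fun x => (\sum_(j < N) f j x)%N).
Proof.
move=> H; elim: N => [|N IH]; first by rewrite (_ : (fun _ => _) = fun=> 0%N); [exact: mfib_cst|apply/funext => x; rewrite big_ord0].
rewrite (_ : (fun _ => _) = (fun x => (\sum_(j < N) f j x) + f N x)%N); first exact: mfib2.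
by apply/funext => x; rewrite big_ord_recr.
Qed.

Lemma mfib_limit (f : nat -> X -> nat) (g : X -> nat) : (forall j, mfib (f j)) ->
  (forall x, exists n, forall N, (n <= N)%N -> f N x = g x) -> mfib g.
Proof.
move=> Hf H k; have -> : [set x | g x = k] = \bigcup_n \bigcap_(N in [set N | (n <= N)%N]) [set x | f N x = k].
  apply/seteqP; split => x /=; first by move=> <-; have [n Hn] := H x; exists n.
  move=> [n _ Hn]; have [n' Hn'] := H x.
  by rewrite -(Hn' (maxn n n')) ?leq_maxr//; apply: Hn => /=; rewrite leq_maxl.
apply: bigcup_measurable => n _; apply: bigcap_measurableType => N _; exact: Hf.
Qed.

Lemma mfib_levels (f : X -> nat) : (forall k, measurable [set x | (k < f x)%N]) -> mfib f.
Proof.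
move=> H [|k].
  rewrite (_ : [set x | _] = ~` [set x | (0 < f x)%N]); first exact: measurableC.
  by apply/seteqP; split => x /=; [move=> ->|case: (f x)].
rewrite (_ : [set x | _] = [set x | (k < f x)%N] `\` [set x | (k.+1 < f x)%N]); first exact: measurableD.
apply/seteqP; split => x /=; first by move=> ->; rewrite !ltnn.
by move=> [h1 /negP]; rewrite -leqNgt => h2; apply/eqP; rewrite eqn_leq h1 h2.
Qed.
End CountableFibres.

Section ZeroCounts.
Variables (R : realType) (n d : nat).
Hypothesis d0 : (0 < d)%N.
Notation CPn := (CP R n.+1).
Implicit Types (p : hpoly R n.+1 d) (A : set CPn) (L M : Gr R n.+1).

Definition zc p A (L : Grm R n) : nat := count (fun x => `[< A x >]) (zl p L).

Lemma zcountE p A L : zcount p A L = (zc p A L)%:R. Proof. exact: zcount_zl. Qed.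

Lemma matched_count (T : eqType) (dst : T -> T -> R) (e : R) (A : pred T) xs ys : matched dst e xs ys ->
  {in xs, forall x y, A x -> dst x y <= e -> A y} -> (count A xs <= count A ys)%N.
Proof.
move=> [ys' p H] HA; rewrite (permP p); elim: xs ys' H HA {p} => [|x xs IH] [|y ys'] //= /andP[h1 h2] HA.
apply: leq_add; last by apply: IH => // z hz; apply: HA; rewrite in_cons hz orbT.
by case: (boolP (A x)) => // Ax; rewrite (HA x (mem_head _ _) y Ax h1).
Qed.

Lemma gr_open_measurable (A : set (Grm R n)) : @gr_open R n.+1 A -> measurable A.
Proof. by move=> h; apply: sub_sigma_algebra. Qed.

Lemma zl_dataP p L : zl p L != [::] -> exists u v rs, zdata p L u v rs.
Proof.
by rewrite /zl; case: pselect => // h _; case: h => -[[u v] rs] D; exists u, v, rs.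
Qed.

(** The number of zeros in an open set is lower semicontinuous: zeros lying in A stay in A under a
    small perturbation of the line. *)
Lemma zc_open p A k : cp_open A -> @gr_open R n.+1 [set L | (k < zc p A L)%N].
Proof.
move=> /cp_openP oA L /= hk.
have [u [v [rs D]]] : exists u v rs, zdata p L u v rs.
  by apply: zl_dataP; apply: contraTneq hk => E; rewrite /zc E.
have Hf (x : CPn) : exists e : R, 0 < e /\ (A x -> forall y, rho x y < e -> A y).
  by have [/oA[e e0 He]|nA] := pselect (A x); [exists e|exists 1].
have [f Hf'] := choice Hf.
have [e e0 He] := @finite_pos R _ (zl p L) f (fun x _ => (Hf' x).1).
have e2 : 0 < e / 2 by rewrite divr_gt0.
have [del del0 HM] := zl_continuous d0 D e2.
exists del => // M /HM mt /=; apply: leq_trans hk _; apply: matched_count mt _ => x hx y /asboolP Ax hxy.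
apply/asboolP; apply: (Hf' x).2 => //; apply: le_lt_trans hxy _; apply: lt_le_trans (He x hx).
by rewrite ltr_pdivrMr// ltr_pMr// ltr1n.
Qed.

Lemma zc_setC p A L : zc p (~` A) L = (zc p setT L - zc p A L)%N.
Proof.
rewrite /zc; set s := zl p L.
rewrite (eq_count (a2 := predC (fun x => `[< A x >]))) => [|x]; last first.
  by apply/asboolP/negP => [h /asboolP//|h Ax]; apply: h; apply/asboolP.
rewrite [X in (X - _)%N](eq_count (a2 := predT)) => [|x]; last exact/asboolP.
by rewrite count_predT -(count_predC (fun x => `[< A x >]) s) addKn.
Qed.

Lemma zc_bigcup p (F : (set CPn)^nat) L : trivIset setT F ->
  exists n, forall N, (n <= N)%N -> (\sum_(j < N) zc p (F j) L)%N = zc p (\bigcup_k F k) L.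
Proof.
move=> tF; rewrite /zc; elim: (zl p L) => [|x s [n1 IH]]; first by exists 0%N => N _; rewrite big1.
have [n2 Hn2] : exists n2, forall N, (n2 <= N)%N -> (\sum_(j < N) `[< F j x >])%N = `[< (\bigcup_k F k) x >].
  case: asboolP => [[k _ Fk]|nF].
    exists k.+1 => N hN; rewrite (bigD1 (Ordinal hN))//= big1 ?addn0; first by case: asboolP.
    move=> j ne; case: asboolP => // Fj; move: ne; rewrite -(inj_eq val_inj)/= => /eqP; case.
    by apply: (tF j k I I); exists x.
  by exists 0%N => N _; rewrite big1// => j _; case: asboolP => // Fj; case: nF; exists j.
exists (maxn n1 n2) => N; rewrite geq_max => /andP[h1 h2] /=.
by rewrite big_split/= IH// Hn2.
Qed.

(** Dynkin's lemma, starting from the open sets, which are stable under intersection. Complements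
    are handled by the measurability of the total count. *)
Lemma zc_mfib p (A : set (CPm R n.+1)) : measurable A -> mfib (zc p A).
Proof.
apply: (@dynkin_induction _ (CPm R n.+1) (@cp_open R n.+1) (fun A => mfib (zc p A))) => //.
- exact: cp_openI.
- apply: mfib_levels => k; apply: gr_open_measurable; apply: zc_open; exact: cp_openT.
- move=> B oB; apply: mfib_levels => k; apply: gr_open_measurable; exact: zc_open.
- move=> S mS HS; rewrite (_ : zc p _ = (fun L => zc p setT L - zc p S L)%N); last by apply/funext => L; exact: zc_setC.
  apply: mfib2 => //; apply: mfib_levels => k; apply: gr_open_measurable; apply: zc_open; exact: cp_openT.
- move=> F mF tF HF; apply: (@mfib_limit _ (Grm R n) (fun N (L : Grm R n) => (\sum_(j < N) zc p (F j) L)%N)); first by move=> N; exact: (@mfib_sum _ _ (fun j => zc p (F j)) N HF).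
  by move=> L; exact: zc_bigcup.
Qed.

Lemma zcount_measurable p (A : set (CPm R n.+1)) : measurable A ->
  measurable_fun setT ((fun L => (zcount p A L)%:E) : Grm R n -> \bar R).
Proof.
move=> mA; rewrite (_ : (fun L => _) = ((fun k : nat => (k%:R : R)%:E) \o zc p A)); last by apply/funext => L; rewrite zcountE.
exact: (mfib_measurable _ (zc_mfib p mA)).
Qed.

Variable vol : probability (Grm R n) R.

Lemma muP_probability p (G : set (Grm R n)) : measurable G -> vol G = 1%E -> (forall L, G L -> size (zl p L) = d) ->
  is_probability (muP vol p).
Proof.
move=> mG vG HG; have dR : 0 < d%:R :> R by rewrite ltr0n.
have z0 A (L : Grm R n) : (0 <= (zcount p A L)%:E)%E by rewrite lee_fin zcountE.
split.
- rewrite /muP (_ : (\int[vol]_L _)%E = 0%E) ?mule0//.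
  under eq_integral do rewrite zcountE.
  rewrite (_ : (fun L : Grm R n => _) = cst 0%E) ?integral0//; apply/funext => L /=.
  rewrite /zc (eq_count (a2 := pred0)) ?count_pred0// => x; apply/asboolP; by case.
- move=> A mA; apply: mule_ge0; first by rewrite lee_fin invr_ge0 ltW.
  by apply: integral_ge0 => L _; exact: z0.
- move=> F mF tF mU; rewrite /muP.
  rewrite (_ : (fun N => _) = (fun N => (d%:R^-1)%:E * \sum_(0 <= i < N) \int[vol]_L (zcount p (F i) L)%:E)%E); last first.
    by apply/funext => N; rewrite ge0_sume_distrr// => i _; apply: integral_ge0 => L _; exact: z0.
  apply: cvgeZl => //.
  have -> : (\int[vol]_L (zcount p (\bigcup_k F k) L)%:E = \sum_(0 <= i <oo) \int[vol]_L (zcount p (F i) L)%:E)%E.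
    rewrite -integral_nneseries//; last by move=> i; exact: zcount_measurable.
    apply: eq_integral => L _; apply/esym/cvg_lim => //.
    have [N0 HN] := zc_bigcup p L tF.
    apply: cvg_near_cst; exists N0 => // N /= hN.
    by rewrite sumEFin big_mkord; congr (_%:E); under eq_bigr do rewrite zcountE; rewrite zcountE -natr_sum HN.
  apply: is_cvg_nneseries => i _ _; apply: integral_ge0 => L _; exact: z0.
- rewrite /muP (_ : (\int[vol]_L _ = (d%:R)%:E)%E); first by rewrite -EFinM mulVf// gt_eqF.
  have aG : (vol (~` G) = 0)%E by rewrite probability_setC// vG subee.
  transitivity (\int[vol]_L (cst (d%:R)%:E L))%E; last by rewrite integral_cst//= probability_setT mule1.
  apply: ae_eq_integral => //; first exact: zcount_measurable.
  exists (~` G); split => //; first exact: measurableC.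
  move=> L /= nL hG; apply: nL => _; rewrite zcountE /zc (eq_count (a2 := predT)) ?count_predT ?(HG L hG)// => x.
  exact/asboolP.
Qed.
End ZeroCounts.
(** * Tubes in the Grassmannian *)

Section Rotations.
Variables (R : realType) (n : nat).
Notation C := (R[i]).
Notation nrm := (@ComplexField.Normc.normc R).
Notation vec := ('rV[C]_(n.+2)).
Implicit Types (u v w z x : vec) (L M : Gr R n.+1) (U : 'M[C]_(n.+2)).

Definition cjm k l (A : 'M[C]_(k, l)) : 'M[C]_(k, l) := map_mx Num.conj A.

Lemma cinner_mx u v : cinner u v = (cjm u *m v^T) 0 0.
Proof. by rewrite mxE; apply: eq_bigr => j _; rewrite !mxE. Qed.

Lemma cjmM k l r (A : 'M[C]_(k, l)) (B : 'M[C]_(l, r)) : cjm (A *m B) = cjm A *m cjm B.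
Proof. exact: map_mxM. Qed.

Lemma cjmT k l (A : 'M[C]_(k, l)) : cjm A^T = (cjm A)^T.
Proof. by rewrite /cjm map_trmx. Qed.

Lemma cjmK k l (A : 'M[C]_(k, l)) : cjm (cjm A) = A.
Proof. by apply/matrixP => i j; rewrite !mxE; exact: conjCK. Qed.

Lemma unitary_cj U : unitary U -> cjm U *m U^T = 1%:M.
Proof.
rewrite /unitary -/(cjm U) => /(congr1 (@cjm _ _)); rewrite cjmM cjmT cjmK => ->.
by apply/matrixP => i j; rewrite !mxE rmorph_nat.
Qed.

Lemma unitary_trl U : unitary U -> (cjm U)^T *m U = 1%:M.
Proof. exact: mulmx1C. Qed.

Lemma cnorm_unitary U x : unitary U -> cnorm (x *m U) = cnorm x.
Proof.
move=> /unitary_cj H; rewrite /cnorm !cinner_mx cjmM trmx_mul mulmxA.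
by rewrite -[cjm x *m cjm U *m _]mulmxA H mulmx1.
Qed.

Definition householder (k : C) w : 'M[C]_(n.+2) := 1%:M - k *: ((cjm w)^T *m w).

Lemma householder_unitary w : unitary (householder (2 / (cnorm w ^+ 2)%:C%C) w).
Proof.
set k := 2 / _; have kr : k^* = k.
  by rewrite /k rmorphM fmorphV/= conjC_nat; congr (_ / _); exact: conjc_real.
have ct : (cjm (householder k w))^T = householder k w.
  rewrite /householder /cjm map_mxB map_mxZ -/(cjm _) linearB linearZ/= kr; congr (_ - _ *: _).
    by apply/matrixP => i j; rewrite !mxE rmorph_nat eq_sym.
  by rewrite -/(cjm ((cjm w)^T *m w)) cjmM cjmT cjmK trmx_mul trmxK.
rewrite /unitary -/(cjm _) ct /householder mulmxBl mul1mx mulmxBr mulmx1 -scalemxAl -scalemxAr.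
have -> : (cjm w)^T *m w *m ((cjm w)^T *m w) = (cnorm w ^+ 2)%:C%C *: ((cjm w)^T *m w).
  rewrite mulmxA -[(cjm w)^T *m w *m _]mulmxA.
  have -> : w *m (cjm w)^T = ((cnorm w ^+ 2)%:C%C)%:M.
    apply/matrixP => i j; rewrite (ord1 i) (ord1 j) -cinner_cnorm cinner_mx [RHS]mxE eqxx mulr1n mxE [RHS]mxE.
    by apply: eq_bigr => l _; rewrite !mxE mulrC.
  by rewrite mul_mx_scalar -scalemxAl.
rewrite !scalerA; have [w0|w0] := eqVneq w 0.
  by rewrite w0 mulmx0 !scaler0 !subr0.
have c0 : (cnorm w ^+ 2)%:C%C != 0 :> C by rewrite -nrm_eq0 nrmR normr_eq0 expf_neq0// cnorm_eq0.
have kc : k * (cnorm w ^+ 2)%:C%C = 2 by rewrite /k divfK.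
have -> : k * k * (cnorm w ^+ 2)%:C%C = k + k by rewrite -mulrA kc mulr_natr.
rewrite scalerDl; set Y := k *: _; have -> : Y - (Y + Y) = - Y by rewrite opprD addrA subrr add0r.
by rewrite opprK subrK.
Qed.

Lemma householderE k w x : x *m householder k w = x - (k * cinner w x) *: w.
Proof.
rewrite /householder mulmxBr mulmx1 -scalemxAr mulmxA; congr (_ - _).
have -> : x *m (cjm w)^T = (cinner w x)%:M.
  apply/matrixP => i j; rewrite (ord1 i) (ord1 j) cinner_mx [RHS]mxE eqxx mulr1n mxE [RHS]mxE.
  by apply: eq_bigr => l _; rewrite !mxE mulrC.
by rewrite mul_scalar_mx scalerA.
Qed.

(** A reflection exchanges two unit vectors when their inner product is real; the phase c achieves
    this. *)
Lemma unit_transitive u v : cnorm u = 1 -> cnorm v = 1 ->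
  exists U (c : C), [/\ unitary U, nrm c = 1 & u *m U = c *: v].
Proof.
move=> u1 v1; pose a := cinner v u.
have [c c1 ca] : exists2 c : C, nrm c = 1 & exists r : R, c^* * a = r%:C%C.
  have [a0|a0] := eqVneq a 0; first by exists 1; rewrite ?nrm1//; exists 0; rewrite a0 mulr0.
  have na : nrm a != 0 by rewrite nrm_eq0.
  exists (a / (nrm a)%:C%C); first by rewrite nrmM nrmV nrmR ger0_norm ?nrm_ge0// mulfV.
  exists (nrm a); rewrite rmorphM fmorphV/= mulrAC mul_conjC.
  have -> : ((nrm a)%:C%C)^* = (nrm a)%:C%C :> C by exact: conjc_real.
  by rewrite -fmorphV -rmorphM/=; congr (_%:C%C); rewrite expr2 mulfK.
case: ca => r cr; set b := c *: v; have b1 : cnorm b = 1 by rewrite cnormZ c1 v1 mulr1.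
have br : cinner b u = r%:C%C by rewrite /b cinnerZl.
have rb : cinner u b = r%:C%C by rewrite cinnerC br; exact: conjc_real.
pose w := u - b; exists (householder (2 / (cnorm w ^+ 2)%:C%C) w), c; split => //; first exact: householder_unitary.
rewrite householderE -/b.
have [w0|w0] := eqVneq w 0.
  by rewrite w0 scaler0 subr0; apply/eqP; rewrite -subr_eq0 -/w w0.
have Ew : cinner w u = 1 - r%:C%C.
  by rewrite /w -[- b]scaleN1r cinnerDl cinnerZl cinner_cnorm u1 expr1n br rmorphN/= conjC1 mulN1r.
have Ew2 : (cnorm w ^+ 2)%:C%C = 2 * (1 - r%:C%C) :> C.
  rewrite -cinner_cnorm {2}/w -[- b]scaleN1r cinnerDr cinnerZr Ew /w -[- b]scaleN1r cinnerDl cinnerZl rb cinner_cnorm b1 expr1n.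
  by rewrite rmorphN/= conjC1 !mulN1r; ring.
have c0 : (cnorm w ^+ 2)%:C%C != 0 :> C by rewrite -nrm_eq0 nrmR normr_eq0 expf_neq0// cnorm_eq0.
rewrite Ew; have -> : 2 / (cnorm w ^+ 2)%:C%C * (1 - r%:C%C) = 1 by rewrite mulrAC -Ew2 mulfV.
by rewrite scale1r /w opprB addrC subrK.
Qed.

Definition Enear (e : vec) (del : R) : set (Grm R n) := [set L | exists2 u, gr_set L u & cnorm (u - e) < del].

Lemma Enear_measurable e del : measurable (Enear e del).
Proof.
apply: gr_open_measurable => L [u Lu hu].
have h : 0 < del - cnorm (u - e) by rewrite subr_gt0.
have [d1 d10 H] := gr_near Lu h; exists d1 => // M /H[w Mw hw]; exists w => //.
by have := cnorm_tri w u e; rewrite [cnorm (w - u)]cnormB; lra.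
Qed.

Lemma Enear_phase (c : C) e del : nrm c = 1 -> Enear (c *: e) del = Enear e del.
Proof.
have key (c' : C) e' L : nrm c' = 1 -> Enear e' del L -> Enear (c' *: e') del L.
  move=> c1 [u Lu hu]; exists (c' *: u); first exact: gr_setZ.
  by rewrite -scalerBr cnormZ c1 mul1r.
move=> c1; have c0 : c != 0 by rewrite -nrm_eq0 c1 oner_eq0.
apply/seteqP; split => L; last exact: key.
move=> /(key c^-1); rewrite nrmV c1 invr1 scalerA mulVf// scale1r; exact.
Qed.

Lemma Enear_rot U e del : unitary U ->
  [set L : Grm R n | exists M : Gr R n.+1, Enear (e *m U) del M /\ gr_set M = [set v *m U | v in gr_set L]] = Enear e del.
Proof.
move=> uU; have V1 := unitary_trl uU; apply/seteqP; split => L.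
  move=> [M [[u Mu hu] EL]]; move: Mu hu; rewrite EL => -[v Lv <-] hu; exists v => //.
  by rewrite -(cnorm_unitary _ uU) mulmxBl.
move=> [u Lu hu].
have [a [b [ind EL]]] := lbasis_exists L.
have ind' : cindep (a *m U) (b *m U).
  move=> s r; rewrite !scalemxAl -mulmxDl => /(congr1 (mulmx^~ (cjm U)^T)).
  by rewrite mul0mx -mulmxA uU mulmx1 => /ind.
pose M := MkGr (ex_intro _ (a *m U) (ex_intro _ (b *m U) (conj ind' erefl))).
have ME : gr_set M = [set v *m U | v in gr_set L].
  apply/seteqP; split => v; first by move=> [s [r ->]]; exists (s *: a + r *: b); [rewrite EL; exists s, r|rewrite mulmxDl !scalemxAl].
  by rewrite EL => -[_ [s [r ->]] <-]; exists s, r; rewrite mulmxDl !scalemxAl.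
exists M; split => //; exists (u *m U); first by rewrite ME; exists u.
by rewrite -mulmxBl cnorm_unitary.
Qed.

Lemma vol_Enear (vol : probability (Grm R n) R) e e' del : gr_invariant vol -> cnorm e = 1 -> cnorm e' = 1 ->
  vol (Enear e del) = vol (Enear e' del).
Proof.
move=> inv e1 e1'; have [U [c [uU c1 E]]] := unit_transitive e1 e1'.
rewrite -(Enear_phase e' del c1) -E -(Enear_rot e del uU) inv//; exact: Enear_measurable.
Qed.
End Rotations.

Section CountingMeasure.
Context (dd : measure_display) (X : measurableType dd) (R : realType) (P : probability X R).

Lemma sum_prob_count (T : finType) (S : {set T}) (E : T -> set X) : (forall t, measurable (E t)) ->
  (\int[P]_x ((\sum_(t in S) `[< E t x >])%N%:R)%:E)%E = (\sum_(t in S) fine (P (E t)))%:E.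
Proof.
move=> mE; rewrite -sumEFin.
transitivity (\int[P]_x \sum_(t in S) (\1_(E t) x)%:E)%E.
  apply: eq_integral => x _; rewrite natr_sum -sumEFin; apply: eq_bigr => t _.
  by rewrite indicE; congr ((_%:R)%:E); congr nat_of_bool; apply/asboolP/idP => [|]; rewrite inE.
under eq_integral do rewrite -big_enum/=.
rewrite ge0_integral_sum//; last by move=> t; apply/measurable_EFinP; exact: measurable_indic.
rewrite -[RHS]big_enum/=; apply: eq_bigr => t _; rewrite integral_indic// setIT fineK// fin_num_measure//.
Qed.

Lemma count_measurable (T : finType) (S : {set T}) (E : T -> set X) : (forall t, measurable (E t)) ->
  mfib (fun x => (\sum_(t in S) `[< E t x >])%N).
Proof.
move=> mE; have H (s : seq T) : mfib (fun x => (\sum_(t <- s | t \in S) `[< E t x >])%N).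
  elim: s => [|t s IH].
    by rewrite (_ : (fun _ => _) = fun=> 0%N); [exact: mfib_cst|apply/funext => x; rewrite big_nil].
  rewrite (_ : (fun _ => _) = (fun x => ((if t \in S then `[< E t x >] : nat else 0) + \sum_(t <- s | t \in S) `[< E t x >])%N)).
    apply: (@mfib2 _ _ nat nat nat (fun x => if t \in S then `[< E t x >] : nat else 0%N) _ addn) => //; case: (t \in S); last exact: mfib_cst.
    apply: mfib_levels => -[|k].
      rewrite (_ : [set x | _] = E t)//; apply/seteqP; split => x /=; first by rewrite lt0b => /asboolP.
      by move=> h; rewrite lt0b; apply/asboolP.
    by rewrite (_ : [set x | _] = set0)//; apply/seteqP; split => x //=; case: asboolP.
  by apply/funext => x; rewrite big_cons; case: ifP.
exact: H.
Qed.

Lemma sum_prob_le (T : finType) (S : {set T}) (E : T -> set X) (k : R) : (forall t, measurable (E t)) ->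
  (forall x, (\sum_(t in S) `[< E t x >])%N%:R <= k) -> \sum_(t in S) fine (P (E t)) <= k.
Proof.
move=> mE H; rewrite -lee_fin -(sum_prob_count _ mE).
apply: (@le_trans _ _ (\int[P]_x (cst k%:E x))%E); last by rewrite integral_cst//= probability_setT mule1.
apply: ge0_le_integral => //.
- exact: (mfib_measurable (fun k : nat => (k%:R : R)%:E) (count_measurable S mE)).
- by move=> x _; rewrite lee_fin.
Qed.

Lemma markov_count (T : finType) (S : {set T}) (E : T -> set X) (k : R) : (forall t, measurable (E t)) -> 0 <= k ->
  measurable [set x | k <= (\sum_(t in S) `[< E t x >])%N%:R] /\
  k * fine (P [set x | k <= (\sum_(t in S) `[< E t x >])%N%:R]) <= \sum_(t in S) fine (P (E t)).
Proof.
move=> mE k0; set B := [set x | _].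
have mB : measurable B.
  by have := @mfib_preimage _ X nat _ [set j : nat | k <= j%:R] (count_measurable S mE).
split => //; rewrite -lee_fin -(sum_prob_count _ mE).
have -> : (k * fine (P B))%:E = (\int[P]_x (k * \1_B x)%:E)%E.
  under eq_integral do rewrite EFinM.
  rewrite ge0_integralZl//; last 1 first.
  - by apply/measurable_EFinP; exact: measurable_indic.
  by rewrite integral_indic// setIT EFinM fineK// fin_num_measure.
apply: ge0_le_integral => //.
- by move=> x _; rewrite lee_fin mulr_ge0.
- by apply/measurable_EFinP; apply: measurable_funM => //; exact: measurable_indic.
- exact: (mfib_measurable (fun k : nat => (k%:R : R)%:E) (count_measurable S mE)).
- move=> x _; rewrite lee_fin indicE; have [h|h] := boolP (x \in B); last by rewrite mulr0.
  by rewrite mulr1; move: h; rewrite inE.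
Qed.
End CountingMeasure.
Lemma card_bigcup_le (I T : finType) (F : I -> {set T}) k : (forall i, #|F i| <= k)%N -> (#|(\bigcup_i F i)%SET| <= #|I| * k)%N.
Proof.
move=> H; rewrite -sum_nat_const; elim/big_rec2: _ => [|i x y _ IH]; first by rewrite cards0.
by rewrite (leq_trans (leq_card_setU _ _).1)// leq_add.
Qed.

(** * Coverings from bounded variation, and complex grids *)

Section Covering.
Variable R : realType.
Notation C := (R[i]).
Notation nrm := (@ComplexField.Normc.normc R).

(** v(t) is the supremum of the sums over partitions of [0, t]; appending t' to a partition gives
    superadditivity. It serves for the covering below and, applied to Riesz terms, for
    [Rbound_density]. *)
Lemma path_variation (D : R -> R -> R) (V : R) : (forall x y, 0 <= D x y) ->
  (forall x s, path <%R x s -> 0 <= x -> last x s <= 1 -> vsum D x s <= V) ->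
  exists v : R -> R, [/\ forall t, 0 <= t <= 1 -> 0 <= v t, forall t, 0 <= t <= 1 -> v t <= V &
    forall t t', 0 <= t -> t < t' -> t' <= 1 -> v t + D t t' <= v t'].
Proof.
move=> D0 HV.
pose S t : set R := [set vsum D 0 s | s in [set s | path <%R 0 s /\ last 0 s = t]].
pose v t := sup (S t).
have SV t : 0 <= t <= 1 -> ubound (S t) V.
  by move=> /andP[t0 t1] _ [s [ps ls] <-]; apply: HV; rewrite ?ls.
have S0 t : 0 <= t <= 1 -> S t !=set0.
  move=> /andP[]; rewrite le_eqVlt => /orP[/eqP <- _|t0 _]; first by exists 0, [::].
  by exists (vsum D 0 [:: t]), [:: t] => //=; rewrite t0.
have vg x s : 0 <= vsum D x s by elim: s x => //= y s IH x; rewrite addr_ge0.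
have v0 t : 0 <= t <= 1 -> 0 <= v t.
  move=> h; have [x Sx] := S0 t h; apply: le_trans (ub_le_sup _ Sx); last by exists V; exact: SV.
  by case: Sx => s _ <-; exact: vg.
have vV t : 0 <= t <= 1 -> v t <= V by move=> h; apply: ge_sup; [exact: S0|exact: SV].
have vm t t' : 0 <= t -> t < t' -> t' <= 1 -> v t + D t t' <= v t'.
  move=> t0 tt t1; have h : 0 <= t <= 1 by rewrite t0 (le_trans (ltW tt)).
  have h' : 0 <= t' <= 1 by rewrite t1 (le_trans t0 (ltW tt)).
  rewrite -lerBrDr; apply: ge_sup; first exact: S0.
  move=> _ [s [ps ls] <-]; rewrite lerBrDr; apply: ub_le_sup; first by exists V; exact: SV.
  exists (rcons s t'); first by split; rewrite ?rcons_path ?ps ?last_rcons ?ls.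
  have vr x r : vsum D x (rcons r t') = vsum D x r + D (last x r) t'.
    by elim: r x => [|y r IH] x /=; rewrite ?addr0 ?add0r// IH addrA.
  by rewrite vr ls.
by exists v; split.
Qed.

(** Times are grouped by the integer part of v / eta. Within a group the values of v differ by less
    than eta, hence so do the D-distances; one representative per group gives the list. *)
Lemma variation_cover (D : R -> R -> R) (V eta : R) : (forall x y, 0 <= D x y) -> 0 <= V -> 0 < eta ->
  (forall x s, path <%R x s -> 0 <= x -> last x s <= 1 -> vsum D x s <= V) ->
  exists ts : seq R, [/\ (size ts <= (Num.trunc (V / eta)).+1)%N, {in ts, forall t, 0 <= t <= 1} &
    forall t, 0 <= t <= 1 -> exists2 t', t' \in ts & t = t' \/ D t t' < eta \/ D t' t < eta].
Proof.
move=> D0 V0 e0 HV.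
have [v [v0 vV vm]] := path_variation D0 HV.
pose K := Num.trunc (V / eta).
have Hf i : exists t, 0 <= t <= 1 /\ ((exists t', 0 <= t' <= 1 /\ Num.trunc (v t' / eta) = i) -> Num.trunc (v t / eta) = i).
  have [[t [t1 t2]]|h] := pselect (exists t', 0 <= t' <= 1 /\ Num.trunc (v t' / eta) = i); first by exists t.
  by exists 0; rewrite lexx ler01.
have [f Hf'] := choice Hf.
exists [seq f i | i <- iota 0 K.+1]; split; first by rewrite size_map size_iota.
  by move=> _ /mapP[i _ ->]; case: (Hf' i).
move=> t t01; pose i := Num.trunc (v t / eta).
have p0 t' : 0 <= t' <= 1 -> 0 <= v t' / eta by move=> /v0 h; rewrite divr_ge0// ltW.
have iK : (i <= K)%N.
  by rewrite /i /K le_truncn// ler_pM2r ?invr_gt0// vV.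
exists (f i); first by apply/mapP; exists i => //; rewrite mem_iota add0n ltnS.
have [f01 fi] := Hf' i; have {}fi := fi (ex_intro _ t (conj t01 erefl)).
have /andP[a1 a2] := Num.Theory.truncn_itv (p0 t t01).
have /andP[b1 b2] := Num.Theory.truncn_itv (p0 (f i) f01).
rewrite fi in b1 b2; rewrite -/i in a1 a2.
rewrite ler_pdivlMr// in a1; rewrite ler_pdivlMr// in b1; rewrite ltr_pdivrMr// in a2; rewrite ltr_pdivrMr// in b2.
rewrite -natr1 in a2 b2.
case/andP: (t01) => t0 t1; case/andP: (f01) => f0 f1.
have [lt|lt|->] := ltgtP t (f i); last by left.
  by right; left; have := vm t (f i) t0 lt f1; lra.
by right; right; have := vm (f i) t f0 lt t1; lra.
Qed.

Lemma card_interval (K : nat) (x c : R) : 0 <= c -> (#|finset (fun a : 'I_K => (`|(a : nat)%:R - x| <= c)%R)| <= (Num.trunc (2 * c)).+1)%N.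
Proof.
move=> c0; set A := finset _.
have [->|[a0 Aa0]] := set_0Vmem A; first by rewrite cards0.
case: (arg_minnP (fun a : 'I_K => a : nat) Aa0) => a1 Aa1 Hmin.
pose f (a : 'I_K) : 'I_(Num.trunc (2 * c)).+1 := inord (a - a1).
have key a : a \in A -> (a - a1 <= Num.trunc (2 * c))%N.
  move=> Aa; have h := Hmin a Aa; move: Aa (Aa1 : a1 \in A); rewrite !inE => Aa Aa1'.
  rewrite -ltnS -(ltr_nat R); have c20 : 0 <= 2 * c by rewrite mulr_ge0.
  have /andP[_ h2] := Num.Theory.truncn_itv c20; apply: le_lt_trans h2; rewrite natrB//.
  by move: Aa Aa1'; rewrite !ler_norml; lra.
rewrite -(card_in_imset (f := f)) => [|a b Aa Ab /(congr1 val)/=].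
  by rewrite (leq_trans (max_card _))// card_ord.
rewrite !inordK ?ltnS ?key// => E; apply: val_inj => /=.
by rewrite -(subnK (Hmin a Aa)) -(subnK (Hmin b Ab)) E.
Qed.

(** The grid of mesh 1 / M in the square of side 10 centred at 0. *)
Definition gv (M : nat) (ab : 'I_(10 * M).+1 * 'I_(10 * M).+1) : C :=
  ((ab.1 : nat)%:R / M%:R - 5)%:C%C + 'i%C * ((ab.2 : nat)%:R / M%:R - 5)%:C%C.

Lemma Re_gv M ab : complex.Re (@gv M ab) = (ab.1 : nat)%:R / M%:R - 5.
Proof. by rewrite /gv /= !mul0r mul1r !subr0 addr0. Qed.
Lemma Im_gv M ab : complex.Im (@gv M ab) = (ab.2 : nat)%:R / M%:R - 5.
Proof. by rewrite /gv /= !mul0r mul1r !add0r. Qed.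

Lemma card_disc (M : nat) (z : C) (c : R) : (0 < M)%N -> 0 <= c ->
  (#|finset (fun ab => (nrm (@gv M ab - z) <= c / M%:R)%R)| <= (Num.trunc (2 * c)).+1 * (Num.trunc (2 * c)).+1)%N.
Proof.
move=> M0 c0; have M0' : 0 < M%:R :> R by rewrite ltr0n.
pose I (x : R) : {set 'I_(10 * M).+1} := finset (fun a : 'I_(10 * M).+1 => `|(a : nat)%:R - (x + 5) * M%:R| <= c).
have sub : finset (fun ab => nrm (@gv M ab - z) <= c / M%:R) \subset finset.setX (I (complex.Re z)) (I (complex.Im z)).
  apply/fintype.subsetP => -[a b]; rewrite finset.in_setX !inE /= => h.
  have key (t x : R) : `|t / M%:R - 5 - x| <= c / M%:R -> `|t - (x + 5) * M%:R| <= c.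
    rewrite ler_pdivlMr// -[X in _ * X](ger0_norm (ltW M0')) -normrM.
    by rewrite (_ : (t / M%:R - 5 - x) * M%:R = t - (x + 5) * M%:R)//; field; rewrite gt_eqF.
  apply/andP; split; apply: key.
    have := le_trans (nrm_Re _) h; rewrite -[complex.Re _]/(part false _) partB /part Re_gv; exact.
  have := le_trans (nrm_Im _) h; rewrite -[complex.Im _]/(part true _) partB /part Im_gv; exact.
by rewrite (leq_trans (subset_leq_card sub))// cardsX leq_mul// card_interval.
Qed.

Lemma gv_round (M : nat) (z : C) : (0 < M)%N -> nrm z <= 5 -> exists ab, nrm (@gv M ab - z) <= 2 / M%:R.
Proof.
move=> M0 z5; have M0' : 0 < M%:R :> R by rewrite ltr0n.
have key (x : R) : `|x| <= 5 -> exists a : 'I_(10 * M).+1, `|(a : nat)%:R / M%:R - 5 - x| <= 1 / M%:R.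
  rewrite ler_norml => /andP[x1 x2].
  have p0 : 0 <= (x + 5) * M%:R by rewrite mulr_ge0//; lra.
  have /andP[h1 h2] := Num.Theory.truncn_itv p0; rewrite -[X in _ < X]natr1 in h2.
  have hk : (Num.trunc ((x + 5) * M%:R) < (10 * M).+1)%N.
    rewrite ltnS -(ler_nat R) natrM (le_trans h1)// ler_wpM2r//; lra.
  exists (Ordinal hk) => /=; rewrite ler_pdivlMr// -[X in _ * X](ger0_norm (ltW M0')) -normrM.
  rewrite (_ : (_ / _ - 5 - x) * _ = (Num.trunc ((x + 5) * M%:R))%:R - (x + 5) * M%:R); last by field; rewrite gt_eqF.
  by rewrite ler_norml; lra.
have [a Ha] := key _ (le_trans (nrm_Re z) z5); have [b Hb] := key _ (le_trans (nrm_Im z) z5).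
exists (a, b); rewrite (le_trans (nrm_le_ReIm _))//.
rewrite -[complex.Re _]/(part false _) -[complex.Im _]/(part true _) !partB /part Re_gv Im_gv.
by rewrite (_ : 2 / M%:R = 1 / M%:R + 1 / M%:R :> R) ?lerD//; ring.
Qed.

Lemma gv_le M ab : (0 < M)%N -> nrm (@gv M ab) <= 10.
Proof.
move=> M0; have M0' : 0 < M%:R :> R by rewrite ltr0n.
have key (a : 'I_(10 * M).+1) : `|(a : nat)%:R / M%:R - 5 : R| <= 5.
  have h : (a : nat)%:R / M%:R <= 10 :> R by rewrite ler_pdivrMr// -natrM ler_nat -ltnS.
  have h0 : 0 <= (a : nat)%:R / M%:R :> R by rewrite divr_ge0.
  by rewrite ler_norml; lra.
rewrite (le_trans (nrm_le_ReIm _))// Re_gv Im_gv.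
by have := key ab.1; have := key ab.2; lra.
Qed.
End Covering.

(** * Small values along a pencil *)

Section PencilTube.
Variables (R : realType) (n d : nat).
Hypothesis d0 : (0 < d)%N.
Notation C := (R[i]).
Notation nrm := (@ComplexField.Normc.normc R).
Notation vec := ('rV[C]_(n.+1)).
Implicit Types (u v w : vec) (p : R -> hpoly R n d).

Lemma pn_pline_mon (B : R) : 1 <= B -> exists2 E : R, 0 <= E & forall u v (a : mon n d), cnorm u <= B -> cnorm v <= B ->
  pn (\prod_(j < n.+1) ((u 0 j)%:P + (v 0 j)%:P * 'X) ^+ (val a j : nat)) <= E.
Proof.
move=> B1; pose B2 := B + B; have B21 : 1 <= B2 by rewrite /B2; lra.
have B20 : 0 <= B2 := le_trans ler01 B21.
exists ((B2 ^+ d) ^+ (size (index_enum 'I_n.+1))); first by rewrite !exprn_ge0.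
move=> u v a hu hv; apply: pn_prod => j.
have lin : pn ((u 0 j)%:P + (v 0 j)%:P * 'X) <= B2.
  rewrite (le_trans (pnD _ _))// /B2 lerD ?pnC ?(le_trans (nrm_le_cnorm _ _))//.
  rewrite mul_polyC pnZ; have := nrm_le_cnorm v j; have := pnX1 R; have := nrm_ge0 (v 0 j) => h0 h1 h2.
  by have := ler_wpM2l h0 h1; lra.
have ad : (val a j <= d)%N by rewrite -ltnS.
rewrite -[X in pn X](_ : \prod_(i <- nseq (val a j) tt) ((u 0 j)%:P + (v 0 j)%:P * 'X) = _); last first.
  by rewrite big_const_seq count_predT size_nseq iter_mulr_1.
by rewrite (le_trans (@pn_prod R _ _ _ B2 _))// ?size_nseq ?ler_weXn2l.
Qed.

Lemma pline_TT s (A0 B : R) : 0 <= A0 -> 1 <= B -> exists2 A' : R, 0 <= A' & forall p u v t, cnorm u <= B -> cnorm v <= B ->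
  (forall a, TT s A0 t (fun x => (p x a)%:P)) -> TT s A' t (fun x => pline (p x) u v).
Proof.
move=> A00 B1; have [E E0 HE] := pn_pline_mon B1.
exists (\sum_(i < #|{: mon n d}|) E * A0); first by apply: sumr_ge0 => i _; rewrite mulr_ge0.
move=> p u v t hu hv H.
pose Q (a : mon n d) : {poly C} := \prod_(j < n.+1) ((u 0 j)%:P + (v 0 j)%:P * 'X) ^+ (val a j : nat).
rewrite (_ : (fun x => _) = (fun x => \sum_(i < #|{: mon n d}|) (p x (enum_val i))%:P * Q (enum_val i))).
  apply: TT_sum => i; apply: (TT_lin (Lm := fun F : {poly C} => F * Q (enum_val i))) (H (enum_val i)) => //.
  - by move=> F G; rewrite mulrDl.
  - by move=> a F; rewrite scalerAl.
  - by move=> F; rewrite (le_trans (pnM _ _))// mulrC ler_wpM2r ?pn_ge0// HE.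
apply/funext => x; rewrite /pline (reindex_onto enum_val enum_rank)/=; last by move=> a _; rewrite enum_rankK.
by under eq_bigl do rewrite enum_valK eqxx; apply: eq_bigr => i _; rewrite mul_polyC.
Qed.

(** Along w + x O the form is p_t(O) times a monic polynomial in x, so a small value puts x near a
    root. The root curves have bounded total variation, by [roots_Rbound] with exponent 1, so they
    are covered by O(1 / eta) discs of radius O(eta), each with O((eta M)^2) grid points. The
    constant is uniform in w. *)
Lemma pencil_tube (A0 W0 c : R) : 0 <= A0 -> 1 <= W0 -> 0 < c -> exists2 C4 : nat -> R, (forall k, 0 <= C4 k) & forall p (O : vec) w (k : nat) (eta : R) (M : nat),
  (forall t a, 0 <= t <= 1 -> TT (4 * d) A0 t (fun x => (p x a)%:P)) ->
  cnorm O <= W0 -> (forall t, 0 <= t <= 1 -> c <= nrm (peval (p t) O)) -> cnorm w <= W0 ->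
  0 < eta <= 1 -> 1 <= eta * M%:R ->
  #|finset (fun ab => `[< exists2 t, 0 <= t <= 1 & nrm (peval (p t) (w + @gv R M ab *: O)) <= k%:R * c * eta ^+ d >])|%:R <= C4 k * (eta * M%:R ^+ 2).
Proof.
move=> A00 W01 c0; have [A' A'0 HA'] := pline_TT (4 * d) A00 W01.
have [A2 HA2] := TT_inv (4 * d) A' c0.
have q1 : (1 : R) <= 1 by [].
have qd : (1 : R) * ((4 * d)%:R - 1) < (4 * d)%:R by rewrite mul1r gtrBl.
have [V0 V00 HV] := roots_Rbound d0 q1 qd (2 ^+ (4 * d) * (A2 * A')) (leqnn d).
pose V := 1 + V0; have V1 : 1 <= V by rewrite lerDl.
exists (fun k => (V + 1) * d%:R * (2 * (k%:R + 2) + 1) ^+ 2).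
  by move=> k; rewrite !mulr_ge0 ?exprn_ge0 ?addr_ge0 ?mulr_ge0//; lra.
move=> p O w k eta M HT hO HO hw /andP[e0 e1] eM.
have M0' : 0 < M%:R :> R.
  by rewrite lt_neqAle ler0n andbT; apply/eqP => h; move: eM; rewrite -h mulr0 ler10.
have M0 : (0 < M)%N by rewrite -(ltr_nat R).
have HF t : exists r : seq C, size r = d /\ (0 <= t <= 1 -> pline (p t) w O = peval (p t) O *: Pr r).
  have [t01|nt] := boolP (0 <= t <= 1); last by exists (nseq d 0); rewrite size_nseq.
  have pO : peval (p t) O != 0 by rewrite -nrm_gt0 (lt_le_trans c0)// HO.
  by have [r h1 h2] := pline_factor w pO; exists r.
have [rs Hrs] := choice HF.
have szr t : size (rs t) = d by case: (Hrs t).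
have HTr t : 0 <= t <= 1 -> TT (4 * d) (2 ^+ (4 * d) * (A2 * A')) t (fun x => Pr (rs x)).
  move=> t01; have T1 := HA' p w O t hw hO (fun a => HT t a t01).
  have T2 : TT (4 * d) A' t (fun x => (peval (p x) O)%:P).
    by have := TT_coef d T1; apply: TT_ext => // x x01; rewrite (pline_top (p x) w O).2.
  have := TT_mul t01 (HA2 t _ t01 HO T2) T1; apply: TT_ext => // x x01.
  rewrite (Hrs x).2// mul_polyC scalerA mulVf ?scale1r//.
  by rewrite -nrm_gt0 (lt_le_trans c0)// HO.
have HR := HV rs szr HTr.
have D0 x y : 0 <= rdist rs x y by exact: bdist_ge0.
have Hvs x s : path <%R x s -> 0 <= x -> last x s <= 1 -> vsum (rdist rs) x s <= V.
  by move=> ps x0 ls; rewrite (le_trans (vsum_le q1 D0 HR ps x0 ls))// /V; lra.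
have [ts [sts ts01 Hts]] := variation_cover D0 (le_trans ler01 V1) e0 Hvs.
pose Z := flatten [seq rs t | t <- ts].
have sZ : (size Z <= (Num.trunc (V / eta)).+1 * d)%N.
  rewrite /Z size_flatten /shape -map_comp sumnE big_map; apply: leq_trans (_ : \sum_(t <- ts) d <= _)%N.
    by apply: leq_sum => t _; rewrite /= szr.
  by rewrite big_const_seq count_predT iter_addn_0 mulnC leq_mul2r sts orbT.
have HZ t la : 0 <= t <= 1 -> la \in rs t -> exists2 z, z \in Z & nrm (la - z) <= eta.
  move=> t01 lr; have [t' tt' H] := Hts t t01.
  have inZ z : z \in rs t' -> z \in Z by move=> hz; apply/flattenP; exists (rs t') => //; apply/mapP; exists t'.
  have M1 : matched (@dC R) eta (rs t) (rs t').
    case: H => [->|[H|H]].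
    - exists (rs t') => //; elim: (rs t') => //= z r ->; by rewrite /dC subrr nrm0 ltW.
    - by apply: bdist_lt => //; rewrite !szr.
    - by apply: matched_sym; [exact: dC_sym|apply: bdist_lt => //; rewrite !szr].
  have [ys py ay] := matched_sym (@dC_sym R) M1.
  have [|z hz1 hz2] := all2_mem ay (_ : la \in ys); first by rewrite -(perm_mem py).
  by exists z; [exact: inZ|rewrite nrmB].
(* A grid point with a small value is within (k + 1) eta of a root at its time t, and this root is
   within eta of a root at one of the sampled times. *)
pose r0 : R := (k%:R + 2) * eta.
pose c' : R := r0 * M%:R; have c'0 : 0 <= c' by rewrite !mulr_ge0 ?addr_ge0// ltW.
set B := finset _.
have sub : B \subset (\bigcup_(i < size Z) finset (fun ab => (nrm (@gv R M ab - nth 0 Z i) <= c' / M%:R)%R))%SET.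
  apply/fintype.subsetP => ab; rewrite inE => /asboolP[t t01 h].
  have [pE] : pline (p t) w O = peval (p t) O *: Pr (rs t) by apply: (Hrs t).2.
  have pO : c <= nrm (peval (p t) O) by exact: HO.
  have pO0 : 0 < nrm (peval (p t) O) := lt_le_trans c0 pO.
  have h1 : nrm (Pr (rs t)).[gv R ab] <= ((k%:R + 1) * eta) ^+ d.
    move: h; rewrite -pline_horner pE hornerZ nrmM => h.
    have h2 : c * nrm (Pr (rs t)).[gv R ab] <= c * (k%:R * eta ^+ d).
      apply: le_trans (_ : nrm (peval (p t) O) * nrm (Pr (rs t)).[gv R ab] <= _).
        by rewrite ler_wpM2r ?nrm_ge0.
      by apply: le_trans h _; rewrite mulrA [c * _]mulrC.
    rewrite ler_pM2l// in h2; apply: le_trans h2 _; rewrite exprMn ler_wpM2r ?exprn_ge0 ?(ltW e0)//.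
    apply: le_trans (_ : k%:R + 1 <= _); first by rewrite lerDl.
    by rewrite -[leLHS]expr1 ler_weXn2l// lerDr.
  have [la lr hla] : exists2 u, u \in rs t & nrm (gv R ab - u) <= (k%:R + 1) * eta.
    by apply: Pr_small_root; rewrite ?szr// mulr_ge0 ?addr_ge0// ltW.
  have [z zZ hz] := HZ t la t01 lr.
  have iZ : (index z Z < size Z)%N by rewrite index_mem.
  apply/finset.bigcupP; exists (Ordinal iZ) => //; rewrite inE /= nth_index//.
  have -> : gv R ab - z = (gv R ab - la) + (la - z) by rewrite addrA subrK.
  rewrite (le_trans (nrmD _ _))// /c' mulfK ?gt_eqF// /r0.
  by rewrite (_ : (k%:R + 2) * eta = (k%:R + 1) * eta + eta) ?lerD//; ring.
have cB : (#|B| <= (Num.trunc (V / eta)).+1 * d * ((Num.trunc (2 * c')).+1 * (Num.trunc (2 * c')).+1))%N.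
  apply: leq_trans (subset_leq_card sub) _; apply: leq_trans (card_bigcup_le (k := (Num.trunc (2 * c')).+1 * (Num.trunc (2 * c')).+1) _) _.
    by move=> i; exact: card_disc.
  by rewrite card_ord leq_mul2r sZ orbT.
have cB' : #|B|%:R <= ((Num.trunc (V / eta)).+1%:R * d%:R) * ((Num.trunc (2 * c')).+1%:R * (Num.trunc (2 * c')).+1%:R) :> R.
  by rewrite -!natrM ler_nat.
apply: le_trans cB' _.
have t1 : (Num.trunc (V / eta)).+1%:R <= (V + 1) / eta.
  have p0 : 0 <= V / eta by rewrite divr_ge0 ?(ltW e0)// (le_trans ler01).
  have /andP[h _] := Num.Theory.truncn_itv p0.
  have -> : (V + 1) / eta = V / eta + eta^-1 by rewrite mulrDl mul1r.
  by rewrite mulrS addrC lerD// invf_ge1.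
have t2 : (Num.trunc (2 * c')).+1%:R <= (2 * (k%:R + 2) + 1) * (eta * M%:R).
  have p0 : 0 <= 2 * c' by rewrite mulr_ge0.
  have /andP[h _] := Num.Theory.truncn_itv p0.
  have -> : (2 * (k%:R + 2) + 1) * (eta * M%:R) = 2 * c' + eta * M%:R by rewrite /c' /r0; ring.
  by rewrite mulrS addrC lerD.
set T1 := (Num.trunc (V / eta)).+1%:R in t1 *; set T2 := (Num.trunc (2 * c')).+1%:R in t2 *.
have T10 : 0 <= T1 by exact: ler0n.
have T20 : 0 <= T2 by exact: ler0n.
have -> : (V + 1) * d%:R * (2 * (k%:R + 2) + 1) ^+ 2 * (eta * M%:R ^+ 2) = ((V + 1) / eta * d%:R) * (((2 * (k%:R + 2) + 1) * (eta * M%:R)) * ((2 * (k%:R + 2) + 1) * (eta * M%:R))).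
  by field; rewrite gt_eqF.
by rewrite ler_pM ?mulr_ge0// ?ler_pM// ler_wpM2r.
Qed.
End PencilTube.

(** * Counting in finite products *)

Section FiniteProducts.
Variables (I X : finType).

Definition upd (f : {ffun I -> X}) i0 x : {ffun I -> X} := [ffun i => if i == i0 then x else f i].

(** A discrete Fubini identity: each function is [upd f i0 x] for exactly #|X| pairs (f, x). It
    turns bounds on all fibres in the direction i0 into a bound on the whole set. *)
Lemma sum_card_upd i0 (A : {set {ffun I -> X}}) :
  (\sum_(f : {ffun I -> X}) #|finset (fun x => upd f i0 x \in A)| = #|X| * #|A|)%N.
Proof.
transitivity (\sum_(f : {ffun I -> X}) \sum_(x : X) (upd f i0 x \in A))%N.
  by apply: eq_bigr => f _; rewrite -sum1_card big_mkcond/=; apply: eq_bigr => x _; rewrite inE; case: ifP.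
rewrite pair_bigA/= (reindex_onto (fun u => (upd u.1 i0 u.2, u.1 i0)) (fun u => (upd u.1 i0 u.2, u.1 i0)))/=; last first.
  move=> [f x] _ /=; rewrite ffunE eqxx; congr (_, _); apply/ffunP => i; rewrite !ffunE.
  by case: eqP => // ->.
rewrite (eq_bigl xpredT) => [|[f x]]; last first.
  rewrite ffunE eqxx -pair_eqE/= eqxx andbT; apply/eqP/ffunP => i; rewrite !ffunE; by case: eqP => // ->.
rewrite (eq_bigr (fun u : {ffun I -> X} * X => (u.1 \in A) : nat)) => [|[f x] _ /=]; last first.
  by congr (nat_of_bool (_ \in A)); apply/ffunP => i; rewrite !ffunE; case: eqP => // ->.
rewrite -(pair_bigA _ (fun f x => (f \in A) : nat))/= exchange_big/= sum_nat_const; congr (_ * _)%N.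
by rewrite -sum1_card [RHS]big_mkcond/=; apply: eq_bigr => f _; case: ifP.
Qed.

Lemma card_family_le (F : I -> {set X}) k : (forall i, #|F i| <= k)%N ->
  (#|finset (fun f : {ffun I -> X} => [forall i, f i \in F i])| <= k ^ #|I|)%N.
Proof.
move=> H; rewrite (_ : #|_| = #|family F|); last first.
  by apply: eq_card => f; rewrite inE; apply/forallP/familyP.
have G s : (foldr muln 1 [seq #|F x| | x <- s] <= k ^ size s)%N by elim: s => //= i s IH; rewrite expnS leq_mul.
by rewrite card_family [#|I|]cardE; exact: G.
Qed.
End FiniteProducts.

(** * Grid points near a line *)

Section TubeCoordinates.
Variables (R : realType) (m : nat).
Notation C := (R[i]).
Notation nrm := (@ComplexField.Normc.normc R).
Notation vec := ('rV[C]_(m.+1)).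
Implicit Types (u v w y : vec) (L : Gr R m).
Variables (O : vec) (i0 : 'I_m.+1).
Hypothesis Oi0 : O 0 i0 != 0.
Let e0 : vec := delta_mx 0 i0.
(** The linear automorphism that sends the basis vector [e0] to O and fixes the other basis vectors:
    changing the coordinate i0 of y moves [Phi y] along O. *)
Definition Phi y : vec := y + y 0 i0 *: (O - e0).
Definition Psi v : vec := v - (v 0 i0 / O 0 i0) *: (O - e0).

Lemma PhiD u v (a b : C) : Phi (a *: u + b *: v) = a *: Phi u + b *: Phi v.
Proof.
by rewrite /Phi !mxE; apply/rowP => j; rewrite !mxE; ring.
Qed.

Lemma PsiK v : Phi (Psi v) = v.
Proof.
rewrite /Phi /Psi !mxE !eqxx/= (_ : v 0 i0 - _ = v 0 i0 / O 0 i0) ?subrK//.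
by field.
Qed.

Lemma PhiK y : Psi (Phi y) = y.
Proof.
rewrite /Phi /Psi !mxE !eqxx/= (_ : _ / O 0 i0 = y 0 i0) ?addrK//.
by field.
Qed.

Lemma Phi_pencil y : Phi y = (y - y 0 i0 *: e0) + y 0 i0 *: O.
Proof. by rewrite /Phi scalerBr addrA addrAC. Qed.

Lemma Phi_bound : exists2 B : R, 1 <= B & (forall y, cnorm (Phi y) <= B * cnorm y) /\ (forall v, cnorm (Psi v) <= B * cnorm v).
Proof.
pose D := cnorm (O - e0); have D0 : 0 <= D := cnorm_ge0 _.
have n0 : 0 <= nrm (O 0 i0)^-1 by exact: nrm_ge0.
exists (1 + D + nrm (O 0 i0)^-1 * D); first by rewrite -addrA lerDl addr_ge0 ?mulr_ge0.
have hD : 0 <= nrm (O 0 i0)^-1 * D by rewrite mulr_ge0.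
split=> y; have y0 := cnorm_ge0 y; have yi := nrm_le_cnorm y i0.
  rewrite (le_trans (cnormD _ _))// cnormZ -/D.
  have h1 := ler_wpM2r D0 yi; have h2 : 0 <= nrm (O 0 i0)^-1 * D * cnorm y by rewrite mulr_ge0.
  rewrite !mulrDl mul1r [D * _]mulrC; lra.
rewrite (le_trans (cnormD _ _))// cnormN cnormZ nrmM -/D.
have h1 := ler_wpM2r hD yi; have h2 : 0 <= D * cnorm y by rewrite mulr_ge0.
rewrite !mulrDl mul1r -mulrA [nrm _^-1 * D * _]mulrC; lra.
Qed.

(* An echelon basis for a pair of coordinates maximising the absolute value of the minor has all its entries bounded by 1. *)
Lemma echelon L : exists j1 j2 (a b : vec),
  [/\ [/\ j1 != j2, gr_set L (Phi a) & gr_set L (Phi b)],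
      [/\ a 0 j1 = 1, a 0 j2 = 0, b 0 j1 = 0 & b 0 j2 = 1],
      (forall j, nrm (a 0 j) <= 1 /\ nrm (b 0 j) <= 1) &
      forall y, gr_set L (Phi y) -> y = y 0 j1 *: a + y 0 j2 *: b].
Proof.
have [u0 [v0 uv]] := lbasis_exists L.
have [u Pu] : exists u, Phi u = u0 by exists (Psi u0); exact: PsiK.
have [v Pv] : exists v, Phi v = v0 by exists (Psi v0); exact: PsiK.
pose mn (t : 'I_m.+1 * 'I_m.+1) : C := u 0 t.1 * v 0 t.2 - u 0 t.2 * v 0 t.1.
have [t0 mt0] : exists t0, mn t0 != 0.
  have [|i [j ij]] := @cindep_minor R m u v; last by exists (i, j).
  move=> a b /(congr1 Phi); rewrite PhiD Pu Pv => h; apply: uv.1; rewrite h.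
  by rewrite /Phi mxE scale0r addr0.
have [[j1 j2] _ Hmax] := @arg_maxP _ _ _ t0 xpredT (fun t => nrm (mn t)) isT.
have D0 : mn (j1, j2) != 0 by rewrite -nrm_gt0 (lt_le_trans _ (Hmax t0 isT))// nrm_gt0.
have D0' : u 0 j1 * v 0 j2 - u 0 j2 * v 0 j1 != 0 by exact: D0.
have Db i j : nrm (mn (i, j) / mn (j1, j2)) <= 1.
  by rewrite nrmM nrmV ler_pdivrMr ?nrm_gt0// mul1r; exact: Hmax.
pose D := mn (j1, j2).
exists j1, j2, ((v 0 j2 / D) *: u + (- u 0 j2 / D) *: v), ((- v 0 j1 / D) *: u + (u 0 j1 / D) *: v); split.
- split; first by apply/eqP => h; move: D0; rewrite h /mn /= mulrC subrr eqxx.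
    by rewrite PhiD Pu Pv; exact: lbasis_mem.
  by rewrite PhiD Pu Pv; exact: lbasis_mem.
- by rewrite !mxE /D /mn /=; split; first [by field|by rewrite -mulrDl; apply/eqP; rewrite mulf_eq0; apply/orP; left; apply/eqP; ring|idtac].
- move=> j; rewrite !mxE; split.
    rewrite (_ : _ + _ = mn (j, j2) / D) ?Db//; rewrite /D /mn /=; by field.
  rewrite (_ : _ + _ = mn (j1, j) / D) ?Db//; rewrite /D /mn /=; by field.
- move=> y; rewrite uv.2 => -[a [b E]].
  have -> : y = a *: u + b *: v by apply: (can_inj PhiK); rewrite E PhiD Pu Pv.
  by apply/rowP => j; rewrite !mxE /D /mn /=; field.
Qed.

Definition gpt M (f : {ffun 'I_m.+1 -> 'I_(10 * M).+1 * 'I_(10 * M).+1}) : vec := \row_j gv R (f j).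

Lemma gpt_le M f : (0 < M)%N -> cnorm (@gpt M f) <= m.+1%:R * 10.
Proof.
move=> M0; rewrite (le_trans (cnorm_le_sum _))//.
rewrite (le_trans (ler_sum _ (G := fun=> 10) _))//; last by rewrite sumr_const card_ord mulr_natl.
by move=> j _; rewrite mxE gv_le.
Qed.

(** A 2-plane has two complex dimensions: in the echelon basis, the values of a grid point at j1 and
    j2 determine its other coordinates up to O(c / M). For fixed c this leaves O(M^4) grid
    points. *)
Lemma card_near_line M L (c : R) : (0 < M)%N -> 0 <= c ->
  (#|finset (fun f : {ffun 'I_m.+1 -> 'I_(10 * M).+1 * 'I_(10 * M).+1} => `[< exists2 y, gr_set L (Phi y) & (cnorm (y - gpt f) <= c / M%:R)%R >])|
   <= ((10 * M).+1 ^ 4) * ((Num.trunc (2 * (3 * c))).+1 * (Num.trunc (2 * (3 * c))).+1) ^ m.+1)%N.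
Proof.
move=> M0 c0; have [j1 [j2 [a [b [[j12 La Lb] [a1 a2 b1 b2] ab1 HL]]]]] := echelon L.
pose X := ('I_(10 * M).+1 * 'I_(10 * M).+1)%type.
pose F (t : X * X) := finset (fun f : {ffun 'I_m.+1 -> X} => [forall j, f j \in
  finset (fun x : X => (nrm (gv R x - (a 0 j * gv R t.1 + b 0 j * gv R t.2)) <= (3 * c) / M%:R)%R)]).
have sub : finset (fun f : {ffun 'I_m.+1 -> X} => `[< exists2 y, gr_set L (Phi y) & (cnorm (y - gpt f) <= c / M%:R)%R >])
    \subset (\bigcup_t F t)%SET.
  apply/fintype.subsetP => f; rewrite inE => /asboolP[y Ly hy].
  have hj j : nrm (y 0 j - gv R (f j)) <= c / M%:R.
    by have := le_trans (nrm_le_cnorm (y - gpt f) j) hy; rewrite !mxE.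
  apply/finset.bigcupP; exists (f j1, f j2) => //; rewrite inE; apply/forallP => j; rewrite inE /=.
  have -> : gv R (f j) - (a 0 j * gv R (f j1) + b 0 j * gv R (f j2)) =
     - (y 0 j - gv R (f j)) + (a 0 j * (y 0 j1 - gv R (f j1)) + b 0 j * (y 0 j2 - gv R (f j2))).
    rewrite [in y 0 j](HL y Ly) !mxE; ring.
  have [aj bj] := ab1 j.
  rewrite (le_trans (nrmD _ _))// nrmN (_ : 3 * c / M%:R = c / M%:R + (1 * (c / M%:R) + 1 * (c / M%:R))); last by ring.
  by rewrite lerD// (le_trans (nrmD _ _))// lerD// nrmM ler_pM ?nrm_ge0.
apply: leq_trans (subset_leq_card sub) _.
apply: leq_trans (card_bigcup_le (k := ((Num.trunc (2 * (3 * c))).+1 * (Num.trunc (2 * (3 * c))).+1) ^ m.+1) _) _.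
  move=> t; rewrite -[X in (_ ^ X)%N]card_ord; apply: card_family_le => j; apply: card_disc => //.
  by rewrite mulr_ge0.
by rewrite !card_prod !card_ord leq_mul2r !expnS expn0 muln1 !mulnA leqnn orbT.
Qed.

(** The vectors s a + r b, with s and r in grids of M^2 points each, are rounded to the grid. The
    results are pairwise distinct because their coordinates at j1 and j2, equal to s and r, are kept
    exactly. *)
Lemma card_on_line M L (A : {set {ffun 'I_m.+1 -> 'I_(10 * M).+1 * 'I_(10 * M).+1}}) : (0 < M)%N ->
  (forall f y, gr_set L (Phi y) -> cnorm y <= m.+1%:R * 5 -> cnorm (gpt f - y) <= m.+1%:R * (2 / M%:R) -> 1 <= cnorm (gpt f) -> f \in A) ->
  (M ^ 4 <= #|A|)%N.
Proof.
move=> M0 HA; have [j1 [j2 [a [b [[j12 La Lb] [a1 a2 b1 b2] ab1 HL]]]]] := echelon L.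
have M0' : 0 < M%:R :> R by rewrite ltr0n.
have ix (i : 'I_M) k : (k <= 6)%N -> (k * M + i < (10 * M).+1)%N.
  move=> k6; rewrite ltnS; apply: (@leq_trans (6 * M + M)%N); last by rewrite -mulSnr leq_mul2r orbT.
  by rewrite leq_add ?leq_mul2r ?k6 ?orbT// ltnW.
pose mk (i j : 'I_M) k (k6 : (k <= 6)%N) : 'I_(10 * M).+1 * 'I_(10 * M).+1 := (Ordinal (ix i k k6), Ordinal (ix j 5%N isT)).
have RI i k : (k * M + i)%:R / M%:R - 5 = k%:R - 5 + i%:R / M%:R :> R.
  by rewrite natrD natrM; field; rewrite gt_eqF.
have iM (i : 'I_M) : (0 <= (i : nat)%:R / M%:R :> R) && ((i : nat)%:R / M%:R <= 1 :> R).
  by rewrite divr_ge0// ler_pdivrMr// mul1r ler_nat ltnW.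
have mkn i j k k6 : (5 <= k)%N -> nrm (gv R (@mk i j k k6)) <= k%:R - 5 + 2.
  move=> k5; have k5' : (5 : R) <= k%:R by rewrite (ler_nat R 5 k).
  rewrite (le_trans (nrm_le_ReIm _))// Re_gv Im_gv /= !RI.
  have /andP[i1 i2] := iM i; have /andP[h1 h2] := iM j.
  by rewrite subrr add0r !ger0_norm//; lra.
(* s ranges over a unit square with real part at least 1, which keeps the norm at least 1; r ranges
   over the unit square at 0. *)
pose s i j := gv R (@mk i j 6 isT); pose r i j := gv R (@mk i j 5 isT).
pose yy (t : ('I_M * 'I_M) * ('I_M * 'I_M)) : vec := s t.1.1 t.1.2 *: a + r t.2.1 t.2.2 *: b.
have s3 i j : nrm (s i j) <= 3 by have := @mkn i j 6 isT isT; rewrite /s; lra.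
have r2 i j : nrm (r i j) <= 2 by have := @mkn i j 5 isT isT; rewrite /r; lra.
have y5 t j : nrm (yy t 0 j) <= 5.
  rewrite !mxE; have [aj bj] := ab1 j; rewrite (le_trans (nrmD _ _))// !nrmM.
  have := ler_pM (nrm_ge0 _) (nrm_ge0 _) (s3 t.1.1 t.1.2) aj.
  have := ler_pM (nrm_ge0 _) (nrm_ge0 _) (r2 t.2.1 t.2.2) bj; lra.
have Hrd0 (z : C) : exists x : 'I_(10 * M).+1 * 'I_(10 * M).+1, nrm z <= 5 -> nrm (gv R x - z) <= 2 / M%:R.
  have [h|h] := boolP (nrm z <= 5); first by have [x] := gv_round M0 h; exists x.
  by exists (ord0, ord0).
have [rd Hrd] := choice Hrd0.
pose G (t : ('I_M * 'I_M) * ('I_M * 'I_M)) : {ffun 'I_m.+1 -> 'I_(10 * M).+1 * 'I_(10 * M).+1} :=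
  [ffun j => if j == j1 then @mk t.1.1 t.1.2 6 isT else if j == j2 then @mk t.2.1 t.2.2 5 isT else rd (yy t 0 j)].
have Gj1 t : G t j1 = @mk t.1.1 t.1.2 6 isT by rewrite ffunE eqxx.
have Gj2 t : G t j2 = @mk t.2.1 t.2.2 5 isT by rewrite ffunE eq_sym (negbTE j12) eqxx.
have Ginj : injective G.
  move=> t t' E; have := Gj1 t; have := Gj2 t; rewrite E Gj1 Gj2.
  case: t t' {E} => [[t1 t2] [t3 t4]] [[t1' t2'] [t3' t4']] /= [/addnI/val_inj -> /addnI/val_inj ->] [/addnI/val_inj -> /addnI/val_inj ->] //.
have cM : (#|{: ('I_M * 'I_M) * ('I_M * 'I_M)}| = M ^ 4)%N by rewrite !card_prod !card_ord !expnS expn0 muln1 !mulnA.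
rewrite -cM -(card_imset _ Ginj); apply: subset_leq_card; apply/fintype.subsetP => _ /imsetP[t _ ->].
apply: (HA _ (yy t)).
- by rewrite PhiD; exact: gr_setD.
- rewrite (le_trans (cnorm_le_sum _))// (le_trans (ler_sum _ (G := fun=> 5) _))//; last by rewrite sumr_const card_ord mulr_natl.
- rewrite (le_trans (cnorm_le_sum _))// (le_trans (ler_sum _ (G := fun=> 2 / M%:R) _))//; last by rewrite sumr_const card_ord -[leLHS]mulr_natl.
  move=> j _; rewrite [in X in nrm X]mxE [in X in nrm X]mxE [X in _ + X]mxE ffunE; case: eqP => [->|_].
    by rewrite !mxE a1 b1 mulr1 mulr0 addr0 /s subrr nrm0 divr_ge0.
  by case: eqP => [->|_]; [rewrite !mxE a2 b2 mulr1 mulr0 add0r /r subrr nrm0 divr_ge0|apply: Hrd].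
- rewrite (le_trans _ (nrm_le_cnorm _ j1))// mxE Gj1 (le_trans _ (nrm_Re _))// Re_gv /= RI ger0_norm.
    by have /andP[] := iM t.1.1; lra.
  by have /andP[] := iM t.1.1; lra.
Qed.
End TubeCoordinates.

Lemma sum_bool_card (T : finType) (S : {set T}) (b : T -> bool) :
  (\sum_(t in S) b t = #|finset (fun t => (t \in S) && b t)|)%N.
Proof.
by rewrite -sum1_card big_mkcond [RHS]big_mkcond/=; apply: eq_bigr => t _; rewrite inE; case: ifP => //=; case: ifP.
Qed.

(** * The tube estimate *)

Section TubeLemma.
Variables (R : realType) (n d : nat).
Hypothesis d0 : (0 < d)%N.
Notation C := (R[i]).
Notation nrm := (@ComplexField.Normc.normc R).
Notation vec := ('rV[C]_(n.+2)).
Implicit Types (u v w y : vec) (L : Gr R n.+1).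
Variable vol : probability (Grm R n) R.
Hypothesis inv : gr_invariant vol.

Lemma card_big_first (M : nat) : (0 < M)%N ->
  (4 * M * (10 * M).+1 <= #|finset (fun x : 'I_(10 * M).+1 * 'I_(10 * M).+1 => (6 * M <= x.1)%N)|)%N.
Proof.
move=> M0; have H (i : 'I_(4 * M)) : (6 * M + i < (10 * M).+1)%N.
  by rewrite ltnS (mulnDl 6 4 M) leq_add2l ltnW.
pose f (x : 'I_(4 * M) * 'I_(10 * M).+1) := (Ordinal (H x.1), x.2).
have fi : injective f by move=> [a b] [a' b'] [/addnI/val_inj -> ->].
rewrite (_ : (4 * M * (10 * M).+1 = #|{: 'I_(4 * M) * 'I_(10 * M).+1}|)%N); last by rewrite card_prod !card_ord.
rewrite -(card_imset _ fi); apply: subset_leq_card; apply/fintype.subsetP => _ /imsetP[x _ ->].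
by rewrite inE /= leq_addr.
Qed.

Lemma peval_lip (A0 B : R) : 0 <= A0 -> 1 <= B -> exists2 Kp : R, 0 <= Kp & forall (p : hpoly R n.+1 d) u v,
  (forall a, nrm (p a) <= A0) -> cnorm u <= B -> cnorm v <= B -> nrm (peval p u - peval p v) <= Kp * cnorm (u - v).
Proof.
move=> A00 B1; have [Kp Kp0 H] := @pline_lip R n.+1 d A0 B A00 B1; exists Kp => // p u v Ha hu hv.
have B0 : 0 <= B := le_trans ler01 B1.
have := H p u 0 v 0 Ha; rewrite cnorm0 subr0 cnorm0 addr0 => /(_ hu B0 hv B0); apply: le_trans.
have -> : peval p u - peval p v = (pline p u 0 - pline p v 0)`_0.
  by rewrite coefB -!horner_coef0 !pline_horner !scaler0 !addr0.
exact: pn_coef.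
Qed.

(* Discretize vectors with mesh 1/M ~ eta^d. By unitary invariance the sets of lines passing near a given grid point all have the same volume. A line on which some p_t is small passes near at least M^4 grid points at which some p_t is small; those are a proportion O(eta) of the grid, as is seen on each line through O; Markov's inequality concludes. *)
Lemma tube_lemma (A0 c : R) (p : R -> hpoly R n.+1 d) (O : vec) : 0 <= A0 -> 0 < c ->
  (forall t a, 0 <= t <= 1 -> TT (4 * d) A0 t (fun x => (p x a)%:P)) ->
  (forall t, 0 <= t <= 1 -> c <= nrm (peval (p t) O)) ->
  exists2 K0 : R, 0 <= K0 & forall eta : R, 0 < eta <= 1 -> exists B : set (Grm R n),
    [/\ measurable B, fine (vol B) <= K0 * eta &
      forall L, (exists2 t, 0 <= t <= 1 & forall w, gr_set L w -> nrm (peval (p t) w) <= eta ^+ d * cnorm w ^+ d) -> B L].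
Proof.
move=> A00 c0 HT HO.
have O0 : O != 0.
  apply/eqP => h; have := HO 0; rewrite lexx ler01 h -(scale0r (0 : vec)) pevalZ expr0n gtn_eqF// mul0r nrm0 => /(_ isT).
  by rewrite leNgt c0.
have [i0 Oi0] : exists i0, O 0 i0 != 0.
  apply/not_existsP => h; case/eqP: O0; apply/rowP => j; rewrite !mxE.
  by apply/eqP/negP => /negP h'; exact: (h j).
have [B B1 [HB1 HB2]] := Phi_bound O i0; have B0 : 0 <= B := le_trans ler01 B1.
pose N : R := n.+2%:R; have N1 : 1 <= N by rewrite /N (ler_nat R 1).
have N0 : 0 <= N := le_trans ler01 N1.
pose B2 := 1 + B * (N * 10); have B21 : 1 <= B2 by rewrite lerDl !mulr_ge0.
have [Kp Kp0 HK] := peval_lip A00 B21.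
pose W0 := 1 + N * 10 + cnorm O.
have W01 : 1 <= W0 by have := cnorm_ge0 O; rewrite /W0; lra.
have W0N : N * 10 <= W0 by have := cnorm_ge0 O; rewrite /W0; lra.
have hO : cnorm O <= W0 by rewrite /W0; lra.
have [C4 C40 HC4] := @pencil_tube R n.+1 d d0 A0 W0 c A00 W01 c0.
pose C3 := (B * (N * 5)) ^+ d + Kp * (B * (N * 2)).
have C30 : 0 <= C3 by rewrite addr_ge0 ?exprn_ge0 ?mulr_ge0.
(* [C3] times eta^d bounds p_t at a grid point close to a vector of a line on which p_t is small; k
   expresses [C3] in units of c, the form [pencil_tube] expects. *)
pose k := (Num.trunc (C3 / c)).+1.
have C3k : C3 <= k%:R * c.
  rewrite -ler_pdivrMr//; have q0 : 0 <= C3 / c by rewrite divr_ge0// ltW.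
  by have /andP[_ /ltW] := Num.Theory.truncn_itv q0.
pose r0 := 2 * N * B * B + 1.
have r00 : 0 < r0 by rewrite ltr_wpDl ?mulr_ge0.
pose c1 := B * (B * (N * 10) * r0); have c10 : 0 <= c1 by rewrite !mulr_ge0// ltW.
pose D := (((Num.trunc (2 * (3 * c1))).+1 * (Num.trunc (2 * (3 * c1))).+1) ^ n.+2)%N.
pose Cu : R := 11 ^+ 4 * D%:R; have Cu0 : 0 <= Cu by rewrite mulr_ge0 ?exprn_ge0.
exists (Cu * C4 k); first by rewrite mulr_ge0.
move=> eta /andP[e0 e1]; pose eps := eta ^+ d; have eps0 : 0 < eps by rewrite exprn_gt0.
have epse : eps <= eta by rewrite -[leRHS]expr1 ler_wiXn2l// ltW.
(* The mesh is of order eta^d, so that rounding to the grid changes p_t by O(eta^d), the size of p_t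
   on a bad line. *)
pose M := (Num.trunc eps^-1).+1; have M0 : (0 < M)%N by [].
have M0' : 0 < M%:R :> R by rewrite ltr0n.
have eM : 1 <= eps * M%:R.
  have q0 : 0 <= eps^-1 by rewrite invr_ge0 ltW.
  have /andP[_ /ltW h] := Num.Theory.truncn_itv q0.
  by rewrite mulrC -ler_pdivrMr// mul1r.
have etaM : 1 <= eta * M%:R by rewrite (le_trans eM)// ler_wpM2r// ltW.
have iM : M%:R^-1 <= eps by rewrite -[leLHS]mul1r ler_pdivrMr.
pose X := ('I_(10 * M).+1 * 'I_(10 * M).+1)%type.
pose T := {ffun 'I_n.+2 -> X}.
pose PG (f : T) := Phi O i0 (gpt R f).
pose E (f : T) := @Enear R n (unitv (PG f)) (r0 / M%:R).
(* Grid points away from 0, whose directions are stable under rounding. *)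
pose T1 : {set T} := finset (fun f : T => 1 <= cnorm (gpt R f)).
pose tub : {set T} := finset (fun f : T => `[< exists2 t, 0 <= t <= 1 & nrm (peval (p t) (PG f)) <= k%:R * c * eps >]).
pose S : {set T} := finset (fun f : T => (f \in T1) && (f \in tub)).
have tubE f : (f \in tub) = `[< exists2 t, 0 <= t <= 1 & nrm (peval (p t) (PG f)) <= k%:R * c * eps >] by rewrite inE.
have T1E f : (f \in T1) = (1 <= cnorm (gpt R f)) by rewrite inE.
have mE f : measurable (E f) by exact: Enear_measurable.
have gle f : cnorm (gpt R (f : T)) <= N * 10 by exact: gpt_le.
have PGle f : cnorm (PG f) <= B * (N * 10) by rewrite (le_trans (HB1 _))// ler_wpM2l.
have PGge f : f \in T1 -> 1 <= B * cnorm (PG f).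
  by rewrite inE => /le_trans; apply; rewrite -[X in cnorm X](PhiK Oi0).
have PG0 f : f \in T1 -> 0 < cnorm (PG f).
  by move=> /PGge h; rewrite lt_neqAle cnorm_ge0 andbT; apply/eqP => h'; move: h; rewrite -h' mulr0 ler10.
have PhiB u v : Phi O i0 u - Phi O i0 v = Phi O i0 (u - v).
  by have := PhiD O i0 u v 1 (-1); rewrite !scale1r !scaleN1r => ->.
have [mB HB] := markov_count vol S mE (ler0n R (M ^ 4)).
set BB := [set L | _] in mB HB; exists BB; split => //.
  pose eO := unitv O; pose pi0 := fine (vol (@Enear R n eO (r0 / M%:R))).
  have pi00 : 0 <= pi0 by rewrite fine_ge0.
  have vE f : f \in T1 -> fine (vol (E f)) = pi0.
    move=> fT; congr fine; apply: vol_Enear => //; apply: cnorm_unitv => //.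
    by rewrite -cnorm_gt0 PG0.
  (* Each line passes near at most Cu M^4 points of [T1], and for these points all sets [E f] have
     the same volume [pi0]; integrating the count bounds [pi0]. *)
  have h1 : #|T1|%:R * pi0 <= M%:R ^+ 4 * Cu.
    have -> : #|T1|%:R * pi0 = \sum_(f in T1) fine (vol (E f)).
      by rewrite (eq_bigr (fun=> pi0)) ?sumr_const ?mulr_natl.
    apply: sum_prob_le => // L; rewrite sum_bool_card.
    have sub : finset (fun f : T => (f \in T1) && `[< E f L >]) \subset
        finset (fun f : T => `[< exists2 y, gr_set (L : Gr R n.+1) (Phi O i0 y) & (cnorm (y - gpt R f) <= c1 / M%:R)%R >]).
      apply/fintype.subsetP => f; rewrite inE => /andP[fT1 /asboolP[u Lu hu]]; rewrite inE; apply/asboolP.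
      exists (Psi O i0 ((cnorm (PG f))%:C%C *: u)); first by rewrite PsiK//; exact: gr_setZ.
      have -> : gpt R f = Psi O i0 (PG f) by rewrite PhiK.
      have -> u' v' : Psi O i0 u' - Psi O i0 v' = Psi O i0 (u' - v').
        by apply: (can_inj (PhiK Oi0)); rewrite -PhiB !PsiK.
      rewrite (le_trans (HB2 _))// /c1 -mulrA ler_wpM2l//.
      have -> : (cnorm (PG f))%:C%C *: u - PG f = (cnorm (PG f))%:C%C *: (u - unitv (PG f)).
        by rewrite scalerBr /unitv scalerA -rmorphM/= divff ?gt_eqF ?PG0// scale1r.
      rewrite cnormZ nrmR ger0_norm ?cnorm_ge0//.
      rewrite -mulrA; apply: ler_pM; rewrite ?cnorm_ge0//; exact: ltW.
    apply: (@le_trans _ _ (((10 * M).+1 ^ 4 * D)%N%:R)).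
      by rewrite ler_nat (leq_trans (subset_leq_card sub))// card_near_line.
    rewrite /Cu natrM mulrA -exprMn natrX ler_wpM2r// lerXn2r ?nnegrE ?mulr_ge0// -natrM ler_nat.
    by rewrite [(M * 11)%N]mulnC (mulSn 10 M) -[ltnLHS]add0n ltn_add2r.
  have h2 : M%:R ^+ 4 * fine (vol BB) <= #|tub|%:R * pi0.
    rewrite -natrX; apply: le_trans HB _.
    rewrite (eq_bigr (fun=> pi0)) => [|f]; last by rewrite inE => /andP[fT _]; exact: vE.
    rewrite sumr_const -[leLHS]mulr_natl ler_wpM2r// ler_nat subset_leq_card//.
    by apply/fintype.subsetP => f; rewrite inE => /andP[].
  pose Kr : R := (10 * M).+1%:R.
  have cX : #|{: X}| = ((10 * M).+1 * (10 * M).+1)%N by rewrite card_prod card_ord.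
  (* Varying the coordinate i0 fibres the grid into pencils in the direction of O; in each pencil
     the points of [tub] are a proportion O(eta). *)
  have h3 : Kr ^+ 2 * #|tub|%:R <= #|{: T}|%:R * (C4 k * (eta * M%:R ^+ 2)).
    have -> : Kr ^+ 2 * #|tub|%:R = (#|{: X}| * #|tub|)%N%:R by rewrite cX !natrM expr2.
    rewrite -(sum_card_upd i0 tub) natr_sum.
    rewrite (_ : #|{: T}|%:R * _ = \sum_(f : T) (C4 k * (eta * M%:R ^+ 2))); last by rewrite sumr_const mulr_natl.
    apply: ler_sum => f _.
    pose w := gpt R f - (gpt R f) 0 i0 *: delta_mx 0 i0.
    have hw : cnorm w <= W0.
      apply: le_trans W0N.
      rewrite (le_trans (cnorm_le_sum _))// (le_trans (ler_sum _ (G := fun=> 10) _))//; last by rewrite sumr_const card_ord mulr_natl.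
      move=> j _; rewrite !mxE eqxx/=; case: (j =P i0) => [->|_].
        by rewrite mulr1 subrr nrm0.
      by rewrite mulr0 subr0 gv_le.
    have e01 : 0 < eta <= 1 by rewrite e0.
    apply: le_trans (HC4 p O w k eta M HT hO HO hw e01 etaM).
    rewrite ler_nat subset_leq_card//; apply/fintype.subsetP => x; rewrite inE tubE => /asboolP[t t01 ht].
    rewrite inE; apply/asboolP; exists t => //; apply: le_trans ht.
    have xi : gpt R (upd f i0 x) 0 i0 = gv R x by rewrite mxE ffunE eqxx.
    have wE : gpt R (upd f i0 x) - gv R x *: delta_mx 0 i0 = w.
      apply/rowP => j; rewrite !mxE eqxx/= !ffunE; case: (j =P i0) => [->|_]; last by rewrite !mulr0.
      by rewrite !mulr1 !subrr.
    by rewrite /PG Phi_pencil xi wE.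
  (* [T1] is a fixed proportion of the grid: it contains every point whose first coordinate has real
     part at least 1. *)
  have h4 : #|{: T}|%:R * (4 * M%:R * Kr) <= Kr ^+ 2 * #|T1|%:R.
    have -> : Kr ^+ 2 * #|T1|%:R = (#|{: X}| * #|T1|)%N%:R by rewrite cX !natrM expr2.
    have -> : 4 * M%:R * Kr = (4 * M * (10 * M).+1)%N%:R by rewrite !natrM.
    rewrite -(sum_card_upd ord0 T1) -natrM ler_nat -sum_nat_const leq_sum// => f _.
    apply: leq_trans (card_big_first M0) _; apply: subset_leq_card; apply/fintype.subsetP => x; rewrite inE => hx; rewrite inE T1E.
    rewrite (le_trans _ (nrm_le_cnorm _ ord0))// mxE ffunE eqxx (le_trans _ (nrm_Re _))// Re_gv.
    rewrite (le_trans _ (ler_norm _))// lerBrDr ler_pdivlMr// (_ : 1 + 5 = 6%:R); last by ring.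
    by rewrite -natrM ler_nat.
  have Kr0 : 0 < Kr by rewrite ltr0n.
  have MK : M%:R <= Kr by rewrite ler_nat (leq_trans (leq_pmull M (isT : (0 < 10)%N))).
  have P0 : 0 <= fine (vol BB) by rewrite fine_ge0.
  have g1 : #|{: T}|%:R * (4 * M%:R) <= Kr * #|T1|%:R.
    have e2 : #|{: T}|%:R * (4 * M%:R) * Kr = #|{: T}|%:R * (4 * M%:R * Kr) by ring.
    have e3 : Kr * #|T1|%:R * Kr = Kr ^+ 2 * #|T1|%:R by ring.
    by rewrite -(ler_pM2r Kr0) e2 e3.
  have g2 : 4 * M%:R * (M%:R ^+ 4 * fine (vol BB)) * Kr ^+ 2 <= Kr * #|T1|%:R * pi0 * (C4 k * (eta * M%:R ^+ 2)).
    apply: (@le_trans _ _ (4 * M%:R * (#|tub|%:R * pi0) * Kr ^+ 2)).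
      by rewrite ler_wpM2r ?exprn_ge0 ?(ltW Kr0)// ler_wpM2l// mulr_ge0.
    have -> : 4 * M%:R * (#|tub|%:R * pi0) * Kr ^+ 2 = 4 * M%:R * pi0 * (Kr ^+ 2 * #|tub|%:R) by ring.
    apply: (@le_trans _ _ (4 * M%:R * pi0 * (#|{: T}|%:R * (C4 k * (eta * M%:R ^+ 2))))).
      by rewrite ler_wpM2l// !mulr_ge0.
    have -> : 4 * M%:R * pi0 * (#|{: T}|%:R * (C4 k * (eta * M%:R ^+ 2))) = (#|{: T}|%:R * (4 * M%:R)) * (pi0 * (C4 k * (eta * M%:R ^+ 2))) by ring.
    rewrite -[leRHS]mulrA; apply: ler_wpM2r => //; rewrite !mulr_ge0 ?exprn_ge0 ?(ltW e0)//.
  have g3 : Kr * #|T1|%:R * pi0 * (C4 k * (eta * M%:R ^+ 2)) <= Kr * (M%:R ^+ 4 * Cu) * (C4 k * (eta * M%:R ^+ 2)).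
    by rewrite -[X in X * _ <= _]mulrA ler_wpM2r ?mulr_ge0 ?exprn_ge0 ?(ltW e0)// ler_wpM2l// ltW.
  have Z0 : 0 < M%:R ^+ 5 * Kr by rewrite mulr_gt0 ?exprn_gt0.
  have g4 : 4 * fine (vol BB) * Kr <= Cu * (C4 k * eta) * M%:R.
    rewrite -(ler_pM2r Z0); have := le_trans g2 g3; congr (_ <= _); ring.
  have g5 : Cu * (C4 k * eta) * M%:R <= Cu * (C4 k * eta) * Kr by rewrite ler_wpM2l// !mulr_ge0// ltW.
  have := le_trans g4 g5; rewrite ler_pM2r// mulrA; apply: le_trans.
  by rewrite -[leLHS]mul1r ler_wpM2r// (ler_nat R 1 4).
move=> L [t t01 Ht]; rewrite /BB /= ler_nat sum_bool_card.
apply: (@card_on_line R n.+1 O i0 Oi0 M L _ M0) => f y Ly hy hfy f1.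
have fT : f \in T1 by rewrite T1E.
have dP : cnorm (Phi O i0 y - PG f) <= B * (N * (2 / M%:R)).
  by rewrite PhiB (le_trans (HB1 _))// ler_wpM2l// cnormB.
have dP' : cnorm (PG f - Phi O i0 y) <= B * (N * (2 / M%:R)).
  rewrite -[PG f]/(Phi O i0 (gpt R f)) PhiB; apply: le_trans (HB1 _) _; exact: (ler_wpM2l B0 hfy).
rewrite inE inE fT tubE /=; apply/andP; split; last first.
  apply/asboolP; exists ((cnorm (PG f))^-1%:C%C *: Phi O i0 y); first exact: gr_setZ.
  rewrite /unitv -scalerBr cnormZ nrmR ger0_norm ?invr_ge0 ?cnorm_ge0// mulrC ltr_pdivrMr ?PG0//.
  apply: le_lt_trans dP _; rewrite -mulrA [_^-1 * _]mulrC mulrA !mulrA ltr_pM2r ?invr_gt0//.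
  have h := PGge f fT; apply: (@le_lt_trans _ _ (2 * N * B * (B * cnorm (PG f)))).
    by rewrite (_ : B * N * 2 = 2 * N * B * 1) ?ler_wpM2l ?mulr_ge0//; ring.
  have -> : r0 * cnorm (PG f) = 2 * N * B * (B * cnorm (PG f)) + cnorm (PG f) by rewrite /r0; ring.
  by rewrite ltrDl PG0.
apply/asboolP; exists t => //.
have yP : cnorm (Phi O i0 y) <= B * (N * 5) by rewrite (le_trans (HB1 _))// ler_wpM2l.
have pa a : nrm (p t a) <= A0 by have := TT_bd (HT t a t01) t01; rewrite pnC.
have hl : nrm (peval (p t) (PG f) - peval (p t) (Phi O i0 y)) <= Kp * (B * (N * (2 / M%:R))).
  rewrite (le_trans (HK _ _ _ pa _ _))//.
  - by apply: le_trans (PGle f) _; rewrite lerDr.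
  - apply: le_trans yP _; apply: ler_wpDl => //; rewrite ler_wpM2l// ler_wpM2l// (ler_nat R 5 10)//.
  - exact: (ler_wpM2l Kp0 dP').
have hp := Ht _ Ly.
have hp' : nrm (peval (p t) (Phi O i0 y)) <= eps * (B * (N * 5)) ^+ d.
  by rewrite (le_trans hp)// ler_wpM2l ?(ltW eps0)// lerXn2r ?nnegrE ?cnorm_ge0 ?mulr_ge0.
rewrite -[X in nrm X](subrK (peval (p t) (Phi O i0 y))) (le_trans (nrmD _ _))//.
apply: le_trans (_ : C3 * eps <= _); last by rewrite ler_wpM2r// ltW.
apply: le_trans (lerD hl hp') _.
have -> : C3 * eps = Kp * (B * (N * (2 * eps))) + eps * (B * (N * 5)) ^+ d by rewrite /C3; ring.
by rewrite lerD2r; do 4!apply: ler_wpM2l => //.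
Qed.
End TubeLemma.
(** * Zeros on generic lines *)

Lemma digits_inj (b m : nat) (f g : 'I_m -> nat) : (forall j, f j < b)%N -> (forall j, g j < b)%N ->
  (\sum_(j < m) f j * b ^ j = \sum_(j < m) g j * b ^ j)%N -> f =1 g.
Proof.
elim: m f g => [|m IH] f g Hf Hg; first by move=> _ [].
have b0 : (0 < b)%N by exact: leq_ltn_trans (Hf ord0).
have E h : (\sum_(j < m.+1) h j * b ^ j = h ord0 + (\sum_(j < m) h (lift ord0 j) * b ^ j) * b)%N.
  rewrite big_ord_recl expn0 muln1 big_distrl/=; congr (_ + _)%N; apply: eq_bigr => j _.
  by rewrite /bump /= add1n expnSr mulnA.
rewrite !E => H.
have H0 : f ord0 = g ord0.
  by rewrite -(modn_small (Hf ord0)) -(modn_small (Hg ord0)) -[in LHS](modnMDl (\sum_(j < m) f (lift ord0 j) * b ^ j)%N) addnC H addnC modnMDl.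
move: H; rewrite H0 => /addnI/eqP; rewrite eqn_pmul2r// => /eqP H j.
have [->|[j' ->]] : j = ord0 \/ exists j', j = lift ord0 j'; [|exact: H0|].
  by case: (unliftP ord0 j) => [j' ->|->]; [right; exists j'|left].
exact: (IH (fun j => f (lift ord0 j)) (fun j => g (lift ord0 j))).
Qed.

Section BigPoint.
Variables (R : realType) (m d : nat).
Notation C := (R[i]).
Notation nrm := (@ComplexField.Normc.normc R).
Notation vec := ('rV[C]_(m.+1)).

(* Kronecker substitution [z_j := x ^ (d+1)^j] turns distinct monomials into distinct powers of [x]. *)
Lemma big_point : exists2 c1 : R, 0 < c1 & forall (p : hpoly R m d) a, exists O : vec,
  cnorm O <= m.+1%:R /\ c1 * nrm (p a) <= nrm (peval p O).
Proof.
pose e (a : mon m d) := (\sum_(j < m.+1) (val a j : nat) * d.+1 ^ j)%N.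
have einj : injective e.
  move=> a b /digits_inj H; apply: val_inj; apply/ffunP => j; apply: val_inj.
  exact: H.
pose K := (\max_(a : mon m d) e a).+1.
have eK a : (e a < K)%N by rewrite ltnS; exact: leq_bigmax.
have [CI CI1 HCI] := interpC R (ltn0Sn _ : (0 < K)%N).
have CI0 : 0 < CI by exact: lt_le_trans CI1.
exists (CI + 1)^-1; first by rewrite invr_gt0 addr_gt0.
move=> p a; pose Q : {poly C} := \sum_(a : mon m d) p a *: 'X^(e a).
have Qa b : Q`_(e b) = p b.
  rewrite /Q coef_sum (bigD1 b)//= coefZ coefXn eqxx mulr1 big1 ?addr0// => b' nb.
  by rewrite coefZ coefXn (inj_eq einj) eq_sym (negbTE nb) mulr0.
have sQ : (size Q <= K)%N.
  apply: (leq_trans (size_sum _ _ _)); apply/bigmax_leqP => b _.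
  by rewrite (leq_trans (size_scale_leq _ _))// size_polyXn.
pose OO (x : C) : vec := \row_j x ^+ (d.+1 ^ j)%N.
have QO x : Q.[x] = peval p (OO x).
  rewrite /Q horner_sum /peval; apply: eq_bigr => b _; rewrite hornerZ hornerXn; congr (_ * _).
  rewrite /e -prodrXr; apply: eq_bigr => j _; by rewrite mxE -exprM mulnC.
have [[i Hi]|H] := pselect (exists i : 'I_K, (CI + 1)^-1 * nrm (p a) <= nrm Q.[(node R K i)%:C%C]).
  exists (OO (node R K i)%:C%C); rewrite -QO; split => //.
  rewrite (le_trans (cnorm_le_sum _))// (le_trans (ler_sum _ (G := fun=> 1) _))//; last by rewrite sumr_const card_ord.
  move=> j _; rewrite mxE nrmX nrmR; have /andP[n0 n1] := @node01 R K i (ltn_ord i).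
  by rewrite ger0_norm// exprn_ile1// (le_trans n1)// invf_le1// ler1n.
have [pa0|pa] := eqVneq (p a) 0.
  by exists 0; rewrite pa0 nrm0 mulr0 nrm_ge0 cnorm0.
have H2 (i : 'I_K) : nrm Q.[(node R K i)%:C%C] <= (CI + 1)^-1 * nrm (p a).
  by rewrite leNgt; apply/negP => /ltW h; apply: H; exists i.
have := HCI Q _ sQ H2 (e a); rewrite Qa mulrA leNgt; case/negP.
by rewrite -[ltRHS]mul1r ltr_pM2r ?nrm_gt0// ltr_pdivrMr ?addr_gt0// mul1r ltrDl.
Qed.
End BigPoint.

Section BadSets.
Variables (R : realType) (n d : nat).
Hypothesis d0 : (0 < d)%N.
Notation C := (R[i]).
Notation nrm := (@ComplexField.Normc.normc R).
Notation vec := ('rV[C]_(n.+2)).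
Implicit Types (L : Gr R n.+1).
Variable vol : probability (Grm R n) R.
Hypothesis inv : gr_invariant vol.

Lemma affine01 (a r x : R) : 0 <= a -> 0 <= r -> a + r <= 1 -> 0 <= x <= 1 -> 0 <= a + r * x <= 1.
Proof.
move=> a0 r0 ar /andP[x0 x1]; rewrite addr_ge0 ?mulr_ge0//= (le_trans _ ar)// lerD2l ler_piMr//.
Qed.

Lemma TT_affine s A a r t (F : R -> {poly C}) : 0 <= a -> 0 <= r -> a + r <= 1 -> 0 <= t <= 1 ->
  TT s A (a + r * t) F -> TT s A t (fun x => F (a + r * x)).
Proof.
move=> a0 r0 ar t01; elim: s F => [|s IH] F /=.
  by move=> H x x01; apply: H; exact: affine01.
move=> [H [G HG E]]; split; first by move=> x x01; apply: H; exact: affine01.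
exists (fun x => r%:C%C *: G (a + r * x)).
  apply: (@TT_mono _ _ (nrm (r%:C%C : C) * A)); last by apply: TT_scale; exact: IH.
  rewrite nrmR ger0_norm// ler_piMl ?(TT_ge0 HG)//; lra.
move=> x x01; rewrite E ?affine01// scalerA; congr (_ + _ *: _).
by rewrite -rmorphM/=; congr (_%:C%C); ring.
Qed.

(** [tube_lemma] requires one point O at which |p_t| is bounded below for all t. By compactness the
    coefficients of p_t stay away from 0, [big_point] gives such a point at each time i / K, and the
    Lipschitz dependence on t keeps it valid for a time 1 / K. The bad sets of the K intervals are
    then united. *)
Lemma bad_sets (A0 : R) (p : R -> hpoly R n.+1 d) : 0 <= A0 ->
  (forall t a, 0 <= t <= 1 -> TT (4 * d) A0 t (fun x => (p x a)%:P)) ->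
  (forall t, 0 <= t <= 1 -> exists a, p t a != 0) ->
  exists2 K0 : R, 0 <= K0 & forall eta : R, 0 < eta <= 1 -> exists B : set (Grm R n),
    [/\ measurable B, fine (vol B) <= K0 * eta &
      forall L, (exists2 t, 0 <= t <= 1 & forall w, gr_set L w -> nrm (peval (p t) w) <= eta ^+ d * cnorm w ^+ d) -> B L].
Proof.
move=> A00 HT Hp; have [s4 E4] : exists s4, (4 * d = s4.+1)%N by exists (4 * d).-1; rewrite prednK// muln_gt0.
(* Clamping extends the coefficients by constants outside [0, 1], so that S is continuous on the
   whole line when the extreme value theorem is applied. *)
pose cl (x : R) : R := if x < 0 then 0 else if 1 < x then 1 else x.
have cl01 x : 0 <= cl x <= 1.
  by rewrite /cl; case: (ltP x 0) => h1; [rewrite lexx ler01|case: (ltP 1 x) => h2; rewrite ?lexx ?ler01// h1].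
have clE x : 0 <= x <= 1 -> cl x = x by move=> /andP[x0 x1]; rewrite /cl !ltNge x0 x1.
have cll x y : `|cl x - cl y| <= `|x - y|.
  wlog xy : x y / x <= y => [H|].
    by have [|/ltW] := leP x y; [exact: H|rewrite distrC [`|x - _|]distrC; exact: H].
  rewrite distrC [`|x - _|]distrC [leRHS]ger0_norm ?subr_ge0// ler_norml.
  rewrite /cl; case: (ltP x 0) => h1; case: (ltP 1 x) => h2; case: (ltP y 0) => h3; case: (ltP 1 y) => h4; apply/andP; split; lra.
pose S (x : R) := \sum_(a : mon n.+1 d) nrm (p (cl x) a).
have pl t t' a : 0 <= t <= 1 -> 0 <= t' <= 1 -> nrm (p t a - p t' a) <= A0 * `|t - t'|.
  move=> t01 t'01; have := HT t' a t'01; rewrite E4 => /TT_lip /(_ t01).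
  by rewrite -polyCB pnC.
have Sl x y : `|S x - S y| <= (#|{: mon n.+1 d}|%:R * A0) * `|x - y|.
  rewrite /S -sumrB (le_trans (ler_norm_sum _ _ _))//.
  rewrite (le_trans (ler_sum _ (G := fun=> A0 * `|x - y|) _))//; last by rewrite sumr_const -mulrA mulr_natl.
  move=> a _; apply: (@le_trans _ _ (nrm (p (cl x) a - p (cl y) a))); last first.
    by rewrite (le_trans (pl _ _ _ _ _))// ler_wpM2l.
  by rewrite ler_norml; have := nrm_ge_sub (p (cl x) a) (p (cl y) a); have := nrm_ge_sub (p (cl y) a) (p (cl x) a); rewrite [nrm (_ (cl y) _ - _)]nrmB; lra.
set NM : R := #|_|%:R in Sl.
have NM0 : 0 <= NM by exact: ler0n.
have Sc : {within `[0, 1], continuous S}.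
  apply: continuous_subspaceT => x; apply/cvgrPdist_le => e e0.
  have h : 0 < e / (NM * A0 + 1) by rewrite divr_gt0// ltr_wpDl// mulr_ge0.
  near=> y; rewrite (le_trans (Sl x y))//.
  have xy : `|x - y| <= e / (NM * A0 + 1) by near: y; exact: (@cvgr_dist_le _ _ _ _ _ id x cvg_id).
  apply: (le_trans (ler_wpM2l _ xy)); first by rewrite mulr_ge0.
  by rewrite mulrCA ler_piMr ?(ltW e0)// ler_pdivrMr ?ltr_wpDl ?mulr_ge0// mul1r lerDl.
have [c c01 Hc] := EVT_min ler01 Sc.
have S0 : 0 < S c.
  have [a pa] := Hp (cl c) (cl01 c); rewrite /S (bigD1 a)//= ltr_wpDr ?nrm_gt0// sumr_ge0// => b _; exact: nrm_ge0.
have [a0 _] := Hp 0 (introT andP (conj (lexx 0) ler01)).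
have NM1 : 0 < NM by rewrite ltr0n; apply/card_gt0P; exists a0.
have [c1 c10 Hc1] := big_point R n.+1 d.
pose dl := c1 * (S c / NM); have dl0 : 0 < dl by rewrite mulr_gt0// divr_gt0.
have HO t : 0 <= t <= 1 -> exists O : vec, cnorm O <= n.+2%:R /\ dl <= nrm (peval (p t) O).
  move=> t01; have [a Ha] : exists a, S c / NM <= nrm (p t a).
    apply/not_existsP => h; have : S t < S c.
      rewrite [ltRHS](_ : _ = \sum_(a : mon n.+1 d) S c / NM); last by rewrite sumr_const -mulr_natl mulrC divfK// gt_eqF.
      rewrite /S clE//; apply: ltr_sum => [|a _]; first by apply/hasP; exists a0 => //; rewrite mem_index_enum.
      by rewrite ltNge; apply/negP => h'; exact: (h a).
    by rewrite ltNge Hc// in_itv.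
  have [Ov [h1 h2]] := Hc1 (p t) a; exists Ov; split => //.
  by apply: le_trans h2; rewrite ler_wpM2l// ltW.
have N1 : 1 <= n.+2%:R :> R by rewrite (ler_nat R 1).
have [A' A'0 HA'] := @pline_TT R n.+1 d (4 * d) A0 n.+2%:R A00 N1.
have Ol t s (O : vec) : 0 <= t <= 1 -> 0 <= s <= 1 -> cnorm O <= n.+2%:R -> nrm (peval (p s) O - peval (p t) O) <= A' * `|s - t|.
  move=> t01 s01 hO; have h0 : cnorm (0 : vec) <= n.+2%:R by rewrite cnorm0.
  have := HA' p O 0 t hO h0 (fun a => HT t a t01); rewrite E4 => /TT_lip /(_ s01); apply: le_trans.
  have -> : peval (p s) O - peval (p t) O = (pline (p s) O 0 - pline (p t) O 0)`_0.
    by rewrite coefB -!horner_coef0 !pline_horner !scaler0 !addr0.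
  exact: pn_coef.
pose K := (Num.trunc (2 * A' / dl)).+1.
have K0' : 0 < K%:R :> R by rewrite ltr0n.
have AK : A' / K%:R <= dl / 2.
  have q0 : 0 <= 2 * A' / dl by apply: divr_ge0; [exact: mulr_ge0|exact: ltW].
  have /andP[_ /ltW] := Num.Theory.truncn_itv q0; rewrite -/K ler_pdivrMr// => h.
  by rewrite ler_pdivrMr//; lra.
have affi (i : nat) : (i < K)%N -> i%:R / K%:R + K%:R^-1 <= 1 :> R.
  by move=> iK; rewrite -[X in _ + X]mul1r -mulrDl ler_pdivrMr// mul1r natr1 ler_nat.
have i0 (i : nat) : 0 <= i%:R / K%:R :> R by rewrite divr_ge0.
have Ki0 : 0 <= K%:R^-1 :> R by rewrite invr_ge0.
have HB (i : nat) : exists K0 : R, 0 <= K0 /\ ((i < K)%N -> forall eta : R, 0 < eta <= 1 -> exists B : set (Grm R n),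
    [/\ measurable B, fine (vol B) <= K0 * eta &
      forall L, (exists2 t, 0 <= t <= 1 & forall w, gr_set L w -> nrm (peval (p (i%:R / K%:R + K%:R^-1 * t)) w) <= eta ^+ d * cnorm w ^+ d) -> B L]).
  have [iK|_] := boolP (i < K)%N; last by exists 0.
  have ti01 : 0 <= (i%:R / K%:R : R) <= 1 by rewrite i0/= (le_trans _ (affi i iK))// lerDl.
  have [Ov [h1 h2]] := HO _ ti01.
  have dl2 : 0 < dl / 2 by rewrite divr_gt0.
  have [||K1 K10 HK1] := @tube_lemma R n d d0 vol inv A0 (dl / 2) (fun x => p (i%:R / K%:R + K%:R^-1 * x)) Ov A00 dl2.
  - move=> t a t01; apply: (TT_affine (F := fun x => (p x a)%:P)); rewrite ?affi//.
    by apply: HT; apply: affine01; rewrite ?affi.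
  - move=> t t01; have := Ol (i%:R / K%:R) (i%:R / K%:R + K%:R^-1 * t) Ov ti01 (affine01 (i0 i) Ki0 (affi i iK) t01) h1.
    rewrite [X in `|X|]addrAC subrr add0r => h3; have h4 : A' * `|K%:R^-1 * t| <= dl / 2.
      case/andP: t01 => t0 t1; rewrite ger0_norm ?mulr_ge0//; apply: le_trans AK.
      by rewrite ler_wpM2l// ler_piMr.
    have := nrm_ge_sub (peval (p (i%:R / K%:R)) Ov) (peval (p (i%:R / K%:R + K%:R^-1 * t)) Ov).
    by rewrite nrmB; lra.
  by exists K1.
have [Kf HKf] := choice HB.
exists (\sum_(i < K) Kf i); first by apply: sumr_ge0 => i _; case: (HKf i).
move=> eta e01.
have HBf (i : nat) : exists B : set (Grm R n), measurable B /\ ((i < K)%N -> fine (vol B) <= Kf i * eta /\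
      forall L, (exists2 t, 0 <= t <= 1 & forall w, gr_set L w -> nrm (peval (p (i%:R / K%:R + K%:R^-1 * t)) w) <= eta ^+ d * cnorm w ^+ d) -> B L).
  have [iK|_] := boolP (i < K)%N; last by exists set0.
  by have [_ /(_ iK eta e01)[B [h1 h2 h3]]] := HKf i; exists B.
have [Bf HBf'] := choice HBf.
have mB i : measurable (Bf i) by case: (HBf' i).
exists (\big[setU/set0]_(i < K) Bf i); split.
- by apply: bigsetU_measurable => i _.
- rewrite mulr_suml -lee_fin fineK ?fin_num_measure//; last by apply: bigsetU_measurable => i _.
  apply: le_trans (Boole_inequality vol (n := K) (fun i _ => mB i)) _.
  rewrite -sumEFin; apply: lee_sum => i _; have [_ /(_ (ltn_ord i))[h _]] := HBf' i.
  by rewrite -[leLHS]fineK ?fin_num_measure// lee_fin.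
- move=> L [t t01 Ht]; case/andP: (t01) => t0 t1.
  (* The cap K - 1 takes care of t = 1. *)
  pose i := minn (Num.trunc (t * K%:R)) K.-1.
  have iK : (i < K)%N by rewrite /i -ltnS; exact: geq_minr.
  have q0 : 0 <= t * K%:R by rewrite mulr_ge0.
  have /andP[a1 a2] := Num.Theory.truncn_itv q0.
  have x0 : i%:R <= t * K%:R by apply: le_trans a1; rewrite ler_nat geq_minl.
  have x1 : t * K%:R <= i%:R + 1.
    rewrite /i /minn; case: ifP => _; first by rewrite natr1 ltW.
    by rewrite natr1 /K /= ler_piMl.
  rewrite -bigcup_mkord; exists i => //; have [_ /(_ iK)[_]] := HBf' i; apply.
  exists (t * K%:R - i%:R); first by rewrite subr_ge0 x0 lerBlDl.
  have -> : i%:R / K%:R + K%:R^-1 * (t * K%:R - i%:R) = t by field; rewrite gt_eqF.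
  exact: Ht.
Unshelve. all: by end_near. Qed.
End BadSets.

(** * Zeros on a line over one cell *)

Section LineCell.
Variables (R : realType) (m d : nat) (q : R).
Hypothesis d0 : (0 < d)%N.
Hypothesis q1 : 1 <= q.
Hypothesis qd : q * ((4 * d)%:R - 1) < (4 * d)%:R.
Notation C := (R[i]).
Notation nrm := (@ComplexField.Normc.normc R).
Notation vec := ('rV[C]_(m.+1)).
Implicit Types (u v w : vec) (L : Gr R m).

Lemma peval_hom (p : hpoly R m d) u v (s r : C) :
  peval p (s *: u + r *: v) = \sum_(i < d.+1) (pline p u v)`_i * (s ^+ (d - i) * r ^+ i).
Proof.
have [sz top] := pline_top p u v; have [->|s0] := eqVneq s 0.
  rewrite scale0r add0r pevalZ big_ord_recr/= subnn expr0 mul1r top mulrC big1 ?add0r// => i _.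
  by rewrite expr0n gtn_eqF ?subn_gt0// mul0r mulr0.
have -> : s *: u + r *: v = s *: (u + (r / s) *: v) by rewrite scalerDr scalerA mulrCA divff// mulr1.
rewrite pevalZ -pline_horner (horner_coef_wide _ sz) mulr_sumr; apply: eq_bigr => i _.
have id : (i <= d)%N by rewrite -ltnS.
have -> : s ^+ d = s ^+ (d - i) * s ^+ i by rewrite -exprD subnK.
rewrite exprMn exprVn; move: (expf_neq0 i s0).
by move: (s ^+ (d - i)) (s ^+ i) (r ^+ i) (pline p u v)`_i => a b c e b0; field.
Qed.

(** The binary form with coefficients F in the basis (u, v), rewritten in the basis (v, u + a v) and
    dehomogenized. Being linear in F, this operation preserves Taylor classes. *)
Definition chg (a : C) (F : {poly C}) : {poly C} := \sum_(i < d.+1) F`_i *: ('X^(d - i) * (1 + a%:P * 'X) ^+ i).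

Lemma pline_chg (p : hpoly R m d) u v a : pline p v (u + a *: v) = chg a (pline p u v).
Proof.
apply: poly_ext => x; rewrite pline_horner horner_sum.
have -> : v + x *: (u + a *: v) = x *: u + (1 + a * x) *: v.
  by rewrite scalerDr scalerA scalerDl scale1r addrCA mulrC.
by rewrite peval_hom; apply: eq_bigr => i _; rewrite !hornerE.
Qed.

Lemma chgZ a (c : C) F : chg a (c *: F) = c *: chg a F.
Proof. by rewrite scaler_sumr; apply: eq_bigr => i _; rewrite coefZ scalerA. Qed.

Lemma pn_chg a F : nrm a <= 1 -> pn (chg a F) <= d.+1%:R * 2 ^+ d * pn F.
Proof.
move=> a1; apply: le_trans (pn_sum _ _ _) _.
rewrite (le_trans (ler_sum _ (G := fun=> 2 ^+ d * pn F) _))//; last by rewrite sumr_const card_ord -mulrA mulr_natl.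
move=> i _; rewrite pnZ mulrC ler_pM ?pn_ge0 ?nrm_ge0 ?pn_coef//.
rewrite mulrC (le_trans (pnMXn _ _))//.
have h : pn (1 + a%:P * 'X) <= 2.
  rewrite (le_trans (pnD _ _))// -polyC1 pnC nrm1 mul_polyC pnZ.
  have := ler_pM (nrm_ge0 _) (pn_ge0 _) a1 (pnX1 R); rewrite mulr1; lra.
have key k : pn ((1 + a%:P * 'X) ^+ k) <= 2 ^+ k.
  elim: k => [|k IH]; first by rewrite !expr0 -polyC1 pnC nrm1.
  by rewrite !exprS (le_trans (pnM _ _))// ler_pM ?pn_ge0.
by apply: le_trans (key i) _; rewrite ler_weXn2l ?ler1n// -ltnS.
Qed.

Lemma TT_chg s A t a F : nrm a <= 1 -> TT s A t F -> TT s (d.+1%:R * 2 ^+ d * A) t (fun x => chg a (F x)).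
Proof.
move=> a1; apply: TT_lin => [f g|c f||f]; [|exact: chgZ|by rewrite mulr_ge0 ?exprn_ge0|exact: pn_chg].
by rewrite /chg -big_split/=; apply: eq_bigr => i _; rewrite coefD scalerDl.
Qed.

Lemma TT_of_cparts s k B y (F : R -> {poly C}) : 0 <= B -> 0 <= y <= 1 -> (forall x, (size (F x) <= k)%N) ->
  (forall j : 'I_(k.*2), exists T : {poly R}, [/\ (size T <= s)%N, forall i, `|T`_i| <= B &
      forall x, 0 <= x <= 1 -> `|cpart F j x - T.[x - y]| <= B * `|x - y| ^+ s]) ->
  TT s (\sum_(i < k) (s.+1%:R * B + s.+1%:R * B)) y F.
Proof.
move=> B0 y01 sz H.
have HT (j : nat) : (j < k.*2)%N -> TT s (s.+1%:R * B) y (fun x => ((cpart F j x)%:C%C)%:P).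
  by move=> jm; have [T [h1 h2 h3]] := H (Ordinal jm); exact: (TT_real B0 y01 h1 h2 h3).
rewrite (_ : F = (fun x => \sum_(i < k)
   (((cpart F i.*2 x)%:C%C)%:P + 'i%C *: ((cpart F i.*2.+1 x)%:C%C)%:P) * 'X^i)).
  apply: TT_sum => i; apply: TT_mulXn; apply: TT_add; first by apply: HT; rewrite ltn_double.
  have -> : s.+1%:R * B = nrm 'i%C * (s.+1%:R * B) by rewrite /= expr0n/= add0r expr1n sqrtr1 mul1r.
  by apply: TT_scale; apply: HT; rewrite ltn_Sdouble.
apply/funext => x; have E : F x = \poly_(i < k) (F x)`_i.
  by apply/polyP => i; rewrite coef_poly; case: ltnP => // h; rewrite nth_default// (leq_trans (sz x)).
rewrite [LHS]E poly_def; apply: eq_bigr => i _.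
by rewrite (cpartE F) -mul_polyC polyCD polyCM -mul_polyC.
Qed.

Definition zlD (p : R -> hpoly R m d) L (s t : R) : R := bdist (@rho R m) (zl (p s) L) (zl (p t) L).

(** In the orthonormal basis the vector has coordinates z and 1 + z a. If |z| < 1, the second one is
    at least 1/2 in absolute value. *)
Lemma line_norm u v (a z : C) : cnorm u = 1 -> cnorm v = 1 -> cinner u v = 0 -> nrm a <= 2^-1 ->
  2^-1 <= cnorm (v + z *: (u + a *: v)).
Proof.
move=> u1 v1 uv a2; set w := v + _.
have vu : cinner v u = 0 by rewrite cinnerC uv conjC0.
have uu : cinner u u = 1 by rewrite cinner_cnorm u1 expr1n.
have vv : cinner v v = 1 by rewrite cinner_cnorm v1 expr1n.
have hz : nrm z <= cnorm w.
  have := cauchy_schwarz u w; rewrite u1 mul1r /w cinnerDr cinnerZr cinnerDr cinnerZr uv uu mulr0 addr0 mulr1 add0r; exact.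
have h1 : nrm (1 + z * a) <= cnorm w.
  have := cauchy_schwarz v w; rewrite v1 mul1r /w cinnerDr cinnerZr cinnerDr cinnerZr vu vv mulr1 add0r; exact.
have [h|h] := leP 1 (nrm z); first by apply: le_trans hz; apply: le_trans h; lra.
apply: le_trans h1; have := nrm_ge_sub 1 (- (z * a)); rewrite opprK nrmN nrm1 nrmM.
have := ler_pM (nrm_ge0 _) (nrm_ge0 _) (ltW h) a2; lra.
Qed.

(** All coefficients carry the same weight d, since the restricted form is only multiplied by a
    constant. A dominant coefficient makes it large over the whole cell at some u + a v with a among
    the nodes. With this vector as point at infinity, the dehomogenized form becomes monic after
    division by a factor bounded below, and [roots_Rbound] applies directly, without clusters. *)
Lemma line_cell (CI : R) : 1 <= CI ->
  exists2 c0 : R, 0 < c0 <= 1 & exists2 M2 : R, 0 <= M2 & forall (A : R) (p : R -> hpoly R m d) L u v l (u0 r t : R), 1 <= A ->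
  lbasis L u v -> cnorm u = 1 -> cnorm v = 1 -> cinner u v = 0 ->
  cell_ok d CI A c0 (fun j : 'I_(d.+1.*2) => cpart (fun x => pline (p x) u v) j) (fun=> d) l u0 r t ->
  Rbound q (zlD p L) u0 (u0 + r) (r `^ (1 - q) * M2).
Proof.
move=> C1; have CI0 : 0 <= CI := le_trans ler01 C1.
have [CI2 CI21 HCI2] := @interpC R d.+1 isT.
have CI20 : 0 < CI2 := lt_le_trans ltr01 CI21.
pose be : R := 16^-1 ^+ d; have be0 : 0 < be by rewrite exprn_gt0.
pose c2 := be / (2 * CI2); have c20 : 0 < c2 by rewrite divr_gt0// mulr_gt0.
pose c0 := Num.min 1 (c2 / (4 * d.+1%:R)).
have c00 : 0 < c0 by rewrite lt_min ltr01 divr_gt0// mulr_gt0.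
have c01 : c0 <= 1 by rewrite ge_min lexx.
have c0c2 : d.+1%:R * (2 * c0) <= c2 / 2.
  have : c0 <= c2 / (4 * d.+1%:R) by rewrite ge_min lexx orbT.
  rewrite ler_pdivlMr ?mulr_gt0// => h; lra.
exists c0; first by rewrite c00.
have c30 : 0 < c2 / 2 by rewrite divr_gt0.
pose B1 : R := \sum_(i < d.+1) ((4 * d).+1%:R * (3 * CI) + (4 * d).+1%:R * (3 * CI)).
pose B2 := d.+1%:R * 2 ^+ d * B1.
have [Ai HAi] := TT_inv (4 * d) B2 c30.
have [M M0 HM] := roots_Rbound d0 q1 qd (2 ^+ (4 * d) * (Ai * B2)) (leqnn d).
pose cr : R := m.+1%:R ^+ 2 * 16; have cr0 : 0 <= cr by rewrite mulr_ge0 ?exprn_ge0.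
exists (cr `^ q * M); first by rewrite mulr_ge0 ?powR_ge0.
move=> A p L u v l u0 r t A1 Luv u1 v1 uv [[u00 ur] /andP[r0 r1] /andP[ut tr] [_ [j0 lev2]] [osc tay]].
pose P x := pline (p x) u v.
pose s := sig A l ^+ d; have s0 : 0 < s by rewrite exprn_gt0// sig_gt0.
have si0 : 0 < s^-1 by rewrite invr_gt0.
pose Q0 x := (s^-1)%:C%C *: P (u0 + r * x).
have szQ x : (size (Q0 x) <= d.+1)%N by rewrite (leq_trans (size_scale_leq _ _))// (pline_top _ _ _).1.
have cQ j x : cpart Q0 j x = cpart P j (u0 + r * x) / s by rewrite /cpart coefZ partZ mulrC.
have in01 x : 0 <= x <= 1 -> u0 <= u0 + r * x <= u0 + r.
  by move=> /andP[x0 x1]; rewrite lerDl mulr_ge0 ?(ltW r0)//= lerD2l ler_piMr// ltW.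
have TTQ y : 0 <= y <= 1 -> TT (4 * d) B1 y Q0.
  move=> y01; apply: TT_of_cparts => //; first by rewrite mulr_ge0.
  by move=> j; have [T [h1 h2 h3]] := tay j y y01; exists T; split => // x x01; rewrite cQ; exact: h3.
pose t' := (t - u0) / r.
have t'E : u0 + r * t' = t by rewrite /t' mulrC divfK ?gt_eqF//; lra.
have t'01 : 0 <= t' <= 1 by rewrite /t' divr_ge0 ?subr_ge0 ?(ltW r0)//= ler_pdivrMr// mul1r; lra.
have cosc (j : 'I_(d.+1.*2)) x : 0 <= x <= 1 -> `|cpart Q0 j x - cpart Q0 j t'| <= c0.
  move=> x01; rewrite !cQ t'E -mulrBl normrM (ger0_norm (ltW si0)) ler_pdivrMr//.
  exact: (osc j _ (in01 x x01)).
have big0 : be < nrm (Q0 t')`_(j0./2).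
  apply: lt_le_trans (cpart_le Q0 j0 t'); rewrite cQ t'E normrM (ger0_norm (ltW si0)) ltr_pdivlMr//.
  apply: le_lt_trans lev2; rewrite le_eqVlt; apply/orP; left; apply/eqP.
  by rewrite /be /s /sig exprS -exprMn; congr (_ ^+ _); ring.
(* If the form were small at all d + 1 nodes, interpolation would make all its coefficients
   small. *)
have [i0 Hi0] : exists i : 'I_(d.+1), c2 < nrm (Q0 t').[(node R d.+1 i)%:C%C].
  apply/not_existsP => h; have h2 (i : 'I_d.+1) : nrm (Q0 t').[(node R d.+1 i)%:C%C] <= c2.
    by rewrite leNgt; apply/negP => h'; exact: (h i).
  have := HCI2 _ _ (szQ t') h2 (j0./2); rewrite leNgt => /negP; apply; apply: le_lt_trans big0.
  have -> : CI2 * c2 = be / 2 by rewrite /c2; field; rewrite gt_eqF.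
  by rewrite ler_pdivrMr// ler_peMr ?(ltW be0)// ler1n.
pose al : C := (node R d.+1 i0)%:C%C.
have al2 : nrm al <= 2^-1.
  by rewrite nrmR; have /andP[n0 n1] := @node01 R d.+1 i0 (ltn_ord i0); rewrite ger0_norm.
have al1 : nrm al <= 1 by rewrite (le_trans al2)// invf_le1// ler1n.
have Qal x : 0 <= x <= 1 -> c2 / 2 <= nrm (Q0 x).[al].
  move=> x01; have h : nrm ((Q0 t').[al] - (Q0 x).[al]) <= c2 / 2.
    apply: le_trans c0c2; rewrite !(horner_coef_wide _ (szQ _)) -sumrB.
    apply: le_trans (nrm_sum _ _ _) _.
    rewrite (le_trans (ler_sum _ (G := fun=> 2 * c0) _))//; last by rewrite sumr_const card_ord -[leLHS]mulr_natl.
    move=> i _; rewrite -mulrBl nrmM nrmX.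
    have hi : nrm al ^+ i <= 1 by rewrite exprn_ile1 ?nrm_ge0.
    have hd : nrm ((Q0 t')`_i - (Q0 x)`_i) <= 2 * c0.
      apply: le_trans (nrm_le_ReIm _) _; rewrite -[complex.Re _]/(part false _) -[complex.Im _]/(part true _) !partB.
      have i1 : (i.*2 < d.+1.*2)%N by rewrite ltn_double.
      have i2 : (i.*2.+1 < d.+1.*2)%N by rewrite ltn_Sdouble.
      have := cosc (Ordinal i1) x x01; have := cosc (Ordinal i2) x x01.
      rewrite /cpart /= odd_double doubleK uphalf_double => h1 h2.
      by rewrite distrC [X in _ + X]distrC; lra.
    by rewrite -[leRHS]mulr1 ler_pM ?nrm_ge0// exprn_ge0 ?nrm_ge0.
  have := nrm_ge_sub (Q0 t').[al] ((Q0 t').[al] - (Q0 x).[al]); rewrite opprB addrCA subrr addr0.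
  have := Hi0; rewrite -/al; lra.
pose v' := u + al *: v.
have Lvv : lbasis L v v'.
  have := @lbasis_change R m L u v 0 1 1 al Luv; rewrite scale0r add0r !scale1r mul0r mul1r sub0r; apply.
  by rewrite oppr_eq0 oner_eq0.
have Qv' x : (Q0 x).[al] = (s^-1)%:C%C * peval (p (u0 + r * x)) v' by rewrite hornerZ pline_horner.
have HF x : exists rs : seq C, size rs = d /\ (0 <= x <= 1 -> zdata (p (u0 + r * x)) L v v' rs).
  have [x01|nx] := boolP (0 <= x <= 1); last by exists (nseq d 0); rewrite size_nseq.
  have nz : peval (p (u0 + r * x)) v' != 0.
    have := lt_le_trans c30 (Qal x x01); rewrite nrm_gt0 Qv' mulf_eq0 negb_or => /andP[]//.
  by have [rs h1 h2] := pline_factor v nz; exists rs; split => // _; split.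
have [rs Hrs] := choice HF.
have szr x : size (rs x) = d by case: (Hrs x).
have HTr y : 0 <= y <= 1 -> TT (4 * d) (2 ^+ (4 * d) * (Ai * B2)) y (fun x => Pr (rs x)).
  move=> y01; have T1 := TT_chg al1 (TTQ y y01).
  have chgE x : chg al (Q0 x) = (s^-1)%:C%C *: pline (p (u0 + r * x)) v v' by rewrite chgZ -pline_chg.
  have T2 : TT (4 * d) B2 y (fun x => ((Q0 x).[al])%:P).
    by have := TT_coef d T1; apply: TT_ext => // x x01; rewrite chgE coefZ (pline_top _ _ _).2 Qv'.
  have := TT_mul y01 (HAi y _ y01 Qal T2) T1; apply: TT_ext => // x x01.
  have [_ /(_ x01)[_ nz _ E]] := Hrs x.
  rewrite chgE E mul_polyC !scalerA Qv' mulVf ?scale1r// mulf_neq0//.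
  by rewrite -nrm_eq0 nrmR normr_eq0 gt_eqF.
have HR := HM rs szr HTr.
have resc : forall x y, 0 <= x <= 1 -> 0 <= y <= 1 -> zlD p L (u0 + r * x) (u0 + r * y) <= cr * rdist rs x y.
  move=> x y x01 y01; have [sx /(_ x01) zx] := Hrs x; have [sy /(_ y01) zy] := Hrs y.
  rewrite /zlD (bdist_perm _ (zl_perm d0 zx) (zl_perm d0 zy)) -[leRHS]addr0; apply: bdist_map => //; first by rewrite sx sy.
  move=> z1 z2 _ _; rewrite addr0 /dC.
  have ind : cindep v v' := Lvv.1.
  apply: le_trans (rho_pt (indep_line_neq0 _ ind) (indep_line_neq0 _ ind)) _.
  rewrite /cr -[leRHS]mulrA; apply: ler_wpM2l; first exact: exprn_ge0.
  have n1 := @line_norm u v al z1 u1 v1 uv al2.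
  have n0 : 0 < cnorm (v + z1 *: v') by apply: lt_le_trans n1; rewrite invr_gt0.
  rewrite ler_pdivrMr// opprD addrACA subrr add0r -scalerBl cnormZ.
  have hv' : cnorm v' <= 2.
    rewrite (le_trans (cnormD _ _))// cnormZ u1 v1 mulr1; lra.
  have := ler_wpM2l (nrm_ge0 (z1 - z2)) hv'; have := ler_wpM2l (nrm_ge0 (z1 - z2)) n1; rewrite -/v'; lra.
have := Rbound_rescale q1 (D := zlD p L) _ _ r0 cr0 resc HR.
rewrite mulrAC [_ * M * _]mulrC; apply => x y; exact: bdist_ge0.
Qed.
End LineCell.

(** * Good lines *)

Section GoodLines.
Variables (R : realType) (m d : nat) (q : R).
Hypothesis d0 : (0 < d)%N.
Hypothesis q1 : 1 <= q.
Hypothesis qd : q * ((4 * d)%:R - 1) < (4 * d)%:R.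
Notation C := (R[i]).
Notation nrm := (@ComplexField.Normc.normc R).
Notation vec := ('rV[C]_(m.+1)).
Implicit Types (L : Gr R m) (p : R -> hpoly R m d).

Lemma zl_size (p : hpoly R m d) L w : gr_set L w -> peval p w != 0 -> size (zl p L) = d.
Proof.
move=> Lw pw; have [u [v [rs z]]] := zdata_exists Lw pw d0.
by rewrite (perm_size (zl_perm d0 z)) size_map; case: z.
Qed.

Lemma zlD_tri p L : (forall t, 0 <= t <= 1 -> size (zl (p t) L) = d) ->
  {in `[0, 1] & &, forall x y z, zlD p L x z <= zlD p L x y + zlD p L y z}.
Proof.
move=> H x y z; rewrite !in_itv/= => hx hy hz; apply: bdist_trans; rewrite ?H//.
by move=> *; exact: rho_tri.
Qed.

Lemma sum8_le l : \sum_(i < l) 8 ^+ i <= 8 ^+ l :> R.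
Proof.
elim: l => [|l IH]; first by rewrite big_ord0.
have : 0 <= 8 ^+ l :> R by rewrite exprn_ge0.
by rewrite big_ord_recr/= exprS; lra.
Qed.

(** The hypothesis on q gives (4 d - 1)(q - 1) < 1, hence 2 d (q - 1) <= 1; this bounds the cost of
    the shortest cells of level l by a multiple of 4^l. *)
Lemma powR_level (rr0 : R) l : 0 < rr0 -> (rr0 * 16^-1 ^+ (l * d)) `^ (1 - q) <= rr0 `^ (1 - q) * 4 ^+ l.
Proof.
move=> r0; rewrite powRM ?exprn_ge0 ?(ltW r0)// ler_wpM2l ?powR_ge0//.
have p16 k : (16^-1 ^+ k : R) = 2 `^ (- (4 * k%:R)).
  rewrite exprVn powRN; have -> : 16 = 2 ^+ 4 :> R by ring.
  by rewrite -exprM -natrM powR_mulrn.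
have p4 : (4 ^+ l : R) = 2 `^ (2 * l%:R).
  have -> : 4 = 2 ^+ 2 :> R by ring.
  by rewrite -exprM -natrM powR_mulrn.
rewrite p16 p4 -powRrM ler_powR ?ler1n//.
have dR : 1 <= d%:R :> R by rewrite (ler_nat R 1).
have h1 : 2 * d%:R * (q - 1) <= 1.
  apply: (@le_trans _ _ (((4 * d)%:R - 1) * (q - 1))).
    by rewrite ler_wpM2r ?subr_ge0// natrM; lra.
  by have := qd; rewrite natrM; lra.
have h2 := ler_wpM2l (ler0n R l) h1; rewrite natrM; nra.
Qed.

(** The cells of level k, O(2^k) in number, cost O(4^k) each. The lower bound on p_t along L
    excludes points below level l, so the sum over levels stops at l and is dominated by 8^l. *)
Lemma good_line_bound (A0 : R) : 0 <= A0 ->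
  exists2 Cg : R, 0 < Cg & exists2 Cn : R, 0 <= Cn & forall p L l,
  (forall t a, 0 <= t <= 1 -> TT (4 * d) A0 t (fun x => (p x a)%:P)) ->
  (forall t, 0 <= t <= 1 -> exists2 w, gr_set L w & (Cg * 16^-1 ^+ l) ^+ d * cnorm w ^+ d < nrm (peval (p t) w)) ->
  Rbound q (zlD p L) 0 1 (Cn * 8 ^+ l).
Proof.
move=> A00; have [A' A'0 HA'] := @pline_TT R m d (4 * d) A0 1 A00 (lexx 1).
pose A := 1 + A'; have A1 : 1 <= A by rewrite lerDl.
have A0' : 0 <= A := le_trans ler01 A1.
have wd (j : 'I_(d.+1.*2)) : (0 < d <= d)%N by rewrite d0 leqnn.
have [CI CI1 Hcell] := cell_lemma d0 wd q1.
have [c0 c01 [M2 M20 HM2]] := line_cell m d0 q1 qd CI1.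
have [Cn [rr0 [Cn0 rr00 H]]] := Hcell A c0 A1 c01.
(* Below level l every coefficient of the restricted form is at most 4 sig(l)^d, and there are d + 1
   of them. *)
pose Cg := 4 * d.+1%:R * A; have Cg0 : 0 < Cg by rewrite !mulr_gt0// (lt_le_trans ltr01).
exists Cg => //; exists (Cn * (rr0 `^ (1 - q) * M2)); first by rewrite !mulr_ge0 ?powR_ge0.
move=> p L l HT HL; have [u [v [Luv u1 v1 uv]]] := lbasis_orthonormal L.
pose P x := pline (p x) u v; pose a (j : 'I_(d.+1.*2)) := cpart P j.
have TP t : 0 <= t <= 1 -> TT (4 * d) A t P.
  move=> t01; apply: (@TT_mono _ _ A'); first by rewrite lerDr.
  by apply: HA'; rewrite ?u1 ?v1// => b; exact: HT.
have sz t : 0 <= t <= 1 -> size (zl (p t) L) = d.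
  move=> /HL[w Lw hw]; apply: (zl_size Lw); rewrite -nrm_gt0; apply: le_lt_trans hw.
  by rewrite mulr_ge0 ?exprn_ge0 ?mulr_ge0 ?cnorm_ge0 ?(ltW Cg0) ?exprn_ge0.
pose W (k : nat) : R := rr0 `^ (1 - q) * 4 ^+ k * M2.
have W0 k : 0 <= W k by rewrite !mulr_ge0 ?powR_ge0 ?exprn_ge0.
apply: Rbound_mono (H a l (zlD p L) W _ _ _ W0 _ _).
- rewrite -mulrA ler_wpM2l// (_ : \sum_(k < l) _ = rr0 `^ (1 - q) * M2 * \sum_(k < l) 8 ^+ k).
    by rewrite ler_wpM2l ?sum8_le// mulr_ge0 ?powR_ge0.
  rewrite mulr_sumr; apply: eq_bigr => k _; rewrite /W (_ : 8 ^+ k = 2 ^+ k * 4 ^+ k :> R); first by ring.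
  by rewrite -exprMn; congr (_ ^+ _); ring.
- by move=> j t t01; apply: TT_cpart => //; exact: TP.
- by move=> x y; exact: bdist_ge0.
- exact: zlD_tri.
- move=> x y [x01 Hx] _; exfalso; have [w Lw hw] := HL x x01.
  move: (Lw); rewrite Luv.2 => -[al [be E]]; move: hw; rewrite ltNge => /negP; apply.
  have vu : cinner v u = 0 by rewrite cinnerC uv conjC0.
  have uu : cinner u u = 1 by rewrite cinner_cnorm u1 expr1n.
  have vv : cinner v v = 1 by rewrite cinner_cnorm v1 expr1n.
  have ha : nrm al <= cnorm w.
    by have := cauchy_schwarz u w; rewrite u1 mul1r E cinnerDr !cinnerZr uv uu mulr0 addr0 mulr1.
  have hb : nrm be <= cnorm w.
    by have := cauchy_schwarz v w; rewrite v1 mul1r E cinnerDr !cinnerZr vu vv mulr0 add0r mulr1.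
  set s := sig A l ^+ d in Hx; have s0 : 0 <= s by rewrite exprn_ge0// mulr_ge0 ?exprn_ge0.
  have w0 := cnorm_ge0 w.
  rewrite {1}E peval_hom (le_trans (nrm_sum _ _ _))//.
  apply: (@le_trans _ _ (\sum_(i < d.+1) 4 * s * cnorm w ^+ d)).
    apply: ler_sum => i _; rewrite nrmM; apply: ler_pM; rewrite ?nrm_ge0//.
      have i1 : (i.*2 < d.+1.*2)%N by rewrite ltn_double.
      have i2 : (i.*2.+1 < d.+1.*2)%N by rewrite ltn_Sdouble.
      apply: le_trans (cpart_nrm P i x) _.
      have h1 : `|cpart P i.*2 x| <= 2 * s := Hx (Ordinal i1).
      have h2 : `|cpart P i.*2.+1 x| <= 2 * s := Hx (Ordinal i2).
      have -> : 4 * s = 2 * s + 2 * s by ring.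
      exact: lerD h1 h2.
    rewrite nrmM !nrmX (_ : cnorm w ^+ d = cnorm w ^+ (d - i) * cnorm w ^+ i); last by rewrite -exprD subnK// -ltnS.
    by rewrite ler_pM ?exprn_ge0 ?nrm_ge0// lerXn2r ?nnegrE ?nrm_ge0.
  rewrite sumr_const card_ord -[leLHS]mulr_natl mulrA ler_wpM2r ?exprn_ge0//.
  have -> : d.+1%:R * (4 * s) = (4 * d.+1%:R) * s by ring.
  have -> : Cg * 16^-1 ^+ l = (4 * d.+1%:R) * sig A l by rewrite /Cg /sig mulrA.
  rewrite [leRHS]exprMn; apply: ler_wpM2r => //.
  have c1 : 1 <= 4 * d.+1%:R :> R by rewrite -natrM (ler_nat R 1).
  by rewrite -[leLHS]expr1 ler_weXn2l.
- move=> k u0 r t kl hr cell; have R1 := HM2 A p L u v k u0 r t A1 Luv u1 v1 uv cell.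
  apply: Rbound_mono R1; rewrite /W ler_wpM2r//; apply: le_trans (powR_level k rr00).
  have g0 : 0 < rr0 * 16^-1 ^+ (k * d) by rewrite mulr_gt0// exprn_gt0.
  have -> : 1 - q = - (q - 1) by rewrite opprB.
  rewrite !powRN lef_pV2 ?posrE ?powR_gt0//; last exact: lt_le_trans hr.
  by rewrite ge0_ler_powR ?nnegrE ?subr_ge0// ?(ltW g0)//; apply: ltW; exact: lt_le_trans hr.
Qed.
End GoodLines.

(** * Integration over lines *)

Section Integrated.
Variables (R : realType) (n d : nat) (q : R).
Hypothesis d0 : (0 < d)%N.
Hypothesis q1 : 1 <= q.
Hypothesis qd : q * ((4 * d)%:R - 1) < (4 * d)%:R.
Notation nrm := (@ComplexField.Normc.normc R).
Implicit Types (p : R -> hpoly R n.+1 d).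
Variable vol : probability (Grm R n) R.
Hypothesis inv : gr_invariant vol.

(** By [zl_continuous], the lines that have d zeros at both times and satisfy zlD < c form an open
    set. *)
Lemma zlD_measurable p s t (G : set (Grm R n)) : measurable G ->
  (forall L, G L -> size (zl (p s) L) = d /\ size (zl (p t) L) = d) ->
  measurable_fun G (fun L : Grm R n => zlD p L s t).
Proof.
move=> mG HG.
have sz0 (p0 : hpoly R n.+1 d) (L : Gr R n.+1) (e : R) : size (zl p0 L) = d -> 0 < e -> exists2 del : R, 0 < del &
    forall M, dGr L M < del -> matched (@rho R n.+1) e (zl p0 L) (zl p0 M).
  move=> sz e0; have [|u [v [rs z]]] := @zl_dataP R n d p0 L; last exact: (zl_continuous d0 z e0).
  by apply/eqP => h; move: sz d0; rewrite h /= => <-.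
have msz (e : R) xs ys : matched (@rho R n.+1) e xs ys -> size xs = size ys.
  by move=> [ys' p1 /all2_size ->]; rewrite (perm_size p1).
have thirds (z c : R) : z < c -> (c - z) / 3 + (z + (c - z) / 3) < c by lra.
have open c : @gr_open R n.+1 [set L | [/\ size (zl (p s) L) = d, size (zl (p t) L) = d & zlD p L s t < c]].
  move=> L [s1 s2 h]; pose e := (c - zlD p L s t) / 3.
  have e0 : 0 < e by rewrite divr_gt0// subr_gt0.
  have [del1 d10 H1] := sz0 _ _ _ s1 e0; have [del2 d20 H2] := sz0 _ _ _ s2 e0.
  exists (Num.min del1 del2); first by rewrite lt_min d10.
  move=> M; rewrite lt_min => /andP[/H1 M1 /H2 M2].
  have s1' := msz _ _ _ M1; have s2' := msz _ _ _ M2.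
  split; rewrite -?s1' -?s2'//.
  have D1 : bdist (@rho R n.+1) (zl (p s) M) (zl (p s) L) <= e.
    by apply: bdist_le; [exact: ltW|apply: matched_sym => //; exact: rho_sym].
  have D2 : bdist (@rho R n.+1) (zl (p t) L) (zl (p t) M) <= e by apply: bdist_le => //; exact: ltW.
  have tri := @bdist_trans R _ (@rho R n.+1).
  have t1 := tri (zl (p s) M) (zl (p s) L) (zl (p t) M) (@rho_tri R n.+1) (esym s1') _.
  have t2 := tri (zl (p s) L) (zl (p t) L) (zl (p t) M) (@rho_tri R n.+1) _ s2'.
  rewrite s1 -s2' s2 in t1; rewrite s1 s2 in t2.
  apply: (le_lt_trans (t1 erefl)); apply: (le_lt_trans (lerD D1 (le_trans (t2 erefl) (lerD (lexx _) D2)))).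
  exact: thirds h.
apply: (measurability _ (RGenInftyO.measurableE R)) => _ [_ [c ->] <-].
rewrite (_ : _ `&` _ = G `&` [set L | [/\ size (zl (p s) L) = d, size (zl (p t) L) = d & zlD p L s t < c]]).
  apply: measurableI => //; exact: gr_open_measurable.
apply/seteqP; split => L /= [GL]; first by rewrite in_itv/= => h; split => //; have [] := HG L GL.
by move=> [_ _ h]; split => //; rewrite in_itv.
Qed.

Lemma zlD_bound p L s t : size (zl (p s) L) = size (zl (p t) L) -> zlD p L s t <= n.+2%:R ^+ 2 * 2.
Proof.
move=> sz; apply: bdist_le; first by rewrite mulr_ge0 ?exprn_ge0.
exists (zl (p t) L) => //; elim: (zl (p s) L) (zl (p t) L) sz => [|x xs IH] [|y ys]//= [/IH ->].
by rewrite rho_le.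
Qed.

Definition zlF p (G : set (Grm R n)) (s t : R) : \bar R := (\int[vol]_(L in G) ((zlD p L s t) `^ q)%:E)%E.

Lemma zlF_fin p (G : set (Grm R n)) s t : measurable G ->
  (forall L, G L -> size (zl (p s) L) = d /\ size (zl (p t) L) = d) -> zlF p G s t \is a fin_num.
Proof.
move=> mG Gsz; have q0 : 0 < q := lt_le_trans ltr01 q1.
rewrite ge0_fin_numE; last by apply: integral_ge0 => L _; rewrite lee_fin powR_ge0.
apply: (@le_lt_trans _ _ (\int[vol]_(L in G) (cst ((n.+2%:R ^+ 2 * 2) `^ q)%:E L))%E).
  apply: ge0_le_integral => //.
  - by move=> L _; rewrite lee_fin powR_ge0.
  - by apply/measurable_EFinP; apply: (measurableT_comp (measurable_powR q)); exact: zlD_measurable.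
  - move=> L GL'; rewrite lee_fin ge0_ler_powR ?nnegrE ?(ltW q0) ?bdist_ge0 ?mulr_ge0 ?exprn_ge0//.
    by apply: zlD_bound; have [-> ->] := Gsz L GL'.
by rewrite integral_cst//= lte_mul_pinfty ?lee_fin ?powR_ge0// (le_lt_trans (probability_le1 _ _))// ltry.
Qed.

(** The Riesz term of an L^q norm is linear in the q-th power of that norm, so the Riesz sum of the
    L^q distance is the integral over lines of the Riesz sums. The rate 8^l on good lines is beaten
    by the volume 16^(-l) of the bad sets. *)
Lemma zlF_Rbound (A0 : R) p : 0 <= A0 ->
  (forall t a, 0 <= t <= 1 -> TT (4 * d) A0 t (fun x => (p x a)%:P)) ->
  (forall t, 0 <= t <= 1 -> exists a, p t a != 0) ->
  exists G : set (Grm R n), [/\ measurable G, vol G = 1%E,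
    forall L, G L -> forall t, 0 <= t <= 1 -> size (zl (p t) L) = d &
    exists2 M : R, 0 <= M & Rbound q (fun s t => fine (zlF p G s t) `^ q^-1) 0 1 M].
Proof.
move=> A00 HT Hp; have q0 : 0 < q := lt_le_trans ltr01 q1.
have [K0 K00 HB] := @bad_sets R n d d0 vol inv A0 p A00 HT Hp.
have [Cg Cg0 [Cn Cn0 HL]] := @good_line_bound R n.+1 d q d0 q1 qd A0 A00.
pose K1 := (K0 + 1) * Cg; have K10 : 0 <= K1 by rewrite mulr_ge0 ?addr_ge0// ltW.
have HB' (l : nat) : exists B : set (Grm R n), [/\ measurable B, (vol B <= (K1 * 16^-1 ^+ l)%:E)%E &
    forall L, ~ B L -> Rbound q (zlD p L) 0 1 (Cn * 8 ^+ l) /\ forall t, 0 <= t <= 1 -> size (zl (p t) L) = d].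
  pose eta := Cg * 16^-1 ^+ l; have e0 : 0 < eta by rewrite mulr_gt0// exprn_gt0.
  (* For eta > 1 the whole space serves as bad set, since its volume 1 is less than eta. *)
  have [e1|e1] := leP eta 1; last first.
    exists setT; split => //.
    - rewrite probability_setT lee_fin /K1 -mulrA -/eta mulrDl mul1r; apply: ler_wpDl; last exact: ltW.
      by rewrite mulr_ge0// ltW.
    - by move=> L [].
  have [|B [mB vB hB]] := HB eta; first by rewrite e0.
  exists B; split => //.
    rewrite -[leLHS]fineK ?fin_num_measure// lee_fin (le_trans vB)// /K1 -mulrA -/eta ler_wpM2r ?(ltW e0)//.
    by rewrite lerDl.
  move=> L nB; have good t : 0 <= t <= 1 -> exists2 w, gr_set L w & eta ^+ d * cnorm w ^+ d < nrm (peval (p t) w).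
    move=> t01; apply: contrapT => h; apply: nB; apply: hB; exists t => // w Lw.
    by rewrite leNgt; apply/negP => h'; apply: h; exists w.
  split; first exact: (HL p L l HT good).
  move=> t /good[w Lw hw]; apply: (zl_size d0 Lw); rewrite -nrm_gt0; apply: le_lt_trans hw.
  by rewrite mulr_ge0 ?exprn_ge0 ?(ltW e0) ?cnorm_ge0.
have [Bf HBf] := choice HB'; clearbody K1.
have mB l : measurable (Bf l) by case: (HBf l).
pose N := \bigcap_l Bf l; have mN : measurable N by apply: bigcap_measurable => // ; exists 0%N.
have vN : vol N = 0%E.
  apply/eqP; rewrite eq_le measure_ge0 andbT; apply/lee_addgt0Pr => e e0; rewrite add0e.
  have h : 0 < e / (K1 + 1) by rewrite divr_gt0// ltr_wpDl.
  have [l Hl] := half_small h.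
  have [_ vb _] := HBf l; apply: le_trans (le_measure _ _ _ _) _; last apply: le_trans vb _; rewrite ?inE//.
    by move=> L; apply.
  rewrite lee_fin; apply: (@le_trans _ _ (K1 * (e / (K1 + 1)))).
    rewrite ler_wpM2l// (le_trans _ Hl)// lerXn2r ?nnegrE ?invr_ge0// lef_pV2 ?posrE// ler_nat//.
  by rewrite mulrCA ler_piMr ?(ltW e0)// ler_pdivrMr ?ltr_wpDl// mul1r lerDl.
(* Outside a null set every line is good at some level; in particular it carries d zeros at all
   times. *)
pose G := ~` N; have mG : measurable G by exact: measurableC.
have GL L : G L -> exists l, ~ Bf l L.
  by move=> nN; apply/not_existsP => h; apply: nN => l _; apply: contrapT; exact: h.
have Gsz L : G L -> forall t, 0 <= t <= 1 -> size (zl (p t) L) = d.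
  by move=> /GL[l nl]; have [_ _ /(_ L nl)[]] := HBf l.
exists G; split => //; first by rewrite /G probability_setC// vN sube0.
have mD s t : 0 <= s <= 1 -> 0 <= t <= 1 -> measurable_fun G (fun L : Grm R n => zlD p L s t).
  by move=> s01 t01; apply: zlD_measurable => // L GL'; split; exact: Gsz.
have mDq s t : 0 <= s <= 1 -> 0 <= t <= 1 -> measurable_fun G (fun L : Grm R n => (zlD p L s t) `^ q).
  by move=> s01 t01; apply: (measurableT_comp (measurable_powR q)); exact: mD.
have Ffin s t : 0 <= s <= 1 -> 0 <= t <= 1 -> zlF p G s t \is a fin_num.
  by move=> s01 t01; apply: zlF_fin => // L GL'; split; exact: Gsz.
have rsE x s : path <%R x s -> 0 <= x -> last x s <= 1 ->
    measurable_fun G (fun L : Grm R n => rsum q (zlD p L) x s) /\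
    (rsum q (fun s t => fine (zlF p G s t) `^ q^-1) x s)%:E = (\int[vol]_(L in G) (rsum q (zlD p L) x s)%:E)%E.
  elim: s x => [|y s IH] x /=; first by split; [exact: measurable_cst|rewrite integral0].
  move=> /andP[xy ps] x0 ls; have y0 : 0 <= y := le_trans x0 (ltW xy).
  have y1 : y <= 1 := le_trans (path_lt_last ps) ls.
  have x01 : 0 <= x <= 1 by rewrite x0 (le_trans (ltW xy)).
  have y01 : 0 <= y <= 1 by rewrite y0.
  have [m1 E1] := IH y ps y0 ls.
  have m2 : measurable_fun G (fun L : Grm R n => rz q (zlD p L x y) (y - x)).
    by rewrite /rz; apply: measurable_funM; [exact: mDq|exact: measurable_cst].
  split; first exact: measurable_funD.
  under [RHS]eq_integral do rewrite EFinD.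
  rewrite ge0_integralD//; last first.
  - by apply/measurable_EFinP.
  - by move=> L _; rewrite lee_fin rsum_ge0// => *; exact: bdist_ge0.
  - by apply/measurable_EFinP.
  - by move=> L _; rewrite lee_fin rz_ge0.
  rewrite EFinD E1; congr (_ + _)%E.
  rewrite /rz -powRrM mulVf ?gt_eqF// powRr1; last by rewrite fine_ge0// integral_ge0// => L _; rewrite lee_fin powR_ge0.
  under [RHS]eq_integral do rewrite mulrC EFinM.
  rewrite ge0_integralZl_EFin ?powR_ge0//; last first.
  - by apply/measurable_EFinP; exact: mDq.
  - by move=> L _; rewrite lee_fin powR_ge0.
  by rewrite mulrC EFinM fineK// Ffin.
pose M := Cn + 16 * Cn * K1; have M0 : 0 <= M by rewrite /M addr_ge0 ?mulr_ge0.
exists M => // x s ps x0 ls; have [ms Es] := rsE x s ps x0 ls.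
rewrite -lee_fin Es.
(* A measurable majorant of the Riesz sums: a line whose first good level is l + 1 lies in [Bf l]
   and so picks up the term of index l, which is Cn 8^(l + 1). *)
pose h (L : Grm R n) : \bar R := (Cn%:E + \sum_(0 <= l <oo) ((8 * Cn * 8 ^+ l)%:E * (\1_(Bf l) L)%:E))%E.
have mt l : measurable_fun G (fun L : Grm R n => ((8 * Cn * 8 ^+ l)%:E * (\1_(Bf l) L)%:E)%E).
  by apply: measurable_funeM; apply/measurable_EFinP; exact: measurable_indic.
have tge l L : (0 <= (8 * Cn * 8 ^+ l)%:E * (\1_(Bf l) L)%:E)%E.
  by rewrite -EFinM lee_fin !mulr_ge0 ?exprn_ge0.
have mh : measurable_fun G h.
  apply: emeasurable_funD; first exact: measurable_cst.
  exact: ge0_emeasurable_sum.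
apply: (@le_trans _ _ (\int[vol]_(L in G) h L)%E).
  apply: ge0_le_integral => //.
  - by move=> L _; rewrite lee_fin rsum_ge0// => *; exact: bdist_ge0.
  - exact/measurable_EFinP.
  - move=> L GL'; have ex := GL L GL'; have ex' : exists l, `[< ~ Bf l L >] by have [l nl] := ex; exists l; exact/asboolP.
    case: (ex_minnP ex') => l /asboolP nl lmin.
    have [_ _ /(_ L nl)[HR _]] := HBf l; have := HR x s ps x0 ls; rewrite -lee_fin => /le_trans; apply.
    case: l lmin nl {HR} => [|l] lmin nl; first by rewrite expr0 mulr1 leeDl// nneseries_ge0.
    have Bl : Bf l L by apply: contrapT => nb; have := lmin l (introT (asboolP _) nb); rewrite ltnn.
    apply: (@le_trans _ _ (\sum_(0 <= l < l.+1) ((8 * Cn * 8 ^+ l)%:E * (\1_(Bf l) L)%:E))%E).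
      rewrite big_nat_recr//= indicE mem_set// mule1 -[leLHS]add0e leeD ?sume_ge0//.
      by rewrite lee_fin exprS; lra.
    apply: (@le_trans _ _ (\sum_(0 <= l <oo) ((8 * Cn * 8 ^+ l)%:E * (\1_(Bf l) L)%:E))%E); first exact: nneseries_lim_ge.
    by rewrite /h leeDr.
rewrite /h ge0_integralD//=; last first.
- exact: ge0_emeasurable_sum.
- by move=> L _; exact: nneseries_ge0.
rewrite integral_cst// integral_nneseries// /M EFinD; apply: leeD.
  by rewrite -[leRHS]mule1 lee_wpmul2l ?lee_fin// probability_le1.
apply: le_trans (epsilon_trick0 xpredT _); last by rewrite !mulr_ge0.
apply: lee_nneseries => [l _ _|l _]; first by apply: integral_ge0.
rewrite ge0_integralZl_EFin ?mulr_ge0 ?exprn_ge0//; last by apply/measurable_EFinP; exact: measurable_indic.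
rewrite integral_indic//; apply: (@le_trans _ _ ((8 * Cn * 8 ^+ l)%:E * (K1 * 16^-1 ^+ l)%:E)%E).
  apply: lee_wpmul2l; first by rewrite lee_fin !mulr_ge0 ?exprn_ge0.
  have [_ vb _] := HBf l; apply: le_trans vb; apply: le_measure; rewrite ?inE//; exact: measurableI.
rewrite -EFinM lee_fin (_ : 16 * Cn * K1 / (2 ^ l.+1)%:R = 8 * Cn * K1 * 2^-1 ^+ l); last first.
  by rewrite natrX exprS exprVn; field; rewrite expf_neq0.
have -> : 2^-1 ^+ l = 8 ^+ l * 16^-1 ^+ l :> R by rewrite -exprMn; congr (_ ^+ _); field.
by rewrite le_eqVlt; apply/orP; left; apply/eqP; ring.
Qed.
End Integrated.
(** * Transport plans *)

Section FiniteMeasureTools.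
Variables (d : measure_display) (T : measurableType d) (R : realType).

(** The value 0 off the measurable sets: a measure structure asks for nonnegativity on every set,
    while [is_probability] gives it on measurable sets only. *)
Definition prob_fun (mu : set T -> \bar R) (h : is_probability mu) (A : set T) : \bar R :=
  if `[< measurable A >] then mu A else 0%E.

Section ProbabilityInstance.
Variables (mu : set T -> \bar R) (h : is_probability mu).
Lemma prob_funE A : measurable A -> prob_fun h A = mu A.
Proof. by move=> mA; rewrite /prob_fun asboolT. Qed.
Let h0 : prob_fun h set0 = 0%E. Proof. by rewrite prob_funE//; case: h. Qed.
Let hsa : semi_sigma_additive (prob_fun h).
Proof.
move=> F mF tF mU; rewrite prob_funE//; have [_ _ H _] := h; have := H F mF tF mU.
rewrite (_ : (fun n => \sum_(0 <= i < n) prob_fun h (F i))%E = (fun n => \sum_(0 <= i < n) mu (F i))%E)//.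
by apply/funext => n; apply: eq_bigr => i _; rewrite prob_funE.
Qed.
Let hT : prob_fun h setT = 1%E. Proof. by rewrite prob_funE//; case: h. Qed.
Let hge (A : set T) : (0 <= prob_fun h A)%E.
Proof. by rewrite /prob_fun; case: asboolP => // mA; have [_ + _ _] := h; apply. Qed.
HB.instance Definition _ := isMeasure.Build d T R (prob_fun h) h0 hge hsa.
HB.instance Definition _ := Measure_isProbability.Build d T R (prob_fun h) hT.
End ProbabilityInstance.

Lemma prob_of (mu : set T -> \bar R) : is_probability mu -> exists P : probability T R, forall A, measurable A -> P A = mu A.
Proof. by move=> h; exists (prob_fun h) => A mA; rewrite /= prob_funE. Qed.

Lemma measure_partition (P : probability T R) (I : finType) (c : T -> I) (A : set T) :
  (forall a, measurable [set x | c x = a]) -> measurable A -> P A = (\sum_(a : I) P (A `&` [set x | c x = a]))%E.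
Proof.
move=> mc mA; have key (s : seq I) : uniq s -> measurable (A `&` [set x | c x \in s]) /\
    P (A `&` [set x | c x \in s]) = (\sum_(a <- s) P (A `&` [set x | c x = a]))%E.
  elim: s => [_|a s IH /= /andP[nas us]].
    by rewrite big_nil (_ : A `&` _ = set0) ?measure0//; apply/seteqP; split => x // [].
  have [m1 E1] := IH us.
  have -> : A `&` [set x | c x \in a :: s] = (A `&` [set x | c x = a]) `|` (A `&` [set x | c x \in s]).
    apply/seteqP; split => x /=; first by rewrite in_cons => -[Ax /orP[/eqP|]]; [left|right].
    by rewrite in_cons => -[[Ax ->]|[Ax ->]]; rewrite ?eqxx ?orbT.
  have m2 : measurable (A `&` [set x | c x = a]) by exact: measurableI.
  split; first exact: measurableU.
  have dj : (A `&` [set x | c x = a]) `&` (A `&` [set x | c x \in s]) = set0.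
    by apply/seteqP; split => x //= [[_ E] [_]]; rewrite E (negPf nas).
  by rewrite big_cons (measureU P m2 m1 dj); congr (_ + _)%E; exact: E1.
have [_] := key (index_enum I) (index_enum_uniq I); rewrite (_ : _ `&` _ = A)//.
by apply/seteqP; split => x /=; [case|split; rewrite ?mem_index_enum].
Qed.

(** Monotonicity without measurability, from the definition of the integral as a supremum over
    simple functions below. It is applied to the cost built from [dFS], whose measurability on the
    product is nowhere established. *)
Lemma le_integral_nonneg (mu : {measure set T -> \bar R}) (f g : T -> \bar R) :
  (forall x, 0 <= f x)%E -> (forall x, f x <= g x)%E -> (\int[mu]_x f x <= \int[mu]_x g x)%E.
Proof.
move=> f0 fg; rewrite !ge0_integralE// => [|x _]; last exact: le_trans (fg x).
rewrite !patch_setT; apply: le_ereal_sup => _ [h hf <-]; exists h => // x; exact: le_trans (hf x) (fg x).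
Qed.
End FiniteMeasureTools.

Section Coupling.
Variables (d : measure_display) (T : measurableType d) (R : realType) (P Q : probability T R).
Variables (I : finType) (c : T -> I).
Hypothesis mc : forall a, measurable [set x | c x = a].
Let Qa a : set T := [set x | c x = a].

(* On Q_a x Q_b the coupling is the product measure rescaled to the mass w_ab. *)
Lemma coupling (w : I -> I -> R) : (forall a b, 0 <= w a b) ->
  (forall a, (\sum_b w a b)%:E = P (Qa a)) -> (forall b, (\sum_a w a b)%:E = Q (Qa b)) ->
  exists pi : probability (T * T)%type R, [/\ forall A, measurable A -> pi (A `*` setT) = P A,
    forall B, measurable B -> pi (setT `*` B) = Q B & forall a b, pi (Qa a `*` Qa b) = (w a b)%:E].
Proof.
move=> w0 Hr Hc; pose PQ := (P \x Q)%E.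
pose pr a := fine (P (Qa a)); pose qr b := fine (Q (Qa b)).
have prE a : pr a = \sum_b w a b by rewrite /pr -Hr.
have qrE b : qr b = \sum_a w a b by rewrite /qr -Hc.
have wp a b : pr a = 0 -> w a b = 0.
  rewrite prE => h; apply/eqP; rewrite eq_le w0 andbT -h (bigD1 b)//= lerDl sumr_ge0//.
have wq a b : qr b = 0 -> w a b = 0.
  rewrite qrE => h; apply/eqP; rewrite eq_le w0 andbT -h (bigD1 a)//= lerDl sumr_ge0//.
have pr0 a : 0 <= pr a by rewrite prE sumr_ge0.
have qr0 b : 0 <= qr b by rewrite qrE sumr_ge0.
(* A vanishing denominator gives weight 0, which is the right value: by [wp] and [wq], w vanishes in
   that case. *)
pose cc (ab : I * I) : R := w ab.1 ab.2 / (pr ab.1 * qr ab.2).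
have cc0 ab : 0 <= cc ab by rewrite divr_ge0 ?mulr_ge0.
pose E (ab : I * I) : set (T * T) := Qa ab.1 `*` Qa ab.2.
have mE ab : measurable (E ab) by apply: measurableX; exact: mc.
pose N := #|{: I * I}|.
pose mk (k : nat) : {measure set (T * T) -> \bar R} :=
  match insub k : option 'I_N with
  | Some o => mscale (NngNum (cc0 (enum_val o))) (mrestr PQ (mE (enum_val o)))
  | None => mzero end.
pose pi0 := msum mk N.
have pi0E A : pi0 A = (\sum_(ab : I * I) (cc ab)%:E * PQ (A `&` E ab))%E.
  rewrite /pi0 /msum (reindex_onto (@enum_val _ {: I * I}) enum_rank)/=; last by move=> ab _; rewrite enum_rankK.
  apply: eq_big => k; first by rewrite enum_valK eqxx.
  by move=> _; rewrite /mk valK.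
have piX A B : measurable A -> measurable B -> pi0 (A `*` B) =
    (\sum_a \sum_b cc (a, b) * (fine (P (A `&` Qa a)) * fine (Q (B `&` Qa b))))%:E.
  move=> mA mB; rewrite pi0E pair_bigA/= -sumEFin; apply: eq_bigr => -[a b] _ /=.
  have -> : (A `*` B) `&` E (a, b) = (A `&` Qa a) `*` (B `&` Qa b).
    by apply/seteqP; split => -[x y] /= [[? ?] [? ?]].
  have m1 : measurable (A `&` Qa a) by apply: measurableI => //; exact: mc.
  have m2 : measurable (B `&` Qa b) by apply: measurableI => //; exact: mc.
  rewrite /PQ (product_measure1E P Q m1 m2) [RHS]EFinM; congr (_ * _)%E.
  by rewrite EFinM !fineK// fin_num_measure.
have marg1 A : measurable A -> pi0 (A `*` setT) = P A.
  move=> mA; rewrite piX// (measure_partition (c := c) P mc mA).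
  rewrite -sumEFin; apply: eq_bigr => a _.
  have mAa : measurable (A `&` Qa a) by apply: measurableI => //; exact: mc.
  rewrite -[RHS]fineK ?fin_num_measure//; congr (_%:E).
  set x := fine _; under eq_bigr do rewrite setTI -/(qr _).
  have xp : 0 <= x <= pr a.
    rewrite fine_ge0//=; apply: fine_le; rewrite ?fin_num_measure//; first exact: mc.
    by apply: le_measure; rewrite ?inE//; exact: mc.
  have [p0|p0] := eqVneq (pr a) 0.
    have -> : x = 0 by apply/eqP; move: xp; rewrite p0 eq_le andbC.
    by rewrite big1// => b _; rewrite mul0r mulr0.
  rewrite (eq_bigr (fun b => w a b * (x / pr a))) => [|b _].
    by rewrite -mulr_suml -prE mulrC divfK.
  rewrite /cc /=; have [q0|q0] := eqVneq (qr b) 0; first by rewrite (wq a b q0) !mul0r.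
  by field; rewrite p0 q0.
have marg2 B : measurable B -> pi0 (setT `*` B) = Q B.
  move=> mB; rewrite piX// (measure_partition (c := c) Q mc mB).
  rewrite exchange_big/= -sumEFin; apply: eq_bigr => b _.
  have mBb : measurable (B `&` Qa b) by apply: measurableI => //; exact: mc.
  rewrite -[RHS]fineK ?fin_num_measure//; congr (_%:E).
  set x := fine _; under eq_bigr do rewrite setTI -/(pr _).
  have xp : 0 <= x <= qr b.
    rewrite fine_ge0//=; apply: fine_le; rewrite ?fin_num_measure//; first exact: mc.
    by apply: le_measure; rewrite ?inE//; exact: mc.
  have [p0|p0] := eqVneq (qr b) 0.
    have -> : x = 0 by apply/eqP; move: xp; rewrite p0 eq_le andbC.
    by rewrite big1// => a _; rewrite !mulr0.
  rewrite (eq_bigr (fun a => w a b * (x / qr b))) => [|a _].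
    by rewrite -mulr_suml -qrE mulrC divfK.
  rewrite /cc /=; have [q0|q0] := eqVneq (pr a) 0; first by rewrite (wp a b q0) !mul0r.
  by field; rewrite p0 q0.
have hpi : is_probability (pi0 : set (T * T)%type -> \bar R).
  split; [exact: measure0|by move=> A _; exact: measure_ge0|exact: measure_semi_sigma_additive|].
  by rewrite -setXTT marg1// probability_setT.
have [pi Hpi] := prob_of hpi; exists pi; split.
- by move=> A mA; rewrite Hpi ?marg1//; exact: measurableX.
- by move=> B mB; rewrite Hpi ?marg2//; exact: measurableX.
- move=> a b; rewrite Hpi; last by apply: measurableX; exact: mc.
  rewrite piX; [|exact: mc|exact: mc]; congr (_%:E).
  have disj (m : probability T R) a' b' : a' != b' -> fine (m (Qa a' `&` Qa b')) = 0.
    move=> ne; rewrite (_ : _ `&` _ = set0) ?measure0//; apply/seteqP; split => x //= [E1 E2].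
    by move: ne; rewrite -E1 -E2 eqxx.
  rewrite (bigD1 a)//= [X in _ + X]big1 ?addr0 => [|a' ne]; last first.
    by rewrite big1// => b' _; rewrite disj 1?eq_sym// mul0r mulr0.
  rewrite (bigD1 b)//= [X in _ + X]big1 ?addr0 => [|b' ne]; last by rewrite (disj Q) 1?eq_sym// !mulr0.
  rewrite !setIid -/(pr a) -/(qr b) /cc /=.
  have [p0|p0] := eqVneq (pr a) 0; first by rewrite (wp a b p0) mul0r mul0r.
  have [q0|q0] := eqVneq (qr b) 0; first by rewrite (wq a b q0) mul0r mul0r.
  by rewrite divfK// mulf_neq0.
Qed.

Lemma coupling_cost (pi : probability (T * T)%type R) (w K : I -> I -> R) (f : T * T -> R) :
  (forall a b, pi (Qa a `*` Qa b) = (w a b)%:E) -> (forall a b, 0 <= K a b) ->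
  (forall z, 0 <= f z <= K (c z.1) (c z.2)) ->
  (\int[pi]_z (f z)%:E <= \sum_(ab : I * I) (K ab.1 ab.2)%:E * (w ab.1 ab.2)%:E)%E.
Proof.
move=> Hw K0 Hf.
have mX a b : measurable (Qa a `*` Qa b) by apply: measurableX; exact: mc.
pose g (z : T * T) : \bar R := (\sum_(ab : I * I) (K ab.1 ab.2)%:E * (\1_(Qa ab.1 `*` Qa ab.2) z)%:E)%E.
apply: (@le_trans _ _ (\int[pi]_z g z)%E).
  apply: le_integral_nonneg => z; first by rewrite lee_fin; case/andP: (Hf z).
  rewrite /g (bigD1 (c z.1, c z.2))//= indicE mem_set// mule1.
  apply: (@le_trans _ _ (K (c z.1) (c z.2))%:E); first by rewrite lee_fin; case/andP: (Hf z).
  by rewrite leeDl// sume_ge0// => ab _; rewrite -EFinM lee_fin mulr_ge0.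
rewrite /g ge0_integral_sum//; last first.
- by move=> ab z _; rewrite -EFinM lee_fin mulr_ge0.
- by move=> ab; apply: measurable_funeM; apply/measurable_EFinP; exact: measurable_indic.
apply: lee_sum => -[a b] _ /=; rewrite ge0_integralZl_EFin//; last first.
- by apply/measurable_EFinP; exact: measurable_indic.
have -> : (\int[pi]_z (\1_(Qa a `*` Qa b) z)%:E = (w a b)%:E)%E by rewrite integral_indic// setIT; exact: Hw.
exact: lexx.
Qed.
End Coupling.

(** * Transport between zero measures *)

Lemma sum_count_fst (I : finType) (z : seq (I * I)) a : (\sum_(b : I) count_mem (a, b) z = count_mem a (unzip1 z))%N.
Proof.
elim: z => [|[x y] z IH] /=; first by rewrite big1.
rewrite big_split/= IH; congr (_ + _)%N; rewrite (bigD1 y)//= xpair_eqE eqxx andbT big1 ?addn0// => b nb.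
by rewrite xpair_eqE [y == b]eq_sym (negPf nb) andbF.
Qed.

Lemma sum_count_snd (I : finType) (z : seq (I * I)) b : (\sum_(a : I) count_mem (a, b) z = count_mem b (unzip2 z))%N.
Proof.
elim: z => [|[x y] z IH] /=; first by rewrite big1.
rewrite big_split/= IH; congr (_ + _)%N; rewrite (bigD1 x)//= xpair_eqE eqxx big1 ?addn0// => a na.
by rewrite xpair_eqE [x == a]eq_sym (negPf na).
Qed.

Lemma sum_row_count (I : finType) (N : I -> I -> nat) (s : seq I) : (forall a, \sum_b N a b = count_mem a s)%N ->
  (\sum_(ab : I * I) N ab.1 ab.2 = size s)%N.
Proof.
move=> H; rewrite -(pair_bigA _ N)/= (eq_bigr _ (fun a _ => H a)).
rewrite (eq_bigr (fun a => \sum_(x <- s) (x == a : nat))%N) => [|a _]; last first.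
  by rewrite -sum1_count big_mkcond/=; apply: eq_bigr => x _; case: eqP.
rewrite exchange_big/= (eq_bigr (fun=> 1%N)) ?sum1_size// => x _.
by rewrite (bigD1 x)//= eqxx big1 ?addn0// => a /negPf na; rewrite eq_sym na.
Qed.

Section TransportCost.
Variables (R : realType) (n d : nat).
Hypothesis d0 : (0 < d)%N.
Implicit Types (p : R -> hpoly R n.+1 d).
Variable vol : probability (Grm R n) R.

(** Where D > lam one has D^q <= lam^(q - qh) D^qh. A bound on the L^qh norm of D thus controls the
    cost of order q, with discretization errors of size lam included. *)
Lemma powR_mix (q qh lam D : R) : 1 <= q -> q <= qh -> 0 < lam -> 0 <= D ->
  (4 * (D + lam)) `^ q <= (8 `^ q) * (2 * lam `^ q + lam `^ (q - qh) * D `^ qh).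
Proof.
move=> q1 qq l0 D0; have q0 : 0 <= q := le_trans ler01 q1.
have s0 : 0 <= 8 `^ q * lam `^ q by rewrite mulr_ge0 ?powR_ge0.
have t0 : 0 <= lam `^ (q - qh) * D `^ qh by rewrite mulr_ge0 ?powR_ge0.
have [Dl|lD] := leP D lam.
  apply: (@le_trans _ _ ((8 * lam) `^ q)).
    rewrite ge0_ler_powR ?nnegrE// ?mulr_ge0 ?addr_ge0 ?(ltW l0)//; lra.
  rewrite powRM ?(ltW l0)// ler_wpM2l ?powR_ge0//; have := powR_ge0 lam q; lra.
apply: (@le_trans _ _ ((8 * D) `^ q)).
  rewrite ge0_ler_powR ?nnegrE// ?mulr_ge0 ?addr_ge0 ?(ltW l0)//; lra.
rewrite powRM// ler_wpM2l ?powR_ge0//.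
apply: (@le_trans _ _ (lam `^ (q - qh) * D `^ qh)); last by have := powR_ge0 lam q; lra.
have D0' : 0 < D := lt_trans l0 lD.
have -> : D `^ q = D `^ (q - qh) * D `^ qh by rewrite -powRD ?(gt_eqF D0') ?implybT// subrK.
rewrite ler_wpM2r ?powR_ge0//; have -> : q - qh = - (qh - q) by rewrite opprB.
by rewrite !powRN lef_pV2 ?posrE ?powR_gt0// ge0_ler_powR ?nnegrE ?subr_ge0// ?(ltW l0)// ltW.
Qed.

Lemma mfib_seq (I : Type) (s : seq I) (f : I -> Grm R n -> nat) : (forall a, mfib (f a)) ->
  mfib (fun L => [seq f a L | a <- s]).
Proof.
move=> Hf; elim: s => [|a s IH] /=; first exact: mfib_cst.
exact: (mfib2 cons (Hf a) IH).
Qed.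

(** The zeros on a line are matched only up to the cubes of [cell]. The matching then depends on L
    only through the numbers of zeros in the cubes, which take countably many values, so it is
    chosen once per value and is measurable in L. Its average over lines gives the weights of a
    coupling. *)
Lemma Wq_le p s t (G : set (Grm R n)) (q qh lam : R) : 1 <= q -> q <= qh -> 0 < lam -> measurable G -> vol G = 1%E ->
  (forall L, G L -> size (zl (p s) L) = d /\ size (zl (p t) L) = d) ->
  (zlF qh vol p G s t <= (lam `^ qh)%:E)%E ->
  (Wq q (muP vol (p s)) (muP vol (p t)) <= (24 * lam)%:E)%E.
Proof.
move=> q1 qq l0 mG vG Gsz HF; have q0 : 0 < q := lt_le_trans ltr01 q1.
have [P HP] := prob_of (muP_probability d0 mG vG (fun L GL => (Gsz L GL).1)).
have [Q HQ] := prob_of (muP_probability d0 mG vG (fun L GL => (Gsz L GL).2)).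
have dR : 0 < d%:R :> R by rewrite ltr0n.
have nG : vol (~` G) = 0%E by rewrite probability_setC// vG subee.
have muG (f0 : hpoly R n.+1 d) (A : set (CPm R n.+1)) : measurable A -> muP vol f0 A = (\int[vol]_(L in G) ((zc f0 A L)%:R / d%:R)%:E)%E.
  move=> mA; rewrite /muP (@ge0_negligible_integral _ _ _ vol setT (~` G))//; last first.
  - by move=> L _; rewrite lee_fin zcountE.
  - exact: zcount_measurable.
  - exact: measurableC.
  rewrite setTD setCK -ge0_integralZl_EFin ?invr_ge0//; last first.
  - by apply: (measurable_funS (E := setT)) => //; exact: zcount_measurable.
  - by move=> L _; rewrite lee_fin zcountE.
  by apply: eq_integral => L _; rewrite zcountE// [RHS]EFinM muleC.
pose NN : R := n.+2%:R ^+ 2; have NN0 : 0 < NN by rewrite exprn_gt0.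
(* The mesh makes [ep] at most lam / 8; the discretization errors, five times [ep] in all, stay
   below lam. *)
pose M := (Num.trunc (16 * NN / lam)).+1; have M0 : (0 < M)%N by [].
have M0' : 0 < M%:R :> R by rewrite ltr0n.
pose ep := NN * (2 / M%:R); have ep0 : 0 <= ep by rewrite mulr_ge0 ?(ltW NN0)// divr_ge0.
have epl : ep <= lam / 8.
  have h0 : 0 <= 16 * NN / lam by rewrite divr_ge0 ?mulr_ge0 ?(ltW NN0) ?(ltW l0).
  have /andP[_ /ltW] := Num.Theory.truncn_itv h0; rewrite -/M ler_pdivrMr// => h.
  by rewrite /ep mulrA ler_pdivrMr//; lra.
pose c := @cell R n.+1 M.
pose I := {ffun 'I_n.+2 * 'I_n.+2 * bool -> 'I_(M.*2).+1}.
pose Qc (a : I) : set (CPm R n.+1) := [set x | c x = a].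
have mc a : measurable (Qc a) by exact: cell_measurable.
have Hrep (a : I) : exists x, (exists y, c y = a) -> c x = a.
  by have [[y cy]|h] := pselect (exists y, c y = a); [exists y|exists point].
have [rep Hrep'] := choice Hrep.
have crep x : c (rep (c x)) = c x by apply: Hrep'; exists x.
have rrep x : rho x (rep (c x)) <= ep by apply: cell_rho => //; rewrite -/c crep.
pose dl (a b : I) := rho (rep a) (rep b).
have ep2 z : z + 2 * ep = ep + (z + ep) by ring.
have dl_le x y : dl (c x) (c y) <= rho x y + 2 * ep.
  rewrite ep2 /dl; apply: le_trans (rho_tri _ x _) _; rewrite rho_sym; apply: lerD; first exact: rrep.
  by apply: le_trans (rho_tri _ y _) _; rewrite lerD2l; exact: rrep.
have le_dl x y : rho x y <= dl (c x) (c y) + 2 * ep.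
  rewrite ep2 /dl; apply: le_trans (rho_tri _ (rep (c x)) _) _; apply: lerD; first exact: rrep.
  by apply: le_trans (rho_tri _ (rep (c y)) _) _; rewrite lerD2l rho_sym; exact: rrep.
pose nv (f0 : hpoly R n.+1 d) (L : Grm R n) := [seq zc f0 (Qc a) L | a <- enum I].
have mnv f0 : mfib (nv f0) by apply: mfib_seq => a; exact: zc_mfib.
have zcc f0 a L : zc f0 (Qc a) L = count_mem a (map c (zl f0 L)).
  rewrite /zc count_map; apply: eq_count => x /=; apply/asboolP/eqP => //.
have nvE f0 L L' : nv f0 L = nv f0 L' -> perm_eq (map c (zl f0 L)) (map c (zl f0 L')).
  move=> /eq_in_map E; apply/allP => a _ /=; apply/eqP.
  by rewrite -!zcc; apply: E; rewrite mem_enum.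
(* The matrix is built from one line [L0] with counts v. It serves for every line of G with the same
   counts, whose lists of cubes are permutations of those of [L0]. *)
have HN (v : seq nat * seq nat) : exists Nm : I -> I -> nat, forall L, G L -> (nv (p s) L, nv (p t) L) = v ->
   [/\ forall a, (\sum_b Nm a b)%N = zc (p s) (Qc a) L, forall b, (\sum_a Nm a b)%N = zc (p t) (Qc b) L &
     forall a b, (0 < Nm a b)%N -> dl a b <= zlD p L s t + 3 * ep].
  have [[L0 [GL0 E0]]|h] := pselect (exists L, G L /\ (nv (p s) L, nv (p t) L) = v); last first.
    by exists (fun _ _ => 0%N) => L GL E; exfalso; apply: h; exists L.
  have [sz1 sz2] := Gsz L0 GL0.
  pose e := bdist dl (map c (zl (p s) L0)) (map c (zl (p t) L0)) + ep.
  have ep0' : 0 < ep by rewrite mulr_gt0// divr_gt0.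
  have [ys py ay] : matched dl e (map c (zl (p s) L0)) (map c (zl (p t) L0)).
    by apply: bdist_lt; rewrite ?size_map ?sz1 ?sz2// ltrDl.
  have sy : size ys = d by rewrite -(perm_size py) size_map.
  exists (fun a b => count_mem (a, b) (zip (map c (zl (p s) L0)) ys)) => L GL; rewrite -E0 => -[E1 E2].
  split=> [a|b|a b].
  - by rewrite sum_count_fst unzip1_zip ?size_map ?sz1 ?sy// -zcc; move: (E1) => /eq_in_map ->//; rewrite mem_enum.
  - rewrite sum_count_snd unzip2_zip ?size_map ?sz1 ?sy// -(permP py) -zcc; by move: (E2) => /eq_in_map ->//; rewrite mem_enum.
  - rewrite -has_count has_pred1 => hz.
    have h1 : dl a b <= e.
      elim: (map c (zl (p s) L0)) ys ay hz {py sy} => [|x xs IH] [|y ys]//= /andP[h1 h2].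
      by rewrite in_cons => /orP[/eqP[-> ->]//|]; exact: IH.
    apply: le_trans h1 _; rewrite /e (bdist_perm dl (nvE _ _ _ (esym E1)) (nvE _ _ _ (esym E2))).
    have [sz1' sz2'] := Gsz L GL.
    have : bdist dl (map c (zl (p s) L)) (map c (zl (p t) L)) <= 1 * zlD p L s t + 2 * ep.
      apply: bdist_map => //; [by rewrite sz1' sz2'|by rewrite mulr_ge0|].
      by move=> x y _ _; rewrite mul1r.
    by rewrite mul1r; lra.
have [Nf HNf] := choice HN.
pose Nm L a b := Nf (nv (p s) L, nv (p t) L) a b.
have HNm L : G L -> [/\ forall a, (\sum_b Nm L a b)%N = zc (p s) (Qc a) L, forall b, (\sum_a Nm L a b)%N = zc (p t) (Qc b) L &
     forall a b, (0 < Nm L a b)%N -> dl a b <= zlD p L s t + 3 * ep] by move=> GL; exact: HNf.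
have mNm (h : nat -> R) a b : measurable_fun setT (fun L : Grm R n => h (Nm L a b)).
  exact: (mfib_measurable (fun v => h (Nf v a b)) (mfib_pair (mnv (p s)) (mnv (p t)))).
have mNE a b : measurable_fun G (fun L : Grm R n => ((Nm L a b)%:R / d%:R : R)%:E).
  apply/measurable_EFinP; apply: (measurable_funS (E := setT)) => //.
  exact: (mNm (fun k => k%:R / d%:R)).
have N0 a b (L : Grm R n) : (0 <= ((Nm L a b)%:R / d%:R : R)%:E)%E by rewrite lee_fin divr_ge0.
have sumI (J : Type) (r : seq J) (f : J -> Grm R n -> \bar R) : (forall j, measurable_fun G (f j)) -> (forall j L, (0 <= f j L)%E) ->
   (\int[vol]_(L in G) (\sum_(j <- r) f j L) = \sum_(j <- r) \int[vol]_(L in G) f j L)%E.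
  by move=> m1 g1; rewrite ge0_integral_sum.
have ifin a b : (\int[vol]_(L in G) ((Nm L a b)%:R / d%:R)%:E)%E \is a fin_num.
  rewrite ge0_fin_numE; last by apply: integral_ge0 => L _.
  apply: (@le_lt_trans _ _ (\int[vol]_(L in G) (cst 1%:E L))%E).
    apply: ge0_le_integral => // L GL; rewrite lee_fin ler_pdivrMr// mul1r ler_nat.
    have [h1 _ _] := HNm L GL; apply: (@leq_trans (zc (p s) (Qc a) L)); first by rewrite -h1 (bigD1 b)//= leq_addr.
    by rewrite zcc (leq_trans (count_size _ _))// size_map (Gsz L GL).1.
  by rewrite integral_cst//= mul1e vG ltry.
pose w a b := fine (\int[vol]_(L in G) ((Nm L a b)%:R / d%:R)%:E)%E.
have wE a b : (w a b)%:E = (\int[vol]_(L in G) ((Nm L a b)%:R / d%:R)%:E)%E by rewrite /w fineK.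
have w0 a b : 0 <= w a b by rewrite fine_ge0// integral_ge0.
have Hr a : (\sum_b w a b)%:E = P (Qc a).
  rewrite HP// muG// -sumEFin (eq_bigr _ (fun b _ => wE a b)) -sumI//.
  apply: eq_integral => L; rewrite inE => GL; have [h1 _ _] := HNm L GL.
  by rewrite sumEFin -mulr_suml -natr_sum h1.
have Hc b : (\sum_a w a b)%:E = Q (Qc b).
  rewrite HQ// muG// -sumEFin (eq_bigr _ (fun a _ => wE a b)) -sumI//.
  apply: eq_integral => L; rewrite inE => GL; have [_ h1 _] := HNm L GL.
  by rewrite sumEFin -mulr_suml -natr_sum h1.
have [pi [pi1 pi2 pi3]] := coupling mc w0 Hr Hc.
pose K a b := (4 * (dl a b + 2 * ep)) `^ q.
have cost : (\int[pi]_z ((dFS z.1 z.2) `^ q)%:E <= ((24 * lam) `^ q)%:E)%E.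
  have K0 a b : 0 <= K a b by exact: powR_ge0.
  have fK z : 0 <= dFS z.1 z.2 `^ q <= K (c z.1) (c z.2).
    have h0 : 0 <= dl (c z.1) (c z.2) + 2 * ep by rewrite addr_ge0 ?rho_ge0 ?mulr_ge0.
    rewrite powR_ge0/= /K ge0_ler_powR ?nnegrE ?dFS_ge0 ?(ltW q0) ?mulr_ge0//.
    by rewrite (le_trans (dFS_le_rho _ _))// ler_wpM2l.
  apply: le_trans (coupling_cost mc pi3 K0 fK) _.
  have -> : (\sum_(ab : I * I) (K ab.1 ab.2)%:E * (w ab.1 ab.2)%:E = \int[vol]_(L in G) \sum_(ab : I * I) ((K ab.1 ab.2)%:E * ((Nm L ab.1 ab.2)%:R / d%:R)%:E))%E.
    rewrite sumI; last first.
    - by move=> ab L; rewrite mule_ge0 ?lee_fin ?powR_ge0// divr_ge0.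
    - by move=> ab; apply: measurable_funeM.
    by apply: eq_bigr => -[a b] _; rewrite /= wE ge0_integralZl_EFin ?powR_ge0.
  have mzD : measurable_fun G (fun L : Grm R n => (zlD p L s t) `^ qh).
    by apply: (measurableT_comp (measurable_powR qh)); exact: zlD_measurable.
  apply: (@le_trans _ _ (\int[vol]_(L in G) (((8 `^ q) * (2 * lam `^ q))%:E + ((8 `^ q) * lam `^ (q - qh))%:E * ((zlD p L s t) `^ qh)%:E))%E).
    apply: ge0_le_integral => //.
    - by move=> L _; apply: sume_ge0 => ab _; rewrite mule_ge0 ?lee_fin ?powR_ge0// divr_ge0.
    - by apply: emeasurable_sum => ab; apply: measurable_funeM.
    - apply: emeasurable_funD; first exact: measurable_cst.
      by apply: measurable_funeM; exact/measurable_EFinP.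
    move=> L GL; rewrite -EFinM -EFinD.
    under eq_bigr do rewrite -EFinM.
    rewrite sumEFin lee_fin.
    have [h1 _ h3] := HNm L GL; have D0 : 0 <= zlD p L s t by exact: bdist_ge0.
    apply: (@le_trans _ _ ((4 * (zlD p L s t + lam)) `^ q)); last first.
      by rewrite -[X in _ <= _ + X]mulrA -mulrDr; exact: powR_mix.
    have -> : (4 * (zlD p L s t + lam)) `^ q = \sum_(ab : I * I) (4 * (zlD p L s t + lam)) `^ q * ((Nm L ab.1 ab.2)%:R / d%:R).
      rewrite -mulr_sumr -mulr_suml -natr_sum (sum_row_count (s := map c (zl (p s) L))) => [|a]; last by rewrite h1 zcc.
      by rewrite size_map (Gsz L GL).1 divff ?gt_eqF// mulr1.
    apply: ler_sum => -[a b] _ /=; have [->|/= nz] := posnP (Nm L a b); first by rewrite mul0r !mulr0.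
    rewrite ler_wpM2r ?divr_ge0// /K ge0_ler_powR ?nnegrE ?(ltW q0)//.
    - by rewrite mulr_ge0 ?addr_ge0 ?rho_ge0 ?mulr_ge0.
    - by rewrite mulr_ge0 ?addr_ge0 ?(ltW l0).
    - have := h3 a b nz; have := epl; lra.
  rewrite ge0_integralD//; last first.
  - by apply: measurable_funeM; exact/measurable_EFinP.
  - by move=> L _; rewrite -EFinM lee_fin !mulr_ge0 ?powR_ge0.
  - by move=> L _; rewrite lee_fin !mulr_ge0 ?powR_ge0.
  rewrite integral_cst// ge0_integralZl_EFin ?mulr_ge0 ?powR_ge0//; last first.
  - exact/measurable_EFinP.
  - by move=> L _; rewrite lee_fin powR_ge0.
  rewrite [X in (_ * X + _)%E](_ : _ = 1%E); last exact: vG.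
  rewrite mule1; apply: le_trans (leeD (lexx _) (lee_wpmul2l _ HF)) _.
    by rewrite lee_fin mulr_ge0 ?powR_ge0.
  rewrite -EFinM -EFinD lee_fin -mulrA -powRD ?(gt_eqF l0) ?implybT// subrK.
  have -> : 24 = 8 * 3 :> R by ring.
  rewrite !powRM ?(ltW l0)// -mulrDr -mulrA ler_wpM2l ?powR_ge0//.
  have h3 : 3 <= 3 `^ q :> R by rewrite -[leLHS](powRr1)// ler_powR// ler1n.
  have := ler_wpM2r (powR_ge0 lam q) h3; lra.
rewrite /Wq.
have cpl : couplings (muP vol (p s)) (muP vol (p t)) pi.
  by split => A mA; [rewrite pi1// HP|rewrite pi2// HQ].
have inf_le : (ereal_inf [set (\int[pi']_z ((dFS z.1 z.2) `^ q)%:E)%E | pi' in couplings (muP vol (p s)) (muP vol (p t))] <= ((24 * lam) `^ q)%:E)%E.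
  by apply: le_trans cost; apply: ereal_inf_lbound; exists pi.
have inf_ge : (0 <= ereal_inf [set (\int[pi']_z ((dFS z.1 z.2) `^ q)%:E)%E | pi' in couplings (muP vol (p s)) (muP vol (p t))])%E.
  apply: le_ereal_inf_tmp => _ [pi' _ <-]; apply: integral_ge0 => z _; by rewrite lee_fin powR_ge0.
apply: (@le_trans _ _ ((((24 * lam) `^ q)%:E) `^ q^-1)%E).
  apply: gt0_ler_poweR => //; first by rewrite invr_ge0 ltW.
  - by rewrite in_itv/= inf_ge leey.
  - by rewrite in_itv/= lee_fin powR_ge0 leey.
by rewrite poweR_EFin -powRrM divff ?gt_eqF// powRr1// mulr_ge0// ltW.
Qed.
End TransportCost.
(** * Taylor expansions of C^(k,1) functions *)

Section MeanValue.
Variable R : realType.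

(** Differentiability relative to [0, 1], one-sided at the end points, in a form without
    quotients. *)
Definition locd (f : R -> R) (x l : R) : Prop := forall e : R, 0 < e -> exists2 del : R, 0 < del &
  forall y, 0 <= y <= 1 -> `|y - x| < del -> `|f y - f x - l * (y - x)| <= e * `|y - x|.

Lemma derivI_local (f : R -> R) x l : derivI f x l -> locd f x l.
Proof.
rewrite /derivI => /cvgrPdist_le H e e0; have := H e e0; rewrite /within /= => /nbhs_ballP[del /= del0 Hd].
exists del => // y y01 yx; have [->|ne] := eqVneq y x; first by rewrite !subrr mulr0 subr0 normr0 mulr0.
have := Hd y; rewrite /ball /= distrC => /(_ yx) /(_ (conj y01 ne)) h.
have yx0 : y - x != 0 by rewrite subr_eq0.
have -> : f y - f x - l * (y - x) = - (l - (f y - f x) / (y - x)) * (y - x) by field.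
by rewrite normrM normrN ler_wpM2r.
Qed.

Lemma locdB f g x l k : locd f x l -> locd g x k -> locd (fun y => f y - g y) x (l - k).
Proof.
move=> Hf Hg e e0; have e2 : 0 < e / 2 by rewrite divr_gt0.
have [d1 d10 H1] := Hf _ e2; have [d2 d20 H2] := Hg _ e2.
exists (Num.min d1 d2); first by rewrite lt_min d10.
move=> y y01; rewrite lt_min => /andP[/(H1 y y01) h1 /(H2 y y01) h2].
have -> : f y - g y - (f x - g x) - (l - k) * (y - x) = (f y - f x - l * (y - x)) - (g y - g x - k * (y - x)) by ring.
rewrite (le_trans (ler_normB _ _))//; have -> : e * `|y - x| = e / 2 * `|y - x| + e / 2 * `|y - x| by field.
exact: lerD.
Qed.

Lemma locd_poly (P : {poly R}) t x : locd (fun y => P.[y - t]) x (P^`().[x - t]).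
Proof.
pose z := x - t; pose c := \sum_(i < (size P)) `|P^`N(i.+2).[z]|.
have c0 : 0 <= c by rewrite sumr_ge0.
move=> e e0; have h0 : 0 < e / (c + 1) by rewrite divr_gt0// ltr_wpDl.
exists (Num.min 1 (e / (c + 1))); first by rewrite lt_min ltr01.
move=> y _; rewrite lt_min => /andP[h1 h2].
pose h := y - x; have -> : y - t = z + h by rewrite /z /h; ring.
rewrite (@nderiv_taylor_wide _ (size P).+2 _ _ _ (mulrC _ _)); last by rewrite -addn2 leq_addr.
rewrite !big_ord_recl /= expr0 mulr1 expr1 nderivn0 nderivn1 -/z -/h.
have E (A B Cc : R) : A + (B * h + Cc) - A - B * h = Cc by ring.
rewrite E; apply: (@le_trans _ _ (c * `|h| ^+ 2)).
  rewrite (le_trans (ler_norm_sum _ _ _))// mulr_suml; apply: ler_sum => i _.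
  by rewrite normrM ler_wpM2l// normrX /bump /= !add1n ler_wiXn2l// ltW.
rewrite expr2 mulrA ler_wpM2r//; apply: (@le_trans _ _ (c * (e / (c + 1)))); first by rewrite ler_wpM2l// ltW.
by rewrite mulrCA ler_piMr ?(ltW e0)// ler_pdivrMr ?ltr_wpDl// mul1r lerDl.
Qed.

(** f is arbitrary outside [0, 1], so the inequality is proved by continuation: the supremum of the
    points where it holds with slope c + e is b. *)
Lemma derivI_mvi (f df : R -> R) (c a b : R) : 0 <= a -> a <= b -> b <= 1 -> 0 <= c ->
  (forall x, 0 <= x <= 1 -> locd f x (df x)) -> (forall x, a <= x <= b -> `|df x| <= c) ->
  `|f b - f a| <= c * (b - a).
Proof.
move=> a0 ab b1 c0 Hd Hc; apply/ler_addgt0Pr => e' e'0.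
pose e := e' / 2; have e0 : 0 < e by rewrite divr_gt0.
suff : `|f b - f a| <= (c + e) * (b - a).
  move/le_trans; apply; rewrite mulrDl lerD2l; apply: (@le_trans _ _ (e * 2)); last by rewrite /e divfK.
  by rewrite ler_wpM2l ?(ltW e0)//; lra.
pose S : set R := [set y | a <= y <= b /\ `|f y - f a| <= (c + e) * (y - a)].
have Sa : S a by split; rewrite ?lexx ?ab// !subrr normr0 mulr0.
have Sb : has_sup S by split; [exists a|exists b => y [/andP[_ yb] _]].
pose s := sup S.
have as_ : a <= s by apply: ub_le_sup Sa; exact: Sb.2.
have sb : s <= b by apply: ge_sup; [exists a|move=> y [/andP[]]].
have s01 : 0 <= s <= 1 by rewrite (le_trans a0)//= (le_trans sb).
have [del del0 Hl] := Hd s s01 _ e0.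
have loc y : 0 <= y <= 1 -> `|y - s| < del -> `|f y - f s| <= (c + e) * `|y - s|.
  move=> y01 ys; have := Hl y y01 ys => h.
  have -> : f y - f s = (f y - f s - df s * (y - s)) + df s * (y - s) by rewrite subrK.
  rewrite (le_trans (ler_normD _ _))// mulrDl addrC lerD// normrM ler_wpM2r//.
  by apply: Hc; rewrite as_.
have Ss : S s.
  split; first by rewrite as_.
  have [y [/andP[ya yb] hy] sy] := sup_adherent del0 Sb; have ys : y <= s by apply: ub_le_sup; [exact: Sb.2|split; rewrite ?ya].
  have y01 : 0 <= y <= 1 by rewrite (le_trans a0)//= (le_trans yb).
  have := loc y y01; rewrite distrC ger0_norm ?subr_ge0// => h.
  have {}h : `|f y - f s| <= (c + e) * (s - y) by apply: h; rewrite -/s in sy; lra.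
  have -> : f s - f a = (f y - f a) - (f y - f s) by lra.
  by rewrite (le_trans (ler_normB _ _))//; lra.
have [slt|] := ltP s b; last by move=> bs; have <- : s = b by [apply/eqP; rewrite eq_le sb]; case: Ss.
exfalso; pose y := Num.min b (s + del / 2).
have d2 : 0 < del / 2 by rewrite divr_gt0.
have sy : s < y by rewrite lt_min slt ltrDl.
have yb : y <= b by rewrite ge_min lexx.
have y01 : 0 <= y <= 1 by rewrite (le_trans _ (ltW sy)) ?(le_trans yb)//; case/andP: s01.
have yd : `|y - s| < del.
  rewrite ger0_norm ?subr_ge0 ?(ltW sy)//; have : y <= s + del / 2 by rewrite ge_min lexx orbT. lra.
have : y <= s.
  apply: ub_le_sup; first exact: Sb.2.
  split; first by rewrite (le_trans as_ (ltW sy)).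
  have := loc y y01 yd; rewrite [`|y - s|]ger0_norm ?subr_ge0 ?(ltW sy)// => h.
  have -> : f y - f a = (f y - f s) + (f s - f a) by rewrite addrA subrK.
  by rewrite (le_trans (ler_normD _ _))//; case: Ss => _ h2; lra.
by rewrite leNgt sy.
Qed.

Lemma derivI_lip (f df : R -> R) (c x y : R) : 0 <= x <= 1 -> 0 <= y <= 1 -> 0 <= c ->
  (forall z, 0 <= z <= 1 -> locd f z (df z)) -> (forall z, 0 <= z <= 1 -> `|z - x| <= `|y - x| -> `|df z| <= c) ->
  `|f y - f x| <= c * `|y - x|.
Proof.
move=> /andP[x0 x1] /andP[y0 y1] c0 Hd Hc; have [xy|/ltW yx] := leP x y.
  rewrite [`|y - x|]ger0_norm ?subr_ge0//; apply: (derivI_mvi x0 xy y1 c0 Hd) => z /andP[z1 z2].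
  apply: Hc; first by rewrite (le_trans x0)//= (le_trans z2).
  by rewrite !ger0_norm ?subr_ge0// lerD2r.
rewrite distrC [`|y - x|]distrC [`|x - y|]ger0_norm ?subr_ge0//; apply: (derivI_mvi y0 yx x1 c0 Hd) => z /andP[z1 z2].
apply: Hc; first by rewrite (le_trans y0)//= (le_trans z2).
by rewrite distrC [`|y - x|]distrC !ger0_norm ?subr_ge0// lerD2l lerN2.
Qed.

(** By induction on j, the remainder of [G (K - j)] vanishes at t and its derivative is the
    remainder one step earlier. The Lipschitz bound on [G K] starts the induction and provides the
    extra order K + 1. *)
Lemma Ck1_taylor K (f : R -> R) k : (K <= k)%N -> Ck1 k f ->
  exists2 A : R, 0 <= A & forall t, 0 <= t <= 1 -> exists T : {poly R}, [/\ (size T <= K.+1)%N, forall i, `|T`_i| <= A &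
    forall x, 0 <= x <= 1 -> `|f x - T.[x - t]| <= A * `|x - t| ^+ K.+1].
Proof.
move=> Kk [G [G0 HG [L HL]]].
have lip j : (j <= k)%N -> exists2 c : R, 0 <= c & forall x y, 0 <= x <= 1 -> 0 <= y <= 1 -> `|G (k - j)%N x - G (k - j)%N y| <= c * `|x - y|.
  elim: j => [_|j IH jk].
    exists `|L| => // x y x01 y01; by rewrite subn0 (le_trans (HL x y x01 y01))// ler_wpM2r// ler_norm.
  have [c c0 Hc] := IH (ltnW jk); have E : (k - j = (k - j.+1).+1)%N by rewrite subnSK.
  rewrite E in Hc; have h0 : 0 <= (0 : R) <= 1 by rewrite lexx ler01.
  exists (`|G (k - j.+1).+1 0| + c) => [|x y x01 y01]; first by rewrite addr_ge0.
  apply: (derivI_lip (df := G (k - j.+1).+1) y01 x01) => [|z z01|z z01 _]; first by rewrite addr_ge0.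
    by apply: derivI_local; apply: HG => //; rewrite -E leq_subr.
  have := Hc z 0 z01 h0; rewrite subr0 => h.
  have -> : G (k - j.+1).+1 z = G (k - j.+1).+1 0 + (G (k - j.+1).+1 z - G (k - j.+1).+1 0) by rewrite addrC subrK.
  rewrite (le_trans (ler_normD _ _))// lerD2l (le_trans h)// ler_piMr// ger0_norm; by case/andP: z01.
have lipG j : (j <= k)%N -> exists2 c : R, 0 <= c & forall x y, 0 <= x <= 1 -> 0 <= y <= 1 -> `|G j x - G j y| <= c * `|x - y|.
  by move=> jk; have := lip (k - j)%N (leq_subr _ _); rewrite subKn.
have HB j : exists c : R, 0 <= c /\ ((j <= k)%N -> forall x, 0 <= x <= 1 -> `|G j x| <= c).
  have [jk|_] := boolP (j <= k)%N; last by exists 0.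
  have [c c0 Hc] := lipG j jk; exists (`|G j 0| + c); split=> [|_ x x01]; first by rewrite addr_ge0.
  have h0 : 0 <= (0 : R) <= 1 by rewrite lexx ler01.
  have := Hc x 0 x01 h0; rewrite subr0 => h.
  have -> : G j x = G j 0 + (G j x - G j 0) by rewrite addrC subrK.
  rewrite (le_trans (ler_normD _ _))// lerD2l (le_trans h)// ler_piMr// ger0_norm; by case/andP: x01.
have [bd Hbd] := choice HB.
have bd0 j : 0 <= bd j by case: (Hbd j).
have [LK LK0 HLK] := lipG K Kk.
exists (LK + \sum_(j < K.+1) bd j); first by rewrite addr_ge0// sumr_ge0.
move=> t t01.
pose T (j : nat) : {poly R} := \poly_(i < (K - j).+1) (G (j + i)%N t / (i`!)%:R).
have T0 : (T 0%N).[0] = f t.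
  by rewrite horner_coef0 coef_poly /= addn0 divr1 G0.
have key j : (j <= K)%N -> forall x, 0 <= x <= 1 -> `|G (K - j)%N x - (T (K - j)%N).[x - t]| <= LK * `|x - t| ^+ j.+1.
  elim: j => [_ x x01|j IH jK x x01].
    rewrite subn0 expr1 /T subnn (_ : (\poly_(_ < 1) _).[_] = G K t); first exact: HLK.
    by rewrite poly_def big_ord1 /= addn0 divr1 hornerZ hornerXn expr0 mulr1.
  have E : (K - j = (K - j.+1).+1)%N by rewrite subnSK.
  pose g y := G (K - j.+1)%N y - (T (K - j.+1)%N).[y - t].
  have dT : (T (K - j.+1)%N)^`() = T (K - j)%N.
    apply/polyP => i; rewrite coef_deriv !coef_poly E.
    have -> : (K - (K - j.+1) = j.+1)%N by rewrite subKn.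
    have -> : (K - (K - j.+1).+1 = j)%N by rewrite -E subKn// ltnW.
    rewrite ltnS; case: ltnP => // ij; last by rewrite mul0rn.
    rewrite addnS addSn factS natrM -[LHS]mulr_natr; field.
    by rewrite pnatr_eq0 -lt0n fact_gt0 /= addrC natr1 pnatr_eq0.
  have gd y : 0 <= y <= 1 -> locd g y (G (K - j)%N y - (T (K - j)%N).[y - t]).
    move=> y01; rewrite -dT; apply: locdB; last exact: locd_poly.
    rewrite E; apply: derivI_local; apply: HG => //; rewrite -E; exact: leq_trans (leq_subr _ _) Kk.
  have gt : g t = 0.
    rewrite /g subrr horner_coef0 coef_poly /= addn0 divr1 subrr//.
  have := @derivI_lip g (fun y => G (K - j)%N y - (T (K - j)%N).[y - t]) (LK * `|x - t| ^+ j.+1) t x t01 x01.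
  rewrite gt subr0 [_ ^+ j.+2]exprSr mulrA; apply => //; first by rewrite mulr_ge0// exprn_ge0.
  move=> z z01 hz; apply: le_trans (IH (ltnW jK) z z01) _.
  by rewrite ler_wpM2l// lerXn2r ?nnegrE.
exists (T 0%N); split.
- by rewrite /T subn0 size_poly.
- move=> i; rewrite coef_poly add0n subn0; case: ltnP => [iK|_]; last by rewrite normr0 addr_ge0// sumr_ge0.
  apply: (@le_trans _ _ (bd i)).
    rewrite normrM; have [_ hb] := Hbd i; apply: (@le_trans _ _ (bd i * 1)); last by rewrite mulr1.
    rewrite ler_pM//; first by apply: hb t01; apply: leq_trans Kk; rewrite -ltnS.
    by rewrite normfV ger0_norm// invf_le1 ?ltr0n ?fact_gt0// ler1n fact_gt0.
  by rewrite (bigD1 (Ordinal iK))//= addrCA lerDl addr_ge0// sumr_ge0.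
- move=> x x01; have := key K (leqnn K) x x01; rewrite subnn G0 => /le_trans; apply.
  by rewrite ler_wpM2r ?exprn_ge0// lerDl sumr_ge0.
Qed.
End MeanValue.

Lemma Ck1_curve_TT (R : realType) (n d k : nat) (p : R -> hpoly R n d) : (0 < d)%N -> Ck1_curve k p -> (4 * d - 1 <= k)%N ->
  exists2 A : R, 0 <= A & forall t a, 0 <= t <= 1 -> TT (4 * d) A t (fun x => (p x a)%:P).
Proof.
move=> d0 Hp hk; have K0 : (4 * d = (4 * d - 1).+1)%N by rewrite subn1 prednK// muln_gt0.
have HA (a : mon n d) : exists A : R, 0 <= A /\ forall t, 0 <= t <= 1 -> TT (4 * d) A t (fun x => (p x a)%:P).
  have [H1 H2] := Hp a; have [A1 A10 T1] := Ck1_taylor hk H1; have [A2 A20 T2] := Ck1_taylor hk H2.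
  exists ((4 * d).+1%:R * A1 + (4 * d).+1%:R * A2); split; first by rewrite addr_ge0// mulr_ge0.
  move=> t t01; have [P1 [s1 c1 e1]] := T1 t t01; have [P2 [s2 c2 e2]] := T2 t t01.
  rewrite -!K0 in s1 s2 e1 e2.
  have R1 := TT_real A10 t01 s1 c1 e1; have R2 := TT_real A20 t01 s2 c2 e2.
  rewrite (_ : (fun x => (p x a)%:P) = (fun x => ((complex.Re (p x a))%:C%C)%:P + 'i%C *: ((complex.Im (p x a))%:C%C)%:P)); last first.
    by apply/funext => x; rewrite {1}[p x a]complexE polyCD polyCM mul_polyC.
  apply: TT_add => //; have -> : (4 * d).+1%:R * A2 = ComplexField.Normc.normc ('i%C : R[i]) * ((4 * d).+1%:R * A2).
    by rewrite /= expr0n/= add0r expr1n sqrtr1 mul1r.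
  exact: TT_scale.
have [Af HAf] := choice HA.
exists (\sum_a Af a); first by apply: sumr_ge0 => a _; case: (HAf a).
move=> t a t01; apply: TT_mono (proj2 (HAf a) t t01).
by rewrite (bigD1 a)//= lerDl; apply: sumr_ge0 => b _; case: (HAf b).
Qed.
(** * Dyadic maximal function *)

Section DyadicMaximal.
Variable R : realType.
Notation mu := (@lebesgue_measure R).
Variable v : R -> R.
Hypothesis vmono : forall x y, x <= y -> v x <= v y.

Section Level.
Variable lam : R.
Hypothesis lam0 : 0 < lam.

Definition badI (a h : R) : Prop := lam * h < v (a + h) - v a.

(** A stopping construction: bisection stops at the first interval on which the average slope of v
    exceeds lam. The selected intervals are disjoint, so their total length is at most the increment
    of v divided by lam. *)
Fixpoint tree (k : nat) (a h : R) : set R :=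
  if `[< badI a h >] then `[a, a + h[%classic else
  if k is k'.+1 then tree k' a (h / 2) `|` tree k' (a + h / 2) (h / 2) else set0.

Lemma tree_measurable k a h : measurable (tree k a h).
Proof.
elim: k a h => [|k IH] a h /=; case: asboolP => // _.
exact: measurableU.
Qed.

Lemma tree_bound k a h : 0 < h -> (mu (tree k a h) <= ((v (a + h) - v a) / lam)%:E)%E.
Proof.
elim: k a h => [|k IH] a h h0 /=; case: asboolP => [b|_].
- rewrite lebesgue_measure_itv /= lte_fin ltrDl h0 -EFinD lee_fin addrC addKr ler_pdivlMr// mulrC; exact: ltW.
- by rewrite measure0 lee_fin divr_ge0 ?(ltW lam0)// subr_ge0 vmono// lerDl ltW.
- rewrite lebesgue_measure_itv /= lte_fin ltrDl h0 -EFinD lee_fin addrC addKr ler_pdivlMr// mulrC; exact: ltW.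
have h2 : 0 < h / 2 by rewrite divr_gt0.
apply: le_trans (measureU2 _ _ _) _; try exact: tree_measurable.
apply: le_trans (leeD (IH a _ h2) (IH (a + h / 2) _ h2)) _.
rewrite -EFinD lee_fin -mulrDl (_ : a + h / 2 + h / 2 = a + h); last by field.
by rewrite addrC subrKA.
Qed.

Lemma treeS k a h : tree k.+1 a h =
  if `[< badI a h >] then `[a, a + h[%classic else tree k a (h / 2) `|` tree k (a + h / 2) (h / 2).
Proof. by []. Qed.

Lemma tree_mono k a h : tree k a h `<=` tree k.+1 a h.
Proof.
elim: k a h => [|k IH] a h; first by rewrite /=; case: asboolP => // _ x [].
rewrite (treeS k.+1) treeS; case: asboolP => _ x; first by [].
by move=> [/IH hx|/IH hx]; [left|right].
Qed.

Lemma tree_in l a h j x : 0 < h -> (j < 2 ^ l)%N ->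
  badI (a + j%:R * (h / 2 ^+ l)) (h / 2 ^+ l) ->
  a + j%:R * (h / 2 ^+ l) <= x < a + j%:R * (h / 2 ^+ l) + h / 2 ^+ l -> tree l a h x.
Proof.
elim: l a h j => [|l IH] a h j h0.
  rewrite expn0 ltnS leqn0 => /eqP ->; rewrite expr0 divr1 mul0r addr0 => b hx /=.
  by rewrite asboolT//= in_itv.
move=> jl b hx; rewrite /=; case: asboolP => [_|_].
  have p0 : 0 < h / 2 ^+ l.+1 by rewrite divr_gt0// exprn_gt0.
  case/andP: hx => x1 x2; rewrite /= in_itv/=; apply/andP; split.
    by apply: le_trans x1; rewrite lerDl mulr_ge0// ltW.
  apply: lt_le_trans x2 _; rewrite -addrA lerD2l -[X in _ + X]mul1r -mulrDl mulrCA ler_piMr ?(ltW h0)//.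
  by rewrite ler_pdivrMr ?exprn_gt0// mul1r natr1 -natrX ler_nat.
have h2 : 0 < h / 2 by rewrite divr_gt0.
have E : h / 2 ^+ l.+1 = (h / 2) / 2 ^+ l by rewrite exprS invfM mulrA.
have [jl'|jl'] := ltnP j (2 ^ l).
  by left; apply: (IH _ _ j h2 jl'); rewrite -E.
right; apply: (IH _ _ (j - 2 ^ l)%N h2).
- by rewrite ltn_subLR// addnn -mul2n -expnS.
all: rewrite -E; have -> : a + h / 2 + (j - 2 ^ l)%:R * (h / 2 ^+ l.+1) = a + j%:R * (h / 2 ^+ l.+1).
  1,3: rewrite natrB// natrX exprS; field; by rewrite expf_neq0.
all: by [].
Qed.

Definition dyad a h : set R := \bigcup_k tree k a h.

Lemma dyad_measurable a h : measurable (dyad a h).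
Proof. by apply: bigcup_measurable => k _; exact: tree_measurable. Qed.

Lemma dyad_bound a h : 0 < h -> (mu (dyad a h) <= ((v (a + h) - v a) / lam)%:E)%E.
Proof.
move=> h0; have H := @nondecreasing_cvg_mu _ _ _ mu (fun k => tree k a h) (fun k => tree_measurable k a h) (dyad_measurable a h).
have H' : {homo (fun k => tree k a h) : n m / (n <= m)%N >-> (n <= m)%O}.
  by apply/nondecreasing_seqP => k; apply/subsetPset; exact: tree_mono.
have C := H H'; rewrite -(cvg_lim _ C)//; apply: lime_le; first by apply/cvg_ex; eexists; exact: C.
by apply: nearW => k; exact: tree_bound.
Qed.

(* The endpoints of level k of the dyadic grids of [-1, 2[ and [0, 3[ are at distance at least 2^-k of each other, so that a short interval lies in a dyadic interval of one of the two grids. *)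
Lemma two_grids s t x : 0 <= s -> s < t -> t <= 1 -> s < x < t ->
  ~ dyad (-1) 3 x -> ~ dyad 0 3 x -> v t - v s <= 6 * lam * (t - s).
Proof.
move=> s0 st t1 /andP[sx xt] n1 n2.
have ts0 : 0 < t - s by rewrite subr_gt0.
have ex : exists k, 2^-1 ^+ k < t - s.
  have [k Hk] := half_small (divr_gt0 ts0 (ltr0n R 2)); exists k; apply: le_lt_trans Hk _.
  by rewrite ltr_pdivrMr// ltr_pMr// ltr1n.
have [k [k1 k2]] : exists k, t - s <= 2^-1 ^+ k /\ 2^-1 ^+ k <= 2 * (t - s).
  case: (ex_minnP ex) => -[|k] hk kmin.
    by exists 0%N; rewrite expr0 in hk *; split; lra.
  exists k; split; first by rewrite leNgt; apply/negP => /kmin; rewrite ltnn.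
  by move: hk; rewrite exprS; lra.
(* The length of the dyadic intervals in use: at least 3 (t - s) and at most 6 (t - s), whence the
   constant 6. *)
pose H : R := 3 / 2 ^+ k; have H0 : 0 < H by rewrite divr_gt0// exprn_gt0.
have HE : H = 3 * 2^-1 ^+ k by rewrite /H exprVn.
have grid a : a = -1 \/ a = 0 -> (exists j : nat, [/\ (j < 2 ^ k)%N, s < a + j%:R * H & a + j%:R * H < t]) \/
    exists j : nat, [/\ (j < 2 ^ k)%N, a + j%:R * H <= s & t <= a + j%:R * H + H].
  move=> aE; pose j := Num.trunc ((s - a) / H).
  have q0 : 0 <= (s - a) / H by rewrite divr_ge0 ?(ltW H0)//; case: aE => ->; lra.
  have /andP[h1 h2] := Num.Theory.truncn_itv q0; rewrite -/j in h1 h2.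
  rewrite ler_pdivlMr// in h1; rewrite ltr_pdivrMr// -addn1 natrD in h2.
  have kk : 2 ^+ k * H = 3 by rewrite /H mulrC divfK// expf_neq0.
  have jk : (j.+1 <= 2 ^ k)%N.
    rewrite -(ltr_nat R) natrX -(ltr_pM2r H0) kk; apply: le_lt_trans h1 _.
    by case: aE => ->; lra.
  have [tj|tj] := leP t (a + j%:R * H + H).
    by right; exists j; split => //; lra.
  left; exists j.+1; split.
  - rewrite -(ltr_nat R) natrX -(ltr_pM2r H0) kk -addn1 natrD; case: aE tj => -> ; lra.
  - rewrite -addn1 natrD; lra.
  - rewrite -addn1 natrD; lra.
have good a : a = -1 \/ a = 0 -> ~ dyad a 3 x -> (exists j : nat, [/\ (j < 2 ^ k)%N, a + j%:R * H <= s & t <= a + j%:R * H + H]) ->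
    v t - v s <= 6 * lam * (t - s).
  move=> _ nx [j [jk js jt]]; have [b|nb] := pselect (badI (a + j%:R * H) H).
    exfalso; apply: nx; exists k => //; apply: (@tree_in k a 3 j x) => //.
    by rewrite -/H (le_trans js (ltW sx)) (lt_le_trans xt jt).
  move/negP: nb; rewrite -leNgt => nb.
  apply: (@le_trans _ _ (v (a + j%:R * H + H) - v (a + j%:R * H))).
    by apply: lerB; exact: vmono.
  apply: le_trans nb _; have -> : 6 * lam * (t - s) = lam * (6 * (t - s)) by ring.
  by apply: ler_wpM2l; [exact: ltW|rewrite HE; lra].
have [[j [jk j1 j2]]|g] := grid (-1) (or_introl erefl); last exact: (good _ (or_introl erefl) n1 g).
have [[i [ik i1 i2]]|g] := grid 0 (or_intror erefl); last exact: (good _ (or_intror erefl) n2 g).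
exfalso; have kp : 0 < 2^-1 ^+ k :> R by rewrite exprn_gt0.
have d1 : -1 + j%:R * H - (0 + i%:R * H) < 2^-1 ^+ k by lra.
have d2 : 0 + i%:R * H - (-1 + j%:R * H) < 2^-1 ^+ k by lra.
have kp2 : 0 < 2 ^+ k :> R by rewrite exprn_gt0.
have E2 : 2^-1 ^+ k * 2 ^+ k = 1 :> R by rewrite exprVn mulVf// gt_eqF.
have HP : H * 2 ^+ k = 3 by rewrite /H divfK// gt_eqF.
have e1 : (-1 + j%:R * H - (0 + i%:R * H)) * 2 ^+ k = j%:R * 3 - i%:R * 3 - 2 ^+ k.
  by rewrite -HP; ring.
have e2 : (0 + i%:R * H - (-1 + j%:R * H)) * 2 ^+ k = 2 ^+ k + i%:R * 3 - j%:R * 3.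
  by rewrite -HP; ring.
move: d1 d2; rewrite -(ltr_pM2r kp2) e1 E2 => f1; rewrite -(ltr_pM2r kp2) e2 E2 => f2.
(* Both grids would have an end point in ]s, t[. Multiplied by 2^k, the difference of these points
   is the integer 3 j - 3 i - 2^k, of absolute value less than 1, hence 0; but 3 does not divide
   2^k. *)
have g1 : (j * 3 < 2 ^ k + i * 3 + 1)%N by rewrite -(ltr_nat R) !natrD !natrM natrX; lra.
have g2 : (2 ^ k + i * 3 < j * 3 + 1)%N by rewrite -(ltr_nat R) !natrD !natrM natrX; lra.
have EE : (2 ^ k + i * 3 = j * 3)%N.
  by rewrite addn1 ltnS in g1; rewrite addn1 ltnS in g2; apply/eqP; rewrite eqn_leq g2 g1.
have : (3 %| 2 ^ k)%N by rewrite -(dvdn_addl _ (dvdn_mull i (dvdnn 3))) EE dvdn_mull.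
by rewrite Euclid_dvdX.
Qed.
End Level.
End DyadicMaximal.

(** * From Riesz bounds to a density in L^q *)

Section SummableCurves.
Variable R : realType.
Notation mu := (@lebesgue_measure R).

Lemma weak_type (v : R -> R) (V lam : R) : 0 < lam -> (forall x y, x <= y -> v x <= v y) -> (forall x, 0 <= v x <= V) ->
  exists U : set R, [/\ measurable U, (mu U <= (2 * V / lam)%:E)%E &
    forall s t x, 0 <= s -> s < t -> t <= 1 -> s < x < t -> ~ U x -> v t - v s <= 6 * lam * (t - s)].
Proof.
move=> l0 vm vV; have b a : (mu (dyad v lam a 3) <= (V / lam)%:E)%E.
  apply: le_trans (dyad_bound vm l0 a _) _ => //; rewrite lee_fin ler_pM2r ?invr_gt0//.
  by have /andP[h1 _] := vV a; have /andP[_ h2] := vV (a + 3); lra.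
exists (dyad v lam (-1) 3 `|` dyad v lam 0 3); split.
- by apply: measurableU; exact: dyad_measurable.
- apply: le_trans (measureU2 _ _ _) _; try exact: dyad_measurable.
  by apply: le_trans (leeD (b _) (b _)) _; rewrite -EFinD lee_fin -mulrA [2 * _]mulrDl !mul1r.
- move=> s t x s0 st t1 sxt /not_orP[n1 n2]; exact: (two_grids vm l0 s0 st t1 sxt n1 n2).
Qed.

(** The hypothesis says that the slope b / l satisfies (b / l)^q <= 6 lam^q, and 6 <= 6^q. *)
Lemma rz_unroot (q b l lam : R) : 1 <= q -> 0 <= b -> 0 < l -> 0 <= lam -> rz q b l <= 6 * lam `^ q * l -> b <= 6 * lam * l.
Proof.
move=> q1 b0 l0 lam0 H; have q0 : 0 < q := lt_le_trans ltr01 q1.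
rewrite leNgt; apply/negP => lt; move: H; apply/negP; rewrite -ltNge.
have e1 : l = l `^ q * l `^ (1 - q).
  by rewrite -powRD ?[q + _]addrC ?subrK ?powRr1 ?(ltW l0) ?oner_eq0.
have h : (6 * lam * l) `^ q < b `^ q by apply: gt0_ltr_powR; rewrite ?nnegrE// !mulr_ge0// ltW.
rewrite /rz {1}e1 mulrA ltr_pM2r ?powR_gt0//; apply: le_lt_trans h.
rewrite !powRM ?mulr_ge0// ?(ltW l0)// ler_wpM2r ?powR_ge0// ler_wpM2r ?powR_ge0//.
by rewrite -[leLHS]powRr1// ler_powR// ler1n.
Qed.

Lemma powR_exprn (a q : R) j : 0 <= a -> (a ^+ j) `^ q = (a `^ q) ^+ j.
Proof. by move=> a0; elim: j => [|j IH]; rewrite ?expr0 ?powR1// !exprS powRM ?IH ?exprn_ge0. Qed.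

(** b = 2^(1 / (qh - q)). The factor 2 makes the series of b^(j q) b^(- j qh) geometric with ratio
    1/2 in [Rbound_density]. *)
Lemma two_gap (q qh : R) : 0 <= q -> q < qh -> exists b : R, [/\ 1 < b, 1 <= b `^ q & b `^ qh = 2 * b `^ q].
Proof.
move=> q0 qq; have g0 : 0 < qh - q by rewrite subr_gt0.
have p1 r : 1 `^ r = 1 :> R by rewrite powR1.
have b1 : 1 < 2 `^ (qh - q)^-1 :> R 
  by rewrite -[ltLHS](p1 (qh - q)^-1) gt0_ltr_powR ?nnegrE ?invr_gt0// ltr1n.
have bE : (2 `^ (qh - q)^-1) `^ (qh - q) = 2 :> R by rewrite -powRrM mulVf ?gt_eqF// powRr1.
exists (2 `^ (qh - q)^-1); move: (2 `^ _) b1 bE => b b1 bE; split => //.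
  by rewrite -[leLHS](p1 q) ge0_ler_powR ?nnegrE// ltW// (lt_trans ltr01).
by rewrite -[X in X * _]bE -powRD ?subrK// [b == 0]gt_eqF ?implybT// (lt_trans ltr01).
Qed.

(* The density is 144 b^N, N(x) being the first level j with x outside the set where the dyadic maximal function of the superadditive function v exceeds b^(j qh); the gap between q and qh makes its q-th power integrable. *)
Lemma Rbound_density (q qh M : R) (B : R -> R -> R) (W : R -> R -> \bar R) :
  1 <= q -> q < qh -> 0 <= M -> (forall s t, 0 <= B s t) -> (forall t, 0 <= t <= 1 -> B t t = 0) -> Rbound qh B 0 1 M ->
  (forall s t lam, 0 <= s -> s <= t -> t <= 1 -> 0 < lam -> B s t <= lam -> (W s t <= (24 * lam)%:E)%E) ->
  exists m : R -> R, [/\ measurable_fun (`[0%R, 1%R] : set R) m,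
        (\int[mu]_(x in `[0%R, 1%R]) ((`|m x| `^ q)%:E) < +oo)%E &
        forall s t, 0 <= s -> s <= t -> t <= 1 -> (W s t <= \int[mu]_(x in `[s, t]) (m x)%:E)%E].
Proof.
move=> q1 qq M0 B0 Btt HB HW; have q0 : 0 < q := lt_le_trans ltr01 q1; have qh1 : 1 <= qh := le_trans q1 (ltW qq).
have [|v [v0 vV vm]] := @path_variation R (fun s t => rz qh (B s t) (t - s)) M (fun s t => rz_ge0 _ _ _).
  move=> x s ps x0 ls; rewrite (_ : vsum _ x s = rsum qh B x s); first exact: HB.
  by elim: s x {ps x0 ls} => //= y s IH x; rewrite IH.
(* The dyadic intervals leave [0, 1], so v is extended to a monotone bounded function by 0 on the
   left and M on the right. *)
pose w x := if x < 0 then 0 else if 1 < x then M else v x.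
have wV x : 0 <= w x <= M.
  rewrite /w; case: ltP => x0; first by rewrite lexx.
  by case: ltP => x1; rewrite ?M0 ?lexx// v0 ?vV ?x0.
have w01 x : 0 <= x <= 1 -> w x = v x by move=> /andP[x0 x1]; rewrite /w !ltNge x0 x1.
have wm x y : x <= y -> w x <= w y.
  move=> xy; have [x0|x0] := ltP x 0; first by rewrite {1}/w x0; case/andP: (wV y).
  have [y1|y1] := ltP 1 y; first by rewrite {2}/w y1 ltNge (le_trans x0 xy)/=; case/andP: (wV x).
  rewrite !w01 ?x0 ?y1 ?(le_trans xy) ?(le_trans x0)//; move: xy; rewrite le_eqVlt => /orP[/eqP ->//|xy].
  by apply: le_trans (vm x y x0 xy y1); rewrite lerDl rz_ge0.
clearbody w.
have [b [b1 beta1 gamE]] := two_gap (ltW q0) qq; have b0 : 0 < b := lt_trans ltr01 b1.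
pose beta := b `^ q; rewrite -/beta in beta1 gamE; have beta0 : 0 < beta := lt_le_trans ltr01 beta1.
have lamE j : (b ^+ j) `^ qh = (2 * beta) ^+ j by rewrite powR_exprn ?gamE// ltW.
have betaE j : (b ^+ j) `^ q = beta ^+ j by rewrite powR_exprn// ltW.
clearbody beta.
have lam0 j : 0 < (b ^+ j) `^ qh by rewrite powR_gt0// exprn_gt0.
have [U HU] := choice (fun j => weak_type (lam0 j) wm wV).
have mU j : measurable (U j) by case: (HU j).
have vU j : (mu (U j) <= (2 * M / (2 * beta) ^+ j)%:E)%E by case: (HU j); rewrite lamE.
have key j s t x : 0 <= s -> s < t -> t <= 1 -> s < x < t -> ~ U j x -> B s t <= 6 * b ^+ j * (t - s).
  move=> s0 st t1 sxt nU; have [_ _ /(_ s t x s0 st t1 sxt nU) h] := HU j.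
  apply: (rz_unroot qh1 (B0 _ _)); rewrite ?subr_gt0// ?exprn_ge0// ?(ltW b0)//.
  apply: le_trans h; rewrite !w01 ?s0 ?t1 ?(le_trans (ltW st)) ?(le_trans s0 (ltW st))//.
  by rewrite lerBrDl; exact: vm.
pose Z := \bigcap_j U j; have mZ : measurable Z by apply: bigcap_measurable => //; exists 0%N.
have vZ : mu Z = 0%E.
  apply/eqP; rewrite eq_le measure_ge0 andbT; apply/lee_addgt0Pr => e e0; rewrite add0e.
  have h : 0 < e / (2 * M + 1) by rewrite divr_gt0// ltr_wpDl// mulr_ge0.
  have [j Hj] := half_small h.
  apply: (@le_trans _ _ (mu (U j))); first by apply: le_measure; rewrite ?inE; [exact: mZ|exact: mU|move=> x; apply].
  apply: le_trans (vU j) _; rewrite lee_fin; apply: (@le_trans _ _ (2 * M * (e / (2 * M + 1)))).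
    rewrite ler_wpM2l ?mulr_ge0// (le_trans _ Hj)// exprVn lef_pV2 ?posrE ?exprn_gt0 ?mulr_gt0//.
    by rewrite lerXn2r ?nnegrE ?mulr_ge0 ?(ltW beta0)// ler_peMr.
  have h2 : 0 < 2 * M + 1 by rewrite ltr_wpDl// mulr_ge0.
  by rewrite mulrCA ler_piMr ?(ltW e0)// ler_pdivrMr// mul1r lerDl.
(* On the null set Z, contained in every U j, the value of N is 0 by convention. *)
have HN x : exists N : nat, [/\ forall k, (k < N)%N -> U k x, ~ Z x -> ~ U N x & Z x -> N = 0%N].
  have [Zx|nZ] := pselect (Z x); first by exists 0%N; split.
  have ex : exists j, `[< ~ U j x >].
    by apply: contrapT => h; apply: nZ => j _; apply: contrapT => nU; apply: h; exists j; exact/asboolP.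
  case: (ex_minnP ex) => N /asboolP nU Nmin; exists N; split => // k kN.
  by apply: contrapT => nk; have := Nmin k (introT (asboolP _) nk); rewrite leqNgt kN.
have [N {}HN] := choice HN.
have NE k : [set x | (k < N x)%N] = (~` Z) `&` \bigcap_(i in [set i | (i <= k)%N]) U i.
  apply/seteqP; split => x /=; have [h1 h2 h3] := HN x.
    by move=> kN; split=> [/h3 N0|i /= ik]; [rewrite N0 in kN|apply: h1; exact: leq_ltn_trans kN].
  by move=> [nZ h]; rewrite ltnNge; apply/negP => /h; exact: h2.
have mN : mfib N.
  by apply: mfib_levels => k; rewrite NE; apply: measurableI; [exact: measurableC|apply: bigcap_measurable => //; exists 0%N].
(* 144 = 24 * 6, where 24 comes from the hypothesis on W and 6 from [weak_type]. *)
pose m x := 144 * b ^+ N x.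
have mm : measurable_fun setT m by exact: (mfib_measurable (fun k => 144 * b ^+ k) mN).
have m0 x : 0 <= m x by rewrite mulr_ge0// exprn_ge0// ltW.
exists m; split; first exact: measurable_funTS.
- pose I : set R := `[0%R, 1%R]%classic; pose c : R := 144 `^ q.
  have c0 : 0 <= c by exact: powR_ge0.
  have mI : measurable I by exact: measurable_itv.
  have vI : mu I = 1%E by rewrite /I lebesgue_measure_itv /= lte_fin ltr01 sube0.
  have mE x : `|m x| `^ q = c * beta ^+ N x by rewrite ger0_norm// powRM ?exprn_ge0 ?(ltW b0)// betaE.
  pose f (j : nat) (x : R) : \bar R := ((c * beta ^+ j.+1)%:E * (\1_(U j) x)%:E)%E.
  have f0 j x : (0 <= f j x)%E by rewrite /f -EFinM lee_fin !mulr_ge0 ?exprn_ge0// ltW.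
  have mf j : measurable_fun I (f j).
    by apply: measurable_funeM; apply/measurable_EFinP; exact: measurable_indic.
  have msum : measurable_fun I (fun x => \sum_(0 <= j <oo) f j x)%E by exact: ge0_emeasurable_sum.
  apply: (@le_lt_trans _ _ (\int[mu]_(x in I) (c%:E + \sum_(0 <= j <oo) f j x))%E).
    apply: ge0_le_integral => //.
    + apply/measurable_EFinP; apply: (measurableT_comp (measurable_powR q)); apply: measurableT_comp => //; exact: measurable_funTS.
    + by apply: emeasurable_funD => //; exact: measurable_cst.
    + move=> x _; rewrite mE; have [h1 _ _] := HN x; case: (N x) h1 => [|j] h1.
        by rewrite expr0 mulr1 leeDl// nneseries_ge0.
      apply: (@le_trans _ _ (\sum_(0 <= i < j.+1) f i x)%E).
        have fE : f j x = (c * beta ^+ j.+1)%:E by rewrite /f indicE mem_set ?mule1//; exact: h1.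
        by rewrite big_nat_recr//= fE leeDr// sume_ge0.
      apply: (@le_trans _ _ (\sum_(0 <= i <oo) f i x)%E); first exact: nneseries_lim_ge.
      by rewrite leeDr// lee_fin.
  rewrite ge0_integralD//=; last by move=> x _; exact: nneseries_ge0.
  have -> : (\int[mu]_(_ in I) c%:E = c%:E)%E.
    by rewrite integral_cst// -[RHS]mule1; congr (_ * _)%E; exact: vI.
  rewrite integral_nneseries// lte_add_pinfty ?ltry//.
  apply: (@le_lt_trans _ _ (4 * c * beta * M)%:E); last exact: ltry.
  apply: le_trans (epsilon_trick0 xpredT _); last by rewrite !mulr_ge0// ltW.
  apply: lee_nneseries => [j _ _|j _]; first by apply: integral_ge0.
  have k0 : 0 <= c * beta ^+ j.+1 by rewrite mulr_ge0// exprn_ge0// ltW.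
  have mi : measurable_fun I (fun x => (\1_(U j) x)%:E : \bar R) by apply/measurable_EFinP; exact: measurable_indic.
  rewrite /f ge0_integralZl_EFin//.
  have -> : (\int[mu]_(x in I) (\1_(U j) x)%:E = mu (U j `&` I))%E by apply: integral_indic; [exact: mI|exact: mU].
  apply: (@le_trans _ _ ((c * beta ^+ j.+1)%:E * (2 * M / (2 * beta) ^+ j)%:E)%E).
    apply: lee_wpmul2l; first by rewrite lee_fin !mulr_ge0 ?exprn_ge0// ltW.
    by apply: le_trans (vU j); apply: le_measure; rewrite ?inE; [apply: measurableI; [exact: mU|exact: mI]|exact: mU|move=> x []].
  rewrite -EFinM lee_fin natrX !exprS exprMn le_eqVlt; apply/orP; left; apply/eqP; field.
  by rewrite !expf_neq0// gt_eqF.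
- move=> s t s0 st t1; have int0 : (0 <= \int[mu]_(x in `[s, t]) (m x)%:E)%E by apply: integral_ge0 => x _; rewrite lee_fin.
  move: st; rewrite le_eqVlt => /orP[/eqP E|st].
    (* For s = t, W is at most 24 lam for every lam > 0. *)
    apply: le_trans int0; apply/lee_addgt0Pr => e e0; rewrite add0e E.
    rewrite (_ : e = 24 * (e / 24)); last by field.
    have t0 : 0 <= t by rewrite -E.
    by apply: HW => //; rewrite ?divr_gt0// Btt ?t0// divr_ge0// ltW.
  (* Every point x of ]s, t[ off Z bounds W(s, t) by m(x) (t - s); averaging over x gives the
     integral. *)
  pose J : set R := `]s, t[%classic; pose J' := J `\` Z.
  have mJ : measurable J by exact: measurable_itv.
  have mJ' : measurable J' by apply: measurableD; [exact: mJ|exact: mZ].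
  have vJ : mu J = (t - s)%:E by rewrite /J lebesgue_measure_itv /= lte_fin st -EFinD.
  have vJZ : mu (J `&` Z) = 0%E.
    apply/eqP; rewrite eq_le measure_ge0 andbT -vZ; apply: le_measure; rewrite ?inE; [apply: measurableI; [exact: mJ|exact: mZ]|exact: mZ|by move=> x []].
  have vJ' : mu J' = (t - s)%:E.
    transitivity (mu J - mu (J `&` Z))%E; last by rewrite vJ vJZ sube0.
    by apply: measureD; [exact: mJ|exact: mZ|apply: (@le_lt_trans _ _ (t - s)%:E); [rewrite -vJ|exact: ltry]].
  have Wm x : J' x -> (W s t <= (m x * (t - s))%:E)%E.
    move=> [/= Jx nZ]; have [_ /(_ nZ) nU _] := HN x.
    have sxt : s < x < t by move: Jx; rewrite /J /= in_itv.
    rewrite (_ : m x * (t - s) = 24 * (6 * b ^+ N x * (t - s))); last by rewrite /m; ring.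
    apply: HW => //; [exact: ltW| |exact: key sxt nU].
    by rewrite !mulr_gt0 ?exprn_gt0 ?subr_gt0.
  have [x0 J'x0] : J' !=set0.
    apply/set0P/eqP => E; move: vJ'; rewrite E measure0 => /eqP; rewrite eqe eq_sym subr_eq0 => /eqP E'.
    by rewrite E' ltxx in st.
  have := Wm x0 J'x0; case WE : (W s t) => [r| |]; last 2 first.
  + by rewrite leye_eq.
  + by move=> _; exact: leNye.
  have [r0|r0] := ltP r 0; first by move=> _; apply: le_trans int0; rewrite lee_fin ltW.
  move=> _; have ts0 : 0 < t - s by rewrite subr_gt0.
  apply: (@le_trans _ _ (\int[mu]_(x in J') (m x)%:E)%E); last first.
    apply: ge0_subset_integral => //.
    + by apply/measurable_EFinP; exact: measurable_funTS.
    + by move=> x _; rewrite lee_fin.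
    + by move=> x [/= Jx _]; move: Jx; rewrite /J /= !in_itv/= => /andP[/ltW -> /ltW ->].
  apply: (@le_trans _ _ (\int[mu]_(x in J') (cst (r / (t - s))%:E x))%E).
    rewrite integral_cst//; apply: (@le_trans _ _ ((r / (t - s))%:E * (t - s)%:E)%E); last by rewrite -vJ'.
    by rewrite -EFinM divfK// gt_eqF.
  apply: ge0_le_integral => //.
  + by move=> x _; rewrite lee_fin divr_ge0// ltW.
  + by apply/measurable_EFinP; exact: measurable_funTS.
  + by move=> x J'x; have := Wm x J'x; rewrite WE !lee_fin ler_pdivrMr.
Qed.
End SummableCurves.
(* Projective space CP^(n+1) (n.+1 >= 1 so that G(1, n+1) is nonempty). *)
Theorem mainTheorem18 (R : realType) (n : nat) :
  exists e : nat, (0 < e)%N /\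
  forall vol : probability (Grm R n) R, gr_invariant vol ->
  forall (d k : nat) (p : R -> hpoly R n.+1 d) (q : R),
    (0 < d)%N ->
    Ck1_curve k p ->
    (forall t : R, 0 <= t <= 1 -> exists a : mon n.+1 d, p t a != 0) ->
    (e * d - 1 <= k)%N ->
    1 <= q -> q * ((e * d)%:R - 1) < (e * d)%:R ->
    ACq q (fun t => muP vol (p t)).
Proof.
exists 4%N; split => // vol inv d k p q d0 Cp Hp hk q1 qd.
have [A0 A00 HT] := Ck1_curve_TT d0 Cp hk.
pose K : R := (4 * d)%:R; rewrite -/K in qd.
have K1 : 0 < K - 1 by rewrite subr_gt0 ltr1n; move: d0; case: (d) => // d' _; rewrite mulnS.
(* The condition on q is open, so it still holds for the midpoint [qh] between q and the limit
   exponent K / (K - 1); [Rbound_density] requires this gap. *)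
pose qh := (q + K / (K - 1)) / 2.
have qK : q < K / (K - 1) by rewrite ltr_pdivlMr.
have qq : q < qh by rewrite /qh; lra.
have qhd : qh * (K - 1) < K by rewrite -ltr_pdivlMr// /qh; lra.
clearbody qh; have qh1 : 1 <= qh := le_trans q1 (ltW qq); have qh0 : 0 < qh := lt_le_trans ltr01 qh1.
have [G [mG vG Gsz [M M0 HM]]] := zlF_Rbound d0 qh1 qhd inv A00 HT Hp.
split=> [t t01|].
  by apply: (muP_probability d0 mG vG) => L GL; exact: Gsz.
have Gsz2 s t : 0 <= s <= 1 -> 0 <= t <= 1 -> forall L, G L -> size (zl (p s) L) = d /\ size (zl (p t) L) = d.
  by move=> s01 t01 L GL; rewrite !Gsz.
have Fge s t : (0 <= zlF qh vol p G s t)%E by apply: integral_ge0 => L _; rewrite lee_fin powR_ge0.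
apply: (Rbound_density q1 qq M0 _ _ HM) => [s t|t t01|s t lam s0 st t1 l0 H]; first exact: powR_ge0.
  rewrite /zlF (eq_integral (fun=> 0%E)) => [|L _].
    by rewrite integral0 /= powR0// invr_eq0 gt_eqF.
  suff -> : zlD p L t t = 0 by rewrite powR0// gt_eqF.
  apply/eqP; rewrite eq_le bdist_ge0 andbT; apply: bdist_le => //.
  by exists (zl (p t) L) => //; elim: (zl (p t) L) => //= x s ->; rewrite rho_xx lexx.
have s01 : 0 <= s <= 1 by rewrite s0 (le_trans st).
have t01 : 0 <= t <= 1 by rewrite t1 (le_trans s0).
apply: (Wq_le d0 q1 (ltW qq) l0 mG vG (Gsz2 s t s01 t01)).
rewrite -(fineK (zlF_fin d0 qh1 vol mG (Gsz2 s t s01 t01))) lee_fin.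
have -> : fine (zlF qh vol p G s t) = (fine (zlF qh vol p G s t) `^ qh^-1) `^ qh.
  by rewrite -powRrM mulVf ?gt_eqF// powRr1// fine_ge0.
by rewrite ge0_ler_powR ?nnegrE ?powR_ge0 ?(ltW l0) ?(ltW qh0).
Qed.
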